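(* Let $N\ge 3$, $p>2$, $0<R_0<R_1<\infty$, $A=\{x\in\mathbb{R}^N : R_0<|x|<R_1\}$, and suppose that $a\in\widehat{\mathcal K}$ and $a>0$ in $\overline A$. Then $c_I>0$, and $c_I$ is attained in $\mathcal N_{\mathcal K}$, i.e. there exists $u\in\mathcal N_{\mathcal K}$ with $I(u)=c_I$. Moreover, every minimizer $u\in\mathcal N_{\mathcal K}$ of $I|_{\mathcal N_{\mathcal K}}$ is a nontrivial solution, belonging to $\mathcal K$, of the problem $$-\Delta u+u=a(x)u^{p-1}\ \text{ in }A,\qquad u>0\ \text{ in }A,\qquad u=0\ \text{ on }\partial A.$$
   Context: A function on $\overline A$ is called axially symmetric if it only depends on $r=|x|\in[R_0,R_1]$ and $\theta=\arcsin(x_N/|x|)\in[-\pi/2,\pi/2]$; then we write $u(x)=\mathfrak u(r,\theta)$, and $\mathfrak u_\theta$ is the partial derivative in $\theta$. $\widehat{\mathcal K}$ is the set of $u\in C^1(\overline A)$ that are axially symmetric, satisfy $u\ge 0$ in $\overline A$, $\mathfrak u(r,\theta)=\mathfrak u(r,-\theta)$ and $\mathfrak u_\theta(r,\theta)\le 0$ for $(r,\theta)\in[R_0,R_1]\times(0,\pi/2)$. Set $C^1_0(A)=\{u\in C^1(\overline A): u|_{\partial A}\equiv 0\}$ and $\mathcal K=\{u\in\widehat{\mathcal K}: u|_{\partial A}\equiv 0\}$. The functional $I:C^1_0(A)\to\mathbb R$ is $$I(u)=\frac12\int_A(|\nabla u|^2+u^2)\,dx-\frac1p\int_A a(x)|u|^p\,dx,$$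 which is of class $C^2$. The Nehari-type set is $\mathcal N_{\mathcal K}=\{u\in\mathcal K: u\not\equiv 0,\ I'(u)u=0\}$ and $c_I=\inf_{u\in\mathcal N_{\mathcal K}}I(u)$. Solutions may be understood in the weak or classical sense (equivalent for functions in $C^1_0(A)$ by elliptic regularity). *)

(* Defs.v *)
From HB Require Import structures.
From mathcomp Require Import all_boot all_order all_algebra.
From mathcomp Require Import all_classical all_reals all_analysis.

Set Implicit Arguments.
Unset Strict Implicit.
Unset Printing Implicit Defensive.

Import Order.TTheory GRing.Theory Num.Theory.
Import numFieldNormedType.Exports.

Local Open Scope classical_set_scope.
Local Open Scope ring_scope.

Section lebesgue_measure_tuple.
Context {R : realType}.
Local Notation T := (measurableTypeR R).

Definition tuple_cons n (x : T * n.-tuple T) : n.+1.-tuple T :=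
  [the n.+1.-tuple T of x.1 :: x.2].

Lemma measurable_tuple_cons n : measurable_fun setT (@tuple_cons n).
Proof. exact: measurable_cons. Qed.

Section step.
Variables (n : nat) (mu : {sigma_finite_measure set (n.-tuple T) -> \bar R}).

Definition lebesgue_step : set (n.+1.-tuple T) -> \bar R :=
  pushforward (lebesgue_measure \x mu)%E (@tuple_cons n).

Let lebesgue_step0 : lebesgue_step set0 = 0%E.
Proof. by rewrite /lebesgue_step /pushforward preimage_set0 measure0. Qed.

Let lebesgue_step_ge0 A : (0 <= lebesgue_step A)%E.
Proof. by rewrite /lebesgue_step /pushforward; exact: measure_ge0. Qed.

Let lebesgue_step_sigma_additive : semi_sigma_additive lebesgue_step.
Proof.
move=> F mF tF mUF; rewrite /lebesgue_step /pushforward preimage_bigcup.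
have mcons A : measurable A -> measurable (@tuple_cons n @^-1` A).
  by move=> mA; rewrite -[X in measurable X]setTI; exact: measurable_tuple_cons.
apply: measure_semi_sigma_additive.
- by move=> k; exact: mcons.
- apply/trivIsetP => /= i j _ _ ij; rewrite -preimage_setI.
  by move/trivIsetP : tF => /(_ _ _ _ _ ij) ->//; rewrite preimage_set0.
- by rewrite -preimage_bigcup; exact: mcons.
Qed.

HB.instance Definition _ := isMeasure.Build _ _ _ lebesgue_step
  lebesgue_step0 lebesgue_step_ge0 lebesgue_step_sigma_additive.

Let lebesgue_step_sigma_finite : sigma_finite setT lebesgue_step.
Proof.
have /sigma_finiteP[F [TF ndF Foo]] := sigma_finiteT (@lebesgue_measure R).
have /sigma_finiteP[G [TG ndG Goo]] := sigma_finiteT mu.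
pose s (t : n.+1.-tuple T) : T * n.-tuple T :=
  (tnth t ord0, [tuple of behead t]).
have ms : measurable_fun setT s.
  by apply/measurable_fun_pairP; split;
    [exact: measurable_tnth | exact: measurable_behead].
have sK : cancel (@tuple_cons n) s by move=> [x t]; congr pair; apply/val_inj.
exists (fun k => s @^-1` (F k `*` G k)).
  apply/seteqP; split=> // t _.
  have [i _ Fi] : (\bigcup_k F k) (s t).1 by rewrite -TF.
  have [j _ Gj] : (\bigcup_k G k) (s t).2 by rewrite -TG.
  exists (maxn i j) => //; split.
    by move: Fi; exact/subsetPset/ndF/leq_maxl.
  by move: Gj; exact/subsetPset/ndG/leq_maxr.
move=> k; have [mF Fk] := Foo k; have [mG Gk] := Goo k; split.
  by rewrite -[X in measurable X]setTI; apply: ms => //; exact: measurableX.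
rewrite /lebesgue_step /pushforward -comp_preimage.
rewrite (_ : s \o _ = id) ?preimage_id; last by apply/funext => x; exact: sK.
by rewrite product_measure1E// lte_mul_pinfty// ge0_fin_numE.
Qed.

HB.instance Definition _ := Measure_isSigmaFinite.Build _ _ _ lebesgue_step
  lebesgue_step_sigma_finite.

End step.

Let dirac0_sigma_finite :
  sigma_finite setT (\d_([tuple] : 0.-tuple T) : set _ -> \bar R).
Proof.
by apply: fin_num_fun_sigma_finite; [rewrite measure0|exact: fin_num_measure].
Qed.

(* The n-fold product of the Lebesgue measure of R. *)
Fixpoint lebesgue_tuple n : {sigma_finite_measure set (n.-tuple T) -> \bar R} :=
  match n with
  | 0 => [the {sigma_finite_measure set _ -> \bar R} of \d_([tuple] : 0.-tuple T)]
  | m.+1 =>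
    [the {sigma_finite_measure set _ -> \bar R} of lebesgue_step (lebesgue_tuple m)]
  end.

End lebesgue_measure_tuple.

Section euclidean.
Context {R : realType}.

(* The library norm on 'rV[R]_n is the sup norm; the two below are Euclidean.
   The topology, hence closure, continuity and differentiability, is the same
   for both norms. *)
Definition dotp n (x y : 'rV[R]_n) : R := \sum_i x 0 i * y 0 i.

Definition enorm n (x : 'rV[R]_n) : R := Num.sqrt (dotp x x).

Definition grad n (u : 'rV[R]_n -> R) (x : 'rV[R]_n) : 'rV[R]_n :=
  \row_i 'D_(delta_mx 0 i) u x.

Definition row_of_tuple {n} (t : n.-tuple (measurableTypeR R)) : 'rV[R]_n :=
  \row_i tnth t i.

Definition integral_rV n (D : set 'rV[R]_n) (f : 'rV[R]_n -> R) : R :=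
  \int[lebesgue_tuple n]_(t in row_of_tuple @^-1` D) f (row_of_tuple t).

End euclidean.

Section annulus.
Context {R : realType} {n : nat}.
(* The space dimension N is n.+1, so that the last
   coordinate x_N is x 0 ord_max. *)
Local Notation E := 'rV[R]_n.+1.
Context (R0 R1 : R).
Implicit Types (u v a : E -> R) (p : R).

Definition annulus : set E := [set x | R0 < enorm x < R1].
Local Notation A := annulus.

(* Functions on the closure of A are represented by total functions on E
   whose values outside the closure are irrelevant. *)

(* C^1(closure A): u is continuous on the closure and C^1 inside, and its
   gradient extends continuously to the closure. *)
Definition C1bar u :=
  [/\ {within closure A, continuous u},
      forall x, A x -> differentiable u x &
      exists2 G : E -> E, {within closure A, continuous G} &
        forall x, A x -> grad u x = G x].

Definition vanishes_on_boundary u :=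
  forall x, (closure A `\` interior A) x -> u x = 0.

Definition C10 u := C1bar u /\ vanishes_on_boundary u.

(* U r th = u x with r = |x| and th = arcsin (x_N / |x|). For n.+1 >= 2, U is
   determined by u on [R0, R1] x [-pi/2, pi/2], and its values elsewhere are
   irrelevant. *)
Definition has_axial_profile u (U : R -> R -> R) :=
  forall x, closure A x -> u x = U (enorm x) (asin (x 0 ord_max / enorm x)).

Definition Khat u :=
  [/\ C1bar u,
      forall x, closure A x -> 0 <= u x &
      exists U : R -> R -> R,
        [/\ has_axial_profile u U,
            forall r th, R0 <= r <= R1 -> - (pi / 2) <= th <= pi / 2 ->
              U r th = U r (- th) &
            (* derivability follows from C1bar u; it is recorded because the
               derivative of a non-derivable function is a junk value *)
            forall r th, R0 <= r <= R1 -> 0 < th < pi / 2 ->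
              derivable (U r) th 1 /\ derive1 (U r) th <= 0]].

Definition K u := Khat u /\ vanishes_on_boundary u.

Definition nontrivial u := exists2 x, closure A x & u x != 0.

Section functional.
Context (p : R) (a : E -> R).

Definition energy u : R :=
  2^-1 * integral_rV A (fun x => dotp (grad u x) (grad u x) + u x ^+ 2)
  - p^-1 * integral_rV A (fun x => a x * `|u x| `^ p).

(* I'(u)v: the functional being C^2 on C^1_0(A), its differential at u applied
   to v is the derivative of t |-> I(u + t v) at t = 0. *)
Definition denergy u v : R :=
  derive1 (fun t : R => energy (fun x => u x + t * v x)) 0.

Definition NK : set (E -> R) :=
  [set u | [/\ K u, nontrivial u & denergy u u = 0]].

(* inf is 0 for a set that is empty or not bounded below, so c_I > 0 also says
   that this infimum is a genuine one. *)
Definition cI : R := inf [set energy u | u in NK].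

Definition minimizer u := NK u /\ forall v, NK v -> energy u <= energy v.

(* Weak formulation of - Delta u + u = a u^(p-1) in A, u > 0 in A, u = 0 on the
   boundary of A. *)
Definition solution u :=
  [/\ C10 u,
      forall v, C10 v ->
        integral_rV A (fun x => dotp (grad u x) (grad v x) + u x * v x) =
        integral_rV A (fun x => a x * u x `^ (p - 1) * v x) &
      forall x, A x -> 0 < u x].

End functional.
End annulus.

(* Main.v *)
(* Write Q(u) for the integral of |grad u|^2 + u^2 and P(u) for that of a |u|^p. By
   homogeneity, minimising I on N_K amounts to maximising P over the u in K with
   Q(u) <= 1.

   Let T send g to the solution w of - Lap w + w = g vanishing on the boundary.
   T preserves the cone K, so the Euler-Lagrange equation is obtained although K
   is not a linear space: P being convex, u |-> T(a u^(p-1)), rescaled to Q = 1,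
   does not decrease P, hence a maximiser is a multiple of T(a u^(p-1)).

   T is constructed, with the invariance of K, by approximating g uniformly by
   Bernstein polynomials in z / q with coefficients depending on q, where
   q = |x|^2 and z = x_N^2. For such data the equation is a triangular system of
   ordinary differential equations in q. Monotonicity in the angle follows from
   a two-point maximum principle, and a Lipschitz bound C sup |g| from doubling
   the variables with a reflection coupling; the latter makes the approximate
   solutions converge in C^1.

   A maximiser exists for the nonlinearity cut off at height M, by
   Arzela-Ascoli. It is Lipschitz with constant C (sup u)^(p-1), and u attains
   its maximum on the equator, in a two-dimensional slice on which the Dirichlet
   integral is controlled. There all moments of u are bounded
   independently of M, which bounds sup u, so that the cut-off is inactive for
   large M whatever the exponent p. *)

Require Import Defs.
From HB Require Import structures.
From mathcomp Require Import all_boot all_order all_algebra.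
From mathcomp Require Import all_classical all_reals all_analysis.
From mathcomp Require Import measurable_realfun ring lra.

Set Implicit Arguments.
Unset Strict Implicit.
Unset Printing Implicit Defensive.

Import Order.TTheory GRing.Theory Num.Theory.
Import numFieldNormedType.Exports.

Local Open Scope classical_set_scope.
Local Open Scope ring_scope.

(** * Euclidean geometry and the annulus *)

(** Every function stays in C^1 up to the boundary. A bound on Q alone then gives no compactness:
    compactness comes from the Lipschitz constant of T after one ascent step. It requires a bounded
    source, and the cut-off supplies one.

    As p may be supercritical, no embedding in dimension N controls the moments. The cone replaces
    it: monotonicity puts the maximum of u on the equator x_N = 0, rotation about the axis carries
    it into any plane slice that passes close enough to the axis, and averaging finds such a slice
    on which Q is controlled.

    Strict positivity comes from an explicit barrier concentrated near the equator. It is chosen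
    before the approximate solution, hence survives the limit. It gives positivity only in a ring of
    radii; rings are then chained.

    The equation has to hold for every minimiser and not only for the constructed one. The height
    bound B for cut-off maximisers does not depend on M, so any maximiser of P also maximises the
    problem cut off at a height above both B and its own maximum, and the Euler-Lagrange argument
    applies to it. *)

Lemma cvg_sumr {R : realType} {T I : Type} (F : set_system T) (FF : Filter F)
    (r : seq I) (P : pred I) (f : I -> T -> R) (l : I -> R) :
  (forall i, f i x @[x --> F] --> l i) ->
  \sum_(i <- r | P i) f i x @[x --> F] --> \sum_(i <- r | P i) l i.
Proof.
move=> h; elim: r => [|i r IH].
  by under eq_fun do rewrite big_nil; rewrite big_nil; exact: cvg_cst.
under eq_fun do rewrite big_cons; rewrite big_cons.
by case: (P i) => //; exact: cvgD.
Qed.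

Section dot_product.
Context {R : realType} {n : nat}.
Implicit Types x y z : 'rV[R]_n.

Lemma dotpC x y : dotp x y = dotp y x.
Proof. by apply: eq_bigr => i _; rewrite mulrC. Qed.

Lemma dotpDl x y z : dotp (x + y) z = dotp x z + dotp y z.
Proof. by rewrite -big_split /=; apply: eq_bigr => i _; rewrite mxE mulrDl. Qed.

Lemma dotpZl c x y : dotp (c *: x) y = c * dotp x y.
Proof. by rewrite /dotp mulr_sumr; apply: eq_bigr => i _; rewrite mxE mulrA. Qed.

Lemma dotpDr x y z : dotp x (y + z) = dotp x y + dotp x z.
Proof. by rewrite dotpC dotpDl !(dotpC x). Qed.

Lemma dotpZr c x y : dotp x (c *: y) = c * dotp x y.
Proof. by rewrite dotpC dotpZl (dotpC x). Qed.

Lemma dotpNl x y : dotp (- x) y = - dotp x y.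
Proof. by rewrite -scaleN1r dotpZl mulN1r. Qed.

Lemma dotpNr x y : dotp x (- y) = - dotp x y.
Proof. by rewrite dotpC dotpNl dotpC. Qed.

Lemma dotp_ge0 x : 0 <= dotp x x.
Proof. by apply: sumr_ge0 => i _; rewrite -expr2 sqr_ge0. Qed.

Lemma coord_le_dotp x i : x 0 i ^+ 2 <= dotp x x.
Proof.
rewrite /dotp (bigD1 i) //= -expr2 lerDl.
by apply: sumr_ge0 => j _; rewrite -expr2 sqr_ge0.
Qed.

Lemma dotp0_eq0 x : dotp x x = 0 -> x = 0.
Proof.
move=> x0; apply/rowP => i; rewrite mxE; apply/eqP; rewrite -sqrf_eq0.
by rewrite eq_le sqr_ge0 -x0 coord_le_dotp.
Qed.

Lemma cauchy_schwarz_dotp x y : dotp x y ^+ 2 <= dotp x x * dotp y y.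
Proof.
have [y0|yn0] := eqVneq (dotp y y) 0.
  rewrite (dotp0_eq0 y0).
  rewrite -(scale0r (0 : 'rV[R]_n)) !dotpZr !mul0r mulr0 expr0n.
  by [].
have yp : 0 < dotp y y by rewrite lt_def yn0 dotp_ge0.
(* This squared length is [|y|^2] times the gap in the inequality. *)
have := dotp_ge0 (dotp y y *: x - dotp x y *: y).
rewrite -scaleNr !(dotpDl, dotpDr, dotpZl, dotpZr) (dotpC y x).
set a := dotp x x; set b := dotp x y; set c := dotp y y => H.
have : 0 <= c * (a * c - b ^+ 2) by nra.
by rewrite pmulr_rge0 // subr_ge0.
Qed.

Lemma enorm_ge0 x : 0 <= enorm x.
Proof. exact: sqrtr_ge0. Qed.

Lemma sqr_enorm x : enorm x ^+ 2 = dotp x x.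
Proof. by rewrite sqr_sqrtr // dotp_ge0. Qed.

Lemma enormZ c x : enorm (c *: x) = `|c| * enorm x.
Proof. by rewrite /enorm dotpZl dotpZr mulrA -expr2 sqrtrM ?sqr_ge0 // sqrtr_sqr. Qed.

Lemma enormN x : enorm (- x) = enorm x.
Proof. by rewrite -scaleN1r enormZ normrN1 mul1r. Qed.

Lemma enorm_distC x y : enorm (x - y) = enorm (y - x).
Proof. by rewrite -enormN opprB. Qed.

Lemma enorm0 : enorm (0 : 'rV[R]_n) = 0.
Proof. by rewrite -(scale0r 0) enormZ normr0 mul0r. Qed.

Lemma enorm0_eq0 x : enorm x = 0 -> x = 0.
Proof. by move=> e; apply: dotp0_eq0; rewrite -sqr_enorm e expr0n. Qed.

Lemma norm_dotp_le x y : `|dotp x y| <= enorm x * enorm y.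
Proof.
rewrite -ler_sqr ?nnegrE ?normr_ge0 ?mulr_ge0 ?enorm_ge0 //.
rewrite real_normK ?num_real // exprMn !sqr_enorm; exact: cauchy_schwarz_dotp.
Qed.

Lemma dotp_le x y : dotp x y <= enorm x * enorm y.
Proof. exact: le_trans (ler_norm _) (norm_dotp_le x y). Qed.

Lemma ler_enormD x y : enorm (x + y) <= enorm x + enorm y.
Proof.
rewrite -ler_sqr ?nnegrE ?addr_ge0 ?enorm_ge0 // sqr_enorm.
rewrite dotpDl !dotpDr (dotpC y x) -!sqr_enorm.
have := dotp_le x y; nra.
Qed.

Lemma ler_dist_enorm x y : `|enorm x - enorm y| <= enorm (x - y).
Proof.
have h (a b : 'rV[R]_n) : enorm a - enorm b <= enorm (a - b).
  by rewrite lerBlDr; have := ler_enormD (a - b) b; rewrite subrK.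
by rewrite ler_norml h lerNl opprB enorm_distC h.
Qed.

Lemma coord_le_enorm x i : `|x 0 i| <= enorm x.
Proof.
rewrite -ler_sqr ?nnegrE ?enorm_ge0 // sqr_enorm real_normK ?num_real //.
exact: coord_le_dotp.
Qed.

Lemma norm_le_enorm x : `|x| <= enorm x.
Proof.
rewrite [leLHS]mx_normrE; apply: bigmax_le; first exact: enorm_ge0.
by move=> [i j] _ /=; rewrite ord1; exact: coord_le_enorm.
Qed.

Lemma coord_le_norm x i : `|x 0 i| <= `|x|.
Proof.
rewrite [leRHS]mx_normrE; exact: (le_bigmax _ (fun ij => `|x ij.1 ij.2|) (0, i)).
Qed.

Lemma dotp_continuous : continuous (fun x : 'rV[R]_n => dotp x x).
Proof.
move=> x; rewrite /dotp.
apply: (@cvg_sumr R _ _ (nbhs x) _ _ _ (fun i y => y 0 i * y 0 i)) => i.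
by apply: cvgM; exact: coord_continuous.
Qed.

Lemma enorm_continuous : continuous (@enorm R n).
Proof.
move=> x; rewrite /enorm.
apply: (@continuous_comp _ _ _ (fun x : 'rV[R]_n => dotp x x) Num.sqrt).
  exact: dotp_continuous.
exact: sqrt_continuous.
Qed.

End dot_product.

Section annulus_topology.
Context {R : realType} {n : nat} (R0 R1 : R).
Hypotheses (hR0 : 0 < R0) (hR01 : R0 < R1).
Local Notation E := 'rV[R]_n.+1.
Local Notation A := (@annulus R n R0 R1).

Lemma open_annulus : open A.
Proof.
have -> : A = @enorm R n.+1 @^-1` `]R0, R1[.
  by apply/seteqP; split => x; rewrite /annulus /= in_itv.
apply: open_comp; last exact: itv_open.
by move=> x _; exact: enorm_continuous.
Qed.

Lemma closure_annulus : closure A = [set x : E | R0 <= enorm x <= R1].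
Proof.
apply/seteqP; split.
  have cl : closed (@enorm R n.+1 @^-1` `[R0, R1]).
    by apply: closed_comp => [y _|]; [exact: enorm_continuous|exact: itv_closed].
  rewrite (_ : [set _ | _] = @enorm R n.+1 @^-1` `[R0, R1]); last first.
    by apply/seteqP; split => x; rewrite /= in_itv.
  rewrite [X in _ `<=` X](closure_id _).1 //; apply: closure_subset => x.
  by rewrite /annulus /= in_itv /= => /andP[/ltW -> /ltW ->].
move=> x /= /andP[x0 x1] B Bx.
have xn0 : 0 < enorm x by apply: lt_le_trans x0.
pose c := (R0 + R1) / 2.
(* Moves [x] radially towards the middle sphere: the norm becomes [(1 - t) |x| + t c], strictly
   between the radii for [0 < t < 1] even if [x] is on the boundary. *)
pose y (t : R) := x + t *: ((c / enorm x - 1) *: x).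
have yc : y t @[t --> 0] --> x.
  rewrite -[X in _ --> X]addr0 -(scale0r ((c / enorm x - 1) *: x)).
  by apply: cvgD; [exact: cvg_cst|apply: cvgZr_tmp].
have c0 : 0 < c by rewrite divr_gt0 // addr_gt0 // (lt_trans hR0).
have ye (t : R) : 0 < t < 1 -> enorm (y t) = (1 - t) * enorm x + t * c.
  move=> t01; rewrite /y scalerA -{1}[x]scale1r -scalerDl enormZ.
  have -> : 1 + t * (c / enorm x - 1) = ((1 - t) * enorm x + t * c) / enorm x.
    by field; rewrite gt_eqF.
  case/andP: t01 => t0 t1.
  rewrite normrM normfV ger0_norm; last by rewrite addr_ge0 // mulr_ge0 //; lra.
  by rewrite (gtr0_norm xn0) mulfVK // gt_eqF.
have yB : \forall t \near 0^'+, B (y t).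
  by apply: cvg_at_right_filter yc _ Bx.
have : \forall t \near 0^'+, A (y t) /\ B (y t).
  near=> t; split; last by near: t.
  have t01 : 0 < t < 1 by apply/andP; split; near: t;
     [exact: nbhs_right_gt|exact: nbhs_right_lt].
  rewrite /annulus /= ye //; move: t01 hR01; rewrite /c => /andP[t0 t1] h01.
  by apply/andP; split; nra.
move=> H; have [t ABt] := @filter_ex _ _ (at_right_proper_filter (0 : R)) _ H.
by exists (y t).
Unshelve. all: by end_near. Qed.

Lemma interior_closure_annulus_boundary (x : E) :
  (closure A `\` A) x <-> enorm x = R0 \/ enorm x = R1.
Proof.
rewrite closure_annulus /annulus /=; split.
  move=> [/andP[]]; rewrite le_eqVlt => /orP[/eqP <-|h0]; first by left.
  by rewrite le_eqVlt => /orP[/eqP ->|h1]; [right|rewrite h0 h1].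
by move=> [] -> ; rewrite ?lexx ?ltxx ?andbF /= ?ltW.
Qed.

Lemma subset_closure_annulus : A `<=` closure A.
Proof. exact: subset_closure. Qed.

Lemma compact_closure_annulus : compact (closure A).
Proof.
apply: bounded_closed_compact; last exact: closed_closure.
exists R1; split; first exact: num_real.
move=> M M1 x; rewrite closure_annulus /= => /andP[_ x1].
by apply: ltW; apply: le_lt_trans M1; apply: le_trans (norm_le_enorm _) x1.
Qed.

Lemma vanishes_on_boundaryP (u : E -> R) : vanishes_on_boundary R0 R1 u <->
  forall x, enorm x = R0 \/ enorm x = R1 -> u x = 0.
Proof.
rewrite /vanishes_on_boundary; have -> : interior A = A.
  by rewrite -interior_id; exact: open_annulus.
by split => h x /interior_closure_annulus_boundary; exact: h.
Qed.

End annulus_topology.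

(** * Iterated integrals *)

Section tuple_measure.
Context {R : realType}.
Local Notation T := (measurableTypeR R).

Lemma measurable_cube n (c : 'I_n -> R) (r : R) :
  measurable [set t : n.-tuple T | forall i, `|tnth t i - c i| < r].
Proof.
have -> : [set t : n.-tuple T | forall i, `|tnth t i - c i| < r] =
    \bigcap_(i in [set: 'I_n]) ((fun t : n.-tuple T => tnth t i) @^-1` ball (c i) r).
  apply/seteqP; split => t /= h.
    by move=> i _ /=; rewrite /ball /= distrC; exact: h.
  by move=> i; have := h i I; rewrite /ball /= distrC.
apply: fin_bigcap_measurable; first exact: finite_finset.
move=> i _; rewrite -[X in measurable X]setTI.
by apply: measurable_tnth => //; rewrite ball_itv; exact: measurable_itv.
Qed.

(** The sigma-algebra on tuples is generated by the coordinates, openness refers to the norm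
    topology. The link is that an open set is the countable union of the cubes it contains with
    rational centre and radius [1/(k+1)]. *)
Lemma open_preimage_row_measurable n (U : set 'rV[R]_n) :
  open U -> measurable (row_of_tuple @^-1` U : set (n.-tuple T)).
Proof.
move=> oU.
pose Q := ((n.-tuple rat) * nat)%type.
pose B (p : Q) := [set t : n.-tuple T |
   forall i, `|tnth t i - ratr (tnth p.1 i)| < p.2.+1%:R^-1].
pose good (p : Q) := B p `<=` row_of_tuple @^-1` U.
have -> : row_of_tuple @^-1` U = \bigcup_(p in [set: Q]) (if `[< good p >] then B p else set0).
  apply/seteqP; split => [t /= tU|t [p _]]; last first.
    by case: asboolP => // gp; exact: gp.
  have [e e0 eU] : exists2 e : R, 0 < e & ball (row_of_tuple t) e `<=` U.
    by apply/nbhs_ballP; apply: open_nbhs_nbhs; split.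
  (* With radius below [e / 2], any two points of a cube differ by less than [e] in each coordinate,
     so a cube containing the given point stays in the ball. *)
  pose k := Num.truncn (2 / e).
  have ke : k.+1%:R^-1 < e / 2.
    rewrite -[ltRHS]invrK invf_div ltf_pV2 ?posrE ?divr_gt0 //.
    exact: truncnS_gt.
  have k0 : 0 < k.+1%:R^-1 :> R by rewrite invr_gt0.
  have hq i : exists q : rat, `|tnth t i - ratr q| < k.+1%:R^-1.
    have : tnth t i - k.+1%:R^-1 < tnth t i + k.+1%:R^-1.
      by move: (tnth t i : R) (k.+1%:R^-1 : R) k0 => a b b0; lra.
    move=> /rat_in_itvoo[q]; rewrite in_itv /= => /andP[q1 q2]; exists q.
    move: q1 q2; move: (tnth t i : R) (k.+1%:R^-1 : R) (ratr q : R) => a b c h1 h2.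
    by rewrite ltr_norml; apply/andP; split; lra.
  pose q i := projT1 (cid (hq i)).
  exists ([tuple q i | i < n], k) => //.
  case: asboolP => [_|]; first by move=> i; rewrite tnth_mktuple; exact: projT2 (cid (hq i)).
  case=> s Bs /=; apply: eU; rewrite /ball /=; split => // i j; rewrite ord1 !mxE.
  have := Bs j; rewrite tnth_mktuple /= => h.
  have := projT2 (cid (hq j)); rewrite -/(q j) => h'.
  move: ke h h'; move: (tnth t j : R) (tnth s j : R) (k.+1%:R^-1 : R) (ratr (q j) : R).
  move=> u v b w hb h h'; rewrite /ball /=.
  have -> : u - v = (u - w) - (v - w) by ring.
  by apply: le_lt_trans (ler_normB _ _) _; apply: lt_le_trans (ltrD h' h) _; lra.
apply: countable_bigcupT_measurable => [|p]; first exact: countableP.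
by case: asboolP => _; [exact: measurable_cube|exact: measurable0].
Qed.

Lemma continuous_row_measurable n (U : set 'rV[R]_n) (f : 'rV[R]_n -> R) :
  open U -> {in U, continuous f} ->
  measurable_fun (row_of_tuple @^-1` U : set (n.-tuple T)) (f \o row_of_tuple).
Proof.
move=> oU cf; apply: (measurability _ (RGenOpens.measurableE R)).
move=> _ [_ [a [b ->] <-]].
rewrite (_ : _ `&` _ = row_of_tuple @^-1` (U `&` f @^-1` `]a, b[)) //.
apply: open_preimage_row_measurable.
rewrite openE /= => x [Ux fx]; apply: filterI; first by apply: open_nbhs_nbhs.
by apply: (cf x (mem_set Ux)); apply: open_nbhs_nbhs; split => //; exact: itv_open.
Qed.

Definition tuple_insert n (i : 'I_n.+1) (x : T) (t : n.-tuple T) : n.+1.-tuple T :=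
  [tuple if unlift i j is Some k then tnth t k else x | j < n.+1].

Definition row_insert n (i : 'I_n.+1) (x : R) (y : 'rV[R]_n) : 'rV[R]_n.+1 :=
  \row_j (if unlift i j is Some k then y 0 k else x).

Lemma row_of_tuple_insert n (i : 'I_n.+1) x (t : n.-tuple T) :
  row_of_tuple (tuple_insert i x t) = row_insert i x (row_of_tuple t).
Proof.
apply/rowP => j; rewrite !mxE tnth_mktuple.
by case: (unlift i j) => // k; rewrite mxE.
Qed.

Lemma tuple_insert0 n x (t : n.-tuple T) : tuple_insert ord0 x t = tuple_cons (x, t).
Proof.
apply: eq_from_tnth => j; rewrite tnth_mktuple.
by case: (unliftP ord0 j) => [k ->|->] /=; rewrite ?tnthS // tnth0.
Qed.

Lemma tuple_insertS n (i : 'I_n.+1) x y (t : n.-tuple T) :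
  tuple_insert (lift ord0 i) x (tuple_cons (y, t)) =
  tuple_cons (y, tuple_insert i x t).
Proof.
apply: eq_from_tnth => j; rewrite tnth_mktuple.
case: (unliftP ord0 j) => [k ->|->].
  rewrite tnthS tnth_mktuple.
  case: (unliftP i k) => [l ->|->].
    have -> : lift ord0 (lift i l) = lift (lift ord0 i) (lift ord0 l).
      by apply: val_inj => /=; rewrite /bump /= ltnS !add1n addnS.
    by rewrite liftK tnthS.
  by rewrite unlift_none.
have -> : ord0 = lift (lift ord0 i) ord0 :> 'I_n.+2 by exact: val_inj.
by rewrite liftK !tnth0.
Qed.

Lemma measurable_tuple_insert n (i : 'I_n.+1) :
  measurable_fun setT (fun z : T * n.-tuple T => tuple_insert i z.1 z.2).
Proof.
apply/measurable_fun_tnthP => j.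
rewrite (_ : _ \o _ = fun z : T * n.-tuple T =>
  if unlift i j is Some k then tnth z.2 k else z.1); last first.
  by apply/funext => z /=; rewrite tnth_mktuple.
case: (unliftP i j) => [k _|_]; last exact: measurable_fst.
apply: (@measurableT_comp _ _ _ _ _ _ (fun t : n.-tuple T => tnth t k) _ snd).
  exact: measurable_tnth.
exact: measurable_snd.
Qed.

Local Open Scope ereal_scope.

Lemma lebesgue_tuple_cons n (F : n.+1.-tuple T -> \bar R) :
  measurable_fun setT F -> (forall t, 0 <= F t) ->
  \int[@lebesgue_tuple R n.+1]_t F t =
  \int[(lebesgue_measure \x @lebesgue_tuple R n)]_z F (tuple_cons z).
Proof.
move=> mF F0.
rewrite /= /lebesgue_step ge0_integral_pushforward //.
exact: measurable_tuple_cons.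
Qed.

Lemma measurable_integral_insert n (i : 'I_n.+1) (F : n.+1.-tuple T -> \bar R) :
  measurable_fun setT F -> (forall t, 0 <= F t) ->
  measurable_fun setT
    (fun t : n.-tuple T => \int[@lebesgue_measure R]_x F (tuple_insert i x t)).
Proof.
move=> mF F0.
apply: (measurable_fun_fubini_tonelli_G (fun z => F (tuple_insert i z.1 z.2))) => //.
exact: measurableT_comp mF (measurable_tuple_insert _).
Qed.

Lemma tonelli_insert0 n (F : n.+1.-tuple T -> \bar R) :
  measurable_fun setT F -> (forall t, 0 <= F t) ->
  \int[@lebesgue_tuple R n.+1]_t F t =
  \int[@lebesgue_tuple R n]_t \int[lebesgue_measure]_x F (tuple_insert ord0 x t).
Proof.
move=> mF F0.
rewrite (lebesgue_tuple_cons mF F0).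
rewrite (fubini_tonelli2 (fun z => F (tuple_cons z))); last by move=> z; exact: F0.
  by apply: eq_integral => t _; apply: eq_integral => x _; rewrite tuple_insert0.
exact: measurableT_comp mF (@measurable_tuple_cons _ _).
Qed.

(** The product measure is built by adding coordinates at the head. To integrate first in another
    coordinate, the head is split off on both sides, the two outer integrals are exchanged, and the
    induction hypothesis is used for each fixed head. *)
Lemma tonelli_insert n (i : 'I_n.+1) (F : n.+1.-tuple T -> \bar R) :
  measurable_fun setT F -> (forall t, 0 <= F t) ->
  \int[@lebesgue_tuple R n.+1]_t F t =
  \int[@lebesgue_tuple R n]_t \int[lebesgue_measure]_x F (tuple_insert i x t).
Proof.
elim: n i F => [|n IH] i F mF F0.
  by rewrite (ord1 i) tonelli_insert0.
case: (unliftP ord0 i) => [i' ->|->]; last by rewrite tonelli_insert0.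
rewrite (lebesgue_tuple_cons mF F0).
rewrite (fubini_tonelli1 (fun z => F (tuple_cons z))); first last.
- by move=> z; exact: F0.
- exact: measurableT_comp mF (@measurable_tuple_cons _ _).
rewrite lebesgue_tuple_cons; first last.
- by move=> t; apply: integral_ge0.
- exact: measurable_integral_insert.
rewrite fubini_tonelli1; first last.
- by move=> z; apply: integral_ge0.
- exact: (measurableT_comp (measurable_integral_insert (lift ord0 i') mF F0)
           (@measurable_tuple_cons _ _)).
apply: eq_integral => x0 _; rewrite /fubini_F (IH i' (fun t => F (tuple_cons (x0, t)))).
- by apply: eq_integral => t _; apply: eq_integral => x _; rewrite tuple_insertS.
- apply: measurableT_comp mF _.
  exact: measurableT_comp (@measurable_tuple_cons _ _) (pair1_measurable x0).
- by move=> t; exact: F0.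
Qed.

Lemma lebesgue_tuple_cube n (c : 'I_n -> R) (r : R) : (0 < r)%R ->
  @lebesgue_tuple R n [set t : n.-tuple T | forall i, (`|tnth t i - c i| < r)%R] =
  ((r *+ 2) ^+ n)%:E.
Proof.
move=> r0; elim: n c => [|n IH] c.
  rewrite /= diracE expr0 (_ : (_ \in _) = true) //.
  by apply/mem_set => -[].
rewrite /= /lebesgue_step /pushforward.
have -> : tuple_cons (n := n) @^-1` [set t | forall i, (`|tnth t i - c i| < r)%R] =
    ball (c ord0) r `*` [set t : n.-tuple T | forall i, (`|tnth t i - c (lift ord0 i)| < r)%R].
  apply/seteqP; split => [[x t] h|[x t] [h1 h2] i].
    split => /=; first by rewrite /ball /= distrC; have := h ord0; rewrite tnth0.
    by move=> i; have := h (lift ord0 i); rewrite tnthS.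
  case: (unliftP ord0 i) => [k ->|->]; first by rewrite tnthS; exact: h2.
  by rewrite tnth0 distrC; exact: h1.
rewrite product_measure1E //; last 2 first.
- by rewrite ball_itv; exact: measurable_itv.
- exact: measurable_cube.
rewrite IH; transitivity ((r *+ 2)%:E * ((r *+ 2) ^+ n)%:E).
  by congr (_ * _); exact: lebesgue_measure_ball (ltW r0).
by rewrite -EFinM exprS.
Qed.

End tuple_measure.

(** * Continuity on a subset and integrals over the annulus *)

Section within_continuity.
Context {R : realType} {T : topologicalType} (S : set T).
Implicit Types f g : T -> R.

Lemma within_contM f g : {within S, continuous f} -> {within S, continuous g} ->
  {within S, continuous (fun x => f x * g x)}.
Proof. by move=> cf cg x; apply: cvgM; [exact: cf|exact: cg]. Qed.

Lemma within_contD f g : {within S, continuous f} -> {within S, continuous g} ->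
  {within S, continuous (fun x => f x + g x)}.
Proof. by move=> cf cg x; apply: cvgD; [exact: cf|exact: cg]. Qed.

Lemma within_cont_cst (c : R) : {within S, continuous (fun=> c)}.
Proof. by move=> x; exact: cvg_cst. Qed.

Lemma within_cont_sum (I : Type) (r : seq I) (P : pred I) (f : I -> T -> R) :
  (forall i, {within S, continuous (f i)}) ->
  {within S, continuous (fun x => \sum_(i <- r | P i) f i x)}.
Proof.
by move=> cf x; apply: (@cvg_sumr R (subspace S) I (nbhs x)) => i; exact: cf.
Qed.

Lemma within_cont_comp (g : R -> R) f : continuous g -> {within S, continuous f} ->
  {within S, continuous (fun x => g (f x))}.
Proof. by move=> cg cf x; apply: continuous_comp; [exact: cf|exact: cg]. Qed.

Lemma continuous_within f : continuous f -> {within S, continuous f}.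
Proof. exact: continuous_subspaceT. Qed.

Lemma eq_within_cont f g : (forall x, S x -> f x = g x) ->
  {within S, continuous f} -> {within S, continuous g}.
Proof.
by move=> fg; apply: subspace_eq_continuous => x /set_mem; exact: fg.
Qed.

End within_continuity.

Section annulus_integral.
Context {R : realType} {n : nat} (R0 R1 : R).
Hypotheses (hR0 : 0 < R0) (hR01 : R0 < R1).
Local Notation T := (measurableTypeR R).
Local Notation E := 'rV[R]_n.+1.
Local Notation A := (@annulus R n R0 R1).
Local Notation D := (row_of_tuple @^-1` A : set (n.+1.-tuple T)).
Local Notation mu := (@lebesgue_tuple R n.+1).
Local Notation J := (integral_rV A).
Implicit Types f g : E -> R.

(** A class of integrands that is stable under sums and products and contains the components of
    [grad u] for [C1bar u]: these are controlled on the open annulus only, whereas their values on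
    the boundary are arbitrary. *)
Definition bcont f :=
  (forall x, A x -> {for x, continuous f}) /\ exists M, forall x, A x -> `|f x| <= M.

Lemma measurable_annulus : measurable D.
Proof. apply: open_preimage_row_measurable; exact: open_annulus. Qed.

Lemma annulus_finite : (mu D < +oo)%E.
Proof.
have R1p : 0 < R1 + 1 by rewrite addr_gt0 // (lt_trans hR0).
apply: (@le_lt_trans _ _ (mu [set t | forall i, `|tnth t i - 0| < R1 + 1])).
  apply: le_measure; rewrite ?inE; [exact: measurable_annulus|exact: measurable_cube|].
  move=> t; rewrite /annulus /= => /andP[_ h] i.
  rewrite subr0; have := coord_le_enorm (row_of_tuple t) i; rewrite mxE => hi.
  by apply: le_lt_trans hi _; apply: lt_trans h _; rewrite ltrDl.
by rewrite lebesgue_tuple_cube // ltry.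
Qed.

Lemma bcont_measurable f : bcont f -> measurable_fun D (f \o row_of_tuple).
Proof.
move=> [cf _]; apply: continuous_row_measurable; first exact: open_annulus.
by move=> x /set_mem; exact: cf.
Qed.

Lemma bcont_integrable f : bcont f -> mu.-integrable D (EFin \o (f \o row_of_tuple)).
Proof.
move=> bf; apply: measurable_bounded_integrable.
- exact: measurable_annulus.
- exact: annulus_finite.
- exact: bcont_measurable.
have [_ [M fM]] := bf; exists M; split; first exact: num_real.
by move=> N MN t Dt /=; apply: le_trans (ltW MN); exact: fM.
Qed.

Lemma within_bcont f : {within closure A, continuous f} -> bcont f.
Proof.
move=> cf; split.
  have := continuous_subspaceW (@subset_closure_annulus R n R0 R1) cf.
  rewrite continuous_open_subspace; last exact: open_annulus.
  by move=> h x Ax; apply: h; exact: mem_set.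
have [A0|/set0P/negP/negPn/eqP A0] := pselect (closure A !=set0); last first.
  by exists 0 => x /subset_closure; rewrite A0.
have cnf := within_cont_comp (@norm_continuous R R) cf.
have [c _ hc] := compact_EVT_max A0 (@compact_closure_annulus _ _ _ _ hR0 hR01) cnf.
by exists `|f c| => x Ax; apply: hc; apply/mem_set/subset_closure.
Qed.

Lemma bcontM f g : bcont f -> bcont g -> bcont (fun x => f x * g x).
Proof.
move=> [cf [M fM]] [cg [N gN]]; split.
  by move=> x Ax; apply: continuousM; [exact: cf|exact: cg].
exists (M * N) => x Ax; rewrite normrM; apply: ler_pM => //; [exact: fM|exact: gN].
Qed.

Lemma bcontD f g : bcont f -> bcont g -> bcont (fun x => f x + g x).
Proof.
move=> [cf [M fM]] [cg [N gN]]; split.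
  by move=> x Ax; apply: continuousD; [exact: cf|exact: cg].
exists (M + N) => x Ax; apply: le_trans (ler_normD _ _) _.
by apply: lerD; [exact: fM|exact: gN].
Qed.

Lemma bcont_cst c : bcont (fun=> c).
Proof. by split; [move=> x _; exact: cst_continuous|exists `|c|]. Qed.

Lemma bcontZ c f : bcont f -> bcont (fun x => c * f x).
Proof. exact: bcontM (bcont_cst c). Qed.

Lemma bcontB f g : bcont f -> bcont g -> bcont (fun x => f x - g x).
Proof.
move=> bf bg; have -> : (fun x => f x - g x) = (fun x => f x + (-1) * g x).
  by apply/funext => x; rewrite mulN1r.
by apply: bcontD => //; exact: bcontZ.
Qed.

Lemma eq_bcont f g : (forall x, A x -> f x = g x) -> bcont f -> bcont g.
Proof.
move=> fg [cf [M fM]]; split; last by exists M => x Ax; rewrite -fg //; exact: fM.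
move=> x Ax; have := cf x Ax; rewrite /prop_for /continuous_at -fg //.
have hx : nbhs x A by apply: open_nbhs_nbhs; split => //; exact: open_annulus.
have hn : \forall y \near nbhs x, f y = g y.
  by near=> y; apply: fg; near: y.
by apply: cvg_trans; exact: (near_eq_cvg hn).
Unshelve. all: by end_near.
Qed.

Lemma integral_annulus_ext f g : (forall x, A x -> f x = g x) -> J f = J g.
Proof. by move=> fg; apply: eq_Rintegral => t /set_mem Dt; exact: fg. Qed.

Lemma integral_annulusD f g : bcont f -> bcont g ->
  J (fun x => f x + g x) = J f + J g.
Proof.
move=> bf bg; rewrite /integral_rV RintegralD //; first exact: measurable_annulus.
  exact: bcont_integrable.
exact: bcont_integrable.
Qed.

Lemma integral_annulusZ c f : bcont f -> J (fun x => c * f x) = c * J f.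
Proof.
move=> bf; rewrite /integral_rV RintegralZl //; first exact: measurable_annulus.
exact: bcont_integrable.
Qed.

Lemma integral_annulusB f g : bcont f -> bcont g ->
  J (fun x => f x - g x) = J f - J g.
Proof.
move=> bf bg; rewrite -[in RHS]mulN1r -integral_annulusZ // -integral_annulusD //.
  by apply: integral_annulus_ext => x _; rewrite mulN1r.
exact: bcontZ.
Qed.

Lemma integral_annulus_le f g : bcont f -> bcont g ->
  (forall x, A x -> f x <= g x) -> J f <= J g.
Proof.
move=> bf bg fg; apply: le_Rintegral; first exact: measurable_annulus.
- exact: bcont_integrable.
- exact: bcont_integrable.
- by move=> t Dt; exact: fg.
Qed.

Lemma integral_annulus_ge0 f : (forall x, A x -> 0 <= f x) -> 0 <= J f.
Proof. by move=> f0; apply: Rintegral_ge0 => t Dt; exact: f0. Qed.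

Definition annulus_volume : R := J (fun=> 1).

Lemma annulus_volume_ge0 : 0 <= annulus_volume.
Proof. exact: integral_annulus_ge0. Qed.

Lemma integral_annulus_bound f M : bcont f -> (forall x, A x -> `|f x| <= M) ->
  `|J f| <= M * annulus_volume.
Proof.
move=> bf fM; rewrite -integral_annulusZ; last exact: bcont_cst.
rewrite ler_norml -mulN1r -integral_annulusZ; last exact: bcontZ (bcont_cst _).
apply/andP; split; apply: integral_annulus_le => //; do ?[exact: bcont_cst | apply: bcontZ];
  do ?exact: bcont_cst.
  by move=> x Ax; rewrite mulr1 mulN1r; have := fM x Ax; rewrite ler_norml => /andP[].
by move=> x Ax; rewrite mulr1; exact: le_trans (ler_norm _) (fM x Ax).
Qed.

Lemma integral_annulus_gt0 f x0 : bcont f -> (forall x, A x -> 0 <= f x) ->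
  A x0 -> 0 < f x0 -> 0 < J f.
Proof.
move=> bf f0 Ax0 fx0.
have [r r0 hr] : exists2 r : R, 0 < r &
    ball x0 r `<=` [set x | A x /\ f x0 / 2 <= f x].
  apply/nbhs_ballP; apply: filterI.
    by apply: open_nbhs_nbhs; split => //; exact: open_annulus.
  have : f x0 / 2 < f x0 by lra.
  by have [cf _] := bf; move=> /(cvgr_ge _ (cf x0 Ax0)).
pose C := [set t : n.+1.-tuple T | forall i, `|tnth t i - x0 0 i| < r].
have mC : measurable C by exact: measurable_cube.
have CD t : C t -> A (row_of_tuple t) /\ f x0 / 2 <= f (row_of_tuple t).
  move=> Ct; apply: hr; split => // i j; rewrite ord1 mxE /ball /= distrC; exact: Ct.
have bi := bcont_integrable bf.
rewrite /integral_rV /Rintegral fine_gt0 //; apply/andP; split; last first.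
  have /(integrable_fin_num measurable_annulus) := bi.
  by rewrite ge0_fin_numE //; apply: integral_ge0 => t Dt; rewrite lee_fin; exact: f0.
apply: (@lt_le_trans _ _ (\int[mu]_(t in C) (f x0 / 2)%:E)%E).
  rewrite integral_cst //= lebesgue_tuple_cube // -EFinM lte_fin.
  by rewrite mulr_gt0 ?divr_gt0 // exprn_gt0 // mulrn_wgt0.
apply: (@le_trans _ _ (\int[mu]_(t in C) (f (row_of_tuple t))%:E)%E).
  apply: ge0_le_integral => //.
  - by move=> t _; rewrite lee_fin; lra.

  - apply/measurable_EFinP; apply: (measurable_funS measurable_annulus); last exact: bcont_measurable.
    by move=> t /CD[].
  - by move=> t Ct; rewrite lee_fin; have [] := CD t Ct.
apply: ge0_subset_integral => //.
- exact: measurable_annulus.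
- by apply/measurable_EFinP; exact: bcont_measurable.
- by move=> t Dt; rewrite lee_fin; exact: f0.
- by move=> t /CD[].
Qed.

Lemma integral_annulus_eq0 f : bcont f -> (forall x, A x -> 0 <= f x) ->
  J f = 0 -> forall x, A x -> f x = 0.
Proof.
move=> bf f0 Jf x Ax; apply/eqP; rewrite eq_le f0 // andbT leNgt; apply/negP => fx.
by have := integral_annulus_gt0 bf f0 Ax fx; rewrite Jf ltxx.
Qed.

Lemma bcont_measurable_restrict f : bcont f ->
  measurable_fun setT ((f \_ A) \o row_of_tuple : n.+1.-tuple T -> R).
Proof.
move=> bf; have -> : (f \_ A) \o row_of_tuple = (f \o row_of_tuple) \_ D.
  by apply/funext => t; rewrite /patch /=; congr (if _ then _ else _); apply/idP/idP; rewrite !inE.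
by apply/(measurable_restrictT _ measurable_annulus); exact: bcont_measurable.
Qed.

Lemma sube_eq0 (x y : \bar R) : (x - y = 0 -> x = y)%E.
Proof. by case: x y => [x| |] [y| |] //= /eqP; rewrite -EFinB eqe subr_eq0 => /eqP ->. Qed.

(** Tonelli requires nonnegative integrands, so it is applied to the positive and negative parts
    separately; their integrals agree on every line parallel to the i-th axis. *)
Lemma integral_annulus_lines f (i : 'I_n.+1) : bcont f ->
  (forall y : 'rV[R]_n,
    \int[@lebesgue_measure R]_x ((f \_ A) (row_insert i x y))%:E = 0)%E ->
  J f = 0.
Proof.
move=> bf f0; rewrite /integral_rV Rintegral_mkcond.
pose g t := ((f \_ A) (row_of_tuple t))%:E.
have -> : \int[mu]_t ((fun t => f (row_of_tuple t)) \_ D) t = fine (\int[mu]_t g t).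
  by congr fine; apply: eq_integral => t _; rewrite /g /patch; congr (if _ then _ else _)%:E.
have mg : measurable_fun setT g by apply/measurable_EFinP; exact: bcont_measurable_restrict.
rewrite integralE.
(* If the common value is infinite, the difference is [-oo] by convention and [fine] still returns
   0. *)
suff -> : (\int[mu]_x (g^\+ x) = \int[mu]_x (g^\- x))%E.
  by case: (\int[mu]_x (g^\- x))%E => //= r; rewrite subrr.
rewrite (tonelli_insert i (measurable_funepos mg)); last by move=> t; exact: funepos_ge0.
rewrite (tonelli_insert i (measurable_funeneg mg)); last by move=> t; exact: funeneg_ge0.
apply: eq_integral => t _.
have := f0 (row_of_tuple t); rewrite integralE => /sube_eq0 h.
transitivity (\int[lebesgue_measure]_x
   ((fun x => ((f \_ A) (row_insert i x (row_of_tuple t)))%:E)^\+ x))%E.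
  by apply: eq_integral => x _; rewrite !funeposE /g row_of_tuple_insert.
by rewrite h; apply: eq_integral => x _; rewrite !funenegE /g row_of_tuple_insert.
Qed.

End annulus_integral.

(** * Ordinary differential equations *)

Section bessel_series.
Context {R : realType} (beta : R).
Hypothesis hbeta : 1 <= beta.

(** Power series coefficients of the regular solution of [4 q y'' + beta y' = y], a modified Bessel
    function up to a change of variables. For [beta = 2 N], [y(|x|^2)] is the radial solution of
    [Lap u = u]. *)
Fixpoint bessel_coef (i : nat) : R :=
  if i is j.+1 then bessel_coef j / (j.+1%:R * (4 * j%:R + beta)) else 1.

(** Two requirements shape this condition: it is inherited by the differentiated series, thanks to
    the third clause, and it gives convergence by comparison with the exponential series. *)
Definition fact_dominated (c : R ^nat) :=
  forall i, [/\ 0 <= c i, c i <= (i`!%:R)^-1 & i.+1%:R * c i.+1 <= c i].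

Lemma fact_dominated_diffs c : fact_dominated c -> fact_dominated (pseries_diffs c).
Proof.
move=> hc i; have [c0 c1 c2] := hc i; have [d0 d1 d2] := hc i.+1.
rewrite /pseries_diffs; split.
- by rewrite mulr_ge0.
- exact: le_trans c2 c1.
- by rewrite ler_wpM2l.
Qed.

Lemma fact_dominated_cvg c x : fact_dominated c -> 0 <= x -> cvgn (pseries c x).
Proof.
move=> hc x0; apply: (@series_le_cvg _ _ (exp_coeff x)).
- by move=> i; have [? _ _] := hc i; rewrite mulr_ge0 // exprn_ge0.
- by move=> i; rewrite /exp_coeff /= mulr_ge0 // ?exprn_ge0 // invr_ge0.
- by move=> i; rewrite /exp_coeff /= mulrC ler_wpM2l ?exprn_ge0 //; have [] := hc i.
- exact: is_cvg_series_exp_coeff.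
Qed.

Lemma bessel_coefS i :
  i.+1%:R * bessel_coef i.+1 = bessel_coef i / (4 * i%:R + beta).
Proof.
have b0 : 0 < beta := lt_le_trans ltr01 hbeta.
have d0 : 4 * i%:R + beta != 0 by rewrite gt_eqF // ltr_wpDl // mulr_ge0.
by rewrite /=; field; rewrite d0 addrC natr1 pnatr_eq0.
Qed.

Lemma bessel_coef_dominated : fact_dominated bessel_coef.
Proof.
have b0 : 0 < beta := lt_le_trans ltr01 hbeta.
have den (i : nat) : 1 <= 4 * i%:R + beta by rewrite (le_trans hbeta) // lerDr mulr_ge0.
have pos i : 0 < bessel_coef i.
  elim: i => [|i IH] /=; first exact: ltr01.
  by rewrite divr_gt0 // mulr_gt0 // (lt_le_trans ltr01).
have dec i : i.+1%:R * bessel_coef i.+1 <= bessel_coef i.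
  have d0 : 0 < 4 * i%:R + beta by exact: lt_le_trans (den i).
  rewrite bessel_coefS -[leRHS]mulr1 ler_wpM2l ?(ltW (pos i)) //.
  by rewrite invf_le1.
move=> i; split; [exact: ltW|elim: i => [|i IH]|exact: dec].
  by rewrite fact0 invr1.
rewrite factS natrM invfM ler_pdivlMl ?ltr0n //.
by rewrite (le_trans (dec i)).
Qed.

Let a := bessel_coef.
Let a1 := pseries_diffs a.
Let a2 := pseries_diffs a1.
Definition bessel_sol (q : R) : R := limn (pseries a q).
Definition bessel_sol1 (q : R) : R := limn (pseries a1 q).
Definition bessel_sol2 (q : R) : R := limn (pseries a2 q).

Lemma pseries_is_derive c (q : R) : fact_dominated c -> 0 < q ->
  is_derive q 1 (fun x : R => limn (pseries c x)) (limn (pseries (pseries_diffs c) q)).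
Proof.
move=> hc q0; have q1 : 0 <= q + 1 by rewrite addr_ge0 // ltW.
apply: (@pseries_snd_diffs _ c (q + 1)).
- exact: fact_dominated_cvg.
- by apply: fact_dominated_cvg => //; exact: fact_dominated_diffs.
- by apply: fact_dominated_cvg => //; do 2 apply: fact_dominated_diffs.
- by rewrite !ger0_norm ?(ltW q0) // ltrDl.
Qed.

Lemma bessel_sol_derive (q : R) : 0 < q -> is_derive q 1 bessel_sol (bessel_sol1 q).
Proof. by move=> q0; apply: pseries_is_derive => //; exact: bessel_coef_dominated. Qed.

Lemma bessel_sol1_derive (q : R) : 0 < q -> is_derive q 1 bessel_sol1 (bessel_sol2 q).
Proof.
move=> q0; apply: pseries_is_derive => //.
by apply: fact_dominated_diffs; exact: bessel_coef_dominated.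
Qed.

Lemma bessel_sol_ge1 (q : R) : 0 < q -> 1 <= bessel_sol q.
Proof.
move=> /ltW q0; apply: limr_ge; first exact/fact_dominated_cvg/q0/bessel_coef_dominated.
exists 1%N => // m /= m1; rewrite /pseries /series /= big_ltn // expr0 mulr1 lerDl.
apply: sumr_ge0 => i _; rewrite mulr_ge0 ?exprn_ge0 //.
by have [] := bessel_coef_dominated i.
Qed.

Lemma bessel_sol_eq (q : R) : 0 < q ->
  4 * q * bessel_sol2 q + beta * bessel_sol1 q - bessel_sol q = 0.
Proof.
move=> /ltW q0.
have h0 := bessel_coef_dominated.
have h1 := fact_dominated_diffs h0.
have h2 := fact_dominated_diffs h1.
have c0 := fact_dominated_cvg h0 q0.
have c1 := fact_dominated_cvg h1 q0.
have c2 := fact_dominated_cvg h2 q0.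

(* The factor [q] raises degrees by one, so the second-derivative sum stops one term earlier; all
   three pieces then have degree at most [n] and the combination vanishes exactly for each [n]. *)
pose s n := 4 * q * pseries a2 q n + beta * pseries a1 q n.+1 - pseries a q n.+1.
have sh f : cvgn (pseries f q) -> pseries f q n.+1 @[n --> \oo] --> limn (pseries f q).
  by move=> cf; have := cf; rewrite -(cvg_shiftS (pseries f q)); apply.
have s_lim : s n @[n --> \oo] --> 4 * q * bessel_sol2 q + beta * bessel_sol1 q - bessel_sol q.
  apply: cvgB; last exact: sh.
  by apply: cvgD; apply: cvgM; first [exact: cvg_cst|exact: c2|exact: sh].
have s0 : s = fun=> 0.
  have e (i : nat) : (4 * i%:R + beta) * a1 i = a i.
    rewrite /a1 /pseries_diffs /= bessel_coefS mulrC mulfVK // gt_eqF //.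
    by rewrite ltr_wpDl ?mulr_ge0 // (lt_le_trans ltr01 hbeta).
  apply/funext; elim => [|m IH].
    rewrite /s /pseries /series /= big_geq // !big_nat1 !expr0 !mulr1.
    by rewrite mulr0 add0r -(e 0) mulr0 add0r subrr.
  rewrite -IH /s /pseries /series /= big_nat_recr //= [in X in _ + _ * X]big_nat_recr //=.
  rewrite (big_nat_recr (m.+1) 0 (fun k => a k * q ^+ k)) // -(e m.+1).
  have -> : a2 m = m.+1%:R * a1 m.+1 by [].
  rewrite exprS; move: (a1 m.+1) => c.
  rewrite /=.
  by ring.
by rewrite s0 in s_lim; rewrite -(cvg_lim (@norm_hausdorff _ R) s_lim); exact: lim_cst.
Qed.

End bessel_series.
Section two_point_boundary_problem.
Context {R : realType}.

Lemma is_derive_continuous (f : R -> R) (x d : R) :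
  is_derive x 1 f d -> {for x, continuous f}.
Proof. by move=> h; apply: differentiable_continuous; apply/derivable1_diffP. Qed.

Lemma antiderivative (h : R -> R) (c : R) :
  (forall q, c <= q -> {for q, continuous h}) ->
  exists H : R -> R, forall q : R, c < q -> is_derive q 1 H (h q).
Proof.
move=> ch; exists (fun q => \int[@lebesgue_measure R]_(t in `[c, q]) h t) => q cq.
have cqu : q < q + 1 by rewrite ltrDl.
have ih : lebesgue_measure.-integrable `[c, q + 1] (EFin \o h).
  apply: continuous_compact_integrable; first exact: segment_compact.
  apply: continuous_in_subspaceT => x; rewrite inE /= in_itv /= => /andP[cx _].
  exact: ch.
have [d e] := continuous_FTC1_closed cqu ih cq (ch q (ltW cq)).
by rewrite -e derive1E; exact: derivableP.
Qed.

(** Reduction of order. With the positive homogeneous solution [y], the integrating factor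
    [P = q^(beta/4)] and [b = y g], the equation becomes [(P y^2 g')' = - P y k / (4 q)], which two
    integrations solve; one free constant is left for the second boundary value. *)
Lemma linear_bvp (beta c Q0 Q1 : R) (k : R -> R) :
  1 <= beta -> 0 < c -> c < Q0 -> Q0 < Q1 ->
  (forall q, c / 2 < q -> {for q, continuous k}) ->
  exists b b1 b2 : R -> R, [/\ b Q0 = 0, b Q1 = 0 &
    forall q : R, c < q ->
    [/\ is_derive q 1 b (b1 q), is_derive q 1 b1 (b2 q) &
        4 * q * b2 q + beta * b1 q - b q = - k q]].
Proof.
move=> hb c00 cQ0 q01 ck.
have b0 : 0 < beta := lt_le_trans ltr01 hb.
pose y := bessel_sol beta; pose y1 := bessel_sol1 beta; pose y2 := bessel_sol2 beta.
pose P (q : R) := q `^ (beta / 4); pose P1 (q : R) := beta / 4 * q `^ (beta / 4 - 1).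
have yd (q : R) : 0 < q -> is_derive q 1 y (y1 q) := @bessel_sol_derive _ _ hb q.
have y1d (q : R) : 0 < q -> is_derive q 1 y1 (y2 q) := @bessel_sol1_derive _ _ hb q.
have Pd (q : R) : 0 < q -> is_derive q 1 P (P1 q) := is_derive1_powR (beta / 4) (x := q).
have P0 (q : R) : 0 < q -> 0 < P q by move=> q0; rewrite powR_gt0.
have y0 (q : R) : 0 < q -> 0 < y q by move=> q0; exact: lt_le_trans (bessel_sol_ge1 hb q0).
have P1E (q : R) : 0 < q -> P1 q = beta / 4 * P q / q.
  move=> q0; rewrite /P1 /P -(@mulr_powRB1 _ q (beta / 4)) ?divr_gt0 // ?ltW //.
  by field; rewrite gt_eqF.
(* An antiderivative of a function continuous on a closed half-line is derivable on the open one
   only. The intermediate bound [3/4 c] between [c/2] and [c] leaves room for the two nested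
   integrations. *)
have [K Kd] : exists K, forall q : R, 3 / 4 * c < q -> is_derive q 1 K (P q / (4 * q) * y q * k q).
  apply: antiderivative => q hq; have q0 : 0 < q by lra.
  apply: continuousM; last by apply: ck; lra.
  apply: continuousM; last exact: is_derive_continuous (yd _ q0).
  apply: continuousM; first exact: is_derive_continuous (Pd _ q0).
  apply: continuousV; first by rewrite mulf_neq0 // gt_eqF.
  by apply: continuousM; [exact: cst_continuous|exact: id].
have den (q : R) : 0 < q -> {for q, continuous (fun q => (P q * y q ^+ 2)^-1)}.
  move=> q0; apply: continuousV; first by rewrite gt_eqF // mulr_gt0 ?exprn_gt0 ?P0 ?y0.
  apply: continuousM; first exact: is_derive_continuous (Pd _ q0).
  by apply: continuousM; exact: is_derive_continuous (yd _ q0).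
have h2 (q : R) : c <= q -> 0 < q by exact: lt_le_trans.
have h24 (q : R) : c <= q -> 3 / 4 * c < q by move=> ?; lra.
have [G0 G0d] := antiderivative (fun q hq => den q (h2 q hq)).
have [G1 G1d] : exists G1, forall q : R, c < q -> is_derive q 1 G1 (K q * (P q * y q ^+ 2)^-1).
  apply: antiderivative => q hq; apply: continuousM; last exact/den/h2.
  exact: is_derive_continuous (Kd _ (h24 _ hq)).
have G01 : 0 < G0 Q1 - G0 Q0.
  have [|||d dI ->] := @MVT R G0 (fun q => (P q * y q ^+ 2)^-1) Q0 Q1.
  - by [].
  - by move=> x; rewrite in_itv /= => /andP[hx _]; apply: G0d; lra.
  - apply: continuous_in_subspaceT => x; rewrite inE /= in_itv /= => /andP[hx _].
    have hx' : c < x by lra.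
    exact: is_derive_continuous (G0d _ hx').
  have d0 : 0 < d by move: dI; rewrite in_itv /= => /andP[? _]; lra.
  by rewrite mulr_gt0 ?subr_gt0 // invr_gt0 mulr_gt0 ?exprn_gt0 ?P0 ?y0.
(* Chosen so that [g] vanishes at [Q1]; the denominator is positive because [G0] has positive
   derivative. *)
pose C := (G1 Q1 - G1 Q0) / (G0 Q1 - G0 Q0).
pose g q := C * (G0 q - G0 Q0) - (G1 q - G1 Q0).
pose D q := (P q * y q ^+ 2)^-1.
pose g1 q := (C - K q) * D q.
pose D1 q := - (D q ^+ 2 * (P1 q * y q ^+ 2 + P q * (2 * y q * y1 q))).
pose g2 q := - (P q / (4 * q) * y q * k q) * D q + (C - K q) * D1 q.
exists (fun q => y q * g q), (fun q => y1 q * g q + y q * g1 q),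
  (fun q => y2 q * g q + 2 * y1 q * g1 q + y q * g2 q); split.
- by rewrite /g !subrr mulr0 subrr mulr0.
- by rewrite /g /C mulfVK ?subrr ?mulr0 // gt_eqF.
move=> q hq; have q0 := h2 q (ltW hq).
have gd : is_derive q 1 g (g1 q).
  have h0 := G0d q hq; have h1 := G1d q hq.
  by rewrite /g; apply: is_derive_eq; rewrite /g1 /D /GRing.scale /=; ring.
have Dd : is_derive q 1 D (D1 q).
  have hP := Pd q q0; have hy := yd q q0.
  have n0 : P q * y q ^+ 2 != 0 by rewrite gt_eqF // mulr_gt0 ?exprn_gt0 ?P0 ?y0.
  have hPy : is_derive q 1 (fun q => P q * y q ^+ 2) (P1 q * y q ^+ 2 + P q * (2 * y q * y1 q)).
    by apply: is_derive_eq; rewrite /GRing.scale /=; ring.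
  apply: is_derive_eq; first exact: (@is_deriveV R (fun q => P q * y q ^+ 2) q _ 1 n0 hPy).
  by rewrite /D1 /D /GRing.scale /= exprVn; ring.
have g1d : is_derive q 1 g1 (g2 q).
  have hK := Kd q (h24 q (ltW hq)).
  by rewrite /g1; apply: is_derive_eq; rewrite /g2 /GRing.scale /=; ring.
have hy := yd q q0; have hy1 := y1d q q0.
split.
- by apply: is_derive_eq; rewrite /GRing.scale /=; ring.
- by apply: is_derive_eq; rewrite /GRing.scale /=; ring.
have := bessel_sol_eq hb q0; rewrite -/(y q) -/(y1 q) -/(y2 q) => eq0.
have ey : y2 q = (y q - beta * y1 q) / (4 * q).
  have -> : y q - beta * y1 q = 4 * q * y2 q by move/eqP: eq0; rewrite subr_eq0 => /eqP <-; ring.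
  by field; rewrite gt_eqF.
rewrite /g2 /g1 /D1 /D ey P1E //; move: (y0 q q0) (P0 q q0); clear -q0.
move: (y q) (y1 q) (P q) (K q) (k q) (g q) => yy yy1 PP KK kk gg hy hP.
by field; rewrite !gt_eqF.
Qed.

End two_point_boundary_problem.

(** * One-sided and second derivative tests *)

Section derivative_tests.
Context {R : realType}.

Lemma deriv_gt0_right (f : R -> R) (d : R) : is_derive (0 : R) 1 f d -> 0 < d ->
  exists2 e : R, 0 < e & forall t, 0 < t < e -> f 0 < f t.
Proof.
move=> [df fd] d0.
have := df; rewrite /derivable => /cvg_ex[l hl].
have ld : l = d by rewrite -fd; apply/esym/cvg_lim.
rewrite ld in hl; have /= hn := cvgr_gt d hl 0 d0.
move: (hn (dnbhs_filter (0 : R))) => /nbhs_ballP[e /= e0 he].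
exists e => // t /andP[t0 te].
have := he t; rewrite /ball /= sub0r normrN gtr0_norm // => /(_ te).
rewrite /= (gt_eqF t0) => /(_ isT); rewrite /GRing.scale /= mulr1 addr0.
by rewrite pmulr_rgt0 ?invr_gt0 // subr_gt0.
Qed.

Lemma deriv_le0_right_max (f : R -> R) (d e : R) : 0 < e -> is_derive (0 : R) 1 f d ->
  (forall t, 0 < t < e -> f t <= f 0) -> d <= 0.
Proof.
move=> e0 fd fm; rewrite leNgt; apply/negP => d0.
have [e' e'0 h] := deriv_gt0_right fd d0.
pose t := Num.min e e' / 2.
have m0 : 0 < Num.min e e' by rewrite lt_min e0.
have t1 : 0 < t < e.
  rewrite divr_gt0 //=; apply: (@lt_le_trans _ _ (Num.min e e')); last by rewrite ge_min lexx.
  by rewrite /t; lra.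
have t2 : 0 < t < e'.
  rewrite divr_gt0 //=; apply: (@lt_le_trans _ _ (Num.min e e')); last by rewrite ge_min lexx orbT.
  by rewrite /t; lra.
by have := fm t t1; rewrite leNgt h.
Qed.

Lemma is_derive_compN (f : R -> R) (d : R) : is_derive (0 : R) 1 f d ->
  is_derive (0 : R) 1 (fun t => f (- t)) (- d).
Proof.
move=> fd; have fd' : is_derive (- 0 : R) 1 f d by rewrite oppr0.
have h := is_derive1_comp fd' (is_deriveN (is_derive_id (0 : R) 1)).
by rewrite -mulrN1; exact: h.
Qed.

Lemma deriv_ge0_left_max (f : R -> R) (d e : R) : 0 < e -> is_derive (0 : R) 1 f d ->
  (forall t, - e < t < 0 -> f t <= f 0) -> 0 <= d.
Proof.
move=> e0 fd fm; rewrite -oppr_le0.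
apply: (deriv_le0_right_max e0 (is_derive_compN fd)) => t /andP[t0 te].
by rewrite oppr0; apply: fm; rewrite ltrN2 te oppr_lt0.
Qed.

(** Only the derivative of [f1] at 0 is assumed. If it were positive, [f1] would be positive just to
    the right of 0 and the mean value theorem would give larger values of [f]. *)
Lemma second_derivative_max (f f1 : R -> R) (D e : R) : 0 < e ->
  (forall t : R, `|t| < e -> is_derive t 1 f (f1 t)) -> is_derive (0 : R) 1 f1 D ->
  (forall t, `|t| < e -> f t <= f 0) -> f1 0 = 0 /\ D <= 0.
Proof.
move=> e0 fd f1d fm.
have f0 : is_derive (0 : R) 1 f (f1 0) by apply: fd; rewrite normr0.
have f10 : f1 0 = 0.
  apply: le_anti; apply/andP; split.
    apply: (deriv_le0_right_max e0 f0) => t /andP[t0 te]; apply: fm.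
    by rewrite gtr0_norm.
  apply: (deriv_ge0_left_max e0 f0) => t /andP[t0 te]; apply: fm.
  by rewrite ltr0_norm // ltrNl.
split => //; rewrite leNgt; apply/negP => D0.
have [e' e'0 h] := deriv_gt0_right f1d D0.
have [t t0 [te te']] : exists2 t : R, 0 < t & t < e /\ t < e'.
  have m0 : 0 < Num.min e e' by rewrite lt_min e0.
  exists (Num.min e e' / 2); first by rewrite divr_gt0.
  by split; apply: (@lt_le_trans _ _ (Num.min e e')); rewrite ?ge_min ?lexx ?orbT //; lra.
have [|||c] := @MVT R f f1 0 t.
- exact: t0.
- move=> x; rewrite in_itv /= => /andP[x0 xt]; apply: fd.
  by rewrite gtr0_norm // (lt_trans xt).
- apply: continuous_in_subspaceT => x; rewrite inE /= in_itv /= => /andP[x0 xt].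
  have hx : `|x| < e by rewrite ger0_norm // (le_lt_trans xt).
  exact: is_derive_continuous (fd x hx).
rewrite in_itv /= subr0 => /andP[c0 ct] E.
have := fm t; rewrite gtr0_norm // => /(_ te).
rewrite -subr_le0 E; apply/negP; rewrite -ltNge mulr_gt0 //.
by rewrite -f10; apply: h; rewrite c0 (lt_trans ct).
Qed.

Lemma is_derive_bigsum (m : nat) (f : 'I_m -> R -> R) (d : 'I_m -> R) (x : R) :
  (forall i, is_derive x 1 (f i) (d i)) ->
  is_derive x 1 (fun t => \sum_(i < m) f i t) (\sum_(i < m) d i).
Proof.
move=> h; have -> : (fun t => \sum_(i < m) f i t) = \sum_(i < m) f i.
  by apply/funext => t; rewrite fct_sumE.
exact: is_derive_sum.
Qed.

End derivative_tests.

(** * Polynomials in x_N^2 with radial coefficients *)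

Section radial_polynomials.
Context {R : realType}.
Implicit Types (m : nat) (b : nat -> R -> R) (q z t : R).

Definition rpoly m b q z : R := \sum_(j < m) b j q * z ^+ j.
Definition rpoly_z m b q z : R := \sum_(j < m) b j q * (j%:R * z ^+ j.-1).
Definition rpoly_zz m b q z : R := \sum_(j < m) b j q * (j%:R * (j.-1%:R * z ^+ j.-2)).

Definition twice_derivable (c : R) b b1 b2 := forall j q, c < q ->
  is_derive q 1 (b j) (b1 j q) /\ is_derive q 1 (b1 j) (b2 j q).

Lemma is_derive_pow (f : R -> R) (d t : R) j : is_derive t 1 f d ->
  is_derive t 1 (fun x => f x ^+ j) (j%:R * f t ^+ j.-1 * d).
Proof.
move=> fd; case: j => [|j].
  by rewrite mul0r mul0r; under eq_fun do rewrite expr0; exact: is_derive_cst.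
rewrite (_ : (fun x => f x ^+ j.+1) = f ^+ j.+1); last first.
  by apply/funext => x; rewrite exprfctE.
by apply: is_derive_eq; rewrite /GRing.scale /=; ring.
Qed.

(** Along a straight line in space both [|x|^2] and [x_N^2] are quadratic in the parameter, so
    differentiating along lines means differentiating along quadratic paths in the [(q, z)]
    plane. *)
Definition quad (a0 a1 a2 t : R) := a0 + a1 * t + a2 * t ^+ 2.

Lemma quad_derive a0 a1 a2 t : is_derive t 1 (quad a0 a1 a2) (a1 + 2 * a2 * t).
Proof. by rewrite /quad; apply: is_derive_eq; rewrite /GRing.scale /=; ring. Qed.

Definition rpoly_path m b q0 q1 q2 z0 z1 z2 t := rpoly m b (quad q0 q1 q2 t) (quad z0 z1 z2 t).
Definition rpoly_path1 m b b1 q0 q1 q2 z0 z1 z2 t :=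
  rpoly m b1 (quad q0 q1 q2 t) (quad z0 z1 z2 t) * (q1 + 2 * q2 * t) +
  rpoly_z m b (quad q0 q1 q2 t) (quad z0 z1 z2 t) * (z1 + 2 * z2 * t).

Lemma rpoly_path_derive c m b b1 b2 q0 q1 q2 z0 z1 z2 t :
  twice_derivable c b b1 b2 -> c < quad q0 q1 q2 t ->
  is_derive t 1 (rpoly_path m b q0 q1 q2 z0 z1 z2)
    (rpoly_path1 m b b1 q0 q1 q2 z0 z1 z2 t).
Proof.
move=> hb hq; have qd := quad_derive q0 q1 q2 t; have zd := quad_derive z0 z1 z2 t.
rewrite /rpoly_path /rpoly_path1 /rpoly /rpoly_z !mulr_suml -big_split /=.
apply: is_derive_bigsum => j.
have [bd _] := hb j _ hq.
have bqd := is_derive1_comp bd qd.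
have zjd := is_derive_pow j zd.
by apply: is_derive_eq; rewrite /GRing.scale /=; ring.
Qed.

Lemma rpoly_path1_derive c m b b1 b2 q0 q1 q2 z0 z1 z2 :
  twice_derivable c b b1 b2 -> c < q0 ->
  is_derive (0 : R) 1 (rpoly_path1 m b b1 q0 q1 q2 z0 z1 z2)
    (rpoly m b2 q0 z0 * q1 ^+ 2 + 2 * rpoly_z m b1 q0 z0 * q1 * z1 +
     rpoly_zz m b q0 z0 * z1 ^+ 2 + 2 * q2 * rpoly m b1 q0 z0 +
     2 * z2 * rpoly_z m b q0 z0).
Proof.
move=> hb hq.
have E a0 a1 a2 : quad a0 a1 a2 0 = a0 by rewrite /quad expr0n /= !mulr0 !addr0.
have hq0 : c < quad q0 q1 q2 0 by rewrite E.
have qd := quad_derive q0 q1 q2 0; have zd := quad_derive z0 z1 z2 0.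
have d1 : is_derive (0 : R) 1 (fun t => rpoly m b1 (quad q0 q1 q2 t) (quad z0 z1 z2 t))
    (rpoly m b2 q0 z0 * q1 + rpoly_z m b1 q0 z0 * z1).
  rewrite /rpoly /rpoly_z !mulr_suml -big_split /=; apply: is_derive_bigsum => j.
  have [_ bd] := hb j _ hq0.
  have bqd := is_derive1_comp bd qd.
  have zjd := is_derive_pow j zd.
  by apply: is_derive_eq; rewrite /GRing.scale /= !E; ring.
have d2 : is_derive (0 : R) 1 (fun t => rpoly_z m b (quad q0 q1 q2 t) (quad z0 z1 z2 t))
    (rpoly_z m b1 q0 z0 * q1 + rpoly_zz m b q0 z0 * z1).
  rewrite /rpoly_z /rpoly_zz !mulr_suml -big_split /=; apply: is_derive_bigsum => j.
  have [bd _] := hb j _ hq0.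
  have bqd := is_derive1_comp bd qd.
  have zjd := is_derive_pow j.-1 zd.
  by apply: is_derive_eq; rewrite /GRing.scale /= !E; ring.
by rewrite /rpoly_path1; apply: is_derive_eq; rewrite /GRing.scale /= !E; ring.
Qed.

Definition rpoly_lap (al be : R) m b b1 b2 q z :=
  4 * q * rpoly m b2 q z + 8 * z * rpoly_z m b1 q z + 4 * z * rpoly_zz m b q z +
  be * rpoly m b1 q z + al * rpoly_z m b q z.

(** Comparison of the coefficients of [z^j]. The terms [4 z F_zz + 2 F_z] lower the degree by one
    and contribute [(2 j + 2)(2 j + 1)] times the next coefficient, while [8 z F_qz] adds [8 j] to
    the first-order coefficient. Hence row [j] involves only [b j] and [b j.+1]. *)
Lemma rpoly_lap_coef (be : R) m b b1 b2 h c :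
  (forall q, b m q = 0) ->
  (forall j q, (j < m)%N -> c < q ->
     4 * q * b2 j q + (be + 8 * j%:R) * b1 j q +
       (2 * j%:R + 2) * (2 * j%:R + 1) * b j.+1 q - b j q = - h j q) ->
  forall q z, c < q -> rpoly_lap 2 be m b b1 b2 q z = rpoly m b q z - rpoly m h q z.
Proof.
move=> bm hb q z cq; rewrite /rpoly_lap.
have E : 4 * z * rpoly_zz m b q z + 2 * rpoly_z m b q z =
    \sum_(j < m) ((2 * j%:R + 2) * (2 * j%:R + 1) * b j.+1 q) * z ^+ j.
  rewrite /rpoly_z /rpoly_zz !mulr_sumr -big_split /=.
  case: m bm hb => [|m] bm hb; first by rewrite !big_ord0.
  rewrite big_ord_recl /= !mul0r !mulr0 addr0 add0r.
  rewrite [RHS]big_ord_recr /= bm mulr0 mul0r addr0.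
  apply: eq_bigr => j _; rewrite /bump /= add1n -natr1.
  case: (j : nat) => [|i] /=; first by rewrite expr0; ring.
  by rewrite exprS -natr1; ring.
transitivity (4 * q * rpoly m b2 q z + 8 * z * rpoly_z m b1 q z + be * rpoly m b1 q z +
   (4 * z * rpoly_zz m b q z + 2 * rpoly_z m b q z)); first by ring.
rewrite E /rpoly /rpoly_z !mulr_sumr -!big_split -sumrB /=; apply: eq_bigr => j _.
have e : h j q = b j q - (4 * q * b2 j q + (be + 8 * j%:R) * b1 j q +
       (2 * j%:R + 2) * (2 * j%:R + 1) * b j.+1 q).
  by have := hb j q (ltn_ord j) cq => /(congr1 -%R); rewrite opprK => <-; ring.
rewrite e; case: (j : nat) => [|i] /=; first by rewrite expr0; ring.
by rewrite exprS; ring.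
Qed.

End radial_polynomials.

(** * Functions of |x|^2 and x_N^2 *)

Section triangular_system.
Context {R : realType} (Q0 Q1 : R).
Hypotheses (hQ0 : 0 < Q0) (hQ01 : Q0 < Q1).

(** The rows of index at least 1 are solved first, on the larger range [q > c / 2], and then enter
    the right-hand side of row 0. Each row costs a halving of the range, which is why [c] is
    quantified inside the induction. *)
Lemma triangular_bvp (m : nat) (be ka : nat -> R) (h : nat -> R -> R) (c : R) :
  (forall j, 1 <= be j) -> 0 < c -> c < Q0 ->
  (forall j q, 0 < q -> {for q, continuous (h j)}) ->
  exists b b1 b2, [/\ twice_derivable c b b1 b2,
    forall j, b j Q0 = 0 /\ b j Q1 = 0,
    forall j q, (m <= j)%N -> b j q = 0 &
    forall j q, (j < m)%N -> c < q ->
      4 * q * b2 j q + be j * b1 j q + ka j * b j.+1 q - b j q = - h j q].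
Proof.
elim: m be ka h c => [|m IH] be ka h c hbe c0 cQ ch.
  exists (fun _ _ => 0), (fun _ _ => 0), (fun _ _ => 0); split => //.
  by move=> j q _; split; exact: is_derive_cst.
have [||b [b1 [b2 [hb b01 bm bE]]]] :=
    IH (be \o S) (ka \o S) (h \o S) (c / 2) (fun j => hbe j.+1) _ _ (fun j => ch j.+1).
- by rewrite divr_gt0.
- by lra.
have [|e [e1 [e2 [e01 e02 eE]]]] := @linear_bvp R (be 0) c Q0 Q1 (fun q => h 0 q + ka 0 * b 0 q)
    (hbe 0) c0 cQ hQ01.
  move=> q hq; apply: continuousD; first by apply: ch; lra.
  apply: continuousM; first exact: cst_continuous.
  by have [bd _] := hb 0 q hq; exact: is_derive_continuous bd.
exists (fun j => if j is i.+1 then b i else e), (fun j => if j is i.+1 then b1 i else e1),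
  (fun j => if j is i.+1 then b2 i else e2); split.
- move=> [|j] q hq; first by have [? ? _] := eE q hq.
  by apply: hb; lra.
- by move=> [|j] //; exact: b01.
- by move=> [|j] q //; exact: bm.
- move=> [|j] q hj hq; last by apply: bE => //; lra.
  by have [_ _ E] := eE q hq; rewrite -[RHS]subr0 -(subrr (ka 0 * b 0 q)); lra.
Qed.

End triangular_system.

(* A function of (q, z), where q stands for |x|^2 and z for x_N^2, bundled with
   candidates for its partial derivatives up to order two. *)
Record jet (R : realType) := Jet {
  jf : R -> R -> R; jq : R -> R -> R; jz : R -> R -> R;
  jqq : R -> R -> R; jqz : R -> R -> R; jzz : R -> R -> R }.

Lemma continuous_comp2 (R : realType) (T : topologicalType) (F : R * R -> R)
    (f g : T -> R) (p : T) :
  {for p, continuous f} -> {for p, continuous g} -> {for (f p, g p), continuous F} ->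
  {for p, continuous (fun x => F (f x, g x))}.
Proof.
move=> cf cg cF; have cfg : (f x, g x) @[x --> p] --> (f p, g p) by exact: cvg_pair cf cg.
exact: (@cvg_comp _ _ _ (fun x => (f x, g x)) F _ _ _ cfg cF).
Qed.

Section jets.
Context {R : realType}.
Implicit Types (J : jet R) (F : R -> R -> R) (q z t c : R).

Definition jcont c F := forall p : R * R, c < p.1 ->
  {for p, continuous (fun p : R * R => F p.1 p.2)}.

Definition jpath F q0 q1 q2 z0 z1 z2 t := F (quad q0 q1 q2 t) (quad z0 z1 z2 t).

Definition jpath1 J q0 q1 q2 z0 z1 z2 t :=
  jpath (jq J) q0 q1 q2 z0 z1 z2 t * (q1 + 2 * q2 * t) +
  jpath (jz J) q0 q1 q2 z0 z1 z2 t * (z1 + 2 * z2 * t).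

Definition jpath2 J q0 q1 q2 z0 z1 z2 :=
  jqq J q0 z0 * q1 ^+ 2 + 2 * jqz J q0 z0 * q1 * z1 + jzz J q0 z0 * z1 ^+ 2 +
  2 * q2 * jq J q0 z0 + 2 * z2 * jz J q0 z0.

(** Derivability is recorded along quadratic paths because straight lines in space and the radial
    and angular paths of the maximum principle are all of this kind. The second derivative is needed
    only at the base point of a path. *)
Record jsmooth c J : Prop := {
  jpath_derive : forall q0 q1 q2 z0 z1 z2 t, c < quad q0 q1 q2 t ->
    is_derive t 1 (jpath (jf J) q0 q1 q2 z0 z1 z2) (jpath1 J q0 q1 q2 z0 z1 z2 t);
  jpath1_derive : forall q0 q1 q2 z0 z1 z2, c < q0 ->
    is_derive (0 : R) 1 (jpath1 J q0 q1 q2 z0 z1 z2) (jpath2 J q0 q1 q2 z0 z1 z2);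
  jf_cont : jcont c (jf J); jq_cont : jcont c (jq J); jz_cont : jcont c (jz J);
  jqq_cont : jcont c (jqq J); jqz_cont : jcont c (jqz J); jzz_cont : jcont c (jzz J) }.

(** The chain rule form of the Laplacian in dimension [N] of [x |-> J(|x|^2, x_N^2)];
    [jet_laplacian] makes the link. *)
Definition jlap (N : R) J q z :=
  4 * q * jqq J q z + 8 * z * jqz J q z + 4 * z * jzz J q z +
  2 * N * jq J q z + 2 * jz J q z.

Definition jlin (s : R) J J' := Jet
  (fun q z => jf J q z + s * jf J' q z) (fun q z => jq J q z + s * jq J' q z)
  (fun q z => jz J q z + s * jz J' q z) (fun q z => jqq J q z + s * jqq J' q z)
  (fun q z => jqz J q z + s * jqz J' q z) (fun q z => jzz J q z + s * jzz J' q z).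

Lemma jcont_lin c s F F' : jcont c F -> jcont c F' ->
  jcont c (fun q z => F q z + s * F' q z).
Proof.
move=> cF cF' p hp; apply: continuousD; first exact: cF.
by apply: continuousM; [exact: cst_continuous|exact: cF'].
Qed.

Lemma jlin_smooth c s J J' : jsmooth c J -> jsmooth c J' -> jsmooth c (jlin s J J').
Proof.
move=> [a1 a2 a3 a4 a5 a6 a7 a8] [b1 b2 b3 b4 b5 b6 b7 b8]; split; try exact: jcont_lin.
- move=> q0 q1 q2 z0 z1 z2 t ht; have ha := a1 _ q1 q2 z0 z1 z2 t ht.
  have hb := b1 _ q1 q2 z0 z1 z2 t ht; rewrite /jpath /=.
  by apply: is_derive_eq; rewrite /jpath1 /jpath /GRing.scale /=; ring.
- move=> q0 q1 q2 z0 z1 z2 ht; have ha := a2 _ q1 q2 z0 z1 z2 ht.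
  have hb := b2 _ q1 q2 z0 z1 z2 ht.
  have -> : jpath1 (jlin s J J') q0 q1 q2 z0 z1 z2 =
     (fun t => jpath1 J q0 q1 q2 z0 z1 z2 t + s * jpath1 J' q0 q1 q2 z0 z1 z2 t).
    by apply/funext => t; rewrite /jpath1 /jpath /=; ring.
  by apply: is_derive_eq; rewrite /jpath2 /GRing.scale /=; ring.
Qed.

Lemma jlap_lin N s J J' q z : jlap N (jlin s J J') q z = jlap N J q z + s * jlap N J' q z.
Proof. by rewrite /jlap /=; ring. Qed.

Definition jrpoly m (b b1 b2 : nat -> R -> R) := Jet (rpoly m b) (rpoly m b1) (rpoly_z m b)
  (rpoly m b2) (rpoly_z m b1) (rpoly_zz m b).

Lemma jcont_bigsum c m (b : nat -> R -> R) (g : nat -> R -> R) :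
  (forall j q, (j < m)%N -> c < q -> {for q, continuous (b j)}) -> (forall j, continuous (g j)) ->
  jcont c (fun q z => \sum_(j < m) b j q * g j z).
Proof.
move=> cb cg p hp.
apply: (@cvg_sumr R _ _ (nbhs p) _ _ _ (fun (j : 'I_m) p => b j p.1 * g j p.2)) => j.
apply: cvgM.
  by apply: (@cvg_comp _ _ _ fst (b j)); [exact: cvg_fst|exact: cb].
by apply: (@cvg_comp _ _ _ snd (g j)); [exact: cvg_snd|exact: cg].
Qed.

Lemma jrpoly_smooth c m b b1 b2 : twice_derivable c b b1 b2 ->
  (forall j q, (j < m)%N -> c < q -> {for q, continuous (b2 j)}) ->
  jsmooth c (jrpoly m b b1 b2).
Proof.
move=> hb cb2.
have cb j q : (j < m)%N -> c < q -> {for q, continuous (b j)}.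
  by move=> _ hq; have [hd _] := hb j q hq; exact: is_derive_continuous hd.
have cb1 j q : (j < m)%N -> c < q -> {for q, continuous (b1 j)}.
  by move=> _ hq; have [_ hd] := hb j q hq; exact: is_derive_continuous hd.
have cX (a : R) k : continuous (fun z : R => a * z ^+ k).
  by move=> z; apply: cvgM; [exact: cvg_cst|exact: exprn_continuous].
have cX0 k : continuous (fun z : R => z ^+ k) by exact: exprn_continuous.
have cX2 (a a' : R) k : continuous (fun z : R => a * (a' * z ^+ k)).
  by move=> z; apply: cvgM; [exact: cvg_cst|exact: cX].
split.
- by move=> q0 q1 q2 z0 z1 z2 t ht; exact: rpoly_path_derive hb ht.
- by move=> q0 q1 q2 z0 z1 z2 ht; exact: rpoly_path1_derive hb ht.
- exact: (@jcont_bigsum c m b (fun j z => z ^+ j)).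
- exact: (@jcont_bigsum c m b1 (fun j z => z ^+ j)).
- exact: (@jcont_bigsum c m b (fun j z => j%:R * z ^+ j.-1)).
- exact: (@jcont_bigsum c m b2 (fun j z => z ^+ j)).
- exact: (@jcont_bigsum c m b1 (fun j z => j%:R * z ^+ j.-1)).
- exact: (@jcont_bigsum c m b (fun j z => j%:R * (j.-1%:R * z ^+ j.-2))).
Qed.

End jets.

(** * Maximum principles in polar variables *)

Section maximum_principle.
Context {R : realType} (N : R).
Hypothesis hN : 1 <= N.
Implicit Types (J : jet R) (q z t s : R).

(** Polar variables [q] and [s = z / q], the squared sine of the latitude. [jrad1] and [jrad] are
    the first and second derivatives in [q] at fixed [s], and [jang] is the angular rest of the
    Laplacian; no mixed derivative survives. *)
Definition jrad J q s := jqq J q (q * s) + 2 * s * jqz J q (q * s) + s ^+ 2 * jzz J q (q * s).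
Definition jrad1 J q s := jq J q (q * s) + s * jz J q (q * s).
Definition jang J q s :=
  4 * (q * s) * (1 - s) * jzz J q (q * s) + (2 - 2 * N * s) * jz J q (q * s).

Lemma jlap_polar J q s :
  jlap N J q (q * s) = 4 * q * jrad J q s + 2 * N * jrad1 J q s + jang J q s.
Proof. by rewrite /jlap /jrad /jrad1 /jang; ring. Qed.

(** The coefficient [s (1 - s)] degenerates at both ends. At [s = 0] only [2 J_z] is left and the
    maximum is one-sided from the right; at [s = 1] only [(2 - 2 N) J_z], one-sided from the left,
    with [N >= 1]. In between [J_z = 0] and [J_zz <= 0]. *)
Lemma jang_le0_max c J q s e : jsmooth c J -> c < q -> 0 < q -> 0 < e -> 0 <= s <= 1 ->
  (forall s', 0 <= s' <= 1 -> `|s' - s| < e -> jf J q (q * s') <= jf J q (q * s)) ->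
  jang J q s <= 0.
Proof.
move=> sJ cq q0 e0 /andP[s0 s1] hmax.
pose f := jpath (jf J) q 0 0 (q * s) q 0.
have E t : quad q 0 0 t = q by rewrite /quad; ring.
have E' t : quad (q * s) q 0 t = q * (s + t) by rewrite /quad; ring.
have fd t : is_derive t 1 f (jpath1 J q 0 0 (q * s) q 0 t).
  by apply: (jpath_derive sJ); rewrite E.
have f1d := jpath1_derive sJ 0 0 (q * s) q 0 cq.
have f10 : jpath1 J q 0 0 (q * s) q 0 0 = q * jz J q (q * s).
  by rewrite /jpath1 /jpath !E !E' addr0; ring.
have fE t : f t = jf J q (q * (s + t)) by rewrite /f /jpath E E'.
have fmax t : `|t| < e -> 0 <= s + t <= 1 -> f t <= f 0.
  by move=> te st; rewrite !fE addr0; apply: hmax => //; rewrite addrAC subrr add0r.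
have f0d : is_derive (0 : R) 1 f (q * jz J q (q * s)) by rewrite -f10.
rewrite /jang.
have [s00|sn0] := eqVneq s 0.
  rewrite s00 in fmax *; rewrite !mulr0 mul0r mul0r add0r subr0.
  rewrite s00 mulr0 in f0d.
  have m0 : 0 < Num.min e 1 by rewrite lt_min e0 ltr01.
  have : q * jz J q 0 <= 0.
    apply: (deriv_le0_right_max m0 f0d) => t /andP[t0]; rewrite lt_min => /andP[te t1].
    by apply: fmax; rewrite ?add0r ?gtr0_norm // (ltW t0) (ltW t1).
  by rewrite pmulr_rle0 // => h; nra.
have [s11|sn1] := eqVneq s 1.
  rewrite s11 in fmax *; rewrite subrr mulr0 mul0r add0r !mulr1.
  rewrite s11 mulr1 in f0d.
  have m0 : 0 < Num.min e 1 by rewrite lt_min e0 ltr01.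
  have : 0 <= q * jz J q q.
    apply: (deriv_ge0_left_max m0 f0d) => t /andP[te t0].
    have /andP[te' t1'] : (- t < e) && (- t < 1) by rewrite -lt_min ltrNl.
    by apply: fmax; [rewrite ltr0_norm|apply/andP; split; lra].
  by rewrite pmulr_rge0 // => h; have := hN; nra.
have sp : 0 < s by rewrite lt_def sn0.
have sl : s < 1 by rewrite lt_def eq_sym sn1.
have m0 : 0 < Num.min e (Num.min s (1 - s)) by rewrite !lt_min e0 sp subr_gt0.
have [|h1 h2] := second_derivative_max m0 (fun t _ => fd t) f1d.
  move=> t; rewrite !lt_min => /and3P[te ts ts']; apply: fmax => //.
  by move: ts ts'; rewrite !ltr_norml => /andP[a1 a2] /andP[a3 a4]; apply/andP; split; lra.
have z0 : jz J q (q * s) = 0.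
  by move/eqP: h1; rewrite f10 mulf_eq0 gt_eqF //= => /eqP.
have jz0 : jzz J q (q * s) <= 0.
  have -> : jzz J q (q * s) = jpath2 J q 0 0 (q * s) q 0 / q ^+ 2.
    by rewrite /jpath2 z0; field; rewrite gt_eqF.
  by rewrite pmulr_lle0 // invr_gt0 exprn_gt0.
rewrite z0 mulr0 addr0 mulr_ge0_le0 // !mulr_ge0 // ?ltW // subr_gt0 //.
Qed.

(** [jlin] forms [J + s J'] only, so [- J] is written [J + (-2) J], here and wherever a lower bound
    is deduced from an upper one. *)
Lemma jet_scaleN J q z : [/\ jf (jlin (-2) J J) q z = - jf J q z, jz (jlin (-2) J J) q z = - jz J q z
  & jzz (jlin (-2) J J) q z = - jzz J q z].
Proof. by split => /=; ring. Qed.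

Lemma jang_ge0_min c J q s e : jsmooth c J -> c < q -> 0 < q -> 0 < e -> 0 <= s <= 1 ->
  (forall s', 0 <= s' <= 1 -> `|s' - s| < e -> jf J q (q * s) <= jf J q (q * s')) ->
  0 <= jang J q s.
Proof.
move=> sJ cq q0 e0 s01 hmin.
have := @jang_le0_max c (jlin (-2) J J) q s e (jlin_smooth _ sJ sJ) cq q0 e0 s01.
have [E1 E2 E3] := jet_scaleN J q (q * s).
rewrite /jang E2 E3 !mulrN -opprD oppr_le0; apply => s' s'01 hs'.
have [-> _ _] := jet_scaleN J q (q * s').
by rewrite E1 lerN2 hmin.
Qed.

Lemma jrad_derive c J q s t : jsmooth c J -> c < q + t ->
  is_derive t 1 (fun t => jf J (q + t) ((q + t) * s)) (jrad1 J (q + t) s).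
Proof.
move=> sJ cq.
have E0 t' : quad q 1 0 t' = q + t' by rewrite /quad; ring.
have E1 t' : quad (q * s) s 0 t' = (q + t') * s by rewrite /quad; ring.
have ht : c < quad q 1 0 t by rewrite E0.
have := jpath_derive sJ (q * s) s 0 ht.
rewrite /jpath1 /jpath E0 E1 !mulr0 mul0r !addr0 mulr1 => h.
have -> : (fun t => jf J (q + t) ((q + t) * s)) =
   (fun t => jf J (quad q 1 0 t) (quad (q * s) s 0 t)).
  by apply/funext => t'; rewrite E0 E1.
by apply: is_derive_eq; rewrite /jrad1; ring.
Qed.

Lemma jrad1_derive c J q s : jsmooth c J -> c < q ->
  is_derive (0 : R) 1 (fun t => jrad1 J (q + t) s) (jrad J q s).
Proof.
move=> sJ cq.
have E0 t' : quad q 1 0 t' = q + t' by rewrite /quad; ring.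
have E1 t' : quad (q * s) s 0 t' = (q + t') * s by rewrite /quad; ring.
have h := jpath1_derive sJ 1 0 (q * s) s 0 cq.
have -> : (fun t => jrad1 J (q + t) s) = jpath1 J q 1 0 (q * s) s 0.
  by apply/funext => t'; rewrite /jpath1 /jpath E0 E1 /jrad1; ring.
by apply: is_derive_eq; rewrite /jpath2 /jrad; ring.
Qed.

Variables (Q0 Q1 : R).
Hypotheses (hQ0 : 0 < Q0) (hQ01 : Q0 < Q1).
Let c := Q0 / 2.

Lemma jet_polar_continuous J (p : R * R) : jsmooth c J -> Q0 <= p.1 ->
  {for p, continuous (fun p : R * R => jf J p.1 (p.1 * p.2))}.
Proof.
move=> sJ hp.
have h : {for (p.1, p.1 * p.2), continuous (fun p : R * R => jf J p.1 p.2)}.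
  by apply: (jf_cont sJ) => /=; rewrite /c; have := hQ0; lra.
have h1 : {for p, continuous (fun p : R * R => p.1)} by exact: cvg_fst.
have h2 : {for p, continuous (fun p : R * R => p.1 * p.2)}.
  by apply: cvgM; [exact: cvg_fst|exact: cvg_snd].
exact: (continuous_comp2 h1 h2 h).
Qed.

(** The values [s = 0] and [s = 1] are not boundary: [jang_le0_max] covers them. So at a maximum
    above [M] the radius is interior, all parts of [jlap] are nonpositive, and this contradicts
    [0 < J - M <= jlap]. *)
Theorem jet_max_principle J M : jsmooth c J ->
  (forall s, 0 <= s <= 1 -> jf J Q0 (Q0 * s) <= M /\ jf J Q1 (Q1 * s) <= M) ->
  (forall q s, Q0 < q < Q1 -> 0 <= s <= 1 ->
     M < jf J q (q * s) -> jf J q (q * s) - M <= jlap N J q (q * s)) ->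
  forall q s, Q0 <= q <= Q1 -> 0 <= s <= 1 -> jf J q (q * s) <= M.
Proof.
move=> sJ bd hlap.
pose D := (`[Q0, Q1] `*` `[0, 1])%classic : set (R * R).
have cD : compact D by apply: compact_setX; exact: segment_compact.
have D0 : D !=set0.
  by exists (Q0, 0) => /=; split; rewrite /= in_itv /= lexx ?ler01 // ltW.
have [|[q s] ] := @compact_EVT_max _ _ (fun p : R * R => jf J p.1 (p.1 * p.2)) D D0 cD.
  apply: continuous_in_subspaceT => p; rewrite inE => -[]; rewrite /= in_itv /= => /andP[p1 _] _.
  exact: jet_polar_continuous.
rewrite inE => -[]; rewrite /= !in_itv /= => /andP[q0 q1] s01 hmax.
have hm q' s' : Q0 <= q' <= Q1 -> 0 <= s' <= 1 -> jf J q' (q' * s') <= jf J q (q * s).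
  by move=> hq' hs'; apply: (hmax (q', s')); rewrite inE; split; rewrite /= in_itv.
suff H : jf J q (q * s) <= M by move=> q' s' hq' hs'; exact: le_trans (hm _ _ hq' hs') H.
have [E0|n0] := eqVneq q Q0; first by rewrite E0; have [] := bd s s01.
have [E1|n1] := eqVneq q Q1; first by rewrite E1; have [] := bd s s01.
have {n0}q0' : Q0 < q by rewrite lt_def n0.
have {n1}q1' : q < Q1 by rewrite lt_def eq_sym n1.
rewrite leNgt; apply/negP => HM.
have qp : 0 < q := lt_trans hQ0 q0'.
have cq : c < q by rewrite /c; have := hQ0; lra.
have : 0 < jlap N J q (q * s).
  by apply: lt_le_trans (hlap q s _ s01 HM); rewrite ?subr_gt0 // q0' q1'.
rewrite jlap_polar.
have a0 : jang J q s <= 0.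
  apply: (jang_le0_max sJ cq qp ltr01 s01) => s' hs' _; apply: hm => //.
  by rewrite (ltW q0') (ltW q1').
pose e := Num.min (q - Q0) (Q1 - q).
have e0 : 0 < e by rewrite lt_min !subr_gt0 q0' q1'.
have he t : `|t| < e -> Q0 < q + t < Q1.
  rewrite lt_min !ltr_norml => /andP[/andP[a1 a2] /andP[a3 a4]].
  by apply/andP; split; lra.
have [|||h1 h2] := @second_derivative_max R (fun t => jf J (q + t) ((q + t) * s))
  (fun t => jrad1 J (q + t) s) (jrad J q s) e e0.
- move=> t /he /andP[h1 _]; apply: (jrad_derive _ sJ).
  by rewrite /c; have := hQ0; lra.
- exact: jrad1_derive sJ cq.
- move=> t /he /andP[h1 h2]; rewrite addr0; apply: hm => //.
  by rewrite (ltW h1) (ltW h2).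
move: h1; rewrite addr0 => ->; rewrite mulr0 addr0; apply/negP; rewrite -leNgt.
have : 4 * q * jrad J q s <= 0 by rewrite mulr_ge0_le0 // mulr_ge0 // ltW.
by move: a0; lra.
Qed.

(** Two-point maximum principle for [J(q, s) - J(q, s')] with a common [q] and [s' <= s]. At a
    positive maximum the radial parts combine into derivatives in [q] of one function, and the
    angular parts have opposite signs at the two points, so the difference of the Laplacians is
    nonpositive; the equation makes it positive. *)
Theorem jet_monotone J (h : R -> R -> R) : jsmooth c J ->
  (forall s, 0 <= s <= 1 -> jf J Q0 (Q0 * s) = 0 /\ jf J Q1 (Q1 * s) = 0) ->
  (forall q s, Q0 < q < Q1 -> 0 <= s <= 1 ->
     jlap N J q (q * s) = jf J q (q * s) - h q s) ->
  (forall q s s', Q0 < q < Q1 -> 0 <= s' -> s' <= s -> s <= 1 -> h q s <= h q s') ->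
  forall q s s', Q0 <= q <= Q1 -> 0 <= s' -> s' <= s -> s <= 1 ->
    jf J q (q * s) <= jf J q (q * s').
Proof.
move=> sJ bd hlap hh.
pose D := (`[Q0, Q1] `*` (`[0, 1] `*` `[0, 1]))%classic : set (R * (R * R)).
have cD : compact D by do 2! [apply: compact_setX; first exact: segment_compact];
  exact: segment_compact.
have D0 : D !=set0.
  by exists (Q0, (0, 0)) => /=; do !split; rewrite /= in_itv /= lexx ?ler01 // ltW.
(* Max and min let [s] and [s'] range over a full square, so that the domain is a product of
   segments instead of a triangle. *)
pose F (p : R * (R * R)) := jf J p.1 (p.1 * Num.max p.2.1 p.2.2) - jf J p.1 (p.1 * Num.min p.2.1 p.2.2).
have [|[q [s s']]] := @compact_EVT_max _ _ F D D0 cD.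
  apply: continuous_in_subspaceT => p; rewrite inE => -[]; rewrite /= in_itv /= => /andP[p1 _] _.
  have fst_snd1 : {for p, continuous (fun p : R * (R * R) => p.2.1)}.
    by apply: (@cvg_comp _ _ _ snd fst); [exact: cvg_snd|exact: cvg_fst].
  have fst_snd2 : {for p, continuous (fun p : R * (R * R) => p.2.2)}.
    by apply: (@cvg_comp _ _ _ snd snd); [exact: cvg_snd|exact: cvg_snd].
  have fst1 : {for p, continuous (fun p : R * (R * R) => p.1)} by exact: cvg_fst.
  apply: cvgB.
    have h1 : {for (p.1, Num.max p.2.1 p.2.2), continuous (fun p : R * R => jf J p.1 (p.1 * p.2))}.
      exact: jet_polar_continuous.
    exact: (continuous_comp2 fst1 (continuous_max fst_snd1 fst_snd2) h1).
  have h1 : {for (p.1, Num.min p.2.1 p.2.2), continuous (fun p : R * R => jf J p.1 (p.1 * p.2))}.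
    exact: jet_polar_continuous.
  exact: (continuous_comp2 fst1 (continuous_min fst_snd1 fst_snd2) h1).
wlog ss' : s s' / s' <= s.
  move=> W; have [|hss] := leP s' s; first exact: W.
  move=> /set_mem[/= hq [hs hs']] hmax; apply: (W s' s (ltW hss)); first exact/mem_set.
  move=> t Dt; have -> : F (q, (s', s)) = F (q, (s, s')) by rewrite /F /= maxC minC.
  exact: hmax.
rewrite inE => -[]; rewrite /= !in_itv /= => /andP[q0 q1] [/andP[s0 s1] /andP[s0' s1']] hmax.
have hm q' t t' : Q0 <= q' <= Q1 -> 0 <= t' -> t' <= t -> t <= 1 ->
    jf J q' (q' * t) - jf J q' (q' * t') <= jf J q (q * s) - jf J q (q * s').
  move=> hq' t0 tt t1; have := hmax (q', (t, t')); rewrite /F /=.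
  rewrite (max_idPl tt) (min_idPr tt) (max_idPl ss') (min_idPr ss'); apply.
  by rewrite inE; do !split; rewrite /= ?in_itv //= ?t0 ?t1 ?andbT ?(le_trans t0) //= (le_trans tt).
suff H : jf J q (q * s) - jf J q (q * s') <= 0.
  by move=> r t t' hr ht0 htt ht1; rewrite -subr_le0; exact: le_trans (hm _ _ _ hr ht0 htt ht1) H.
rewrite leNgt; apply/negP => HM.
have [E0|n0] := eqVneq q Q0.
  move: HM; rewrite E0; have [|-> _] := bd s; first by rewrite s0.
  by have [|-> _] := bd s'; rewrite ?s0' // subrr ltxx.
have [E1|n1] := eqVneq q Q1.
  move: HM; rewrite E1; have [|_ ->] := bd s; first by rewrite s0.
  by have [|_ ->] := bd s'; rewrite ?s0' // subrr ltxx.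
have [E|ns] := eqVneq s' s; first by move: HM; rewrite E subrr ltxx.
have {n0}q0' : Q0 < q by rewrite lt_def n0.
have {n1}q1' : q < Q1 by rewrite lt_def eq_sym n1.
have {ns}ss : s' < s by rewrite lt_def eq_sym ns.
have qp : 0 < q := lt_trans hQ0 q0'.
have cq : c < q by rewrite /c; have := hQ0; lra.
have qi : Q0 < q < Q1 by rewrite q0'.
have qI : Q0 <= q <= Q1 by rewrite q0 q1.
have d0 : 0 < s - s' by rewrite subr_gt0.
(* Moving one of the two points by less than [s - s'] keeps their order, so each point is a local
   extremum by itself. *)
have a0 : jang J q s <= 0.
  apply: (jang_le0_max sJ cq qp d0) => [|t /andP[t0 t1]]; first by rewrite s0.
  rewrite ltr_norml => /andP[h1 _]; have := hm q t s' qI s0' _ t1.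
  by rewrite lerD2r; apply; lra.
have a0' : 0 <= jang J q s'.
  apply: (jang_ge0_min sJ cq qp d0) => [|t /andP[t0 t1]]; first by rewrite s0'.
  rewrite ltr_norml => /andP[_ h1]; have := hm q s t qI t0 _ s1.
  by rewrite lerD2l lerN2; apply; lra.
pose e := Num.min (q - Q0) (Q1 - q).
have e0 : 0 < e by rewrite lt_min !subr_gt0 q0' q1'.
have he t : `|t| < e -> Q0 < q + t < Q1.
  rewrite lt_min !ltr_norml => /andP[/andP[a1 a2] /andP[a3 a4]].
  by apply/andP; split; lra.
have [|||h1 h2] := @second_derivative_max R
  (fun t => jf J (q + t) ((q + t) * s) - jf J (q + t) ((q + t) * s'))
  (fun t => jrad1 J (q + t) s - jrad1 J (q + t) s') (jrad J q s - jrad J q s') e e0.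
- move=> t /he /andP[h1 _].
  have ct : c < q + t by rewrite /c; have := hQ0; lra.
  exact: is_deriveB (jrad_derive s sJ ct) (jrad_derive s' sJ ct).
- exact: is_deriveB (jrad1_derive s sJ cq) (jrad1_derive s' sJ cq).
- by move=> t /he /andP[h1 h2]; rewrite addr0; apply: hm => //; rewrite (ltW h1) (ltW h2).
have := hlap q s qi; rewrite s0 s1 => /(_ isT).
have := hlap q s' qi; rewrite s0' s1' => /(_ isT).
rewrite !jlap_polar => E1 E2.
have hs := hh q s s' qi s0' ss' s1.
move: h1; rewrite addr0 => /eqP; rewrite subr_eq0 => /eqP h1; rewrite h1 in E2.
have : 4 * q * (jrad J q s - jrad J q s') <= 0 by rewrite mulr_ge0_le0 // mulr_ge0 // ltW.
move: a0 a0' HM hs E1 E2; move: (jrad J q s) (jrad J q s') (jang J q s) (jang J q s').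
move: (jf _ _ _) (jf _ _ _) (h q s) (h q s') (jrad1 _ _ _) => x y u v g a b a' b'.
by move=> *; lra.
Qed.

End maximum_principle.

(** * Comparison and boundary barriers *)

Section jet_comparison.
Context {R : realType} (N : R) (Q0 Q1 : R).
Hypotheses (hN : 1 <= N) (hQ0 : 0 < Q0) (hQ01 : Q0 < Q1).
Implicit Types (J B : jet R) (h : R -> R -> R) (q z M : R).
Let c := Q0 / 2.

Record jsolves J h : Prop := {
  jsolves_smooth : jsmooth c J;
  jsolves_bd : forall z, jf J Q0 z = 0 /\ jf J Q1 z = 0;
  jsolves_eq : forall q z, Q0 <= q <= Q1 -> 0 <= z <= q ->
    jlap N J q z = jf J q z - h q z }.

Lemma jsolves_lin s J J' h h' : jsolves J h -> jsolves J' h' ->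
  jsolves (jlin s J J') (fun q z => h q z + s * h' q z).
Proof.
move=> [s1 b1 e1] [s2 b2 e2]; split; first exact: jlin_smooth.
  by move=> z; have [/= -> ->] := b1 z; have [-> ->] := b2 z; rewrite mulr0 addr0.
by move=> q z hq hz; rewrite jlap_lin e1 // e2 //=; ring.
Qed.

Lemma jet_comparison J h B : jsolves J h -> jsmooth c B ->
  (forall z, 0 <= z -> 0 <= jf B Q0 z /\ 0 <= jf B Q1 z) ->
  (forall q z, Q0 <= q <= Q1 -> 0 <= z <= q -> h q z + jlap N B q z <= jf B q z) ->
  forall q z, Q0 <= q <= Q1 -> 0 <= z <= q -> jf J q z <= jf B q z.
Proof.
move=> [sJ bJ eJ] sB bB hB q z hq hz.
have q0 : 0 < q by case/andP: hq => ? _; apply: lt_le_trans hQ0 _.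
have zE : z = q * (z / q) by rewrite mulrC mulfVK // gt_eqF.
have zq : 0 <= z / q <= 1.
  by case/andP: hz => z0 zq; rewrite divr_ge0 ?(ltW q0) //= ler_pdivrMr // mul1r.
have := @jet_max_principle _ N hN Q0 Q1 hQ0 hQ01 (jlin (-1) J B) 0 (jlin_smooth _ sJ sB) _ _ q (z / q) hq zq.
rewrite -zE /= mulN1r subr_le0; apply.
  move=> s /andP[s0 s1]; have [-> _] := bJ (Q0 * s); have [_ ->] := bJ (Q1 * s).
  have [h1 _] := bB (Q0 * s) (mulr_ge0 (ltW hQ0) s0).
  have [_ h2] := bB (Q1 * s) (mulr_ge0 (ltW (lt_trans hQ0 hQ01)) s0).
  by rewrite !mulN1r !sub0r !oppr_le0.
move=> r s /andP[r0 r1] /andP[s0 s1] _.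
have rI : Q0 <= r <= Q1 by rewrite !ltW.
have rp : 0 < r := lt_trans hQ0 r0.
have rs : 0 <= r * s <= r.
  by rewrite mulr_ge0 ?(ltW rp) //= -[leRHS]mulr1 ler_wpM2l ?(ltW rp).
have := hB r (r * s) rI rs; rewrite jlap_lin eJ //=.
by move: (jf J _ _) (h _ _) (jlap _ _ _ _) (jf B _ _) => a b d e; lra.
Qed.

Definition jradial (b b1 b2 : R -> R) := Jet (fun q _ => b q) (fun q _ => b1 q) (fun _ _ => 0)
  (fun q _ => b2 q) (fun _ _ => 0) (fun _ _ => 0).

Lemma jradial_smooth (b b1 b2 : R -> R) :
  (forall q, c < q -> is_derive q 1 b (b1 q) /\ is_derive q 1 b1 (b2 q)) ->
  (forall q, c < q -> {for q, continuous b2}) ->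
  jsmooth c (jradial b b1 b2).
Proof.
move=> hb cb2.
have E0 (u : R -> R) q z : rpoly 1 (fun _ => u) q z = u q.
  by rewrite /rpoly big_ord1 expr0 mulr1.
have E1 (u : R -> R) q z : rpoly_z 1 (fun _ => u) q z = 0.
  by rewrite /rpoly_z big_ord1 mul0r mulr0.
have E2 (u : R -> R) q z : rpoly_zz 1 (fun _ => u) q z = 0.
  by rewrite /rpoly_zz big_ord1 mul0r mulr0.
have -> : jradial b b1 b2 = jrpoly 1 (fun _ => b) (fun _ => b1) (fun _ => b2).
  by congr Jet; apply/funext => q; apply/funext => z; rewrite ?E0 ?E1 ?E2.
by apply: jrpoly_smooth => [j q hq|j q _ hq]; [exact: hb|exact: cb2].
Qed.

Lemma jsolves_ub J h M : jsolves J h -> 0 <= M ->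
  (forall q z, Q0 <= q <= Q1 -> 0 <= z <= q -> h q z <= M) ->
  forall q z, Q0 <= q <= Q1 -> 0 <= z <= q -> jf J q z <= M.
Proof.
move=> sJ M0 hM q z hq hz.
apply: (jet_comparison sJ (B := jradial (fun=> M) (fun=> 0) (fun=> 0)) _ _ _ hq hz).
- by apply: jradial_smooth => [r _|r _]; [split; exact: is_derive_cst|exact: cst_continuous].
- by [].
- by move=> r t hr ht; rewrite /jlap /= !mulr0 !addr0; exact: hM.
Qed.

(** The barrier decreases linearly in [q], and its Laplacian [- 2 N M] already absorbs the
    source. *)
Lemma barrier_outer J h M : jsolves J h -> 0 <= M ->
  (forall q z, Q0 <= q <= Q1 -> 0 <= z <= q -> h q z <= M) ->
  forall q z, Q0 <= q <= Q1 -> 0 <= z <= q -> jf J q z <= M * (Q1 - q).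
Proof.
move=> sJ M0 hM q z hq hz.
apply: (jet_comparison sJ (B := jradial (fun q => M * (Q1 - q)) (fun=> - M) (fun=> 0)) _ _ _ hq hz).
- apply: jradial_smooth => [r _|r _]; last exact: cst_continuous.
  split; last exact: is_derive_cst.
  by apply: is_derive_eq; rewrite /GRing.scale /=; ring.
- by move=> t _ /=; rewrite subrr mulr0 lexx mulr_ge0 // subr_ge0 ltW.
- move=> r t hr ht; rewrite /jlap /= !mulr0 !add0r addr0.
  have := hM r t hr ht; case/andP: hr => r0 r1 h1.
  have : 0 <= M * (Q1 - r) by rewrite mulr_ge0 // subr_ge0.
  have := hN; nra.
Qed.

(** An increasing linear function of [q] would have Laplacian of the wrong sign, so a concave
    barrier [1 - (Q0 / q)^N] is used. The integer [d] turns the exponent [N] into a natural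
    number. *)
Lemma barrier_inner (d : nat) : N = d.+1%:R -> exists2 C, 0 <= C &
  forall J h M, jsolves J h -> 0 <= M ->
  (forall q z, Q0 <= q <= Q1 -> 0 <= z <= q -> h q z <= M) ->
  forall q z, Q0 <= q <= Q1 -> 0 <= z <= q -> jf J q z <= C * M * (q - Q0).
Proof.
move=> Nd; pose k := d.+1.
have N0 : 0 < N := lt_le_trans ltr01 hN.
have Q1p : 0 < Q1 := lt_trans hQ0 hQ01.
(* Normalisation for which the Laplacian of the barrier is exactly [- M (Q1 / q)^(N+1)], hence at
   most [- M] on the ring. *)
pose K := Q1 ^+ k.+1 / (Q0 ^+ k * N * (2 * N + 4)).
have K0 : 0 < K.
  by rewrite divr_gt0 ?exprn_gt0 // !mulr_gt0 ?exprn_gt0 // addr_gt0 // mulr_gt0.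
exists (K * N / Q0); first by rewrite ltW // divr_gt0 // mulr_gt0.
move=> J h M sJ M0 hM q z hq hz.
pose b q := M * K * (1 - Q0 ^+ k * q^-1 ^+ k).
pose b1 q := M * K * Q0 ^+ k * N * q^-1 ^+ k.+1.
pose b2 q := - (M * K * Q0 ^+ k * N * (N + 1)) * q^-1 ^+ k.+2.
have dV (r : R) : 0 < r -> is_derive r 1 (fun q => q^-1) (- r^-1 ^+ 2).
  move=> r0; apply: is_derive_eq; first by apply: (@is_deriveV R id r 1 1); rewrite gt_eqF.
  by rewrite /GRing.scale /= mulr1 exprVn.
have sB : jsmooth c (jradial b b1 b2).
  have cp r : c < r -> 0 < r by apply: lt_trans; rewrite /c divr_gt0.
  apply: jradial_smooth => [r /cp r0|r /cp r0].
    have h1 := is_derive_pow k (dV r r0); have h2 := is_derive_pow k.+1 (dV r r0).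
    split; rewrite /b /b1.
      by apply: is_derive_eq; rewrite /GRing.scale /= -Nd !exprS; ring.
    have kN : k.+1%:R = N + 1 by rewrite -natr1 Nd.
    by apply: is_derive_eq; rewrite /b2 kN /GRing.scale /= !exprS; ring.
  have h3 := is_derive_pow k.+2 (dV r r0).
  by apply: continuousM; [exact: cst_continuous|exact: is_derive_continuous h3].
have bb r : Q0 <= r -> 0 <= b r.
  move=> hr; have r0 : 0 < r by exact: lt_le_trans hr.
  apply: mulr_ge0; first by rewrite mulr_ge0 // ltW.
  rewrite subr_ge0 -exprMn exprn_ile1 //; first by rewrite mulr_ge0 ?invr_ge0 ?ltW.
  by rewrite ler_pdivrMr // mul1r.
have J1 : jf J q z <= b q.
  apply: (jet_comparison sJ sB _ _ hq hz).
    by move=> t _ /=; rewrite !bb // ltW.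
  move=> r t hr ht; rewrite /jlap /= !mulr0 !addr0.
  have r0 : 0 < r by case/andP: hr => r0 _; exact: lt_le_trans r0.
  have : h r t <= M by exact: hM.
  have : 0 <= b r by apply: bb; case/andP: hr.
  have : 4 * r * b2 r + 2 * N * b1 r <= - M.
    have -> : 4 * r * b2 r + 2 * N * b1 r = - (M * (Q1 / r) ^+ k.+1).
      rewrite /b1 /b2 /K exprMn (exprS _ k.+1).
      move: (r^-1 ^+ k.+1) (Q0 ^+ k) (exprn_gt0 k hQ0) (Q1 ^+ k.+1) => u v v0 w.
      have N4 : 2 * N + 4 != 0 by rewrite gt_eqF // addr_gt0 // mulr_gt0.
      by field; rewrite !gt_eqF ?addr_gt0 ?mulr_gt0.
    rewrite lerN2 -[leLHS]mulr1 ler_wpM2l // exprn_ege1 // ler_pdivlMr // mul1r.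
    by case/andP: hr.
  by move: (b r) (b1 r) (b2 r) (h r t) => x y u v; lra.
apply: le_trans J1 _; case/andP: hq => q0 q1.
have qp : 0 < q := lt_le_trans hQ0 q0.
rewrite /b -exprMn.
(* Bernoulli's inequality turns the power into a bound linear in the distance to the boundary. *)
have B : 1 - (Q0 * q^-1) ^+ k <= N * (1 - Q0 * q^-1).
  rewrite Nd -/k; have : 0 <= Q0 * q^-1 <= 1.
    by rewrite divr_ge0 ?(ltW hQ0) ?(ltW qp) //= ler_pdivrMr // mul1r.
  move: (Q0 * q^-1) => x /andP[x0 x1]; elim: (k) => [|i IH]; first by rewrite expr0 subrr mul0r.
  have xi : x ^+ i <= 1 by exact: exprn_ile1.
  have xi0 : 0 <= x ^+ i by exact: exprn_ge0.
  by rewrite exprS -natr1; nra.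
have B2 : 1 - Q0 * q^-1 <= (q - Q0) / Q0.
  have -> : 1 - Q0 * q^-1 = (q - Q0) / q by field; rewrite gt_eqF.
  by rewrite ler_wpM2l ?subr_ge0 // lef_pV2.
have -> : K * N / Q0 * M * (q - Q0) = M * K * (N * ((q - Q0) / Q0)) by field; rewrite gt_eqF.
apply: ler_wpM2l; first by rewrite mulr_ge0 // ltW.
apply: le_trans B _.
by rewrite ler_wpM2l // ltW.
Qed.

End jet_comparison.

(** * Jets as functions on space and the Lipschitz estimate *)

Section jet_in_space.
Context {R : realType} {n : nat} (R0 R1 : R).
Hypotheses (hR0 : 0 < R0) (hR01 : R0 < R1).
Local Notation E := 'rV[R]_n.+1.
Local Notation N := (n.+1%:R : R).
Local Notation A := (@annulus R n R0 R1).
Implicit Types (x y v e : E) (J : jet R) (h : R -> R -> R) (s t M : R).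

Definition height2 x : R := x 0 ord_max ^+ 2.

Definition of_jet (F : R -> R -> R) x : R := F (dotp x x) (height2 x).

Definition jet_line J x v t := jpath1 J (dotp x x) (2 * dotp x v) (dotp v v)
  (height2 x) (2 * x 0 ord_max * v 0 ord_max) (height2 v) t.

Definition jet_line2 J x v := jpath2 J (dotp x x) (2 * dotp x v) (dotp v v)
  (height2 x) (2 * x 0 ord_max * v 0 ord_max) (height2 v).

Lemma dotp_line x v t :
  dotp (x + t *: v) (x + t *: v) = quad (dotp x x) (2 * dotp x v) (dotp v v) t.
Proof.
by rewrite !(dotpDl, dotpDr, dotpZl, dotpZr) (dotpC v x) /quad; ring.
Qed.

Lemma height2_line x v t :
  height2 (x + t *: v) = quad (height2 x) (2 * x 0 ord_max * v 0 ord_max) (height2 v) t.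
Proof. by rewrite /height2 !mxE /quad; ring. Qed.

Lemma of_jet_line F x v t : of_jet F (x + t *: v) =
  jpath F (dotp x x) (2 * dotp x v) (dotp v v)
  (height2 x) (2 * x 0 ord_max * v 0 ord_max) (height2 v) t.
Proof. by rewrite /of_jet dotp_line height2_line. Qed.

Lemma jet_line_derive c J x v t : jsmooth c J -> c < dotp (x + t *: v) (x + t *: v) ->
  is_derive t 1 (fun t : R => of_jet (jf J) (x + t *: v)) (jet_line J x v t).
Proof.
move=> sJ hc; under eq_fun do rewrite of_jet_line.
by apply: (jpath_derive sJ); rewrite -dotp_line.
Qed.

Lemma jet_line_derive2 c J x v : jsmooth c J -> c < dotp x x ->
  is_derive (0 : R) 1 (jet_line J x v) (jet_line2 J x v).
Proof. by move=> sJ hc; exact: (jpath1_derive sJ). Qed.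

Lemma dotp_sqr (x : E) : \sum_i x 0 i ^+ 2 = dotp x x.
Proof. by []. Qed.

(** The four identities hold for every orthonormal frame and are all that the computation uses. They
    are checked once for the coordinate frame and once for its mirror image. *)
Lemma jet_line2_sum J x (v : 'I_n.+1 -> E) :
  (forall i, dotp (v i) (v i) = 1) ->
  \sum_i dotp x (v i) ^+ 2 = dotp x x ->
  \sum_i dotp x (v i) * v i 0 ord_max = x 0 ord_max ->
  \sum_i height2 (v i) = 1 ->
  \sum_i jet_line2 J x (v i) = jlap N J (dotp x x) (height2 x).
Proof.
move=> v1 vx vxN vN; rewrite /jet_line2 /jpath2 /jlap.
move: (jqq _ _ _) (jqz _ _ _) (jzz _ _ _) (jq _ _ _) (jz _ _ _) => qq qz zz jq jz.
transitivity (4 * qq * (\sum_i dotp x (v i) ^+ 2) +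
   8 * qz * x 0 ord_max * (\sum_i dotp x (v i) * v i 0 ord_max) +
   (4 * zz * height2 x + 2 * jz) * (\sum_i height2 (v i)) + \sum_(i < n.+1) (2 * jq)).
  rewrite !mulr_sumr -!big_split /=; apply: eq_bigr => i _.
  by rewrite v1 /height2; ring.
rewrite vx vxN vN sumr_const card_ord -mulr_natl /height2; ring.
Qed.

Lemma dotp_delta x i : dotp x (delta_mx 0 i) = x 0 i.
Proof.
rewrite /dotp (bigD1 i) //= mxE !eqxx mulr1 big1 ?addr0 // => j ji.
by rewrite mxE (negbTE ji) andbF mulr0.
Qed.

Lemma delta_coord i j : (delta_mx 0 i : E) 0 j = (j == i)%:R.
Proof. by rewrite mxE eqxx. Qed.

Lemma sum_coord_delta (f : 'I_n.+1 -> R) (k : 'I_n.+1) : \sum_i f i * (k == i)%:R = f k.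
Proof.
by rewrite (bigD1 k) //= eqxx mulr1 big1 ?addr0 // => i; rewrite eq_sym => /negbTE ->; rewrite mulr0.
Qed.

Lemma jet_laplacian J x :
  \sum_i jet_line2 J x (delta_mx 0 i) = jlap N J (dotp x x) (height2 x).
Proof.
apply: jet_line2_sum.
- by move=> i; rewrite dotp_delta delta_coord eqxx.
- by under eq_bigr do rewrite dotp_delta.
- by under eq_bigr do rewrite dotp_delta delta_coord; rewrite sum_coord_delta.
- under eq_bigr do rewrite /height2 delta_coord expr2.
  by rewrite (sum_coord_delta (fun i => (ord_max == i)%:R)) eqxx.
Qed.

Definition reflected e (i : 'I_n.+1) : E := delta_mx 0 i - (2 * e 0 i) *: e.

Lemma dotp_reflected y e i : dotp y (reflected e i) = y 0 i - 2 * dotp y e * e 0 i.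
Proof. by rewrite /reflected dotpDr dotpNr dotpZr dotp_delta; ring. Qed.

Lemma reflected_unit e i : dotp e e = 1 -> dotp (reflected e i) (reflected e i) = 1.
Proof.
move=> e1; have cI : reflected e i 0 i = 1 - 2 * e 0 i ^+ 2 by rewrite !mxE !eqxx /=; ring.
by rewrite dotp_reflected cI dotpC dotp_reflected e1; ring.
Qed.

Lemma jet_laplacian_reflected J x e : dotp e e = 1 ->
  \sum_i jet_line2 J x (reflected e i) = jlap N J (dotp x x) (height2 x).
Proof.
move=> e1; have dx := dotp_reflected.
have cN i : reflected e i 0 ord_max = (ord_max == i)%:R - 2 * e 0 ord_max * e 0 i.
  by rewrite !mxE eqxx /=; ring.
apply: jet_line2_sum.
- by move=> i; exact: reflected_unit.
- have [p pE dxp] : exists2 p, p = dotp x e & forall i, dotp x (reflected e i) = x 0 i - 2 * p * e 0 i.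
    by exists (dotp x e) => // i; exact: dx.
  transitivity (\sum_i x 0 i ^+ 2 - 4 * p * (\sum_i x 0 i * e 0 i) +
    4 * p ^+ 2 * (\sum_i e 0 i ^+ 2)).
    rewrite !mulr_sumr -sumrB -big_split /=; apply: eq_bigr => i _; rewrite dxp; ring.
  by rewrite !dotp_sqr e1 -/(dotp x e) -pE; ring.
- have [p pE dxp] : exists2 p, p = dotp x e & forall i, dotp x (reflected e i) = x 0 i - 2 * p * e 0 i.
    by exists (dotp x e) => // i; exact: dx.
  transitivity (\sum_i x 0 i * (ord_max == i)%:R - 2 * e 0 ord_max * (\sum_i x 0 i * e 0 i)
    - 2 * p * (\sum_i e 0 i * (ord_max == i)%:R) + 4 * p * e 0 ord_max * (\sum_i e 0 i ^+ 2)).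
    rewrite !mulr_sumr -!sumrB -big_split /=; apply: eq_bigr => i _; rewrite dxp cN; ring.
  by rewrite !sum_coord_delta dotp_sqr e1 -/(dotp x e) -pE; ring.
- transitivity (\sum_(i < n.+1) (ord_max == i)%:R * (ord_max == i)%:R
     - 4 * e 0 ord_max * (\sum_i e 0 i * (ord_max == i)%:R) +
    4 * e 0 ord_max ^+ 2 * (\sum_i e 0 i ^+ 2)).
    rewrite !mulr_sumr -sumrB -big_split /=; apply: eq_bigr => i _; rewrite /height2 cN; ring.
  have S1 : \sum_(i < n.+1) (ord_max == i)%:R * (ord_max == i)%:R = 1 :> R.
    by rewrite (sum_coord_delta (fun i => (ord_max == i)%:R)) eqxx.
  by rewrite S1 sum_coord_delta dotp_sqr e1; ring.
Qed.

Lemma height2_dotp x : 0 <= height2 x <= dotp x x.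
Proof. by rewrite sqr_ge0 coord_le_dotp. Qed.

Lemma closure_annulus_dotp x : closure A x -> R0 ^+ 2 <= dotp x x <= R1 ^+ 2.
Proof.
rewrite closure_annulus //= => /andP[x0 x1]; rewrite -sqr_enorm.
by rewrite !ler_sqr ?nnegrE ?enorm_ge0 ?(ltW hR0) ?x0 ?x1 // ltW // (lt_trans hR0).
Qed.

Lemma annulus_dotp x : A x -> R0 ^+ 2 < dotp x x < R1 ^+ 2.
Proof.
rewrite /annulus /= => /andP[x0 x1]; rewrite -sqr_enorm.
by rewrite !ltr_sqr ?nnegrE ?enorm_ge0 ?(ltW hR0) ?x0 ?x1 // ltW // (lt_trans hR0).
Qed.

Lemma height2_continuous : continuous height2.
Proof.
have -> : height2 = (fun x : E => x 0 ord_max * x 0 ord_max).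
  by apply/funext => x; rewrite /height2 expr2.
by move=> x; apply: continuousM; exact: coord_continuous.
Qed.

Lemma of_jet_continuous c F x : jcont c F -> c < dotp x x -> {for x, continuous (of_jet F)}.
Proof.
move=> cF hx; rewrite /of_jet.
apply: (@continuous_comp2 R _ (fun p => F p.1 p.2) (fun x : E => dotp x x) height2).
- exact: dotp_continuous.
- exact: height2_continuous.
- exact: (cF (dotp x x, height2 x)).
Qed.

Lemma enorm_gt0 x : x != 0 -> 0 < enorm x.
Proof.
move=> x0; rewrite lt_def enorm_ge0 andbT; apply/eqP => /enorm0_eq0 /eqP.
by rewrite (negbTE x0).
Qed.

(* Reflection coupling: moving x along the i-th coordinate vector and y along its
   reflection in the hyperplane orthogonal to x - y changes |x - y| only through
   the component along x - y, and summing over i turns the second derivatives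
   into the difference of the two Laplacians. *)
Lemma doubling_interior c J (L K r : R) x y : jsmooth c J ->
  c < dotp x x -> c < dotp y y -> x != y -> 0 < r ->
  (forall x' y', enorm (x' - x) < r -> enorm (y' - y) < r ->
    of_jet (jf J) x' - of_jet (jf J) y' - L * (K * enorm (x' - y') - enorm (x' - y') ^+ 2 / 2) <=
    of_jet (jf J) x - of_jet (jf J) y - L * (K * enorm (x - y) - enorm (x - y) ^+ 2 / 2)) ->
  jlap N J (dotp x x) (height2 x) - jlap N J (dotp y y) (height2 y) + 4 * L <= 0.
Proof.
move=> sJ cx cy xy r0 hmax.
pose s := enorm (x - y).
have s0 : 0 < s by apply: enorm_gt0; rewrite subr_eq0.
have [e xyE e1] : exists2 e, x - y = s *: e & dotp e e = 1.
  exists (s^-1 *: (x - y)); first by rewrite scalerA mulfV ?scale1r // gt_eqF.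
  by rewrite dotpZl dotpZr -sqr_enorm -/s; field; rewrite gt_eqF.
have dpos z v : c < dotp z z -> exists2 d : R, 0 < d &
    forall t, `|t| < d -> c < dotp (z + t *: v) (z + t *: v).
  move=> cz; have cq := is_derive_continuous (quad_derive (dotp z z) (2 * dotp z v) (dotp v v) 0).
  have E0 : quad (dotp z z) (2 * dotp z v) (dotp v v) 0 = dotp z z.
    by rewrite /quad expr0n /= !mulr0 !addr0.
  have cq' : quad (dotp z z) (2 * dotp z v) (dotp v v) t @[t --> (0 : R)] --> dotp z z.
    by rewrite -[X in _ --> X]E0; exact: cq.
  have /nbhs_ballP[d /= d0 hd] :
    \forall t \near (0 : R), c < quad (dotp z z) (2 * dotp z v) (dotp v v) t.
    exact: (cvgr_gt (dotp z z) cq' c cz).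
  exists d => // t td; rewrite dotp_line; apply: hd.
  by rewrite /ball /= sub0r normrN.
have en1 i : enorm (delta_mx 0 i : E) = 1.
  by rewrite /enorm dotp_delta delta_coord eqxx sqrtr1.
have ei i : `|e 0 i| <= 1.
  by apply: le_trans (coord_le_enorm _ _) _; rewrite /enorm e1 sqrtr1.
have enr i : enorm (reflected e i) = 1.
  by rewrite /enorm reflected_unit // sqrtr1.
have one i : jet_line2 J x (delta_mx 0 i) - jet_line2 J y (reflected e i) + 4 * L * e 0 i ^+ 2 <= 0.
  pose f t := of_jet (jf J) (x + t *: delta_mx 0 i) - of_jet (jf J) (y + t *: reflected e i)
    - L * (K * (s + 2 * t * e 0 i) - (s + 2 * t * e 0 i) ^+ 2 / 2).
  pose f1 t := jet_line J x (delta_mx 0 i) t - jet_line J y (reflected e i) t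
    - L * (K * (2 * e 0 i) - (s + 2 * t * e 0 i) * (2 * e 0 i)).
  have [d1 d10 hd1] := dpos x (delta_mx 0 i) cx.
  have [d2 d20 hd2] := dpos y (reflected e i) cy.
  (* The bound [s / 2] keeps [s + 2 t e_i] nonnegative, so that it equals the distance of the two
     moving points. *)
  pose m := Num.min (Num.min r (s / 2)) (Num.min d1 d2).
  have m0 : 0 < m by rewrite !lt_min r0 divr_gt0 // d10.
  have [|||_ h] := @second_derivative_max R f f1
    (jet_line2 J x (delta_mx 0 i) - jet_line2 J y (reflected e i) + 4 * L * e 0 i ^+ 2) m m0.
  - move=> t; rewrite !lt_min => /andP[_ /andP[t1 t2]].
    have h1 := jet_line_derive sJ (hd1 t t1); have h2 := jet_line_derive sJ (hd2 t t2).
    by apply: is_derive_eq; rewrite /f1 /GRing.scale /=; field.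
  - have h1 := jet_line_derive2 (delta_mx 0 i) sJ cx.
    have h2 := jet_line_derive2 (reflected e i) sJ cy.
    by apply: is_derive_eq; rewrite /GRing.scale /=; ring.
  - move=> t; rewrite !lt_min => /andP[/andP[tr ts] _].
    have st : 0 <= s + 2 * t * e 0 i.
      have h1 : `|2 * t * e 0 i| <= s.
        rewrite !normrM (ger0_norm (ler0n _ 2)).
        apply: (@le_trans _ _ (2 * `|t| * 1)); last by lra.
        by rewrite ler_wpM2l ?mulr_ge0.
      by move: h1; rewrite ler_norml => /andP[h1 _]; lra.
    have dE : (x + t *: delta_mx 0 i) - (y + t *: reflected e i) = (s + 2 * t * e 0 i) *: e.
      apply/rowP => k; have := congr1 (fun z : E => z 0 k) xyE; rewrite /= !mxE => h.
      have -> : x 0 k = s * e 0 k + y 0 k by rewrite -h; ring.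
      by ring.
    have := hmax (x + t *: delta_mx 0 i) (y + t *: reflected e i).
    have ex : enorm (x + t *: delta_mx 0 i - x) < r by rewrite addrC addKr enormZ en1 mulr1.
    have ey : enorm (y + t *: reflected e i - y) < r by rewrite addrC addKr enormZ enr mulr1.
    move=> /(_ ex ey); rewrite dE enormZ.
    have en_e : enorm e = 1 by rewrite /enorm e1 sqrtr1.
    rewrite en_e mulr1 (ger0_norm st) => /le_trans; apply.
    by rewrite /f !scale0r !addr0 !mulr0 mul0r addr0.
  exact: h.
rewrite -jet_laplacian -(jet_laplacian_reflected J y e1).
have -> : 4 * L = \sum_i 4 * L * e 0 i ^+ 2 by rewrite -mulr_sumr dotp_sqr e1 mulr1.
by rewrite -sumrB -big_split /=; apply: sumr_le0 => i _; exact: one.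
Qed.

Let N1 : 1 <= N. Proof. by rewrite ler1n. Qed.
Let R1p : 0 < R1. Proof. exact: lt_trans hR0 hR01. Qed.
Let Q0p : 0 < R0 ^+ 2. Proof. by rewrite exprn_gt0. Qed.
Let Q01 : R0 ^+ 2 < R1 ^+ 2. Proof. by rewrite ltr_sqr ?nnegrE ?ltW. Qed.

Lemma jet_boundary_bound : exists2 C, 0 <= C & forall J h M,
  jsolves N (R0 ^+ 2) (R1 ^+ 2) J h -> 0 <= M ->
  (forall q z, R0 ^+ 2 <= q <= R1 ^+ 2 -> 0 <= z <= q -> `|h q z| <= M) ->
  forall x, closure A x -> `|of_jet (jf J) x| <= C * M * (R1 ^+ 2 - dotp x x) /\
    `|of_jet (jf J) x| <= C * M * (dotp x x - R0 ^+ 2).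
Proof.
have [Ci Ci0 hCi] := @barrier_inner R N _ _ N1 Q0p Q01 n erefl.
exists (1 + Ci); first by rewrite addr_ge0.
move=> J h M sJ M0 hM x /closure_annulus_dotp hq; have hz := height2_dotp x.
have sN := jsolves_lin (-2) sJ sJ.
have hM1 q z : R0 ^+ 2 <= q <= R1 ^+ 2 -> 0 <= z <= q -> h q z <= M.
  by move=> ? ?; apply: le_trans (ler_norm _) (hM _ _ _ _).
have hM2 q z : R0 ^+ 2 <= q <= R1 ^+ 2 -> 0 <= z <= q -> h q z + (-2) * h q z <= M.
  by move=> h1 h2; have := hM _ _ h1 h2; rewrite ler_norml => /andP[h3 _]; lra.
have o1 := barrier_outer N1 Q0p Q01 sJ M0 hM1 hq hz.
have o2 := barrier_outer N1 Q0p Q01 sN M0 hM2 hq hz.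
have i1 := hCi _ _ _ sJ M0 hM1 _ _ hq hz.
have i2 := hCi _ _ _ sN M0 hM2 _ _ hq hz.
case/andP: hq => q0 q1.
have c0 : 0 <= M * (dotp x x - R0 ^+ 2) by rewrite mulr_ge0 // subr_ge0.
have c1 : 0 <= Ci * (M * (R1 ^+ 2 - dotp x x)) by rewrite !mulr_ge0 // subr_ge0.
rewrite /of_jet !ler_norml; move: o2 i2 => /=; move: (jf J _ _) o1 i1 => v.
rewrite !mulrDl !mul1r; rewrite -!mulrA in c0 c1 *.
by move=> *; split; apply/andP; split; lra.
Qed.

Lemma dotp_sub_le (a b : E) : closure A a -> closure A b ->
  dotp a a - dotp b b <= 2 * R1 * enorm (a - b).
Proof.
rewrite closure_annulus //= => /andP[a0 a1] /andP[b0 b1].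
rewrite -!sqr_enorm; have := ler_dist_enorm a b; rewrite ler_norml => /andP[_ h1].
have -> : enorm a ^+ 2 - enorm b ^+ 2 = (enorm a - enorm b) * (enorm a + enorm b) by ring.
have h2 : enorm a + enorm b <= 2 * R1 by lra.
apply: (@le_trans _ _ (enorm (a - b) * (enorm a + enorm b))).
  by rewrite ler_wpM2r // addr_ge0 ?enorm_ge0.
by rewrite mulrC ler_wpM2r ?enorm_ge0.
Qed.

Lemma jsolves_boundary J h x : jsolves N (R0 ^+ 2) (R1 ^+ 2) J h ->
  enorm x = R0 \/ enorm x = R1 -> of_jet (jf J) x = 0.
Proof.
move=> sJ hx; rewrite /of_jet -sqr_enorm.
by have [h0 h1] := jsolves_bd sJ (height2 x); case: hx => ->.
Qed.

(** If [w x - w y] exceeded [L phi(|x - y|)] somewhere, take a maximal pair. The barriers exclude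
    boundary points. Inside, the coupling produces [4 L] from the concavity of [phi], which the
    difference of the two source terms cannot balance. *)
Theorem jet_lipschitz : exists2 C, 0 <= C & forall J h M,
  jsolves N (R0 ^+ 2) (R1 ^+ 2) J h -> 0 <= M ->
  (forall q z, R0 ^+ 2 <= q <= R1 ^+ 2 -> 0 <= z <= q -> `|h q z| <= M) ->
  forall x y, closure A x -> closure A y ->
    of_jet (jf J) x - of_jet (jf J) y <= C * M * enorm (x - y).
Proof.
have [Ci Ci0 hCi] := jet_boundary_bound.
exists (4 * R1 * (1 + Ci)); first by rewrite mulr_ge0 // ?addr_ge0 // mulr_ge0 // ltW.
move=> J h M sJ M0 hM.
(* The part [Ci M] serves the boundary; the part [M] makes [4 L] dominate the oscillation [2 M] of
   the source. *)
pose L := (1 + Ci) * M.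
have L0 : 0 <= L by rewrite mulr_ge0 // addr_ge0.
have [sm _ eqn] := sJ.
pose w x := of_jet (jf J) x.
have wb x := hCi J h M sJ M0 hM x.
(* Strictly concave, and at least [2 R1 s] up to the diameter [2 R1]; here [2 R1] is the Lipschitz
   constant of [|x|^2] on the closure, the unit in which the barriers are expressed. *)
pose phi (s : R) := 4 * R1 * s - s ^+ 2 / 2.
have phi_lb s : 0 <= s -> s <= 2 * R1 -> 2 * R1 * s <= phi s by move=> ? ?; rewrite /phi; nra.
pose Psi (p : E * E) := w p.1 - w p.2 - L * phi (enorm (p.1 - p.2)).
pose D := (closure A `*` closure A)%classic : set (E * E).
have cD : compact D by apply: compact_setX; exact: compact_closure_annulus hR0 hR01.
have q0half (x : E) : closure A x -> R0 ^+ 2 / 2 < dotp x x.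
  by move=> /closure_annulus_dotp/andP[hx _]; apply: lt_le_trans hx; have := Q0p; lra.
suff key p : D p -> Psi p <= 0.
  move=> x y Ax Ay; have := key (x, y) (conj Ax Ay).
  rewrite /Psi /= subr_le0 => /le_trans; apply.
  have -> : 4 * R1 * (1 + Ci) * M * enorm (x - y) = L * (4 * R1 * enorm (x - y)).
    by rewrite /L; ring.
  by rewrite ler_wpM2l // /phi gerBl divr_ge0 // sqr_ge0.
move=> Dp; have D0 : D !=set0 by exists p.
have [|[x y] ] := @compact_EVT_max _ _ Psi D D0 cD.
  apply: continuous_in_subspaceT => -[x y]; rewrite inE => -[/= Ax Ay].
  have c1 : {for (x, y), continuous (fun p : E * E => w p.1)}.
    apply: (@continuous_comp _ _ _ fst w); first exact: cvg_fst.
    exact: of_jet_continuous (jf_cont sm) (q0half _ Ax).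
  have c2 : {for (x, y), continuous (fun p : E * E => w p.2)}.
    apply: (@continuous_comp _ _ _ snd w); first exact: cvg_snd.
    exact: of_jet_continuous (jf_cont sm) (q0half _ Ay).
  have c3 : {for (x, y), continuous (fun p : E * E => enorm (p.1 - p.2))}.
    apply: (@continuous_comp _ _ _ (fun p : E * E => p.1 - p.2) (@enorm R n.+1)); last exact: enorm_continuous.
    by apply: cvgB; [exact: cvg_fst|exact: cvg_snd].
  have cc k : {for (x, y), continuous (fun p : E * E => k : R)} by exact: cst_continuous.
  exact: (cvgB (cvgB c1 c2) (cvgM (cc L) (cvgB (cvgM (cc (4 * R1)) c3) (cvgM (cvgM c3 c3) (cc 2^-1))))).
rewrite inE => -[/= Ax Ay] hmax.
suff H : Psi (x, y) <= 0 by apply: le_trans H; apply: hmax; rewrite inE.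
rewrite leNgt; apply/negP => HP.
have sR : enorm (x - y) <= 2 * R1.
  move: Ax Ay; rewrite closure_annulus //= => /andP[_ x1] /andP[_ y1].
  by have := ler_enormD x (- y); rewrite enormN; lra.
have HP' : L * (2 * R1 * enorm (x - y)) < w x - w y.
  apply: (@le_lt_trans _ _ (L * phi (enorm (x - y)))).
    by rewrite ler_wpM2l // phi_lb ?enorm_ge0.
  by move: HP; rewrite /Psi /= subr_gt0.
have CM0 : 0 <= Ci * M by rewrite mulr_ge0.
have bdw a b : closure A a -> closure A b -> enorm a = R0 \/ enorm a = R1 ->
    w a = 0 /\ `|w b| <= L * (2 * R1 * enorm (a - b)).
  move=> Aa Ab ha; have [h1 h2] := wb _ Ab; split; first exact: jsolves_boundary sJ ha.
  apply: (@le_trans _ _ (Ci * M * (2 * R1 * enorm (a - b)))); last first.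
    rewrite ler_wpM2r //; first by rewrite !mulr_ge0 ?enorm_ge0 // ltW.
    by rewrite /L mulrDl mul1r lerDr.
  case: ha => ha.
    apply: (le_trans h2); rewrite -ha sqr_enorm ler_wpM2l //.
    by rewrite enorm_distC; exact: dotp_sub_le.
  by apply: (le_trans h1); rewrite -ha sqr_enorm ler_wpM2l // ha; exact: dotp_sub_le.
have interior_of a : closure A a -> enorm a <> R0 -> enorm a <> R1 -> A a.
  rewrite closure_annulus //= /annulus /= => /andP[a0 a1] /eqP n0 /eqP n1.
  by rewrite !lt_def n0 a0 eq_sym n1 a1.
have notbd a b : closure A a -> closure A b -> L * (2 * R1 * enorm (a - b)) < `|w a - w b| -> A a.
  move=> Aa Ab hab; apply: interior_of => // ha.
    have [w0 w1] := bdw a b Aa Ab (or_introl ha).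
    by move: hab; rewrite w0 sub0r normrN ltNge w1.
  have [w0 w1] := bdw a b Aa Ab (or_intror ha).
  by move: hab; rewrite w0 sub0r normrN ltNge w1.
have Axi : A x by apply: (notbd x y) => //; exact: lt_le_trans HP' (ler_norm _).
have Ayi : A y.
  by apply: (notbd y x) => //; rewrite enorm_distC distrC; exact: lt_le_trans HP' (ler_norm _).
have xy : x != y.
  by apply/eqP => E; move: HP'; rewrite E !subrr enorm0 !mulr0 ltxx.
have [r r0 hr] : exists2 r : R, 0 < r & forall x' y', enorm (x' - x) < r -> enorm (y' - y) < r ->
    closure A x' /\ closure A y'.
  have ball_in a : A a -> exists2 r : R, 0 < r & forall a', enorm (a' - a) < r -> closure A a'.
    move=> Aa; have /nbhs_ballP[r /= r0 hr] : nbhs a A.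
      by apply: open_nbhs_nbhs; split => //; exact: open_annulus.
    exists r => // a' ha; apply/subset_closure/hr; rewrite mx_norm_ball /ball_ /= distrC.
    exact: le_lt_trans (norm_le_enorm _) ha.
  have [r1 r10 h1] := ball_in x Axi; have [r2 r20 h2] := ball_in y Ayi.
  exists (Num.min r1 r2); first by rewrite lt_min r10.
  by move=> x' y'; rewrite !lt_min => /andP[hx _] /andP[_ hy]; split; [exact: h1|exact: h2].
have := @doubling_interior _ J L (4 * R1) r x y sm (q0half _ Ax) (q0half _ Ay) xy r0.
have -> : 4 * L = 4 * L by [].
move=> H; have {H}: jlap N J (dotp x x) (height2 x) - jlap N J (dotp y y) (height2 y) + 4 * L <= 0.
  by apply: H => x' y' hx hy; apply: (hmax (x', y')); rewrite inE; exact: hr.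
rewrite !eqn; do ?[exact: closure_annulus_dotp|exact: height2_dotp].
have := hM _ _ (closure_annulus_dotp Ax) (height2_dotp x).
have := hM _ _ (closure_annulus_dotp Ay) (height2_dotp y).
rewrite !ler_norml => /andP[a1 a2] /andP[a3 a4] H.
have : 0 < w x - w y.
  apply: le_lt_trans HP'; apply: mulr_ge0 => //; apply: mulr_ge0; last exact: enorm_ge0.
  by rewrite mulr_ge0 // ltW.
move: H; rewrite /w /of_jet /L.
have : 0 <= Ci * M by [].
by rewrite mulrDl mul1r; lra.
Qed.

End jet_in_space.

(** * Approximation of symmetric decreasing functions *)

Section bernstein.
Context {R : realType}.
Implicit Types (s : nat -> R) (t a e K : R) (m k : nat).

(* De Casteljau's recursion for Bernstein polynomials *)
Fixpoint bern m s t : R :=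
  if m is k.+1 then (1 - t) * bern k s t + t * bern k (s \o S) t else s 0.

(** Coefficients in the monomial basis: the data fed to the differential equations are the
    coefficients of powers of [z]. *)
Fixpoint bern_coef m s (j : nat) : R :=
  if m is k.+1 then
    bern_coef k s j + (if j is i.+1 then bern_coef k (s \o S) i - bern_coef k s i else 0)
  else if j is 0 then s 0 else 0.

Lemma bern_coef_big m s j : (m < j)%N -> bern_coef m s j = 0.
Proof.
elim: m s j => [|m IH] s [|j] //= mj; rewrite !IH ?subrr ?addr0 //; first exact: ltnW.
Qed.

Lemma bernE m s t : bern m s t = \sum_(j < m.+1) bern_coef m s j * t ^+ j.
Proof.
elim: m s => [|m IH] s; first by rewrite big_ord1 /= expr0 mulr1.
have E : \sum_(j < m.+2) bern_coef m s j * t ^+ j = \sum_(j < m.+1) bern_coef m s j * t ^+ j.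
  by rewrite big_ord_recr /= bern_coef_big // mul0r addr0.
rewrite /= !IH; under [in RHS]eq_bigr do rewrite mulrDl.
rewrite big_split /= E [X in _ = _ + X]big_ord_recl /= mul0r add0r.
under [X in _ = _ + X]eq_bigr => j _.
  rewrite /bump /= add1n exprS mulrCA mulrBl mulrBr.
  over.
by rewrite sumrB -!mulr_sumr; ring.
Qed.

Lemma bern_le m s s' t : 0 <= t <= 1 -> (forall k, (k <= m)%N -> s k <= s' k) ->
  bern m s t <= bern m s' t.
Proof.
move=> /andP[t0 t1]; elim: m s s' => [|m IH] s s' h /=; first exact: h.
apply: lerD; apply: ler_wpM2l; rewrite ?subr_ge0 //; apply: IH => k km; apply: h => //.
exact: leqW.
Qed.

Lemma bern_lin m s s' a t : bern m (fun k => s k + a * s' k) t = bern m s t + a * bern m s' t.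
Proof.
elim: m s s' => [|m IH] s s' //=; rewrite IH.
have -> : (fun k => s k + a * s' k) \o S = fun k => (s \o S) k + a * (s' \o S) k by [].
by rewrite IH; ring.
Qed.

Lemma bern_cst m a t : bern m (fun=> a) t = a.
Proof.
elim: m => [|m IH] //=; have -> : (fun=> a) \o S = (fun=> a) :> (nat -> R) by [].
by rewrite IH; ring.
Qed.

Lemma bern_decr m s t t' : 0 <= t -> t <= t' -> t' <= 1 ->
  (forall k, (k < m)%N -> s k.+1 <= s k) -> bern m s t' <= bern m s t.
Proof.
move=> t0 tt t1; elim: m s => [|m IH] s h //=.
have h1 : bern m s t' <= bern m s t by apply: IH => k km; apply: h; exact: leqW.
have h2 : bern m (s \o S) t' <= bern m (s \o S) t by apply: IH => k km; apply: h.
have h3 : bern m (s \o S) t <= bern m s t.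
  by apply: bern_le => [|k km]; [rewrite t0 (le_trans tt)|exact: h].
by nra.
Qed.

Lemma bern_id m t : bern m (fun k => k%:R) t = m%:R * t.
Proof.
elim: m => [|m IH] /=; first by rewrite mul0r.
have -> : (fun k => k%:R) \o S = fun k => (fun k => k%:R) k + 1 * (fun=> 1) k :> R.
  by apply/funext => k /=; rewrite mulr1 natr1.
by rewrite bern_lin bern_cst IH -natr1; ring.
Qed.

Lemma bern_sqr m t : bern m (fun k => k%:R ^+ 2) t = m%:R * t * (1 - t) + (m%:R * t) ^+ 2.
Proof.
elim: m => [|m IH] /=; first by rewrite expr0n /=; ring.
have -> : (fun k => k%:R ^+ 2) \o S =
    fun k => (fun k => (fun k => k%:R ^+ 2) k + 2 * (fun k => k%:R) k) k + 1 * (fun=> 1) k :> R.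
  by apply/funext => k /=; rewrite -natr1; ring.
by rewrite !bern_lin bern_cst IH bern_id -natr1; ring.
Qed.

(** Bernstein's argument: the operator is monotone and reproduces affine functions, and it maps
    [(k/m - t)^2] to [t (1 - t) / m], so a quadratic modulus of continuity at [t] becomes an error
    of order [K / m]. *)
Lemma bern_approx m s t a e K : (0 < m)%N -> 0 <= t <= 1 -> 0 <= K ->
  (forall k, (k <= m)%N -> `|s k - a| <= e + K * (k%:R / m%:R - t) ^+ 2) ->
  `|bern m s t - a| <= e + K / m%:R.
Proof.
move=> m0 t01 K0 h.
have mr : 0 < m%:R :> R by rewrite ltr0n.
have key (sg : R) : bern m (fun k => a + sg * (e + K * (k%:R / m%:R - t) ^+ 2)) t =
    a + sg * (e + K * t * (1 - t) / m%:R).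
  have -> : (fun k => a + sg * (e + K * (k%:R / m%:R - t) ^+ 2)) =
     (fun k => (fun k => (fun=> a + sg * (e + K * t ^+ 2)) k +
        (- 2 * sg * K * t / m%:R) * (fun k => k%:R) k) k + (sg * K / m%:R ^+ 2) * (fun k => k%:R ^+ 2) k).
    by apply/funext => k /=; field; rewrite gt_eqF.
  rewrite (bern_lin m (fun k => (fun=> a + sg * (e + K * t ^+ 2)) k +
        (- 2 * sg * K * t / m%:R) * (fun k => k%:R) k) (fun k => k%:R ^+ 2)).
  rewrite (bern_lin m (fun=> a + sg * (e + K * t ^+ 2)) (fun k => k%:R)).
  by rewrite bern_cst bern_id bern_sqr; field; rewrite gt_eqF.
have le1 : K * t * (1 - t) / m%:R <= K / m%:R.
  rewrite ler_wpM2r ?invr_ge0 ?(ltW mr) // -mulrA -[leRHS]mulr1 ler_wpM2l //.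
  by case/andP: t01 => ? ?; nra.
rewrite ler_norml; apply/andP; split.
  rewrite lerBrDr; apply: le_trans (_ : bern m (fun k => a + (-1) * (e + K * (k%:R / m%:R - t) ^+ 2)) t <= _).
    by rewrite key; lra.
  apply: bern_le => // k km; have := h k km; rewrite ler_norml => /andP[h1 _]; lra.
rewrite lerBlDr; apply: le_trans (_ : _ <= bern m (fun k => a + 1 * (e + K * (k%:R / m%:R - t) ^+ 2)) t) _.
  apply: bern_le => // k km; have := h k km; rewrite ler_norml => /andP[_ h1]; lra.
by rewrite key; lra.
Qed.

Lemma bern_coef_continuous m (s : nat -> R -> R) j :
  (forall k, continuous (s k)) -> continuous (fun q => bern_coef m (s^~ q) j).
Proof.
elim: m s j => [|m IH] s j cs /=; first by case: j => [|j]; [exact: cs|move=> q; exact: cvg_cst].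
move=> q; apply: cvgD; first exact: IH.
case: j => [|j]; first exact: cvg_cst.
by apply: cvgB; [exact: (IH (fun k => s k.+1))|exact: IH].
Qed.

End bernstein.

(** * Solutions for polynomial data *)

Section polynomial_data.
Context {R : realType} {n : nat} (R0 R1 : R).
Hypotheses (hR0 : 0 < R0) (hR01 : R0 < R1).
Local Notation N := (n.+1%:R : R).

Lemma jsolves_exists m (h : nat -> R -> R) :
  (forall j (q : R), 0 < q -> {for q, continuous (h j)}) ->
  exists J, jsolves N (R0 ^+ 2) (R1 ^+ 2) J (rpoly m h).
Proof.
move=> ch.
have Q0p : 0 < R0 ^+ 2 by rewrite exprn_gt0.
have Q01 : R0 ^+ 2 < R1 ^+ 2 by rewrite ltr_sqr ?nnegrE ?ltW // (lt_trans hR0).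
have hbe (j : nat) : 1 <= 2 * N + 8 * j%:R.
  have : 0 <= j%:R :> R by []. have : 1 <= N by rewrite ler1n. lra.
have [||b [b1 [b2 [hb bd bm eqn]]]] := @triangular_bvp R (R0 ^+ 2) (R1 ^+ 2) Q01 m
  (fun j => 2 * N + 8 * j%:R) (fun j => (2 * j%:R + 2) * (2 * j%:R + 1)) h (R0 ^+ 2 / 2) hbe _ _ ch.
- by rewrite divr_gt0.
- by lra.
exists (jrpoly m b b1 b2); split.
- apply: (jrpoly_smooth hb) => j q jm hq.
  have q0 : 0 < q by lra.
  have cb i : {for q, continuous (b i)}.
    by have [hd _] := hb i q hq; exact: is_derive_continuous hd.
  have cb1 : {for q, continuous (b1 j)}.
    by have [_ hd] := hb j q hq; exact: is_derive_continuous hd.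
  have cc (k : R) : {for q, continuous (fun=> k)} by exact: cst_continuous.
  have cq : {for q, continuous (fun q : R => (4 * q)^-1)}.
    apply: continuousV; first by rewrite mulf_neq0 // gt_eqF.
    by apply: continuousM; [exact: cst_continuous|exact: id].
  have c2 : {for q, continuous (fun q => (- h j q - (2 * N + 8 * j%:R) * b1 j q -
      (2 * j%:R + 2) * (2 * j%:R + 1) * b j.+1 q + b j q) * (4 * q)^-1)}.
    have ch0 := ch j q q0.
    exact: (cvgM (cvgD (cvgB (cvgB (cvgN ch0) (cvgM (cc _) cb1)) (cvgM (cc _) (cb j.+1))) (cb j)) cq).
  (* The construction provides second derivatives but not their continuity; it is read off from the
     equation. *)
  have E r : R0 ^+ 2 / 2 < r -> b2 j r = (- h j r - (2 * N + 8 * j%:R) * b1 j r -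
      (2 * j%:R + 2) * (2 * j%:R + 1) * b j.+1 r + b j r) * (4 * r)^-1.
    by move=> hr; rewrite -(eqn j r jm hr); field; rewrite gt_eqF //; lra.
  rewrite /prop_for /continuous_at E //; apply: cvg_trans c2; apply: near_eq_cvg.
  near=> r; rewrite E //; near: r; exact: lt_nbhsr.
- move=> z; rewrite /= /rpoly.
  by split; apply: big1 => j _; have [h0 h1] := bd j; rewrite ?h0 ?h1 mul0r.
- move=> q z /andP[hq _] _.
  have hq2 : R0 ^+ 2 / 2 < q by lra.
  have := @rpoly_lap_coef R (2 * N) m b b1 b2 h (R0 ^+ 2 / 2) (fun q => bm m q (leqnn m)).
  move=> /(_ (fun j q jm hq => eqn j q jm hq)) /(_ q z hq2) <-.
  by rewrite /jlap /rpoly_lap /=; ring.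
Unshelve. all: by end_near. Qed.

End polynomial_data.

(** * Profiles of axially symmetric functions *)

Section axial_profile.
Context {R : realType} {n : nat} (R0 R1 : R).
Hypotheses (hR0 : 0 < R0) (hR01 : R0 < R1) (hn : (0 < n)%N).
Local Notation E := 'rV[R]_n.+1.
Local Notation N := (n.+1%:R : R).
Local Notation A := (@annulus R n R0 R1).
Implicit Types (x y : E) (g : E -> R) (q t e : R).

(** A representative, in the plane of the first and last axes, of the orbit with [|x|^2 = q] and
    [x_N^2 = q t]. *)
Definition profile_point q t : E :=
  Num.sqrt q *: (Num.sqrt (1 - t) *: delta_mx 0 ord0 + Num.sqrt t *: delta_mx 0 ord_max).

Lemma dotp_plane (a b : R) :
  dotp (a *: delta_mx 0 ord0 + b *: delta_mx 0 ord_max : E)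
       (a *: delta_mx 0 ord0 + b *: delta_mx 0 ord_max) = a ^+ 2 + b ^+ 2.
Proof.
have h0 : (ord_max == ord0 :> 'I_n.+1) = false by apply/negbTE; rewrite -lt0n.
have h1 : (ord0 == ord_max :> 'I_n.+1) = false by rewrite eq_sym.
rewrite !(dotpDl, dotpDr, dotpZl, dotpZr) !dotp_delta !delta_coord h0 h1 !eqxx.
by rewrite /=; ring.
Qed.

Lemma plane_height (a b : R) :
  (a *: delta_mx 0 ord0 + b *: delta_mx 0 ord_max : E) 0 ord_max = b.
Proof.
have h0 : (ord_max == ord0 :> 'I_n.+1) = false by apply/negbTE; rewrite -lt0n.
by rewrite !mxE /= h0 eqxx mulr0 add0r mulr1.
Qed.

Lemma dotp_profile_point q t : 0 <= q -> 0 <= t <= 1 ->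
  dotp (profile_point q t) (profile_point q t) = q.
Proof.
move=> q0 /andP[t0 t1]; rewrite /profile_point dotpZl dotpZr dotp_plane.
rewrite !sqr_sqrtr // ?subr_ge0 // subrK mulr1 -expr2 sqr_sqrtr //.
Qed.

Lemma height2_profile_point q t : 0 <= q -> 0 <= t <= 1 ->
  height2 (profile_point q t) = q * t.
Proof.
move=> q0 /andP[t0 t1]; rewrite /profile_point /height2 mxE plane_height.
by rewrite exprMn !sqr_sqrtr.
Qed.

Lemma sqr_sqrtB_le (a b : R) : 0 <= a -> 0 <= b -> (Num.sqrt a - Num.sqrt b) ^+ 2 <= `|a - b|.
Proof.
wlog ba : a b / b <= a.
  move=> W a0 b0; have [h|h] := leP b a; first exact: W.
  by rewrite -sqrrN opprB distrC; apply: W => //; exact: ltW.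
move=> a0 b0; rewrite ger0_norm ?subr_ge0 //.
have h1 : Num.sqrt b <= Num.sqrt a by rewrite ler_wsqrtr.
have := sqrtr_ge0 b; have := sqr_sqrtr a0; have := sqr_sqrtr b0.
move: (Num.sqrt a) (Num.sqrt b) h1 => u v uv <- <- v0.
by have : 0 <= v * (u - v) by [apply: mulr_ge0 => //; rewrite subr_ge0]; nra.
Qed.

(** The square root is only Hölder continuous of order 1/2 at 0, so the estimate is linear for the
    squared distance. *)
Lemma profile_point_dist q t t' : 0 <= q -> 0 <= t <= 1 -> 0 <= t' <= 1 ->
  enorm (profile_point q t - profile_point q t') ^+ 2 <= 2 * q * `|t - t'|.
Proof.
move=> q0 /andP[t0 t1] /andP[t0' t1'].
have -> : profile_point q t - profile_point q t' = Num.sqrt q *: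
    ((Num.sqrt (1 - t) - Num.sqrt (1 - t')) *: delta_mx 0 ord0 +
     (Num.sqrt t - Num.sqrt t') *: delta_mx 0 ord_max).
  rewrite /profile_point -scalerBr; congr (_ *: _).
  by rewrite opprD addrACA -!scalerBl.
rewrite sqr_enorm dotpZl dotpZr dotp_plane mulrA -expr2 sqr_sqrtr //.
rewrite (mulrC 2) -mulrA ler_wpM2l //.
have h1 := sqr_sqrtB_le t0 t0'.
have : (Num.sqrt (1 - t) - Num.sqrt (1 - t')) ^+ 2 <= `|t - t'|.
  apply: le_trans (sqr_sqrtB_le _ _) _; rewrite ?subr_ge0 //.
  by have -> : 1 - t - (1 - t') = t' - t by [ring]; rewrite distrC.
lra.
Qed.

Lemma closure_annulusE x : closure A x <-> R0 ^+ 2 <= dotp x x <= R1 ^+ 2.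
Proof.
have R1p := lt_trans hR0 hR01.
split; first exact: closure_annulus_dotp.
rewrite closure_annulus //= -sqr_enorm.
by rewrite !ler_sqr ?nnegrE ?enorm_ge0 ?(ltW hR0) ?(ltW R1p).
Qed.

Lemma profile_point_closure q t : R0 ^+ 2 <= q <= R1 ^+ 2 -> 0 <= t <= 1 ->
  closure A (profile_point q t).
Proof.
move=> hq ht; apply/closure_annulusE; rewrite dotp_profile_point //.
by case/andP: hq => h _; exact: le_trans (sqr_ge0 _) h.
Qed.

Lemma unif_continuous_closure g : {within closure A, continuous g} ->
  forall e, 0 < e -> exists2 d, 0 < d & forall x y, closure A x -> closure A y ->
    enorm (x - y) < d -> `|g x - g y| < e.
Proof.
move=> cg e e0.
have cA : compact (closure A) by exact: compact_closure_annulus.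
have := cA; rewrite compact_near_coveringP => /(_ R (0 : R)^'+
  (fun d x => closure A x -> forall y, closure A y -> enorm (x - y) < d -> `|g x - g y| < e)).
case=> //.
  move=> x Ax.
  have /subspace_continuousP/(_ x Ax) cgx := cg.
  have e2 : 0 < e / 2 by rewrite divr_gt0.
  have /cvgrPdist_lt/(_ _ e2) := cgx.
  rewrite near_withinE => /nbhs_ballP[r /= r0 hr].
  have r2 : 0 < r / 2 by rewrite divr_gt0.
  exists (ball x (r / 2), [set d : R | d < r / 2]).
    split => /=; first exact: nbhsx_ballx.
    exact: nbhs_right_lt.
  move=> [x' d] [/= hx' hd] Ax' y Ay hy.
  have h1 : ball x r y.
    rewrite [r]splitr; apply: ball_triangle hx' _.
    rewrite mx_norm_ball /ball_ /=; apply: le_lt_trans (norm_le_enorm _) _.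
    exact: lt_trans hy hd.
  have h2 : ball x r x' by apply: le_ball hx'; lra.
  have a1 := hr _ h1 Ay; have a2 := hr _ h2 Ax'.
  have -> : g x' - g y = (g x - g y) - (g x - g x') by ring.
  by rewrite [e]splitr; apply: le_lt_trans (ler_normB _ _) _; exact: ltrD.
move=> d /= d0 H; have d2 : 0 < d / 2 by rewrite divr_gt0.
exists (d / 2) => // x y Ax; apply: (H (d / 2)) => //.
by rewrite /= sub0r normrN gtr0_norm //; lra.
Qed.

End axial_profile.

Section approximation.
Context {R : realType} {n : nat} (R0 R1 : R).
Hypotheses (hR0 : 0 < R0) (hR01 : R0 < R1) (hn : (0 < n)%N).
Local Notation E := 'rV[R]_n.+1.
Local Notation N := (n.+1%:R : R).
Local Notation A := (@annulus R n R0 R1).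
Implicit Types (x y : E) (g : E -> R) (q t e M : R).

(** Axial symmetry, evenness in the latitude and monotonicity in one inequality without angles: used
    in both directions it gives equal values when [|x|] and [x_N^2] agree. It passes to pointwise
    limits, unlike a condition on derivatives. *)
Definition symdec g := forall x y, closure A x -> closure A y ->
  dotp x x = dotp y y -> height2 x <= height2 y -> g y <= g x.

Lemma symdec_profile g x : symdec g -> closure A x ->
  g x = g (profile_point (dotp x x) (height2 x / dotp x x)).
Proof.
move=> sg Ax; have /(closure_annulusE hR0 hR01) hq := Ax.
have q0 : 0 < dotp x x by case/andP: hq => h _; apply: lt_le_trans h; rewrite exprn_gt0.
have h01 : 0 <= height2 x / dotp x x <= 1.
  by rewrite divr_ge0 ?sqr_ge0 ?(ltW q0) //= ler_pdivrMr // mul1r; case/andP: (height2_dotp x).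
have AP := profile_point_closure hR0 hR01 hn hq h01.
have hd := dotp_profile_point hn (ltW q0) h01.
have hh := height2_profile_point hn (ltW q0) h01.
have {}hh : height2 (profile_point (dotp x x) (height2 x / dotp x x) : E) = height2 x.
  by rewrite hh mulrC divfK // gt_eqF.
by apply/eqP; rewrite eq_le; apply/andP; split; apply: sg; rewrite ?hd ?hh.
Qed.

(** [jsolves_exists] asks for coefficients continuous at every [q > 0], while [g] matters only over
    the ring; freezing [q] at the ends extends the profile. *)
Let clamp q : R := Num.max (R0 ^+ 2) (Num.min q (R1 ^+ 2)).

Let clamp_range q : R0 ^+ 2 <= clamp q <= R1 ^+ 2.
Proof.
have R1p := lt_trans hR0 hR01; have h := hR01.
have Q01 : R0 ^+ 2 <= R1 ^+ 2 by rewrite ler_sqr ?nnegrE ?ltW.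
by rewrite /clamp le_max lexx /= ge_max Q01 ge_min lexx orbT.
Qed.

Let clamp_id q : R0 ^+ 2 <= q <= R1 ^+ 2 -> clamp q = q.
Proof. by move=> /andP[h1 h2]; rewrite /clamp min_l // max_r. Qed.

Let clamp_continuous : continuous clamp.
Proof.
move=> q; apply: (@continuous_max _ _ (fun=> R0 ^+ 2) (fun q => Num.min q (R1 ^+ 2))).
  exact: cst_continuous.
by apply: (@continuous_min _ _ id (fun=> R1 ^+ 2)); [exact: id|exact: cst_continuous].
Qed.

Lemma profile_continuous g t : {within closure A, continuous g} -> 0 <= t <= 1 ->
  continuous (fun q => g (profile_point (clamp q) t)).
Proof.
move=> cg ht q.
have Aq r : closure A (profile_point (clamp r) t) by exact: profile_point_closure.
have /subspace_continuousP/(_ _ (Aq q)) c1 := cg.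
have c2 : (profile_point (clamp r) t : E) @[r --> q] --> (profile_point (clamp q) t : E).
  rewrite /profile_point; apply: cvgZr_tmp.
  apply: (continuous_comp (f := clamp) (g := Num.sqrt)); first exact: clamp_continuous.
  exact: sqrt_continuous.
apply: (@cvg_comp _ _ _ (fun r => profile_point (clamp r) t : E) g _ _ _ _ c1).
move=> P hP; apply: (@filterS R (nbhs (q : R)) _ _ _ _ (c2 _ hP)) => r h; exact: h.
Qed.

Lemma jet_approximation g M e : {within closure A, continuous g} -> symdec g ->
  (forall x, closure A x -> 0 <= g x <= M) -> 0 < e ->
  exists J h, [/\ jsolves N (R0 ^+ 2) (R1 ^+ 2) J h,
    forall x, closure A x -> `|of_jet h x - g x| <= e,
    forall q z z', R0 ^+ 2 <= q <= R1 ^+ 2 -> 0 <= z -> z <= z' -> z' <= q -> h q z' <= h q z &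
    forall q z, R0 ^+ 2 <= q <= R1 ^+ 2 -> 0 <= z <= q -> 0 <= h q z <= M].
Proof.
move=> cg sg gM e0.
have R1p := lt_trans hR0 hR01.
have e2 : 0 < e / 2 by rewrite divr_gt0.
have [d d0 hd] := unif_continuous_closure hR0 hR01 cg e2.
(* By [profile_point_dist], values of [t] closer than [eta] give points closer than [d]. *)
pose eta := d ^+ 2 / (2 * R1 ^+ 2).
have eta0 : 0 < eta by rewrite divr_gt0 ?exprn_gt0 // mulr_gt0 ?exprn_gt0.
have Q01 : R0 ^+ 2 <= R1 ^+ 2 by rewrite ler_sqr ?nnegrE ?ltW.
have h01 : 0 <= (0 : R) <= 1 by rewrite lexx ler01.
have M0 : 0 <= M.
  have [|h1 h2] := andP (gM (profile_point (R0 ^+ 2) 0) _); last exact: le_trans h1 h2.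
  by apply: profile_point_closure => //; rewrite lexx.
(* When [|k/m - t| >= eta], the quadratic term is at least [M], the largest possible oscillation of
   [g]. *)
pose K := M / eta ^+ 2.
have K0 : 0 <= K by rewrite divr_ge0 ?sqr_ge0.
have [m m0 hm] : exists2 m, (0 < m)%N & K / m%:R <= e / 2.
  exists (Num.truncn (K / (e / 2))).+1 => //.
  rewrite ler_pdivrMr ?ltr0n // mulrC -ler_pdivrMr //; apply: ltW.
  by have := truncnS_gt (K / (e / 2)).
have mr : 0 < m%:R :> R by rewrite ltr0n.
(* The truncation at [m] keeps all nodes in [[0, 1]], since continuity of the samples is asked for
   every index. *)
pose tt k : R := (minn k m)%:R / m%:R.
have tt01 k : 0 <= tt k <= 1.
  by rewrite divr_ge0 //= ler_pdivrMr // mul1r ler_nat geq_minr.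
pose s q k : R := g (profile_point (clamp q) (tt k)).
have As q k : closure A (profile_point (clamp q) (tt k)) by exact: profile_point_closure.
(* Powers of [t = z / q] are rewritten as powers of [z]; the inverse powers of [q] go into the
   coefficients. *)
pose hc j q := bern_coef m (s q) j * (clamp q)^-1 ^+ j.
have cp q : 0 < clamp q.
  by case/andP: (clamp_range q) => h _; apply: lt_le_trans h; rewrite exprn_gt0.
have [|J hJ] := @jsolves_exists R n R0 R1 hR0 hR01 m.+1 hc.
  move=> j q q0.
  have c1 : {for q, continuous (fun q => bern_coef m (s q) j)}.
    have cs k : continuous (fun q => s q k) by exact: profile_continuous.
    have := @bern_coef_continuous R m (fun k q => s q k) j cs q; exact.
  have c2 : {for q, continuous (fun q => (clamp q)^-1)}.
    by apply: continuousV; [rewrite gt_eqF|exact: clamp_continuous].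
  have c3 : {for q, continuous (fun q => (clamp q)^-1 ^+ j)}.
    elim: j {c1} => [|j IH]; first exact: cst_continuous.
    have -> : (fun q => (clamp q)^-1 ^+ j.+1) = (fun q => (clamp q)^-1 * (clamp q)^-1 ^+ j).
      by apply/funext => r; rewrite exprS.
    exact: (continuousM c2 IH).
  exact: (continuousM c1 c3).
have hE q z : R0 ^+ 2 <= q <= R1 ^+ 2 -> rpoly m.+1 hc q z = bern m (s q) (z / q).
  move=> hq; rewrite bernE /rpoly; apply: eq_bigr => j _.
  by rewrite /hc clamp_id // -mulrA -exprMn (mulrC z).
exists J, (rpoly m.+1 hc); split => //.
- move=> x Ax; have /(closure_annulusE hR0 hR01) hq := Ax.
  have q0 : 0 < dotp x x by case/andP: hq => h _; apply: lt_le_trans h; rewrite exprn_gt0.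
  rewrite /of_jet hE // (symdec_profile sg Ax).
  set t := height2 x / dotp x x.
  have t01 : 0 <= t <= 1.
    by rewrite divr_ge0 ?sqr_ge0 ?(ltW q0) //= ler_pdivrMr // mul1r; case/andP: (height2_dotp x).
  apply: (le_trans (@bern_approx R m _ t _ (e / 2) K m0 t01 K0 _)); last by lra.
  move=> k km; rewrite /s clamp_id // /tt (minn_idPl km).
  have tk : 0 <= (k%:R / m%:R : R) <= 1 by have := tt01 k; rewrite /tt (minn_idPl km).
  have A1 := profile_point_closure hR0 hR01 hn hq tk.
  have A2 := profile_point_closure hR0 hR01 hn hq t01.
  have K1 : 0 <= K * (k%:R / m%:R - t) ^+ 2 by rewrite mulr_ge0 ?sqr_ge0.
  have [hlt|hge] := ltP (enorm (profile_point (dotp x x) (k%:R / m%:R) - profile_point (dotp x x) t : E)) d.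
    by have := ltW (hd _ _ A1 A2 hlt); lra.
  have D := @profile_point_dist R n hn (dotp x x) (k%:R / m%:R) t (ltW q0) tk t01.
  have d2 : d ^+ 2 <= 2 * R1 ^+ 2 * `|k%:R / m%:R - t|.
    apply: le_trans (_ : _ <= enorm (profile_point (dotp x x) (k%:R / m%:R) - profile_point (dotp x x) t : E) ^+ 2) _.
      by rewrite ler_sqr ?nnegrE ?enorm_ge0 // ltW.
    apply: (le_trans D); rewrite ler_wpM2r //; case/andP: hq; lra.
  have h1 : eta <= `|k%:R / m%:R - t|.
    by rewrite ler_pdivrMr ?mulr_gt0 ?exprn_gt0 // mulrC.
  have h2 : eta ^+ 2 <= (k%:R / m%:R - t) ^+ 2.
    by rewrite -(real_normK (num_real (k%:R / m%:R - t))) ler_sqr ?nnegrE //; exact: ltW.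
  have h3 : M <= K * (k%:R / m%:R - t) ^+ 2.
    rewrite /K mulrAC ler_pdivlMr ?exprn_gt0 //; exact: ler_wpM2l.
  have /andP[g1 g2] := gM _ A1; have /andP[g3 g4] := gM _ A2.
  by rewrite ler_norml; apply/andP; split; lra.
- move=> q z z' hq z0 zz' z'q; rewrite !hE //.
  have q0 : 0 < q by case/andP: hq => h _; apply: lt_le_trans h; rewrite exprn_gt0.
  apply: bern_decr.
  + by rewrite divr_ge0 // ltW.
  + by rewrite ler_wpM2r // invr_ge0 ltW.
  + by rewrite ler_pdivrMr // mul1r.
  + move=> k km; rewrite /s clamp_id //.
    have t1 := tt01 k; have t2 := tt01 k.+1.
    apply: sg; try exact: profile_point_closure.
      by rewrite !dotp_profile_point ?(ltW q0).
    rewrite !height2_profile_point ?(ltW q0) // ler_wpM2l ?(ltW q0) //.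
    rewrite /tt ler_wpM2r ?invr_ge0 ?(ltW mr) // ler_nat.
    by rewrite (minn_idPl km) (minn_idPl (ltnW km)).
- move=> q z hq /andP[z0 zq]; rewrite hE //.
  have q0 : 0 < q by case/andP: hq => h _; apply: lt_le_trans h; rewrite exprn_gt0.
  have zq1 : 0 <= z / q <= 1 by rewrite divr_ge0 ?(ltW q0) //= ler_pdivrMr // mul1r.
  have [b0 bM] := (bern_cst m 0 (z / q), bern_cst m M (z / q)).
  by apply/andP; split; [rewrite -[leLHS]b0|rewrite -[leRHS]bM]; apply: bern_le => // k km;
    have /andP[] := gM _ (As q k).
Qed.

End approximation.

(** * The weak formulation *)

Section line_integrals.
Context {R : realType}.
Implicit Types (g G : R -> R) (a b c t : R).
Local Notation mu := (@lebesgue_measure R).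

Lemma within_continuous_compS (T U : topologicalType) (S : set T) (B : set U)
    (f : T -> U) (F : U -> R) : continuous f -> (forall s, S s -> B (f s)) ->
  {within B, continuous F} -> {within S, continuous (fun s => F (f s))}.
Proof.
move=> cf fB /subspace_continuousP cF; apply/subspace_continuousP => s St.
have := cF _ (fB _ St); apply: cvg_trans => P hP /=.
have h : nbhs s (f @^-1` (fun u => B u -> P (F u))) := cf s _ hP.
by apply: (@filterS T (nbhs s) _ _ _ _ h) => s' h' Ss; apply: h'; exact: fB.
Qed.

Lemma integral_derivative_itv g G a b : {within `[a, b], continuous g} ->
  {within `[a, b], continuous G} -> (forall t, a < t < b -> is_derive t 1 G (g t)) ->
  G a = 0 -> G b = 0 -> (\int[mu]_(t in `]a, b[) (g t)%:E = 0)%E.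
Proof.
move=> cg cG dG Ga Gb; have [ab|ba] := ltP a b; last first.
  by rewrite set_itv_ge ?integral_set0 // bnd_simp -leNgt.
have mg : measurable_fun `]a, b[%classic (EFin \o g).
  apply/measurable_EFinP; apply: (measurable_funS (measurable_itv `[a, b])).
    exact: subset_itv_oo_cc.
  by apply: subspace_continuous_measurable_fun; [exact: measurable_itv|].
rewrite -(@integral_itv_bndoo R a b (EFin \o g) true false) //.
rewrite (@continuous_FTC2 R g G a b ab cg).
- by rewrite Ga Gb subee.
- have /(continuous_within_itvP _ ab)[_ h1 h2] := cG; split => // t.
  by rewrite in_itv /= => /dG h; exact: ex_derive.
- by move=> t; rewrite in_itv /= => /dG h; rewrite derive1E; exact: derive_val.
Qed.

Lemma integral_patch_two_itv g a b : 0 <= a -> measurable_fun `]- b, - a[%classic g ->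
  measurable_fun `]a, b[%classic g ->
  (\int[mu]_(t in `](- b)%R, (- a)%R[ `|` `]a, b[) (g t)%:E =
   \int[mu]_(t in `](- b)%R, (- a)%R[) (g t)%:E + \int[mu]_(t in `]a, b[) (g t)%:E)%E.
Proof.
move=> a0 m1 m2; rewrite integral_setU //.
  by apply/measurable_EFinP/measurable_funU.
apply/disj_setPLR => t /=; rewrite !in_itv /= => /andP[_ h1] /andP[h2 _]; lra.
Qed.

End line_integrals.

Section divergence.
Context {R : realType} {n : nat} (R0 R1 : R).
Hypotheses (hR0 : 0 < R0) (hR01 : R0 < R1).
Local Notation E := 'rV[R]_n.+1.
Local Notation A := (@annulus R n R0 R1).
Local Notation J := (integral_rV A).
Local Notation mu := (@lebesgue_measure R).
Implicit Types (x v : E) (y : 'rV[R]_n) (F f : E -> R) (t c : R).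

Lemma row_insertE (i : 'I_n.+1) t y : row_insert i t y = row_insert i 0 y + t *: delta_mx 0 i.
Proof.
apply/rowP => j; rewrite !mxE eqxx /=; case: unliftP => [k|] ->.
  by rewrite eq_sym (negbTE (neq_lift _ _)) mulr0 addr0.
by rewrite eqxx mulr1 add0r.
Qed.

Lemma dotp_row_insert (i : 'I_n.+1) t y :
  dotp (row_insert i t y) (row_insert i t y) = t ^+ 2 + dotp y y.
Proof.
rewrite /dotp (bigD1_ord i) //= !mxE unlift_none -expr2; congr (_ + _).
by apply: eq_bigr => j _; rewrite !mxE liftK.
Qed.

Lemma row_insert_continuous (i : 'I_n.+1) y : continuous (fun t : R => row_insert i t y).
Proof.
under eq_fun do rewrite row_insertE.
move=> t; apply: cvgD; first exact: cvg_cst.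
by apply: cvgZr_tmp; exact: cvg_id.
Qed.

Lemma annulusE x : A x <-> R0 ^+ 2 < dotp x x < R1 ^+ 2.
Proof.
split; first exact: annulus_dotp.
have R1p := lt_trans hR0 hR01.
rewrite /annulus /= -sqr_enorm.
by rewrite !ltr_sqr ?nnegrE ?enorm_ge0 ?(ltW hR0) ?(ltW R1p).
Qed.

Lemma is_derive_line x v F t d : is_derive (0 : R) 1 (fun s => F (x + t *: v + s *: v)) d ->
  is_derive t 1 (fun s => F (x + s *: v)) d.
Proof.
move=> h.
have h1 : is_derive t 1 (fun s : R => s - t) 1.
  by apply: is_derive_eq; rewrite subr0.
have E1 : t - t = 0 :> R by rewrite subrr.
rewrite -E1 in h.
have := @is_derive1_comp R (fun s => F (x + t *: v + s *: v)) (fun s : R => s - t) t d 1 h h1.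
rewrite mulr1 => h2.
have -> : (fun s => F (x + s *: v)) = (fun s => F (x + t *: v + s *: v)) \o (fun s : R => s - t).
  by apply/funext => s /=; rewrite -addrA -scalerDl [t + _]addrC subrK.
exact: h2.
Qed.

(** The divergence theorem one coordinate at a time: a line parallel to the axis meets the annulus
    in at most two open intervals, at whose ends [F] vanishes, so the fundamental theorem of
    calculus gives 0 on each line. *)
Lemma integral_partial_derivative (i : 'I_n.+1) F f :
  {within closure A, continuous F} -> {within closure A, continuous f} ->
  vanishes_on_boundary R0 R1 F ->
  (forall x, A x -> is_derive (0 : R) 1 (fun t => F (x + t *: delta_mx 0 i)) (f x)) ->
  J f = 0.
Proof.
move=> cF cf /(vanishes_on_boundaryP hR0 hR01) F0 dF.
have R1p := lt_trans hR0 hR01.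
apply: (integral_annulus_lines (i := i) (within_bcont hR0 hR01 cf)) => y.
pose c := dotp y y; have c0 : 0 <= c by exact: dotp_ge0.
pose g t := f (row_insert i t y); pose G t := F (row_insert i t y).
have piece a b : (forall t, a <= t <= b -> R0 ^+ 2 <= t ^+ 2 + c <= R1 ^+ 2) ->
    (forall t, a < t < b -> R0 ^+ 2 < t ^+ 2 + c < R1 ^+ 2) ->
    (a ^+ 2 + c = R0 ^+ 2 \/ a ^+ 2 + c = R1 ^+ 2) ->
    (b ^+ 2 + c = R0 ^+ 2 \/ b ^+ 2 + c = R1 ^+ 2) ->
    measurable_fun `]a, b[%classic g /\ (\int[mu]_(t in `]a, b[) (g t)%:E = 0)%E.
  move=> hc ho ha hb.
  have cA t : `[a, b]%classic t -> closure A (row_insert i t y).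
    by rewrite /= in_itv /= => /hc h; apply/closure_annulusE => //; rewrite dotp_row_insert.
  have cg : {within `[a, b], continuous g}.
    exact: (within_continuous_compS (@row_insert_continuous i y) cA cf).
  have cG : {within `[a, b], continuous G}.
    exact: (within_continuous_compS (@row_insert_continuous i y) cA cF).
  have bd t : t ^+ 2 + c = R0 ^+ 2 \/ t ^+ 2 + c = R1 ^+ 2 -> G t = 0.
    have r t' : 0 < t' -> t ^+ 2 + c = t' ^+ 2 -> enorm (row_insert i t y) = t'.
      by move=> t'0 h; rewrite /enorm dotp_row_insert h sqrtr_sqr gtr0_norm.
    by move=> [] /r h; apply: F0; [left|right]; apply: h.
  split.
    apply: (measurable_funS (measurable_itv `[a, b])); first exact: subset_itv_oo_cc.
    by apply: subspace_continuous_measurable_fun; [exact: measurable_itv|].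
  apply: (integral_derivative_itv cg cG) => [t ht||]; try exact: bd.
  have Ax : A (row_insert i t y) by apply/annulusE; rewrite dotp_row_insert; exact: ho.
  have := dF _ Ax; rewrite /G /g; under [X in _ -> is_derive _ _ X _]eq_fun do rewrite row_insertE.
  by rewrite row_insertE; exact: is_derive_line.
have reduce (S : set R) : (forall t, S t <-> R0 ^+ 2 < t ^+ 2 + c < R1 ^+ 2) -> measurable S ->
    (\int[mu]_t ((f \_ A) (row_insert i t y))%:E = \int[mu]_(t in S) (g t)%:E)%E.
  move=> hS mS; rewrite [RHS]integral_mkcond; apply: eq_integral => t _.
  rewrite /patch /g; have -> : (row_insert i t y \in A) = (t \in S).
    have aE : A (row_insert i t y) <-> R0 ^+ 2 < t ^+ 2 + c < R1 ^+ 2.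
      by rewrite -(dotp_row_insert i); exact: annulusE.
    apply/idP/idP; rewrite !inE; first by move=> /aE/hS.
    by move=> /hS/aE.
  by case: ifP.
have [cR1|cR1] := leP (R1 ^+ 2) c.
  rewrite (reduce set0) ?integral_set0 // => t; split => // /andP[_ h].
  by have := sqr_ge0 t; lra.
pose be := Num.sqrt (R1 ^+ 2 - c).
have be2 : be ^+ 2 + c = R1 ^+ 2 by rewrite sqr_sqrtr; lra.
have be0 : 0 < be by rewrite sqrtr_gt0; lra.
(* A line at distance more than [R0] from the origin misses the hole and gives one interval;
   otherwise there are two, which share the excluded endpoint 0 when the line is tangent to the
   inner sphere. *)
have [cR0|cR0] := ltP (R0 ^+ 2) c.
  rewrite (reduce `]- be, be[%classic) //; last first.
    move=> t; rewrite /= in_itv /= -ltr_norml.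
    have -> : (`|t| < be) = (t ^+ 2 < be ^+ 2).
      by rewrite -[in RHS](real_normK (num_real t)) ltr_sqr ?nnegrE // ltW.
    by have := sqr_ge0 t; split=> [h|/andP[_ h]]; [apply/andP; split|]; lra.
  have [||||_ ->//] := piece (- be) be.
  - move=> t; rewrite -ler_norml => h; have : t ^+ 2 <= be ^+ 2.
      by rewrite -(real_normK (num_real t)) ler_sqr ?nnegrE // ltW.
    by have := sqr_ge0 t => h1 h2; apply/andP; split; lra.
  - move=> t; rewrite -ltr_norml => h; have : t ^+ 2 < be ^+ 2.
      by rewrite -(real_normK (num_real t)) ltr_sqr ?nnegrE // ltW.
    by have := sqr_ge0 t => h1 h2; apply/andP; split; lra.
  - by right; rewrite sqrrN.
  - by right.
pose al := Num.sqrt (R0 ^+ 2 - c).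
have al2 : al ^+ 2 + c = R0 ^+ 2 by rewrite sqr_sqrtr; lra.
have al0 : 0 <= al by exact: sqrtr_ge0.
have sqle (s t : R) : 0 <= s -> s <= t -> s ^+ 2 <= t ^+ 2 by nra.
have sqlt (s t : R) : 0 <= s -> s < t -> s ^+ 2 < t ^+ 2 by nra.
have [||||m2 i2] := piece al be; [| |by left|by right|].
- move=> t /andP[h1 h2]; have := sqle _ _ al0 h1; have := sqle t be (le_trans al0 h1) h2.
  by move=> ? ?; apply/andP; split; lra.
- move=> t /andP[h1 h2]; have := sqlt _ _ al0 h1; have := sqlt t be (le_trans al0 (ltW h1)) h2.
  by move=> ? ?; apply/andP; split; lra.
have [||||m1 i1] := piece (- be) (- al); [| |by right; rewrite sqrrN|by left; rewrite sqrrN|].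
- move=> t /andP[h1 h2]; have h3 : al <= - t by lra. have h4 : - t <= be by lra.
  have := sqle _ _ al0 h3; have := sqle (- t) be (le_trans al0 h3) h4; rewrite sqrrN.
  by move=> ? ?; apply/andP; split; lra.
- move=> t /andP[h1 h2]; have h3 : al < - t by lra. have h4 : - t < be by lra.
  have := sqlt _ _ al0 h3; have := sqlt (- t) be (le_trans al0 (ltW h3)) h4; rewrite sqrrN.
  by move=> ? ?; apply/andP; split; lra.
rewrite (reduce (`]- be, - al[ `|` `]al, be[)%classic); last exact: measurableU.
  by rewrite integral_patch_two_itv // i1 i2 adde0.
move=> t; rewrite /= !in_itv /=; split.
  move=> [] /andP[h1 h2].
    have h3 : al < - t by lra. have h4 : - t < be by lra.
    have := sqlt _ _ al0 h3; have := sqlt (- t) be (le_trans al0 (ltW h3)) h4; rewrite sqrrN.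
    by move=> ? ?; apply/andP; split; lra.
  have := sqlt _ _ al0 h1; have := sqlt t be (le_trans al0 (ltW h1)) h2.
  by move=> ? ?; apply/andP; split; lra.
move=> /andP[h1 h2]; have [t0|t0] := leP 0 t; [right|left]; apply/andP; split.
- by rewrite ltNge; apply/negP => h; have := sqle _ _ t0 h; lra.
- by rewrite ltNge; apply/negP => h; have := sqle _ _ (ltW be0) h; lra.
- rewrite ltNge; apply/negP => h; have h' : be <= - t by lra.
  by have := sqle _ _ (ltW be0) h'; rewrite sqrrN; lra.
- rewrite ltNge; apply/negP => h; have h' : - t <= al by lra. have h'' : 0 <= - t by lra.
  by have := sqle _ _ h'' h'; rewrite sqrrN; lra.
Qed.

End divergence.

(** * Integration by parts for jets *)

Section weak_formulation.
Context {R : realType} {n : nat} (R0 R1 : R).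
Hypotheses (hR0 : 0 < R0) (hR01 : R0 < R1).
Local Notation E := 'rV[R]_n.+1.
Local Notation N := (n.+1%:R : R).
Local Notation A := (@annulus R n R0 R1).
Local Notation J := (integral_rV A).
Local Notation c := (R0 ^+ 2 / 2).
Implicit Types (x v : E) (B : jet R) (f : E -> R) (t : R).

Definition jgrad B x : E := (2 * of_jet (jq B) x) *: x +
  (2 * of_jet (jz B) x * x 0 ord_max) *: delta_mx 0 ord_max.

Lemma dotp_jgrad B x v : dotp (jgrad B x) v = jet_line B x v 0.
Proof.
rewrite /jgrad dotpDl !dotpZl (dotpC (delta_mx _ _)) dotp_delta /jet_line /jpath1 /jpath /quad.
by rewrite !(mulr0, mul0r, expr0n, addr0) /= /of_jet; ring.
Qed.

Lemma jet_line_shift B x v s t : jet_line B (x + s *: v) v t = jet_line B x v (s + t).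
Proof.
rewrite /jet_line /jpath1 /jpath dotp_line height2_line.
have -> : dotp (x + s *: v) v = dotp x v + s * dotp v v by rewrite dotpDl dotpZl.
have -> : (x + s *: v) 0 ord_max = x 0 ord_max + s * v 0 ord_max by rewrite !mxE.
rewrite /height2; generalize (dotp x x) (dotp x v) (dotp v v) => a b d.
have -> : quad (quad a (2 * b) d s) (2 * (b + s * d)) d t = quad a (2 * b) d (s + t).
  by rewrite /quad; ring.
have -> : quad (quad (x 0 ord_max ^+ 2) (2 * x 0 ord_max * v 0 ord_max) (v 0 ord_max ^+ 2) s)
   (2 * (x 0 ord_max + s * v 0 ord_max) * v 0 ord_max) (v 0 ord_max ^+ 2) t =
   quad (x 0 ord_max ^+ 2) (2 * x 0 ord_max * v 0 ord_max) (v 0 ord_max ^+ 2) (s + t).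
  by rewrite /quad; ring.
ring.
Qed.

Lemma jet_is_derive B x v : jsmooth c B -> c < dotp x x ->
  is_derive (0 : R) 1 (fun t => of_jet (jf B) (x + t *: v)) (dotp (jgrad B x) v).
Proof.
move=> sB hx; rewrite dotp_jgrad; apply: (jet_line_derive sB).
by rewrite scale0r addr0.
Qed.

Lemma jgrad_is_derive B x i : jsmooth c B -> c < dotp x x ->
  is_derive (0 : R) 1 (fun t => jgrad B (x + t *: delta_mx 0 i) 0 i)
    (jet_line2 B x (delta_mx 0 i)).
Proof.
move=> sB hx; have := jet_line_derive2 (delta_mx 0 i) sB hx; congr (is_derive _ _ _ _).
by apply/funext => t; rewrite -dotp_delta dotp_jgrad jet_line_shift addr0.
Qed.

Lemma closure_dotp_gt x : closure A x -> c < dotp x x.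
Proof.
move=> /(closure_annulus_dotp hR0 hR01)/andP[h _]; apply: lt_le_trans h.
have : 0 < R0 ^+ 2 by rewrite exprn_gt0. lra.
Qed.

Lemma of_jet_within F : jcont c F -> {within closure A, continuous (of_jet F : E -> R)}.
Proof.
move=> cF; apply: continuous_in_subspaceT => x /set_mem Ax.
exact: (of_jet_continuous cF (closure_dotp_gt Ax)).
Qed.

Lemma coord_within i : {within closure A, continuous (fun x : E => x 0 i)}.
Proof. by apply: continuous_within => x; exact: coord_continuous. Qed.

Lemma jgrad_coord_within B i : jsmooth c B ->
  {within closure A, continuous (fun x => jgrad B x 0 i)}.
Proof.
move=> [_ _ _ cq cz _ _ _].
apply: (@eq_within_cont _ _ _ (fun x => 2 * of_jet (jq B) x * x 0 i +
   2 * of_jet (jz B) x * x 0 ord_max * (delta_mx 0 ord_max : E) 0 i)).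
  by move=> x _; rewrite /jgrad !mxE.
apply: within_contD; apply: within_contM; do ?[exact: within_cont_cst|exact: coord_within].
  apply: within_contM; [exact: within_cont_cst|exact: of_jet_within].
apply: within_contM; last exact: coord_within.
apply: within_contM; [exact: within_cont_cst|exact: of_jet_within].
Qed.

Lemma jet_line2_within B v : jsmooth c B ->
  {within closure A, continuous (fun x => jet_line2 B x v)}.
Proof.
move=> [_ _ _ cq cz cqq cqz czz].
have dw : {within closure A, continuous (fun x : E => dotp x v)}.
  by rewrite /dotp; apply: within_cont_sum => i; apply: within_contM;
    [exact: coord_within|exact: within_cont_cst].
have k (a : R) : {within closure A, continuous (fun _ : E => a)} by exact: within_cont_cst.
rewrite /jet_line2 /jpath2.
have w1 := of_jet_within cq; have w2 := of_jet_within cz; have w3 := of_jet_within cqq.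
have w4 := of_jet_within cqz; have w5 := of_jet_within czz.
have w6 := @coord_within ord_max.
have w7 := within_contM (k 2) dw.
have w8 := within_contM (within_contM (k 2) w6) (k (v 0 ord_max)).
have w9 := within_contM w7 w7; have w10 := within_contM w8 w8.
apply: (eq_within_cont _ (within_contD (within_contD (within_contD (within_contD
  (within_contM w3 w9) (within_contM (within_contM (within_contM (k 2) w4) w7) w8))
  (within_contM w5 w10)) (within_contM (k (2 * dotp v v)) w1)) (within_contM (k (2 * height2 v)) w2))).
by move=> x _; rewrite /of_jet !expr2.
Qed.

Lemma integral_annulus_sum (I : Type) (r : seq I) (f : I -> E -> R) :
  (forall i, bcont R0 R1 (f i)) -> bcont R0 R1 (fun x => \sum_(i <- r) f i x) /\
    J (fun x => \sum_(i <- r) f i x) = \sum_(i <- r) J (f i).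
Proof.
move=> bf; elim: r => [|i r [IHb IHJ]].
  split; first by apply: eq_bcont (bcont_cst _ _ 0) => x _; rewrite big_nil.
  have h0 := integral_annulusZ hR0 hR01 0 (bcont_cst R0 R1 (1 : R) : bcont R0 R1 (fun _ : E => 1)).
  rewrite big_nil -[RHS](mul0r (J (fun=> 1))) -h0.
  by apply: integral_annulus_ext => x _; rewrite big_nil mul0r.
split.
  by apply: (eq_bcont _ (bcontD (bf i) IHb)) => // x _; rewrite big_cons.
rewrite big_cons -IHJ -integral_annulusD //.
by apply: integral_annulus_ext => x _; rewrite big_cons.
Qed.

Lemma grad_is_derive u x (i : 'I_n.+1) : differentiable u x ->
  is_derive (0 : R) 1 (fun t => u (x + t *: delta_mx 0 i)) (grad u x 0 i).
Proof.
move=> du; have dv : derivable u x (delta_mx 0 i) by exact: diff_derivable.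
have E : (fun h : R => h^-1 *: (u (h *: delta_mx 0 i + x) - u x)) =
   (fun h : R => h^-1 *: ((fun t => u (x + t *: delta_mx 0 i)) (h *: 1 + 0) -
      (fun t => u (x + t *: delta_mx 0 i)) 0)).
  by apply/funext => h; rewrite /= scale0r !addr0 [_ *: _ + x]addrC [h%:A]mulr1.
apply: DeriveDef; first by move: dv; rewrite /derivable /= E.
by rewrite mxE /derive /= E.
Qed.

Lemma of_jet_C10 B h : jsolves N (R0 ^+ 2) (R1 ^+ 2) B h ->
  forall x, closure A x -> of_jet h x =
    of_jet (jf B) x - \sum_i jet_line2 B x (delta_mx 0 i).
Proof.
move=> sB x Ax; rewrite jet_laplacian /of_jet (jsolves_eq sB) ?height2_dotp //.
  by ring.
exact: closure_annulus_dotp.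
Qed.

(** The integral of [d_i (v d_i w)] vanishes for each [i]; summing over [i] brings in the Laplacian,
    which the equation replaces. *)
Lemma jsolves_weak B h (v : E -> R) : jsolves N (R0 ^+ 2) (R1 ^+ 2) B h -> C10 R0 R1 v ->
  J (fun x => dotp (jgrad B x) (grad v x) + of_jet (jf B) x * v x) =
  J (fun x => of_jet h x * v x).
Proof.
move=> sB [[cv dv [G cG gG]] v0].
have sm := jsolves_smooth sB.
have Gi i : {within closure A, continuous (fun x => G x 0 i)}.
  move=> x; apply: (@continuous_comp (subspace (closure A)) E R G (fun y : E => y 0 i)).
    exact: cG.
  exact: coord_continuous.
(* [G] stands for [grad v]: the two agree inside, and only [G] is known to be continuous up to the
   boundary. *)
pose f i x := G x 0 i * jgrad B x 0 i + v x * jet_line2 B x (delta_mx 0 i).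
have cf i : {within closure A, continuous (f i)}.
  by apply: within_contD; apply: within_contM => //;
    [exact: jgrad_coord_within|exact: jet_line2_within].
have f0 i : J (f i) = 0.
  apply: (integral_partial_derivative hR0 hR01 (i := i) (F := fun x => v x * jgrad B x 0 i)) => //.
  - by apply: within_contM => //; exact: jgrad_coord_within.
  - by move=> x hx; rewrite v0 // mul0r.
  - move=> x Ax.
    have Acx : closure A x by exact: subset_closure.
    have h1 := grad_is_derive i (dv _ Ax).
    have h2 := jgrad_is_derive i sm (closure_dotp_gt Acx).
    have := is_deriveM h1 h2; rewrite scale0r addr0 => h3.
    apply: is_derive_eq; rewrite gG // /f /GRing.scale /=; ring.
have bf i := within_bcont hR0 hR01 (cf i).
have [bS] := integral_annulus_sum (index_enum 'I_n.+1) bf.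
rewrite [RHS]big1 => [S0|i _]; last exact: f0.
have bG : bcont R0 R1 (fun x => dotp (jgrad B x) (grad v x) + of_jet (jf B) x * v x).
  apply: (eq_bcont _ (f := fun x => \sum_i jgrad B x 0 i * G x 0 i + of_jet (jf B) x * v x)).
    by move=> x Ax; rewrite gG.
  apply: bcontD.
    apply: within_bcont => //; apply: within_cont_sum => i; apply: within_contM => //.
    exact: jgrad_coord_within.
  apply: within_bcont => //; apply: within_contM => //; apply: of_jet_within.
  exact: (jf_cont sm).
have -> : J (fun x => of_jet h x * v x) = J (fun x => dotp (jgrad B x) (grad v x) +
    of_jet (jf B) x * v x - \sum_i f i x).
  apply: integral_annulus_ext => x Ax; rewrite (of_jet_C10 sB) ?gG //; last exact: subset_closure.
  have -> : \sum_i f i x = dotp (jgrad B x) (G x) + v x * \sum_i jet_line2 B x (delta_mx 0 i).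
    by rewrite mulr_sumr -big_split /=; apply: eq_bigr => i _; rewrite /f [G x 0 i * _]mulrC.
  ring.
by rewrite integral_annulusB // S0 subr0.
Qed.

End weak_formulation.

(** * Positivity *)

Section ring_barrier.
Context {R : realType}.
Implicit Types (q z s t mu : R).

(* The function b(q) exp(- mu z / q): separable in the polar variables q and
   s = z / q. *)
Definition jpolar mu (b b1 b2 : R -> R) :=
  let E q z := expR (- mu * (z * q^-1)) in Jet
  (fun q z => b q * E q z)
  (fun q z => (b1 q + mu * z * q^-1 ^+ 2 * b q) * E q z)
  (fun q z => - mu * q^-1 * b q * E q z)
  (fun q z => (b2 q + 2 * mu * z * q^-1 ^+ 2 * b1 q +
     (mu ^+ 2 * z ^+ 2 * q^-1 ^+ 4 - 2 * mu * z * q^-1 ^+ 3) * b q) * E q z)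
  (fun q z => (- mu * q^-1 * b1 q + (mu * q^-1 ^+ 2 - mu ^+ 2 * z * q^-1 ^+ 3) * b q) * E q z)
  (fun q z => mu ^+ 2 * q^-1 ^+ 2 * b q * E q z).

Lemma jlap_jpolar N mu (b b1 b2 : R -> R) q s : q != 0 ->
  jlap N (jpolar mu b b1 b2) q (q * s) = expR (- mu * s) *
    (4 * q * b2 q + 2 * N * b1 q +
     b q * q^-1 * (4 * s * (1 - s) * mu ^+ 2 - 2 * mu + 2 * N * mu * s)).
Proof.
move=> q0; have -> : - mu * s = - mu * (q * s * q^-1) by field.
rewrite /jlap /jpolar /=; move: (expR _) (b q) (b1 q) (b2 q) => e x x1 x2.
by field.
Qed.

Lemma jpolar_smooth c mu (b b1 b2 : R -> R) : 0 <= c ->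
  (forall q, c < q -> is_derive q 1 b (b1 q) /\ is_derive q 1 b1 (b2 q)) ->
  (forall q, c < q -> {for q, continuous b2}) ->
  jsmooth c (jpolar mu b b1 b2).
Proof.
move=> c0 hb cb2.
have pos q : c < q -> q != 0 by move=> h; rewrite gt_eqF // (le_lt_trans c0).
have dE q1 z1 (Q Z : R -> R) t : c < Q t -> is_derive t 1 Q q1 -> is_derive t 1 Z z1 ->
    is_derive t 1 (fun t => (Q t)^-1) (- (Q t)^-1 ^+ 2 * q1) /\
    is_derive t 1 (fun t => expR (- mu * (Z t * (Q t)^-1)))
     (expR (- mu * (Z t * (Q t)^-1)) * (- mu * (z1 * (Q t)^-1 - Z t * (Q t)^-1 ^+ 2 * q1))).
  move=> ht dQ dZ; have dV : is_derive t 1 (fun t => (Q t)^-1) (- (Q t)^-1 ^+ 2 * q1).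
    have h := @is_deriveV R Q t q1 1 (pos _ ht) dQ.
    by apply: is_derive_eq; rewrite /GRing.scale /= exprVn.
  split=> //.
  have dA : is_derive t 1 (fun t => - mu * (Z t * (Q t)^-1))
      (- mu * (z1 * (Q t)^-1 - Z t * (Q t)^-1 ^+ 2 * q1)).
    by apply: is_derive_eq; rewrite /GRing.scale /=; ring.
  exact: (@is_derive1_comp R expR (fun t => - mu * (Z t * (Q t)^-1)) t _ _
    (is_derive_expR _) dA).
have db q1 (Q : R -> R) t : c < Q t -> is_derive t 1 Q q1 ->
    is_derive t 1 (fun t => b (Q t)) (b1 (Q t) * q1) /\
    is_derive t 1 (fun t => b1 (Q t)) (b2 (Q t) * q1).
  move=> ht dQ; have [h1 h2] := hb _ ht.
  by split; [exact: (is_derive1_comp h1 dQ)|exact: (is_derive1_comp h2 dQ)].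
have cpos (p : R * R) : c < p.1 -> [/\ {for p, continuous (fun p : R * R => b p.1)},
    {for p, continuous (fun p : R * R => b1 p.1)}, {for p, continuous (fun p : R * R => b2 p.1)},
    {for p, continuous (fun p : R * R => p.1^-1)} & {for p, continuous (fun p : R * R => p.2)}].
  move=> hp; have [h1 h2] := hb _ hp.
  have f1 : {for p, continuous (fun p : R * R => p.1)} by exact: cvg_fst.
  split; last exact: cvg_snd.
  - by apply: (@cvg_comp _ _ _ fst b); [exact: f1|exact: is_derive_continuous h1].
  - by apply: (@cvg_comp _ _ _ fst b1); [exact: f1|exact: is_derive_continuous h2].
  - by apply: (@cvg_comp _ _ _ fst b2); [exact: f1|exact: cb2].
  - by apply: continuousV; [exact: pos|exact: f1].
have cE (p : R * R) : c < p.1 -> {for p, continuous (fun p : R * R => expR (- mu * (p.2 * p.1^-1)))}.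
  move=> /cpos[_ _ _ h1 h2]; have k : {for p, continuous (fun _ : R * R => - mu)} by exact: cst_continuous.
  exact: (continuous_comp (continuousM k (continuousM h2 h1)) (@continuous_expR R _)).
have cc a (p : R * R) : {for p, continuous (fun _ : R * R => a : R)} by exact: cst_continuous.
split.
- move=> q0 q1 q2 z0 z1 z2 t ht; rewrite /jpath /=.
  have dQ := quad_derive q0 q1 q2 t; have dZ := quad_derive z0 z1 z2 t.
  have [_ h1] := dE _ _ _ _ _ ht dQ dZ; have [h2 _] := db _ _ _ ht dQ.
  by apply: is_derive_eq; rewrite /jpath1 /jpath /jpolar /GRing.scale /=; ring.
- move=> q0 q1 q2 z0 z1 z2 hq.
  have Q0E : quad q0 q1 q2 0 = q0 by rewrite /quad; ring.
  have Z0E : quad z0 z1 z2 0 = z0 by rewrite /quad; ring.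
  have ht : c < quad q0 q1 q2 0 by rewrite Q0E.
  have dQ := quad_derive q0 q1 q2 0; have dZ := quad_derive z0 z1 z2 0.
  have [dV h1] := dE _ _ _ _ _ ht dQ dZ; have [h2 h3] := db _ _ _ ht dQ.
  have dV2 := is_derive_pow 2 dV.
  have dL (u v : R) : is_derive (0 : R) 1 (fun t => u + 2 * v * t) (2 * v).
    by apply: is_derive_eq; rewrite /GRing.scale /=; ring.
  have L1 := dL q1 q2; have L2 := dL z1 z2.
  rewrite /jpath1 /jpath /jpolar /=.
  apply: is_derive_eq; rewrite /jpath2 /jpolar /GRing.scale /= Q0E Z0E.
  by set e := expR _; set r := q0^-1; ring.
all: move=> p hp /=; have [h1 h2 h3 h4 h5] := cpos _ hp; have hE := cE _ hp; have k a := cc a p;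
  have cX (f : R * R -> R) j : {for p, continuous f} -> {for p, continuous (fun p => f p ^+ j)} by
    move=> cf; elim: j => [|j IH]; [exact: cst_continuous|
      rewrite (_ : (fun p => f p ^+ j.+1) = (fun p => f p * f p ^+ j));
        [exact: (continuousM cf IH)|apply/funext => ?; exact: exprS]].
- exact: (continuousM h1 hE).
- exact: (continuousM (continuousD h2 (continuousM (continuousM (continuousM (k mu) h5)
    (cX _ 2%N h4)) h1)) hE).
- exact: (continuousM (continuousM (continuousM (k (- mu)) h4) h1) hE).
- exact: (continuousM (continuousD (continuousD h3 (continuousM (continuousM (continuousM
    (k (2 * mu)) h5) (cX _ 2%N h4)) h2)) (continuousM (continuousB (continuousM (continuousM
    (k (mu ^+ 2)) (cX _ 2%N h5)) (cX _ 4%N h4)) (continuousM (continuousM (k (2 * mu)) h5)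
    (cX _ 3%N h4))) h1)) hE).
- exact: (continuousM (continuousD (continuousM (continuousM (k (- mu)) h4) h2)
    (continuousM (continuousB (continuousM (k mu) (cX _ 2%N h4)) (continuousM (continuousM
    (k (mu ^+ 2)) h5) (cX _ 3%N h4))) h1)) hE).
- exact: (continuousM (continuousM (continuousM (k (mu ^+ 2)) (cX _ 2%N h4)) h1) hE).
Qed.

End ring_barrier.

Section ring_positivity.
Context {R : realType} (N Q0 Q1 : R).
Hypotheses (hN : 3 <= N) (hQ0 : 0 < Q0) (hQ01 : Q0 < Q1).
Implicit Types (J B : jet R) (h : R -> R -> R) (q z s t mu : R).

(** The maximum principle is applied to [e B - J]. As [J >= 0], this can be positive only where [B]
    is, so the differential inequality for [B] is required there only. *)
Lemma jet_subsolution J h B e : jsolves N Q0 Q1 J h -> jsmooth (Q0 / 2) B -> 0 <= e ->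
  (forall q z, Q0 <= q <= Q1 -> 0 <= z <= q -> 0 <= h q z) ->
  (forall z, 0 <= z -> jf B Q0 z <= 0 /\ jf B Q1 z <= 0) ->
  (forall q s, Q0 < q < Q1 -> 0 <= s <= 1 -> 0 < jf B q (q * s) ->
    e * (jf B q (q * s) - jlap N B q (q * s)) <= h q (q * s)) ->
  forall q z, Q0 <= q <= Q1 -> 0 <= z <= q -> e * jf B q z <= jf J q z.
Proof.
move=> sJ sB e0 h0 bB hB q z hq hz.
have N1 : 1 <= N by have := hN; lra.
have J0 r t : Q0 <= r <= Q1 -> 0 <= t <= r -> 0 <= jf J r t.
  move=> hr ht; have sN := jsolves_lin (-2) sJ sJ.
  have := @jsolves_ub R N Q0 Q1 N1 hQ0 hQ01 _ _ 0 sN (lexx _) _ r t hr ht.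
  rewrite /= => H; suff : jf J r t + -2 * jf J r t <= 0 by lra.
  by apply: H => q' z' hq' hz'; have := h0 q' z' hq' hz'; lra.
have q0 : 0 < q by case/andP: hq => ? _; apply: lt_le_trans hQ0 _.
have zE : z = q * (z / q) by rewrite mulrC mulfVK // gt_eqF.
have zq : 0 <= z / q <= 1.
  by case/andP: hz => z0 zq; rewrite divr_ge0 ?(ltW q0) //= ler_pdivrMr // mul1r.
(* The inner combination [B + (e - 1) B] is [e B]. *)
pose Z := jlin (- 1) (jlin (e - 1) B B) J.
have eZ r t : jf Z r t = e * jf B r t - jf J r t by rewrite /=; ring.
have sZ : jsmooth (Q0 / 2) Z by apply: jlin_smooth (jlin_smooth _ sB sB) (jsolves_smooth sJ).
have := @jet_max_principle _ N N1 Q0 Q1 hQ0 hQ01 Z 0 sZ _ _ q (z / q) hq zq.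
rewrite -zE eZ subr_le0; apply.
  move=> s /andP[s0 s1]; have [b1 b2] := jsolves_bd sJ (Q0 * s).
  have [_ b3] := jsolves_bd sJ (Q1 * s).
  have [h1 _] := bB (Q0 * s) (mulr_ge0 (ltW hQ0) s0).
  have [_ h2] := bB (Q1 * s) (mulr_ge0 (ltW (lt_trans hQ0 hQ01)) s0).
  by rewrite !eZ b1 b3 !subr0; split; apply: mulr_ge0_le0.
move=> r s /andP[r0 r1] /andP[s0 s1]; rewrite eZ subr_gt0 subr0.
have rI : Q0 <= r <= Q1 by rewrite !ltW.
have rp : 0 < r := lt_trans hQ0 r0.
have rs : 0 <= r * s <= r.
  by rewrite mulr_ge0 ?(ltW rp) //= -[leRHS]mulr1 ler_wpM2l ?(ltW rp).
move=> hpos; have eB : 0 < e * jf B r (r * s) by apply: le_lt_trans hpos; exact: J0.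
have Bp : 0 < jf B r (r * s).
  by rewrite ltNge; apply/negP => hle; have := mulr_ge0_le0 e0 hle; rewrite leNgt eB.
have := hB r s _ _ Bp; rewrite r0 r1 s0 s1 => /(_ isT isT).
rewrite !jlap_lin (jsolves_eq sJ) //=.
by move: (jf J _ _) (h _ _) (jlap _ _ _ _) (jf B _ _) => a b d x; nra.
Qed.

End ring_positivity.

(* With q = |x|^2, u = q - q* and s = z / q, this is the sign of (Lap B - B) e^(mu s) for
   B = (e^(- mu al u^2) - e^(- mu al c^2)) e^(- mu s), where x and y stand for the two
   exponentials in the first factor. *)
Lemma ring_barrier_sign (R : realType) (N Q0 Q1 q s u d al mu x y : R) :
  3 <= N -> 0 < Q0 -> Q0 <= q -> q <= Q1 -> 0 <= s -> s <= 1 -> `|u| <= Q1 ->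
  0 < d -> 0 < al -> 12 * N * al * Q1 = (4 * Q1)^-1 -> 1 <= mu ->
  (4 * Q1)^-1 + 2 / Q0 + 1 <= 16 * Q0 * al ^+ 2 * d ^+ 2 * mu ->
  (4 * Q1)^-1 + 2 / Q0 + 1 <= d / Q1 * mu -> 2 * Q1 <= mu ->
  0 < y -> y < x -> x <= 1 -> (`|u| < d -> 2 * y <= x) ->
  let T := x * (16 * q * (mu * al * u) ^+ 2 - 8 * q * mu * al - 4 * N * mu * al * u) +
    (x - y) * (q^-1 * (4 * s * (1 - s) * mu ^+ 2 - 2 * mu + 2 * N * mu * s) - 1) in
  - (mu * ((4 * Q1)^-1 + 2 / Q0 + 1)) <= T /\ (d <= `|u| \/ d <= s -> 0 <= T).
Proof.
move=> hN hQ0 q00 q11 s0 s1 uQ1 d0 al0 alE mu1 mu2 mu3 mu4 y0 yx x1 xy T.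
have q0 : 0 < q := lt_le_trans hQ0 q00.
have hQ1 : 0 < Q1 := lt_le_trans q0 q11.
have mup : 0 < mu := lt_le_trans ltr01 mu1.
have hN0 : 0 < N by apply: lt_le_trans hN.
have x0 := lt_trans y0 yx.
have b0 : 0 < x - y by rewrite subr_gt0.
have bx : x - y <= x by rewrite gerBl ltW.
pose W := q^-1 * (4 * s * (1 - s) * mu ^+ 2 - 2 * mu + 2 * N * mu * s) - 1.
have m0 := ltW mup; have n0 := ltW hN0; have a0 := ltW al0.
pose m1 := mu * (4 * Q1)^-1; pose m2 := 2 * (mu * Q0^-1).
have m10 : 0 <= m1 by rewrite /m1 mulr_ge0 // invr_ge0 mulr_ge0 // ltW.
have m20 : 0 <= m2 by rewrite /m2 mulr_ge0 // mulr_ge0 // invr_ge0 ltW.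
have LE : mu * ((4 * Q1)^-1 + 2 / Q0 + 1) = m1 + m2 + mu by rewrite /m1 /m2; ring.
have r0 : Q1^-1 <= q^-1 by rewrite lef_pV2 ?posrE.
have r1 : q^-1 <= Q0^-1 by rewrite lef_pV2 ?posrE.
have rp : 0 < q^-1 by rewrite invr_gt0.
have hP : 8 * q * mu * al + 4 * N * mu * al * u <= m1.
  have uQ : u <= Q1 by apply: le_trans (ler_norm _) _.
  have k1 : N * al * u <= N * al * Q1 by rewrite ler_wpM2l // mulr_ge0.
  have k2 : al * q <= N * al * Q1.
    apply: le_trans (_ : al * Q1 <= _); first by rewrite ler_wpM2l.
    rewrite -mulrA ler_peMl //; first by rewrite mulr_ge0 // ltW.
    by apply: le_trans hN; lra.
  have -> : 8 * q * mu * al + 4 * N * mu * al * u = mu * (8 * (al * q) + 4 * (N * al * u)) by ring.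
  by rewrite /m1 -alE ler_wpM2l //; move: k1 k2; clear; move: (N * al * u) => *; lra.
have ss : 0 <= 4 * s * (1 - s) * mu ^+ 2.
  by apply: mulr_ge0 (sqr_ge0 _); rewrite mulr_ge0 ?mulr_ge0 // subr_ge0.
have ns : 0 <= 2 * N * mu * s by rewrite mulr_ge0 // mulr_ge0 // mulr_ge0.
have mq : 2 * (mu * q^-1) <= m2 by rewrite /m2 ler_wpM2l // ler_wpM2l.
have WE : W = q^-1 * (4 * s * (1 - s) * mu ^+ 2) + q^-1 * (2 * N * mu * s) - 2 * (mu * q^-1) - 1.
  by rewrite /W; ring.
have w1 : 0 <= q^-1 * (4 * s * (1 - s) * mu ^+ 2) by rewrite mulr_ge0 // ltW.
have w2 : 0 <= q^-1 * (2 * N * mu * s) by rewrite mulr_ge0 // ltW.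
have hW : - (m2 + 1) <= W.
  by rewrite WE; move: w1 w2 mq; clear; move: (q^-1 * _) (q^-1 * _) (mu * q^-1) => *; lra.
have T1 : x * (16 * q * (mu * al * u) ^+ 2 - m1) + (x - y) * W <= T.
  by rewrite /T -/W lerD2r ler_pM2l //; move: hP; clear; move: (8 * q * mu * al) => *; lra.
have u2 : 0 <= 16 * q * (mu * al * u) ^+ 2 by apply: mulr_ge0 (sqr_ge0 _); rewrite mulr_ge0 // ltW.
have bW : - (x * (m2 + 1)) <= (x - y) * W.
  have [W0|W0] := leP 0 W.
    apply: le_trans (_ : 0 <= _); last by rewrite mulr_ge0 // ltW.
    by rewrite oppr_le0 mulr_ge0 ?(ltW x0) // addr_ge0.
  have k1 : x * W <= (x - y) * W by rewrite ler_wnM2r ?(ltW W0).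
  apply: le_trans k1; by rewrite -mulrN ler_pM2l.
have xm : x <= x * mu by rewrite ler_peMr // ltW.
have k0 : x * (- m1) <= x * (16 * q * (mu * al * u) ^+ 2 - m1).
  by rewrite ler_pM2l // lerDr.
split.
  apply: le_trans T1; rewrite LE.
  have k1 : x * (m1 + m2 + mu) <= m1 + m2 + mu.
    by rewrite ler_piMl // addr_ge0 // addr_ge0.
  by move: k0 k1 bW xm; clear; move: (x * (16 * q * _ - m1)) ((x - y) * W) => *; lra.
have m1E : mu * (2 * Q1)^-1 = 2 * m1 by rewrite /m1; field; rewrite gt_eqF.
(* Away from the central radius the quadratic term in [u] is of order [mu^2] and beats all the
   others, whatever the latitude. *)
have [ud _|ud] := leP d `|u|.
  apply: le_trans T1.
  have k1 : d ^+ 2 <= u ^+ 2.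
    by rewrite -(real_normK (num_real u)) ler_sqr ?nnegrE // ltW.
  have k2 : 16 * Q0 * al ^+ 2 * d ^+ 2 * mu * mu <= 16 * q * (mu * al * u) ^+ 2.
    have -> : 16 * Q0 * al ^+ 2 * d ^+ 2 * mu * mu = 16 * (mu * al) ^+ 2 * (Q0 * d ^+ 2) by ring.
    have -> : 16 * q * (mu * al * u) ^+ 2 = 16 * (mu * al) ^+ 2 * (q * u ^+ 2) by ring.
    rewrite ler_wpM2l //; first by apply: mulr_ge0 (sqr_ge0 _).
    by apply: ler_pM => //; [exact: ltW|exact: sqr_ge0].
  have k3 : m1 + m2 + mu <= 16 * Q0 * al ^+ 2 * d ^+ 2 * mu * mu.
    by rewrite -LE mulrC ler_wpM2r.
  have k4 : x * (m2 + mu) <= x * (16 * q * (mu * al * u) ^+ 2 - m1).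
    by rewrite ler_pM2l // lerBrDr addrC addrA; exact: le_trans k3 k2.
  by move: k4 bW xm; clear; move: (x * (16 * q * _ - m1)) ((x - y) * W) => *; lra.
case=> [//|sd].
suff HW : 2 * m1 <= W.
  have W0 : 0 <= W by apply: le_trans HW; rewrite mulr_ge0.
  apply: le_trans T1; have k1 : x / 2 * W <= (x - y) * W.
    by rewrite ler_wpM2r //; move: (xy ud); clear; lra.
  have k2 : x * m1 <= x / 2 * W.
    have -> : x / 2 * W = x * (W / 2) by ring.
    by rewrite ler_pM2l //; move: HW; clear; lra.
  by move: k0 k1 k2; clear; rewrite mulrN; move: (x * (16 * q * _ - m1)) ((x - y) * W) => *; lra.
rewrite WE; have [s2|s2] := leP s (1 / 2).
  have k1 : 2 * (d / Q1 * mu * mu) <= q^-1 * (4 * s * (1 - s) * mu ^+ 2).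
    have -> : 2 * (d / Q1 * mu * mu) = Q1^-1 * (2 * d * mu ^+ 2) by ring.
    apply: ler_pM => //; first by rewrite invr_ge0 ltW.
      by apply: mulr_ge0 (sqr_ge0 _); rewrite mulr_ge0 // ltW.
    rewrite ler_wpM2r ?sqr_ge0 //; move: sd s2 d0; clear; nra.
  have k2 : m1 + m2 + mu <= d / Q1 * mu * mu by rewrite -LE mulrC ler_wpM2r.
  move: k1 k2 w2 mq mu1 m20; clear; move: (q^-1 * _) (q^-1 * _) (mu * q^-1) (d / _ * _ * _) => *; lra.
(* Near the pole the factor [1 - s] is of no help. The first-order term takes over: [2 N s - 2 >= 1]
   for [s > 1/2], because [N >= 3]. *)
have k2 : 2 * (Q1^-1 * mu) <= q^-1 * (2 * N * mu * s) - 2 * (mu * q^-1) + Q1^-1 * mu.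
  have -> : q^-1 * (2 * N * mu * s) - 2 * (mu * q^-1) = q^-1 * (mu * (2 * N * s - 2)) by ring.
  rewrite mulr2n mulrDl mul1r lerD2r; apply: ler_pM => //; first by rewrite invr_ge0 ltW.
  by rewrite ler_peMr //; move: hN s2; clear; nra.
have k3 : Q1^-1 * mu = 4 * m1 by rewrite /m1; field; rewrite gt_eqF.
have k4 : 2 <= Q1^-1 * mu by rewrite mulrC ler_pdivlMr.
by move: k2 k3 k4 w1; clear; move: (q^-1 * _) (q^-1 * _) (mu * q^-1) (Q1^-1 * mu) => *; lra.
Qed.

(** [B] fails to be a subsolution only close to the central radius and to the equator, where the
    source is at least [c0]; scaling by [c0 / C], with [- C] a lower bound for the defect, lets the
    source pay for it. [B] is chosen before [J] and [h], so the bound is uniform along a sequence of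
    solutions. *)
Lemma jet_ring_barrier (R : realType) (N Q0 Q1 qs c d c0 : R) :
  3 <= N -> 0 < Q0 -> Q0 < Q1 -> Q0 <= qs - c -> qs + c <= Q1 -> 0 < d -> d <= c / 2 ->
  d <= 1 / 2 -> 0 < c0 ->
  exists2 B : R -> R -> R,
    forall q z, Q0 <= q <= Q1 -> `|q - qs| < c -> 0 < B q z &
    forall J h, jsolves N Q0 Q1 J h ->
      (forall q z, Q0 <= q <= Q1 -> 0 <= z <= q -> 0 <= h q z) ->
      (forall q s, Q0 <= q <= Q1 -> 0 <= s <= 1 -> `|q - qs| < d -> s < d -> c0 <= h q (q * s)) ->
      forall q z, Q0 <= q <= Q1 -> 0 <= z <= q -> B q z <= jf J q z.
Proof.
move=> hN hQ0 hQ01 hc0 hc1 d0 dc d12 c00.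
have hQ1 : 0 < Q1 := lt_trans hQ0 hQ01.
have cp : 0 < c by lra.
have hN0 : 0 < N by have := hN; lra.
(* Small enough for the first-order terms in [al] to be at most [mu / (4 Q1)], a fraction of the
   angular gain. *)
pose al := (48 * N * Q1 ^+ 2)^-1.
have al0 : 0 < al by rewrite invr_gt0 !mulr_gt0 ?exprn_gt0.
have alE : 12 * N * al * Q1 = (4 * Q1)^-1.
  by rewrite /al; field; rewrite !gt_eqF.
pose L1 := (4 * Q1)^-1 + 2 / Q0 + 1.
have L10 : 0 < L1 by rewrite !addr_gt0 ?divr_gt0 ?invr_gt0 ?mulr_gt0.
pose a1 := 16 * Q0 * al ^+ 2 * d ^+ 2.
have a10 : 0 < a1 by rewrite !mulr_gt0 ?exprn_gt0.
(* The witness is the sum of all the thresholds. The last condition makes the radial exponential at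
   least twice its value at distance [c] as soon as [|q - qs| < d], where [d <= c / 2]. *)
have [mu [mu1 mu2 mu3 mu4 mu5]] : exists mu, [/\ 1 <= mu, L1 <= a1 * mu,
    L1 <= d / Q1 * mu, 2 * Q1 <= mu & 1 <= 3 / 4 * al * c ^+ 2 * mu].
  have p1 : 0 < L1 / a1 by rewrite divr_gt0.
  have p2 : 0 < L1 / (d / Q1) by rewrite !divr_gt0.
  have ac : 0 < 3 / 4 * al * c ^+ 2 by rewrite !mulr_gt0 ?exprn_gt0 // invr_gt0.
  have p3 : 0 < (3 / 4 * al * c ^+ 2)^-1 by rewrite invr_gt0.
  exists (1 + L1 / a1 + L1 / (d / Q1) + 2 * Q1 + (3 / 4 * al * c ^+ 2)^-1).
  have dQ : 0 < d / Q1 by rewrite divr_gt0.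
  split; first lra.
  - by rewrite mulrC -ler_pdivrMr //; lra.
  - by rewrite mulrC -ler_pdivrMr //; lra.
  - by lra.
  - by rewrite mulrC -ler_pdivrMr // div1r; lra.
have mup : 0 < mu by lra.
pose X q := expR (- mu * al * (q - qs) ^+ 2).
pose Y := expR (- mu * al * c ^+ 2).
pose X1 q := - 2 * mu * al * (q - qs) * X q.
pose X2 q := (4 * (mu * al * (q - qs)) ^+ 2 - 2 * mu * al) * X q.
have dX (q : R) : is_derive q 1 X (X1 q) /\ is_derive q 1 X1 (X2 q).
  have dA : is_derive q 1 (fun q => - mu * al * (q - qs) ^+ 2) (- 2 * mu * al * (q - qs)).
    by apply: is_derive_eq; rewrite /GRing.scale /=; ring.
  have h := @is_derive1_comp R expR (fun q => - mu * al * (q - qs) ^+ 2) q _ _ (is_derive_expR _) dA.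
  have h1 : is_derive q 1 X (X1 q) by apply: is_derive_eq; rewrite /X1 /X; ring.
  split=> //; rewrite /X1; apply: is_derive_eq; rewrite /X2 /X1 /GRing.scale /=; ring.
pose B := jpolar mu (fun q => X q - Y) X1 X2.
have sB : jsmooth (Q0 / 2) B.
  apply: jpolar_smooth => [|q _|q _]; first by rewrite divr_ge0 // ltW.
    have [h1 h2] := dX q; split => //.
    by apply: is_derive_eq; rewrite subr0.
  have [h1 h2] := dX q; have cX := is_derive_continuous h1.
  apply: continuousM => //.
  have cs : {for q, continuous (fun q : R => mu * al * (q - qs))}.
    have h3 : is_derive (q : R) 1 (fun q : R => mu * al * (q - qs)) (mu * al).
      by apply: is_derive_eq; rewrite /GRing.scale /=; ring.
    exact: is_derive_continuous h3.
  have k (a : R) : {for q, continuous (fun _ : R => a)} by exact: cst_continuous.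
  exact: (continuousB (continuousM (k 4) (continuousM cs cs)) (k (2 * mu * al))).
have XY q : 0 < X q - Y -> `|q - qs| < c.
  rewrite subr_gt0 ltr_expR !mulNr ltrN2 ltr_pM2l ?mulr_gt0 // => h.
  rewrite -(ltr_pXn2r (n := 2)) ?nnegrE ?(ltW cp) //.
  by rewrite real_normK // num_real.
have YX q : `|q - qs| < c -> 0 < X q - Y.
  move=> h; rewrite subr_gt0 ltr_expR !mulNr ltrN2 ltr_pM2l ?mulr_gt0 //.
  rewrite -(real_normK (num_real (q - qs))) ltr_pXn2r ?nnegrE ?(ltW cp) //.
pose C := mu * L1.
have C0 : 0 < C by rewrite mulr_gt0.
exists (fun q z => c0 / C * jf B q z).
  move=> q z hq hqs; rewrite /= mulr_gt0 ?divr_gt0 // mulr_gt0 ?expR_gt0 //; exact: YX.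
move=> J h sJ h0 hh q z hq hz.
have e0 : 0 <= c0 / C by rewrite divr_ge0 // ltW.
apply: (jet_subsolution hN hQ0 hQ01 sJ sB e0 h0) => // {q z hq hz}.
  move=> z z0 /=; split.
    apply: mulr_le0_ge0 (expR_ge0 _); rewrite leNgt; apply/negP => /XY.
    by rewrite ltr_norml => /andP[]; move: hc0 hc1; clear; lra.
  apply: mulr_le0_ge0 (expR_ge0 _); rewrite leNgt; apply/negP => /XY.
  by rewrite ltr_norml => /andP[]; move: hc0 hc1; clear; lra.
move=> q s hq hs.
have q0 : 0 < q by case/andP: hq => ? _; apply: lt_trans hQ0 _.
rewrite jlap_jpolar ?gt_eqF // /jpolar /=.
have -> : - mu * (q * s / q) = - mu * s by field; rewrite gt_eqF.
set E := expR (- mu * s) => BE.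
have E0 : 0 < E by exact: expR_gt0.
have E1 : E <= 1 by rewrite -expR0 ler_expR mulNr oppr_le0 mulr_ge0 ?(ltW mup) //; case/andP: hs.
have b0 : 0 < X q - Y by move: BE; rewrite pmulr_lgt0.
have hu := XY _ b0; pose u := q - qs.
have x1 : X q <= 1.
  rewrite -expR0 ler_expR !mulNr oppr_le0.
  exact: mulr_ge0 (mulr_ge0 (ltW mup) (ltW al0)) (sqr_ge0 _).
have x0 : 0 < X q by exact: expR_gt0.
have y0 : 0 < Y by exact: expR_gt0.
have uQ1 : `|u| <= Q1.
  by apply: le_trans (ltW hu) _; move: hc0 hc1 hQ0 hQ1; clear; lra.
have xy : `|u| < d -> 2 * Y <= X q.
  move=> ud; have -> : X q = Y * expR (mu * al * (c ^+ 2 - u ^+ 2)).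
    by rewrite -expRD; congr expR; rewrite -/u; ring.
  rewrite mulrC ler_pM2l //; apply: le_trans (expR_ge1Dx _).
  have k : u ^+ 2 <= (c / 2) ^+ 2.
    rewrite -(real_normK (num_real u)) ler_sqr ?nnegrE //; first exact: le_trans (ltW ud) dc.
    by rewrite divr_ge0 // ltW.
  have k2 : mu * al * (3 / 4 * c ^+ 2) <= mu * al * (c ^+ 2 - u ^+ 2).
    rewrite ler_wpM2l ?mulr_ge0 ?(ltW mup) ?(ltW al0) //.
    by move: k; rewrite expr_div_n; clear; move: (u ^+ 2) (c ^+ 2) => *; lra.
  rewrite -[2](natrD _ 1 1) lerD2l; apply: le_trans k2; apply: le_trans mu5 _.
  by rewrite le_eqVlt; apply/orP; left; apply/eqP; ring.
case/andP: (hq) => q00 q11; case/andP: (hs) => s0 s1.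
have YXq : Y < X q by rewrite -subr_gt0.
have [Tge T0] := ring_barrier_sign hN hQ0 (ltW q00) (ltW q11) s0 s1 uQ1 d0 al0 alE mu1 mu2 mu3 mu4
  y0 YXq x1 xy.
move: Tge T0; set T := (_ + (X q - Y) * _) => Tge T0.
have -> : c0 / C * ((X q - Y) * E - E * (4 * q * X2 q + 2 * N * X1 q + (X q - Y) / q *
    (4 * s * (1 - s) * mu ^+ 2 - 2 * mu + 2 * N * mu * s))) = - (c0 / C * E * T).
  by rewrite /T /X2 /X1 -/u; ring.
have [/andP[ud sd]|out] := boolP ((`|u| < d) && (s < d)).
  apply: le_trans (hh q s _ hs ud sd); last by rewrite !ltW.
  have cE : c0 = c0 / C * C by rewrite divfK // gt_eqF.
  have -> : - (c0 / C * E * T) = c0 / C * - (E * T) by ring.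
  rewrite [leRHS]cE; apply: (ler_wpM2l e0).
  have [T1|T1] := leP 0 T.
    by apply: le_trans (ltW C0); rewrite oppr_le0 mulr_ge0 // ltW.
  apply: le_trans (_ : - T <= _); last by rewrite lerNl.
  by rewrite -mulrN ler_piMl // oppr_ge0 ltW.
apply: le_trans (h0 q (q * s) _ _); last first.
- by rewrite mulr_ge0 ?(ltW q0) //= ler_piMr // ltW.
- by rewrite !ltW.
rewrite oppr_le0; apply: mulr_ge0; first by rewrite mulr_ge0 // ltW.
by apply: T0; move: out; rewrite negb_and -!leNgt => /orP[]; [left|right].
Qed.

(** * The solution operator *)

Section uniform_limits.
Context {R : realType}.
Implicit Types (K a b : R) (k l : nat).

Lemma le_of_harmonic a b K : (forall k, a <= b + K / k.+1%:R) -> a <= b.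
Proof.
move=> h; rewrite leNgt; apply/negP => ab.
have d0 : 0 < a - b by rewrite subr_gt0.
have K0 : 0 < K by have := h 0; rewrite divr1; lra.
have := truncnS_gt (K / (a - b)); rewrite ltr_pdivrMr // mulrC.
set m := (Num.truncn _).+1 => hm.
have m0 : 0 < m%:R :> R by rewrite ltr0n.
by have := h m.-1; rewrite prednK // -lerBlDl ler_pdivlMr // leNgt hm.
Qed.

(** The limit is the supremum of [f k x - e k]: the hypothesis says that every [f l x + e l] is an
    upper bound. *)
Lemma uniform_cauchy_limit (T : Type) (S : set T) (f : nat -> T -> R) (e : nat -> R) :
  (forall k l x, S x -> f k x - f l x <= e k + e l) ->
  exists F, forall k x, S x -> `|f k x - F x| <= e k.
Proof.
move=> h; exists (fun x => sup [set f k x - e k | k in [set: nat]]) => k x Sx.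
set D := [set _ | _ in _].
have ub l : ubound D (f l x + e l) by move=> _ [k' _ <-]; have := h k' l x Sx; lra.
have Dne : D !=set0 by exists (f 0 x - e 0); exists 0.
have h1 : sup D <= f k x + e k by exact: ge_sup.
have h2 : f k x - e k <= sup D by apply: ub_le_sup; [exists (f 0 x + e 0)|exists k].
by rewrite ler_norml; apply/andP; split; lra.
Qed.

Lemma uniform_limit_within (T : topologicalType) (S : set T) (f : nat -> T -> R) F K :
  (forall k, {within S, continuous (f k)}) ->
  (forall k x, S x -> `|f k x - F x| <= K / k.+1%:R) -> {within S, continuous F}.
Proof.
move=> cf hF; apply/subspace_continuousP => x Sx; apply/cvgrPdist_le => e e0.
have [k hk] : exists k : nat, K / k.+1%:R <= e / 3.
  exists (Num.truncn (K / (e / 3))); have := truncnS_gt (K / (e / 3)).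
  by rewrite ltr_pdivrMr ?divr_gt0 // mulrC => /ltW; rewrite ler_pdivrMr ?ltr0n.
have /subspace_continuousP/(_ x Sx)/cvgrPdist_le/(_ (e / 3)) := cf k.
move=> /(_ ltac:(by rewrite divr_gt0)); rewrite !near_withinE; apply: filterS => y hy Sy.
have h1 : `|f k x - f k y| <= e / 3 := hy Sy; have := hF k x Sx; have := hF k y Sy.
move: h1; change (`|from_subspace S F x - from_subspace S F y|) with `|F x - F y|.
move: (K / _) (f k x) (f k y) (F x) (F y) hk => r a b a' b' re; clear -re.
by rewrite !ler_norml => /andP[? ?] /andP[? ?] /andP[? ?]; apply/andP; split; lra.
Qed.

End uniform_limits.

(** * Gradients, and bounds for them *)

Section gradients.
Context {R : realType} {n : nat}.
Local Notation E := 'rV[R]_n.+1.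
Implicit Types (x g v : E) (u : E -> R).

Definition dotl g := fun v : E => dotp g v.

Let dotl_linear g : linear (dotl g).
Proof. by move=> a v w; rewrite /dotl dotpDr dotpZr. Qed.

HB.instance Definition _ g := GRing.isLinear.Build R E R _ (dotl g) (dotl_linear g).

Lemma dotl_continuous g : continuous (dotl g).
Proof.
move=> x; rewrite /dotl /dotp.
apply: (@cvg_sumr R E _ (nbhs x) _ _ _ (fun i (v : E) => g 0 i * v 0 i)) => i.
by apply: cvgM; [exact: cvg_cst|exact: coord_continuous].
Qed.

(** The estimate is a first-order expansion with continuous linear part, so it identifies the full
    differential that [C1bar] demands and not only directional derivatives. *)
Lemma differentiable_of_gradient u x g :
  (forall e : R, 0 < e -> \forall v \near (0 : E),
     `|u (v + x) - u x - dotp g v| <= e * `|v|) ->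
  differentiable u x /\ (forall v, 'D_v u x = dotp g v).
Proof.
move=> h.
have lo : u \o shift x = cst (u x) + dotl g +o_ (0 : E) id.
  apply/eqaddoP => e e0; have := h e e0; apply: filterS => v.
  by rewrite /= !fctE /= opprD addrA.
have dE := diff_unique (@dotl_continuous g) lo.
have du : differentiable u x.
  by apply/diff_locallyP; split; rewrite dE //; exact: dotl_continuous.
by split=> // v; rewrite deriveE // dE.
Qed.

End gradients.

Section lipschitz_gradient.
Context {R : realType} {n : nat} (R0 R1 : R).
Hypotheses (hR0 : 0 < R0) (hR01 : R0 < R1) (hn : (0 < n)%N).
Local Notation E := 'rV[R]_n.+1.
Local Notation N := (n.+1%:R : R).
Local Notation A := (@annulus R n R0 R1).
Local Notation J := (integral_rV A).
Local Notation c := (R0 ^+ 2 / 2).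
Implicit Types (x v : E) (B : jet R) (f u : E -> R) (t L : R).

Lemma within_closure_le f L : {within closure A, continuous f} ->
  (forall x, A x -> f x <= L) -> forall x, closure A x -> f x <= L.
Proof.
move=> /subspace_continuousP cf fL x Ax; rewrite leNgt; apply/negP => Lf.
have U : \forall y \near within (closure A) (nbhs x), L < f y.
  exact: (cvgr_gt (f x) (cf x Ax) L Lf).
have [y [Ay /= h]] := Ax _ U.
by have := h (subset_closure Ay); rewrite ltNge fL.
Qed.

Lemma line_in_annulus x v : A x -> \forall t \near (0 : R), A (x + t *: v).
Proof.
move=> Ax; have c0 : (x + t *: v : E) @[t --> (0 : R)] --> (x : E).
  rewrite -[X in _ --> X]addr0 -(scale0r v); apply: cvgD; first exact: cvg_cst.
  by apply: cvgZr_tmp; exact: cvg_id.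
by apply: c0; apply: open_nbhs_nbhs; split => //; exact: open_annulus.
Qed.

Lemma is_derive_le_lipschitz f x v (d L : R) : A x ->
  is_derive (0 : R) 1 (fun t => f (x + t *: v)) d ->
  (forall y, A y -> f y - f x <= L * enorm (y - x)) -> d <= L * enorm v.
Proof.
move=> Ax df hL; rewrite -subr_le0.
have /nbhs_ballP[e /= e0 he] := line_in_annulus v Ax.
have dg : is_derive (0 : R) 1 (fun t => f (x + t *: v) - L * enorm v * t) (d - L * enorm v).
  by apply: is_derive_eq; rewrite /GRing.scale /=; ring.
apply: (deriv_le0_right_max e0 dg) => t /andP[t0 te].
have At : A (x + t *: v) by apply: he; rewrite /ball /= sub0r normrN gtr0_norm.
have := hL _ At; rewrite [x + _ - x]addrAC subrr add0r enormZ gtr0_norm // => h.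
by rewrite mulr0 subr0 scale0r addr0; move: h; move: (f _) (f _) (enorm v) => *; lra.
Qed.

Lemma jgrad_bound B L i : jsmooth c B ->
  (forall x y, A x -> A y -> of_jet (jf B) x - of_jet (jf B) y <= L * enorm (x - y)) ->
  forall x, closure A x -> jgrad B x 0 i <= L.
Proof.
move=> sB hL; apply: within_closure_le; first exact: jgrad_coord_within.
move=> x Ax; have Acx := subset_closure Ax.
have h := jet_is_derive (delta_mx 0 i) sB (closure_dotp_gt hR0 hR01 Acx).
have e1 : enorm (delta_mx 0 i : E) = 1 by rewrite /enorm dotp_delta delta_coord eqxx sqrtr1.
have := is_derive_le_lipschitz Ax h (fun y Ay => hL y x Ay Ax).
by rewrite dotp_delta e1 mulr1.
Qed.

Lemma jet_mean_value B x v : jsmooth c B ->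
  (forall t, 0 <= t <= 1 -> closure A (x + t *: v)) ->
  exists2 t, 0 <= t <= 1 &
    of_jet (jf B) (x + v) - of_jet (jf B) x = dotp (jgrad B (x + t *: v)) v.
Proof.
move=> sB hA.
have dB t : 0 <= t <= 1 -> is_derive t 1 (fun t : R => of_jet (jf B) (x + t *: v))
    (dotp (jgrad B (x + t *: v)) v).
  move=> /hA/(closure_dotp_gt hR0 hR01) ht; rewrite dotp_jgrad jet_line_shift addr0.
  exact: (jet_line_derive sB).
have [||t] := @MVT_segment R (fun t => of_jet (jf B) (x + t *: v))
  (fun t => dotp (jgrad B (x + t *: v)) v) 0 1 ler01.
- by move=> t; rewrite in_itv /= => /andP[t0 t1]; apply: dB; rewrite !ltW.
- apply: continuous_in_subspaceT => t /set_mem; rewrite /= in_itv /= => /dB h.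
  exact: is_derive_continuous h.
by rewrite in_itv /= => ht; rewrite scale1r scale0r addr0 subr0 mulr1; exists t.
Qed.

End lipschitz_gradient.

(** * Axial symmetry and the cone *)

Section axial_symmetry.
Context {R : realType} {n : nat} (R0 R1 : R).
Hypotheses (hR0 : 0 < R0) (hR01 : R0 < R1) (hn : (0 < n)%N).
Local Notation E := 'rV[R]_n.+1.
Local Notation A := (@annulus R n R0 R1).
Implicit Types (x y : E) (u g : E -> R) (r th : R).

Definition sphere_point r th : E :=
  r *: (cos th *: delta_mx 0 ord0 + sin th *: delta_mx 0 ord_max).

Lemma dotp_sphere_point r th : dotp (sphere_point r th) (sphere_point r th) = r ^+ 2.
Proof. by rewrite /sphere_point dotpZl dotpZr dotp_plane // cos2Dsin2 mulr1 expr2. Qed.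

Lemma height2_sphere_point r th : height2 (sphere_point r th) = (r * sin th) ^+ 2.
Proof. by rewrite /height2 /sphere_point mxE plane_height. Qed.

Lemma sphere_point_closure r th : R0 <= r <= R1 -> closure A (sphere_point r th).
Proof.
move=> /andP[r0 r1]; have R1p := lt_trans hR0 hR01; have rp := lt_le_trans hR0 r0.
apply/(closure_annulusE hR0 hR01); rewrite dotp_sphere_point.
by rewrite !ler_sqr ?nnegrE ?r0 ?r1 //; exact: ltW.
Qed.

Lemma symdec_eq u x y : symdec R0 R1 u -> closure A x -> closure A y ->
  dotp x x = dotp y y -> height2 x = height2 y -> u x = u y.
Proof.
by move=> su Ax Ay d h; apply/eqP; rewrite eq_le; apply/andP; split; apply: su; rewrite ?d ?h.
Qed.

Lemma height_ratio x : closure A x -> -1 <= x 0 ord_max / enorm x <= 1.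
Proof.
move=> Ax; have e0 : 0 < enorm x.
  by move: Ax; rewrite closure_annulus //= => /andP[h _]; exact: lt_le_trans h.
by rewrite -ler_norml normrM normfV (gtr0_norm e0) ler_pdivrMr // mul1r coord_le_enorm.
Qed.

Lemma symdec_axial u : symdec R0 R1 u ->
  has_axial_profile R0 R1 u (fun r th => u (sphere_point r th)).
Proof.
move=> su x Ax; have hx := height_ratio Ax.
have /andP[e0 e1] : R0 <= enorm x <= R1 by move: Ax; rewrite closure_annulus.
apply: (symdec_eq su Ax); first by apply: sphere_point_closure; rewrite e0.
  by rewrite dotp_sphere_point sqr_enorm.
rewrite height2_sphere_point asinK ?in_itv //= mulrC divfK //.
by rewrite gt_eqF // (lt_le_trans hR0).
Qed.

Lemma sphere_point_is_derive u r th : differentiable u (sphere_point r th) ->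
  derivable (fun t : R => u (sphere_point r t)) th 1.
Proof.
move=> du; apply/derivable1_diffP.
have dc (f : R -> R) (v : E) : differentiable f th -> differentiable (fun t => f t *: v) th.
  move=> df; apply: (@differentiable_comp _ _ _ _ f (fun t : R => t *: v)) => //.
apply: (@differentiable_comp _ _ _ _ (sphere_point r) u) => //.
rewrite /sphere_point; apply: differentiableZ.
apply: differentiableD; apply: dc; apply/derivable1_diffP; exact: ex_derive.
Qed.

(** The profile in the angle is read on the circle of [sphere_point], where [x_N^2 = r^2 sin^2 th]
    increases on [[0, pi/2]]; [symdec] then makes it decreasing and the sign of the derivative
    follows. *)
Lemma K_of_symdec u : C10 R0 R1 u -> (forall x, closure A x -> 0 <= u x) ->
  symdec R0 R1 u -> K R0 R1 u.
Proof.
move=> [C1u u0] up su; split => //; split => //.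
exists (fun r th => u (sphere_point r th)); split.
- exact: symdec_axial.
- move=> r th hr _; apply: (symdec_eq su); try exact: sphere_point_closure.
    by rewrite !dotp_sphere_point.
  by rewrite !height2_sphere_point sinN mulrN sqrrN.
move=> r th hr hth.
have e_r t : enorm (sphere_point r t) = r.
  rewrite /enorm dotp_sphere_point sqrtr_sqr ger0_norm //.
  by case/andP: hr => h _; exact: le_trans (ltW hR0) h.
have mono t t' : 0 <= t -> t <= t' -> t' <= pi / 2 -> u (sphere_point r t') <= u (sphere_point r t).
  move=> t0 tt t1; apply: su; try exact: sphere_point_closure.
    by rewrite !dotp_sphere_point.
  rewrite !height2_sphere_point !exprMn ler_wpM2l ?sqr_ge0 //.
  have s0 : 0 <= sin t by apply: sin_ge0_pi; rewrite t0 /=; have := pi_gt0 R; lra.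
  have s1 : sin t <= sin t'.
    have [-> //|ne] := eqVneq t t'; apply: ltW; rewrite ltr_sin ?in_itv /=; have := pi_gt0 R; try lra.
  by rewrite ler_sqr ?nnegrE // (le_trans s0).
have dU : derivable (fun t : R => u (sphere_point r t)) th 1.
  (* [C1bar] gives differentiability inside the annulus only; on the two boundary spheres the
     profile is constant because [u] vanishes. *)
  have [hb|hb] := boolP ((r == R0) || (r == R1)).
    have -> : (fun t : R => u (sphere_point r t)) = (fun=> 0).
      apply/funext => t; have /(vanishes_on_boundaryP hR0 hR01) u00 := u0.
      by apply: u00; rewrite e_r; case/orP: hb => /eqP ->; [left|right].
    exact: derivable_cst.
  apply: sphere_point_is_derive; case: C1u => _ du _; apply: du.
  rewrite /annulus /= e_r; move: hb hr; rewrite negb_or => /andP[n0 n1] /andP[r0 r1].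
  by rewrite !lt_def n0 r0 /= eq_sym n1.
split=> //; case/andP: hth => t0 t1.
have e0 : 0 < pi / 2 - th by lra.
have dv : is_derive th 1 (fun t : R => u (sphere_point r t)) (derive1 (fun t : R => u (sphere_point r t)) th).
  by rewrite derive1E; exact: derivableP.
have dw : is_derive (0 : R) 1 (fun t : R => u (sphere_point r (th + t)))
    (derive1 (fun t : R => u (sphere_point r t)) th).
  have ds : is_derive (0 : R) 1 (fun t : R => (th : R) + t) 1.
    by have := is_deriveD (is_derive_cst (th : R) (0 : R) 1) (is_derive_id (0 : R) 1); rewrite add0r.
  rewrite -[X in is_derive X](addr0 th) in dv.
  have := @is_derive1_comp R (fun t : R => u (sphere_point r t)) (fun t : R => th + t) 0 _ _ dv ds.
  by rewrite mulr1.
apply: (deriv_le0_right_max e0 dw) => t /andP[h0 h1]; rewrite addr0.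
by apply: mono; lra.
Qed.

(** Evenness replaces the angle by its absolute value; then the sign of the derivative on the open
    interval, with continuity on the closed one, gives monotonicity including the equator and the
    pole. *)
Lemma Khat_symdec u : Khat R0 R1 u -> symdec R0 R1 u.
Proof.
move=> [[cu _ _] up [U [aU eU dU]]] x y Ax Ay dxy hxy.
have rE : enorm x = enorm y by rewrite /enorm dxy.
rewrite (aU x Ax) (aU y Ay) -rE; set r := enorm x.
have hr : R0 <= r <= R1 by move: Ax; rewrite closure_annulus.
have r0 : 0 < r by case/andP: hr => h _; exact: lt_le_trans h.
have hx := height_ratio Ax; have hy := height_ratio Ay; rewrite -rE -/r in hy; rewrite -/r in hx.
have pi0 := pi_gt0 R.
have an (z : R) : -1 <= z <= 1 -> -1 <= `|z| <= 1 by rewrite -ler_norml => ->; have := normr_ge0 z; lra.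
have aN (z : R) : -1 <= z <= 1 -> asin (- z) = - asin z.
  move=> hz; have h : - (pi / 2) <= asin z <= pi / 2 by rewrite asin_geNpi2 ?asin_lepi2.
  rewrite -[in LHS](@asinK R z) ?in_itv // -sinN sinK // in_itv /=.
  by case/andP: h => h1 h2; apply/andP; split; lra.
have abs (z : R) : -1 <= z <= 1 -> U r (asin z) = U r (asin `|z|).
  move=> hz; have [z0|z0] := leP 0 z; first by rewrite ger0_norm.
  by rewrite ltr0_norm // aN // -eU // asin_geNpi2 // asin_lepi2.
rewrite (abs _ hx) (abs _ hy).
have ineq : `|x 0 ord_max / r| <= `|y 0 ord_max / r|.
  by rewrite !normrM ler_wpM2r // -ler_sqr ?nnegrE // !real_normK ?num_real.
have range (z : R) : -1 <= z <= 1 -> 0 <= asin `|z| <= pi / 2.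
  move=> /an hz; rewrite (asin_lepi2 hz) andbT leNgt; apply/negP => h.
  have h2 := asin_geNpi2 hz; have := normr_ge0 z.
  rewrite -(@asinK R `|z|) ?in_itv // leNgt -oppr_gt0 -sinN sin_gt0_pi //.
  by apply/andP; split; lra.
have /andP[x0 x1] := range _ hx; have /andP[y0 y1] := range _ hy.
have xy : asin `|x 0 ord_max / r| <= asin `|y 0 ord_max / r|.
  rewrite leNgt; apply/negP => h.
  have : sin (asin `|y 0 ord_max / r|) < sin (asin `|x 0 ord_max / r|).
    by rewrite ltr_sin // in_itv /=; apply/andP; split; lra.
  by rewrite !asinK ?in_itv ?an //= ltNge ineq.
have UE (t : R) : (`[0, pi / 2]%classic : set R) t -> u (sphere_point r t) = U r t.
  rewrite /= in_itv /= => /andP[t0 t1]; have As := @sphere_point_closure r t hr.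
  rewrite (aU _ As) /enorm dotp_sphere_point sqrtr_sqr (gtr0_norm r0).
  rewrite /sphere_point mxE plane_height // mulrC mulKf ?gt_eqF // sinK // in_itv /=.
  by apply/andP; split; lra.
have cU : {within `[0, pi / 2], continuous (U r)}.
  apply: (eq_within_cont UE).
  have cS : continuous (sphere_point r : R -> E).
    move=> t; rewrite /sphere_point; apply: cvgZl_tmp; apply: cvgD; apply: cvgZr_tmp.
      exact: continuous_cos.
    exact: continuous_sin.
  have hS (t : R) : (`[0, pi / 2]%classic : set R) t -> closure A (sphere_point r t).
    by move=> _; exact: sphere_point_closure.
  have h := @within_continuous_compS R R E (`[0, pi / 2]%classic) (closure A) (sphere_point r) u cS hS cu.
  exact: h.
apply: (ler0_derive1_le_cc _ _ cU) => [t|t|||]; rewrite ?in_itv /= ?x0 ?y0 //.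
  by move=> /(dU r t hr)[].
by move=> /(dU r t hr)[].
Qed.

End axial_symmetry.

(** * Construction of the solution operator *)

Section elliptic.
Context {R : realType} {n : nat} (R0 R1 : R).
Hypotheses (hR0 : 0 < R0) (hR01 : R0 < R1) (hn : (1 < n)%N).
Local Notation E := 'rV[R]_n.+1.
Local Notation N := (n.+1%:R : R).
Local Notation A := (@annulus R n R0 R1).
Local Notation J := (integral_rV A).
Local Notation c := (R0 ^+ 2 / 2).
Implicit Types (x y v : E) (B : jet R) (g u w : E -> R) (t L M : R).
Let hn0 : (0 < n)%N := ltnW hn.

Lemma region_point (q z : R) : R0 ^+ 2 <= q <= R1 ^+ 2 -> 0 <= z <= q ->
  exists x : E, [/\ closure A x, dotp x x = q & height2 x = z].
Proof.
move=> hq /andP[z0 zq]; have q0 : 0 < q.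
  by case/andP: hq => h _; apply: lt_le_trans h; rewrite exprn_gt0.
have ht : 0 <= z / q <= 1 by rewrite divr_ge0 ?(ltW q0) //= ler_pdivrMr // mul1r.
exists (profile_point q (z / q)); split; first exact: profile_point_closure.
  by rewrite dotp_profile_point // ltW.
by rewrite height2_profile_point ?(ltW q0) // mulrC divfK // gt_eqF.
Qed.

Lemma jgrad_jlin s B B' x i :
  jgrad (jlin s B B') x 0 i = jgrad B x 0 i + s * jgrad B' x 0 i.
Proof. by rewrite /jgrad /of_jet !mxE /=; ring. Qed.

Lemma row_subE (x y : E) i : (x - y) 0 i = x 0 i - y 0 i.
Proof. by rewrite !mxE. Qed.

Lemma dotp_bound (x y : E) (a b : R) : (forall i, `|x 0 i| <= a) -> (forall i, `|y 0 i| <= b) ->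
  `|dotp x y| <= N * a * b.
Proof.
move=> hx hy; rewrite /dotp; apply: le_trans (ler_norm_sum _ _ _) _.
apply: le_trans (_ : \sum_(i < n.+1) a * b <= _); last first.
  by rewrite sumr_const card_ord -mulrA mulr_natl.
by apply: ler_sum => i _; rewrite normrM ler_pM.
Qed.

(** The mean value theorem holds for each jet. Letting [k] tend to infinity with the increment [v]
    fixed transfers the first-order expansion to [w], with [G] as gradient. *)
Lemma jet_limit (B : nat -> jet R) (w : E -> R) (G : E -> E) L :
  (forall k, jsmooth c (B k)) ->
  (forall k x, closure A x -> `|of_jet (jf (B k)) x - w x| <= L / k.+1%:R) ->
  (forall k x i, closure A x -> `|jgrad (B k) x 0 i - G x 0 i| <= L / k.+1%:R) ->
  C1bar R0 R1 w /\ forall x, A x -> grad w x = G x.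
Proof.
move=> sB hw hG.
have cG i : {within closure A, continuous (fun x => G x 0 i)}.
  apply: (@uniform_limit_within R E (closure A) (fun k x => jgrad (B k) x 0 i) _ L) => [k|k x].
    exact: jgrad_coord_within.
  exact: hG.
have cw : {within closure A, continuous w}.
  apply: (@uniform_limit_within R E (closure A) (fun k => of_jet (jf (B k))) _ L) => // k.
  by apply: of_jet_within => //; exact: (jf_cont (sB k)).
have key x : A x -> differentiable w x /\ forall v, 'D_v w x = dotp (G x) v.
  move=> Ax; apply: differentiable_of_gradient => e e0.
  pose e1 := e / (2 * N); have N0 : 0 < N by rewrite ltr0n.
  have e10 : 0 < e1 by rewrite divr_gt0 // mulr_gt0.
  have nb : \forall v \near (0 : E), A (x + v) /\ forall i, `|G (x + v) 0 i - G x 0 i| <= e1.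
    have cx : (x + v) @[v --> (0 : E)] --> (x : E).
      rewrite -[X in _ --> X](addr0 x).
      by apply: (@cvgD _ _ _ (nbhs (0 : E)) _ (fun=> x) id x 0); [exact: cvg_cst|exact: cvg_id].
    have nA : nbhs x A by apply: open_nbhs_nbhs; split => //; exact: open_annulus.
    apply: filterI; first exact: cx.
    suff H i : \forall v \near (0 : E), `|G (x + v) 0 i - G x 0 i| <= e1.
      exact: (@filter_forall _ _ _ (nbhs (0 : E)) _ H).
    apply: (cx [set y | `|G y 0 i - G x 0 i| <= e1]).
    have [cGi _] := within_bcont hR0 hR01 (cG i).
    by have /cvgrPdist_le/(_ e1 e10) := cGi x Ax; apply: filterS => y; rewrite distrC.
  have /nbhs_ballP[r /= r0 hr] := nb.
  apply/nbhs_ballP; exists r => //= v bv.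
  have hseg t : 0 <= t <= 1 -> A (x + t *: v) /\ forall i, `|G (x + t *: v) 0 i - G x 0 i| <= e1.
    move=> /andP[t0 t1]; apply: (hr (t *: v)); move: bv; rewrite !mx_norm_ball /ball_ /= !sub0r !normrN.
    by rewrite normrZ ger0_norm //; apply: le_lt_trans; rewrite ler_piMl.
  (* The error counts two values of [w] and one gradient along the segment, each replaced by its
     k-th approximation. *)
  apply: (@le_of_harmonic R _ _ (2 * L + N * L * `|v|)) => k.
  have [t ht hmv] := @jet_mean_value R n R0 R1 hR0 hR01 (B k) x v (sB k)
    (fun t ht => subset_closure (proj1 (hseg t ht))).
  have [At hGt] := hseg t ht; have Ac := subset_closure At; have Axc := subset_closure Ax.
  have [A1 _] := hseg 1 ltac:(by rewrite ler01 lexx); rewrite scale1r in A1.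
  have h1 := hw k _ (subset_closure A1); have h2 := hw k _ Axc.
  have h3 : `|dotp (jgrad (B k) (x + t *: v) - G x) v| <= N * (e1 + L / k.+1%:R) * `|v|.
    apply: dotp_bound => i; last exact: coord_le_norm.
    have := hGt i; have := hG k _ i Ac; rewrite row_subE => a b.
    have -> : jgrad (B k) (x + t *: v) 0 i - G x 0 i = (jgrad (B k) (x + t *: v) 0 i -
      G (x + t *: v) 0 i) + (G (x + t *: v) 0 i - G x 0 i) by ring.
    by apply: le_trans (ler_normD _ _) _; rewrite addrC; exact: lerD.
  rewrite dotpDl dotpNl -hmv in h3.
  have e1E : N * e1 = e / 2 by rewrite /e1; field; rewrite gt_eqF.
  rewrite [v + x]addrC.
  have E3 : N * (e1 + L / k.+1%:R) * `|v| = e / 2 * `|v| + N * L * `|v| / k.+1%:R.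
    by rewrite -e1E; ring.
  rewrite E3 in h3.
  have -> : (2 * L + N * L * `|v|) / k.+1%:R = 2 * (L / k.+1%:R) + N * L * `|v| / k.+1%:R by ring.
  have : 0 <= e / 2 * `|v| by rewrite mulr_ge0 // ltW // divr_gt0.
  have -> : e * `|v| = 2 * (e / 2 * `|v|) by field.
  move: h1 h2 h3; move: (L / _) (N * L * _ / _) (e / 2 * _) (of_jet _ _) (of_jet _ _) (w _) (w _) (dotp _ _).
  move=> a b d f1 f2 w1 w2 D; rewrite !ler_norml => /andP[? ?] /andP[? ?] /andP[? ?] ?.
  by apply/andP; split; lra.
have gw x : A x -> grad w x = G x.
  move=> Ax; have [_ h] := key x Ax; apply/rowP => i; rewrite mxE h.
  by rewrite dotp_delta.
split=> //; split=> //; first by move=> x /key[].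
exists G => //; apply/subspace_continuousP => x Ax; apply/cvg_ballP => e e0.
have : \forall y \near within (closure A) (nbhs x), forall i, `|G x 0 i - G y 0 i| < e.
  suff H i : \forall y \near within (closure A) (nbhs x), `|G x 0 i - G y 0 i| < e.
    exact: (@filter_forall _ _ _ (within (closure A) (nbhs x)) _ H).
  by have /subspace_continuousP/(_ x Ax)/cvgrPdist_lt/(_ e e0) := cG i.
by apply: filterS => y h; split => // i j; rewrite ord1; exact: h.
Qed.

Lemma jsolves_ge0 B h : jsolves N (R0 ^+ 2) (R1 ^+ 2) B h ->
  (forall q z, R0 ^+ 2 <= q <= R1 ^+ 2 -> 0 <= z <= q -> 0 <= h q z) ->
  forall x, closure A x -> 0 <= of_jet (jf B) x.
Proof.
move=> sB h0 x /(closure_annulus_dotp hR0 hR01) hq.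
have R1p := lt_trans hR0 hR01.
have N1 : 1 <= N by rewrite ler1n.
have Q0 : 0 < R0 ^+ 2 by rewrite exprn_gt0.
have Q01 : R0 ^+ 2 < R1 ^+ 2 by rewrite ltr_sqr ?nnegrE ?ltW.
have := @jsolves_ub R N _ _ N1 Q0 Q01 _ _ 0 (jsolves_lin (-2) sB sB) (lexx _) _ _ _ hq (height2_dotp x).
rewrite /= /of_jet => H.
suff : jf B (dotp x x) (height2 x) + -2 * jf B (dotp x x) (height2 x) <= 0 by lra.
by apply: H => q z hq' hz'; have := h0 q z hq' hz'; lra.
Qed.

Lemma jsolves_symdec B h : jsolves N (R0 ^+ 2) (R1 ^+ 2) B h ->
  (forall q z z', R0 ^+ 2 <= q <= R1 ^+ 2 -> 0 <= z -> z <= z' -> z' <= q -> h q z' <= h q z) ->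
  symdec R0 R1 (of_jet (jf B) : E -> R).
Proof.
move=> sB hmono x y Ax Ay dxy hxy.
have /(closure_annulus_dotp hR0 hR01) hq := Ax.
have R1p := lt_trans hR0 hR01.
have N1 : 1 <= N by rewrite ler1n.
have Q0 : 0 < R0 ^+ 2 by rewrite exprn_gt0.
have Q01 : R0 ^+ 2 < R1 ^+ 2 by rewrite ltr_sqr ?nnegrE ?ltW.
have q0 : 0 < dotp x x by case/andP: hq => a _; exact: lt_le_trans a.
have /andP[z0 _] := height2_dotp x; have /andP[_ z1] := height2_dotp y.
rewrite /of_jet -dxy; rewrite -dxy in z1.
have E1 t : t = dotp x x * (t / dotp x x) by rewrite mulrC divfK // gt_eqF.
rewrite (E1 (height2 x)) (E1 (height2 y)).
apply: (@jet_monotone R N N1 _ _ Q0 Q01 B (fun q s => h q (q * s)) (jsolves_smooth sB)) => //.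
- by move=> s _; have [-> _] := jsolves_bd sB (R0 ^+ 2 * s); have [_ ->] := jsolves_bd sB (R1 ^+ 2 * s).
- move=> q s /andP[a b] /andP[s0 s1]; have qp := lt_trans Q0 a.
  apply: (jsolves_eq sB); first by rewrite !ltW.
  by rewrite mulr_ge0 ?(ltW qp) //= ler_piMr // ltW.
- move=> q s s' /andP[a b] s0 ss s1; have qp := lt_trans Q0 a.
  apply: hmono; first by rewrite !ltW.
  + by rewrite mulr_ge0 // ltW.
  + by rewrite ler_wpM2l // ltW.
  + by rewrite ler_piMr // ltW.
- by rewrite divr_ge0 // ltW.
- by rewrite ler_wpM2r // invr_ge0 ltW.
- by rewrite ler_pdivrMr // mul1r.
Qed.

Lemma C1bar_bcont u : C1bar R0 R1 u -> bcont R0 R1 u.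
Proof. by move=> [cu _ _]; exact: within_bcont. Qed.

Lemma C1bar_grad_bcont u i : C1bar R0 R1 u -> bcont R0 R1 (fun x => grad u x 0 i).
Proof.
move=> [_ _ [G cG gG]].
apply: (eq_bcont (f := fun x => G x 0 i)) => //; first by move=> x Ax; rewrite gG.
apply: within_bcont => // x.
apply: (@continuous_comp (subspace (closure A)) E R G (fun y : E => y 0 i)); first exact: cG.
exact: coord_continuous.
Qed.

Lemma C1bar_grad_bounded u : C1bar R0 R1 u ->
  exists2 L, 0 <= L & forall x i, A x -> `|grad u x 0 i| <= L.
Proof.
move=> [_ _ [G cG gG]].
have cN : {within closure A, continuous (fun x => `|G x|)} by move=> x; exact: cvg_norm (cG x).
have [_ [L hL]] := within_bcont hR0 hR01 cN.
exists `|L| => // x i Ax; rewrite gG //; apply: le_trans (coord_le_norm _ _) _.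
by have := hL x Ax; rewrite normr_id => h; apply: le_trans h (ler_norm _).
Qed.

Lemma bcont_sum (I : Type) (r : seq I) (f : I -> E -> R) :
  (forall i, bcont R0 R1 (f i)) -> bcont R0 R1 (fun x => \sum_(i <- r) f i x).
Proof. by move=> bf; have [] := integral_annulus_sum hR0 hR01 r bf. Qed.

Lemma grad_dot_bcont u w : C1bar R0 R1 u -> C1bar R0 R1 w ->
  bcont R0 R1 (fun x => dotp (grad u x) (grad w x)).
Proof.
by move=> cu cw; apply: bcont_sum => i; apply: bcontM; exact: C1bar_grad_bcont.
Qed.

Lemma integral_annulus_close f g L : bcont R0 R1 f -> bcont R0 R1 g ->
  (forall x, A x -> `|f x - g x| <= L) -> `|J f - J g| <= L * @annulus_volume R n R0 R1.
Proof.
move=> bf bg h; rewrite -integral_annulusB //; apply: integral_annulus_bound => //.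
exact: bcontB.
Qed.

(** On each sphere [g] is largest on the equator, so [y] may be replaced by an equatorial point of
    its sphere. Uniform continuity then compares it first with the equatorial point at the radius of
    [x] and next with a point of the orbit of [x]. *)
Lemma ring_neighborhood g y e : {within closure A, continuous g} -> symdec R0 R1 g ->
  A y -> 0 < e -> exists2 d, 0 < d & forall x, closure A x ->
    `|dotp x x - dotp y y| < d -> height2 x < d * dotp x x -> g y - e <= g x.
Proof.
move=> cg sg Ay e0.
have [d d0 hd] := unif_continuous_closure hR0 hR01 cg (divr_gt0 e0 (ltr0n _ 2 : 0 < 2)).
have R1p := lt_trans hR0 hR01.
have r2 : 0 < 2 * R1 ^+ 2 + 1 by rewrite ltr_wpDl // mulr_ge0 // exprn_ge0 // ltW.
exists (d ^+ 2 / (2 * R1 ^+ 2 + 1)); first by rewrite divr_gt0 // exprn_gt0.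
move=> x Ax hxy hz; have /(closure_annulus_dotp hR0 hR01) hq := Ax.
have Acy := subset_closure Ay; have /(closure_annulus_dotp hR0 hR01) hqy := Acy.
have p0 (q : R) : R0 ^+ 2 <= q <= R1 ^+ 2 -> 0 < q.
  by case/andP=> h _; apply: lt_le_trans h; rewrite exprn_gt0.
have qp := p0 _ hq; have qyp := p0 _ hqy.
have h0 : 0 <= (0 : R) <= 1 by rewrite lexx ler01.
have hs : 0 <= height2 x / dotp x x <= 1.
  by rewrite divr_ge0 ?sqr_ge0 ?(ltW qp) //= ler_pdivrMr // mul1r; case/andP: (height2_dotp x).
pose x0 := profile_point (dotp x x) 0 : E; pose y0 := profile_point (dotp y y) 0 : E.
pose xs := profile_point (dotp x x) (height2 x / dotp x x) : E.
have Ax0 : closure A x0 by exact: profile_point_closure.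
have Ay0 : closure A y0 by exact: profile_point_closure.
have Axs : closure A xs by exact: profile_point_closure.
have gy : g y <= g y0.
  apply: sg => //; first by rewrite dotp_profile_point // ltW.
  by rewrite height2_profile_point ?(ltW qyp) // mulr0 sqr_ge0.
have dsmall (a : R) : a < d ^+ 2 / (2 * R1 ^+ 2 + 1) -> (2 * R1 ^+ 2 + 1) * a < d ^+ 2.
  by rewrite ltr_pdivlMr // mulrC.
have lt_d (z : E) : enorm z ^+ 2 < d ^+ 2 -> enorm z < d.
  by rewrite ltr_sqr ?nnegrE ?enorm_ge0 // ltW.
have d1 : enorm (xs - x0) < d.
  apply: lt_d; apply: le_lt_trans (profile_point_dist hn0 (ltW qp) hs h0) _.
  have hsd : height2 x / dotp x x < d ^+ 2 / (2 * R1 ^+ 2 + 1) by rewrite ltr_pdivrMr.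
  apply: le_lt_trans (dsmall _ hsd).
  rewrite subr0 ger0_norm; last by case/andP: hs.
  apply: ler_wpM2r; first by case/andP: hs.
  by case/andP: hq; lra.
have d2 : enorm (x0 - y0) < d.
  apply: lt_d; rewrite sqr_enorm /x0 /y0 /profile_point -scalerBl dotpZl dotpZr.
  rewrite subr0 sqrtr1 sqrtr0 dotp_plane // expr1n expr0n addr0 mulr1 -expr2.
  apply: le_lt_trans (sqr_sqrtB_le (ltW qp) (ltW qyp)) _.
  apply: le_lt_trans (dsmall _ hxy); rewrite ler_peMl //.
  by have := sqr_ge0 R1; lra.
have := hd _ _ Axs Ax0 d1; have := hd _ _ Ax0 Ay0 d2.
rewrite (symdec_profile hR0 hR01 hn0 sg Ax) -/xs !ltr_norml => /andP[? ?] /andP[? ?]; lra.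
Qed.

Theorem elliptic_solution : exists2 C, 0 <= C & forall g M,
  {within closure A, continuous g} -> symdec R0 R1 g ->
  (forall x, closure A x -> 0 <= g x <= M) -> exists w, [/\ K R0 R1 w, symdec R0 R1 w,
    forall x y, closure A x -> closure A y -> w x - w y <= C * M * enorm (x - y),
    forall u, C10 R0 R1 u ->
      J (fun x => dotp (grad w x) (grad u x) + w x * u x) = J (fun x => g x * u x) &
    forall y x, A y -> A x -> 0 < g y ->
      `|dotp x x - dotp y y| < Num.min (dotp y y - R0 ^+ 2) (R1 ^+ 2 - dotp y y) -> 0 < w x].
Proof.
have R1p := lt_trans hR0 hR01.
have N1 : 1 <= N by rewrite ler1n.
have Q0 : 0 < R0 ^+ 2 by rewrite exprn_gt0.
have Q01 : R0 ^+ 2 < R1 ^+ 2 by rewrite ltr_sqr ?nnegrE ?ltW.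
have [C C0 hC] := @jet_lipschitz R n R0 R1 hR0 hR01.
exists C => // g M cg sg gM.
pose e k : R := k.+1%:R^-1.
have e0 k : 0 < e k by rewrite invr_gt0.
have /choice[d hd] : forall k, exists d : jet R * (R -> R -> R),
    [/\ jsolves N (R0 ^+ 2) (R1 ^+ 2) d.1 d.2,
      forall x, closure A x -> `|of_jet d.2 x - g x| <= e k,
      forall q z z', R0 ^+ 2 <= q <= R1 ^+ 2 -> 0 <= z -> z <= z' -> z' <= q -> d.2 q z' <= d.2 q z &
      forall q z, R0 ^+ 2 <= q <= R1 ^+ 2 -> 0 <= z <= q -> 0 <= d.2 q z <= M].
  move=> k; have [B [h [? ? ? ?]]] := jet_approximation hR0 hR01 hn0 cg sg gM (e0 k).
  by exists (B, h).
pose B k := (d k).1; pose h k := (d k).2.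
have sB k : jsolves N (R0 ^+ 2) (R1 ^+ 2) (B k) (h k) by have [] := hd k.
have smB k := jsolves_smooth (sB k).
have hg k x : closure A x -> `|of_jet (h k) x - g x| <= e k by have [_ + _ _] := hd k; apply.
have h0 k q z : R0 ^+ 2 <= q <= R1 ^+ 2 -> 0 <= z <= q -> 0 <= h k q z.
  by have [_ _ _ H] := hd k => hq hz; have /andP[] := H q z hq hz.
have hM k q z : R0 ^+ 2 <= q <= R1 ^+ 2 -> 0 <= z <= q -> h k q z <= M.
  by have [_ _ _ H] := hd k => hq hz; have /andP[] := H q z hq hz.
have hkl k l q z : R0 ^+ 2 <= q <= R1 ^+ 2 -> 0 <= z <= q ->
    `|h k q z + -1 * h l q z| <= e k + e l.
  move=> hq hz; have [x [Ax <- <-]] := region_point hq hz.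
  rewrite mulN1r; have -> : h k (dotp x x) (height2 x) - h l (dotp x x) (height2 x) =
    (of_jet (h k) x - g x) - (of_jet (h l) x - g x) by rewrite /of_jet; ring.
  by apply: le_trans (ler_normB _ _) _; apply: lerD; exact: hg.
have ekl k l : 0 <= e k + e l by rewrite addr_ge0 // ltW.
have skl k l := jsolves_lin (-1) (sB k) (sB l).
have wkl k l x : closure A x -> of_jet (jf (B k)) x - of_jet (jf (B l)) x <= e k + e l.
  move=> /(closure_annulus_dotp hR0 hR01) hq.
  have := @jsolves_ub R N _ _ N1 Q0 Q01 _ _ _ (skl k l) (ekl k l) _ _ _ hq (height2_dotp x).
  rewrite /= mulN1r; apply => q z hq' hz'.
  exact: le_trans (ler_norm _) (hkl k l _ _ hq' hz').
(* The difference of two approximate solutions solves the equation with source [h k - h l], so the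
   Lipschitz estimate bounds its gradient: the sequence is Cauchy in C^1. *)
have gkl i k l x : closure A x -> jgrad (B k) x 0 i - jgrad (B l) x 0 i <= C * e k + C * e l.
  move=> Ax; have -> : jgrad (B k) x 0 i - jgrad (B l) x 0 i = jgrad (jlin (-1) (B k) (B l)) x 0 i.
    by rewrite jgrad_jlin mulN1r.
  rewrite -mulrDr; move: x Ax.
  apply: (jgrad_bound hR0 hR01 i (jsolves_smooth (skl k l))) => y z Ay Az.
  apply: (hC _ _ _ (skl k l) (ekl k l)); try exact: subset_closure.
  by move=> q t hq ht; exact: hkl.
have [w hw] := uniform_cauchy_limit wkl.
have /choice[G0 hG0] : forall i, exists F, forall k x, closure A x ->
    `|jgrad (B k) x 0 i - F x| <= C * e k by move=> i; exact: uniform_cauchy_limit (gkl i).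
pose G x : E := \row_i G0 i x.
pose L := 1 + C.
have Lw k x : closure A x -> `|of_jet (jf (B k)) x - w x| <= L / k.+1%:R.
  move=> Ax; apply: le_trans (hw k x Ax) _.
  by rewrite /L mulrDl mul1r lerDl mulr_ge0 // invr_ge0.
have LG k x i : closure A x -> `|jgrad (B k) x 0 i - G x 0 i| <= L / k.+1%:R.
  move=> Ax; have -> : G x 0 i = G0 i x by rewrite [LHS]mxE.
  apply: le_trans (hG0 i k x Ax) _.
  by rewrite /L mulrDl mul1r lerDr invr_ge0.
have [C1w gw] := jet_limit smB Lw LG.
have lim_le (a b : R) D : (forall k, a <= b + D / k.+1%:R) -> a <= b by exact: le_of_harmonic.
have w0 x : closure A x -> 0 <= w x.
  move=> Ax; apply: (lim_le _ _ 1) => k; rewrite div1r.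
  have := hw k x Ax; have := jsolves_ge0 (sB k) (h0 k) Ax.
  rewrite ler_norml /e => a /andP[b b']; move: a b b'; move: (k.+1%:R^-1) => *; lra.
have bw : vanishes_on_boundary R0 R1 w.
  apply/(vanishes_on_boundaryP hR0 hR01) => x hx.
  have Ax : closure A x by rewrite closure_annulus //=; case: hx => ->; rewrite lexx ltW.
  apply/eqP; rewrite -normr_eq0 eq_le normr_ge0 andbT; apply: (lim_le _ _ 1) => k.
  have b0 : of_jet (jf (B k)) x = 0.
    by rewrite /of_jet -sqr_enorm; have [a b] := jsolves_bd (sB k) (height2 x); case: hx => ->.
  by have := hw k x Ax; rewrite b0 sub0r normrN add0r div1r.
have sw : symdec R0 R1 w.
  move=> x y Ax Ay dxy hxy; apply: (lim_le _ _ 2) => k.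
  have [_ _ mono _] := hd k.
  have := jsolves_symdec (sB k) mono Ax Ay dxy hxy; have := hw k x Ax; have := hw k y Ay.
  rewrite !ler_norml /e => /andP[a b] /andP[a' b'] c'.
  by move: a b a' b' c'; move: (k.+1%:R^-1) => *; lra.
have Cw : C10 R0 R1 w by split.
exists w; split.
- exact: K_of_symdec.
- exact: sw.
- move=> x y Ax Ay; apply: (lim_le _ _ 2) => k.
  have M0 : 0 <= M by have /andP[a b] := gM x Ax; exact: le_trans b.
  have := hC _ _ _ (sB k) M0 _ x y Ax Ay; have := hw k x Ax; have := hw k y Ay.
  have hMn q z : R0 ^+ 2 <= q <= R1 ^+ 2 -> 0 <= z <= q -> `|h k q z| <= M.
    by move=> hq hz; rewrite ger0_norm; [exact: hM|exact: h0].
  rewrite !ler_norml /e => /andP[a b] /andP[a' b'] /(_ hMn).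
  move: a b a' b'; move: (k.+1%:R^-1) (C * M * _) => r s *; lra.
- move=> u Cu; have [C1u _] := Cu.
  have [Mu hMu] := (C1bar_bcont C1u).2; have [Mg Mg0 hMg] := C1bar_grad_bounded C1u.
  pose f k x := dotp (jgrad (B k) x) (grad u x) + of_jet (jf (B k)) x * u x.
  have bu := C1bar_bcont C1u.
  have bf k : bcont R0 R1 (f k).
    apply: bcontD.
      apply: bcont_sum => i; apply: bcontM; last exact: C1bar_grad_bcont.
      by apply: within_bcont => //; exact: jgrad_coord_within.
    apply: bcontM => //; apply: within_bcont => //; apply: of_jet_within => //.
    exact: (jf_cont (smB k)).
  have bhu k : bcont R0 R1 (fun x => of_jet (h k) x * u x).
    apply: bcontM => //.
    apply: (eq_bcont (f := fun x => of_jet (jf (B k)) x - \sum_i jet_line2 (B k) x (delta_mx 0 i))) => //.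
      by move=> x Ax; rewrite (of_jet_C10 hR0 hR01 (sB k)) //; exact: subset_closure.
    apply: bcontB; first by apply: within_bcont => //; apply: of_jet_within => //; exact: (jf_cont (smB k)).
    by apply: bcont_sum => i; apply: within_bcont => //; exact: jet_line2_within.
  have bw2 : bcont R0 R1 (fun x => dotp (grad w x) (grad u x) + w x * u x).
    by apply: bcontD; [exact: grad_dot_bcont|apply: bcontM => //; exact: C1bar_bcont].
  have bgu : bcont R0 R1 (fun x => g x * u x) by apply: bcontM => //; exact: within_bcont.
  apply/eqP; rewrite -subr_eq0 -normr_eq0 eq_le normr_ge0 andbT.
  apply: (lim_le _ _ ((N * L * Mg + L * Mu + Mu) * @annulus_volume R n R0 R1)) => k; rewrite add0r.
  have W := jsolves_weak hR0 hR01 (sB k) Cu.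
  have E1 := integral_annulus_close (L := (N * L * Mg + L * Mu) * e k) bw2 (bf k).
  have E2 := integral_annulus_close (L := Mu * e k) (bhu k) bgu.
  have -> : J (fun x => dotp (grad w x) (grad u x) + w x * u x) - J (fun x => g x * u x) =
     (J (fun x => dotp (grad w x) (grad u x) + w x * u x) - J (f k)) +
     (J (fun x => of_jet (h k) x * u x) - J (fun x => g x * u x)) by rewrite /f W; ring.
  apply: le_trans (ler_normD _ _) _.
  have -> : (N * L * Mg + L * Mu + Mu) * @annulus_volume R n R0 R1 / k.+1%:R =
    (N * L * Mg + L * Mu) * e k * @annulus_volume R n R0 R1 + Mu * e k * @annulus_volume R n R0 R1.
    by rewrite /e; ring.
  have L0 : 0 <= L by rewrite /L addr_ge0.
  apply: lerD.
    apply: E1 => x Ax; have Acx := subset_closure Ax.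
    have -> : dotp (grad w x) (grad u x) + w x * u x - f k x =
       dotp (grad w x - jgrad (B k) x) (grad u x) + (w x - of_jet (jf (B k)) x) * u x.
      by rewrite /f dotpDl dotpNl; ring.
    apply: le_trans (ler_normD _ _) _; rewrite [leRHS]mulrDl; apply: lerD.
      have -> : N * L * Mg * e k = N * (L * e k) * Mg by ring.
      apply: dotp_bound => i; last exact: hMg.
      by rewrite row_subE gw // distrC; exact: LG.
    rewrite normrM; have -> : L * Mu * e k = (L * e k) * Mu by ring.
    by apply: ler_pM => //; [rewrite distrC; exact: Lw|exact: hMu].
  apply: E2 => x Ax; rewrite -mulrBl normrM mulrC.
  by apply: ler_pM => //; [exact: hMu|apply: hg; exact: subset_closure].
- move=> y x Ay Ax gy hxy.
  have g4 : 0 < g y / 2 by rewrite divr_gt0.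
  have [d1 d10 hd1] := ring_neighborhood cg sg Ay g4.
  have /(annulus_dotp hR0 hR01)/andP[qy0 qy1] := Ay.
  have /(closure_annulus_dotp hR0 hR01) hqx := subset_closure Ax.
  pose cc := Num.min (dotp y y - R0 ^+ 2) (R1 ^+ 2 - dotp y y).
  have cc0 : 0 < cc by rewrite lt_min !subr_gt0 qy0.
  pose dd := Num.min d1 (Num.min (cc / 2) (1 / 2)).
  have dd0 : 0 < dd by rewrite !lt_min d10 !divr_gt0.
  have dd1 : dd <= d1 by rewrite ge_min lexx.
  have dd2 : dd <= cc / 2 by rewrite /dd !ge_min lexx orbT.
  have dd3 : dd <= 1 / 2 by rewrite /dd !ge_min lexx !orbT.
  have c4 : 0 < g y / 4 by rewrite divr_gt0.
  have N3 : 3 <= N by rewrite (ler_nat R 3).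
  have cl : R0 ^+ 2 <= dotp y y - cc by rewrite lerBrDr -lerBrDl ge_min lexx.
  have cr : dotp y y + cc <= R1 ^+ 2 by rewrite -lerBrDl ge_min lexx orbT.
  (* Near the equator of the ring [g >= g y / 2], hence [h k >= g y / 4] once [e k <= g y / 4]. The
     barrier [b] does not depend on [k], so its positivity passes to the limit. *)
  have [b bpos hb] := @jet_ring_barrier R N _ _ _ _ _ _ N3 Q0 Q01 cl cr dd0 dd2 dd3 c4.
  apply: lt_le_trans (bpos _ (height2 x) hqx hxy) _.
  pose k0 := Num.truncn (4 / g y).
  have hk0 k : e (k0 + k)%N <= g y / 4.
    rewrite -[leRHS]invrK lef_pV2 ?posrE ?ltr0n ?invr_gt0 // invf_div.
    apply: ltW; apply: lt_le_trans (truncnS_gt _) _; by rewrite ler_nat ltnS leq_addr.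
  apply: (lim_le _ _ 1) => k; rewrite div1r.
  have := hb _ _ (sB (k0 + k)%N) (h0 (k0 + k)%N) _ _ _ hqx (height2_dotp x).
  move=> H; have {}H : b (dotp x x) (height2 x) <= jf (B (k0 + k)%N) (dotp x x) (height2 x).
    apply: H => q s hq /andP[s0 s1] hqd sd.
    have qp : 0 < q by case/andP: hq => ? _; exact: lt_le_trans Q0 _.
    have hz : 0 <= q * s <= q by rewrite mulr_ge0 ?(ltW qp) //= ler_piMr // ltW.
    have [p [Ap qE zE]] := region_point hq hz.
    have := hd1 p Ap; rewrite qE zE => /(_ (lt_le_trans hqd dd1)).
    rewrite [X in X < _ -> _]mulrC ltr_pM2r // => /(_ (lt_le_trans sd dd1)).
    have := hg (k0 + k)%N p Ap; rewrite /of_jet qE zE ler_norml => /andP[a _] a'.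
    move: a a' (hk0 k); move: (e _) (h _ _ _) (g p) (g y); clear => *; lra.
  have := hw (k0 + k)%N x (subset_closure Ax); rewrite ler_norml => /andP[_ a].
  have ek : e (k0 + k)%N <= k.+1%:R^-1.
    by rewrite lef_pV2 ?posrE ?ltr0n // ler_nat ltnS leq_addl.
  by move: H a ek; rewrite /of_jet; move: (k.+1%:R^-1) (e _) (jf _ _ _) => *; lra.
Qed.

End elliptic.

(** * Maximisation on the cone *)

Section dirichlet_form.
Context {R : realType} {n : nat} (R0 R1 : R).
Hypotheses (hR0 : 0 < R0) (hR01 : R0 < R1) (hn : (1 < n)%N).
Local Notation E := 'rV[R]_n.+1.
Local Notation A := (@annulus R n R0 R1).
Local Notation J := (integral_rV A).
Implicit Types (x y : E) (u v w g : E -> R) (t : R).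

Lemma grad_lin u v t x : differentiable u x -> differentiable v x ->
  differentiable (fun x => u x + t * v x) x /\
  grad (fun x => u x + t * v x) x = grad u x + t *: grad v x.
Proof.
move=> du dv; have dtv : differentiable (t \*: v) x by exact: differentiableZ.
have E1 : (fun x => u x + t * v x) = u + (t \*: v) by [].
split; first by rewrite E1; exact: differentiableD.
apply/rowP => i; rewrite !mxE E1 deriveD; [|exact: diff_derivable|exact: diff_derivable].
by rewrite deriveZ //; exact: diff_derivable.
Qed.

Lemma C1bar_lin u v t : C1bar R0 R1 u -> C1bar R0 R1 v ->
  C1bar R0 R1 (fun x => u x + t * v x).
Proof.
move=> [cu du [G cG gG]] [cv dv [H cH gH]].
have gl x Ax := grad_lin t (du x Ax) (dv x Ax).
split; last exists (fun x => G x + t *: H x).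
- by apply: within_contD => //; apply: within_contM => //; exact: within_cont_cst.
- by move=> x Ax; have [] := gl x Ax.
- by move=> x; apply: cvgD; [exact: cG|apply: cvgZl_tmp; exact: cH].
- by move=> x Ax; have [_ ->] := gl x Ax; rewrite gG // gH.
Qed.

Lemma C10_lin u v t : C10 R0 R1 u -> C10 R0 R1 v -> C10 R0 R1 (fun x => u x + t * v x).
Proof.
move=> [cu u0] [cv v0]; split; first exact: C1bar_lin.
by move=> x hx; rewrite u0 // v0 // mulr0 addr0.
Qed.

Lemma C10_cst0 : C10 R0 R1 (fun _ : E => 0).
Proof.
have d0 x : differentiable (fun _ : E => 0 : R) x by exact: differentiable_cst.
split=> //; split; [exact: within_cont_cst|by move=> x _|].
exists (fun=> 0); first by move=> x; exact: cvg_cst.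
by move=> x _; apply/rowP => i; rewrite !mxE derive_cst.
Qed.

Definition qform u v := J (fun x => dotp (grad u x) (grad v x) + u x * v x).

Lemma qform_bcont u v : C1bar R0 R1 u -> C1bar R0 R1 v ->
  bcont R0 R1 (fun x => dotp (grad u x) (grad v x) + u x * v x).
Proof.
move=> cu cv; apply: bcontD; first exact: grad_dot_bcont.
by apply: bcontM; exact: C1bar_bcont.
Qed.

Lemma qformC u v : qform u v = qform v u.
Proof. by congr (J _); apply/funext => x; rewrite dotpC mulrC. Qed.

Lemma qform_lin u v w t : C1bar R0 R1 u -> C1bar R0 R1 v -> C1bar R0 R1 w ->
  qform (fun x => u x + t * v x) w = qform u w + t * qform v w.
Proof.
move=> cu cv cw; rewrite /qform -integral_annulusZ //; last exact: qform_bcont.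
rewrite -integral_annulusD //; [|exact: qform_bcont|by apply: bcontZ; exact: qform_bcont].
apply: integral_annulus_ext => x Ax.
have [_ du _] := cu; have [_ dv _] := cv; have [_ ->] := grad_lin t (du x Ax) (dv x Ax).
by rewrite dotpDl dotpZl; ring.
Qed.

Lemma qform_expand u v t : C1bar R0 R1 u -> C1bar R0 R1 v ->
  qform (fun x => u x + t * v x) (fun x => u x + t * v x) =
  qform u u + 2 * t * qform u v + t ^+ 2 * qform v v.
Proof.
move=> cu cv; have cuv := C1bar_lin t cu cv.
rewrite qform_lin // (qformC u) (qformC v) !qform_lin // (qformC v u); ring.
Qed.

Lemma qform_ge0 u : 0 <= qform u u.
Proof. by apply: integral_annulus_ge0 => x _; rewrite addr_ge0 ?dotp_ge0 // -expr2 sqr_ge0. Qed.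

Lemma qform_eq0 u : C1bar R0 R1 u -> qform u u = 0 -> forall x, A x -> u x = 0.
Proof.
move=> cu Q0 x Ax.
have pos y : A y -> 0 <= dotp (grad u y) (grad u y) + u y * u y.
  by move=> _; rewrite addr_ge0 ?dotp_ge0 // -expr2 sqr_ge0.
have h := integral_annulus_eq0 hR0 hR01 (qform_bcont cu cu) pos Q0 Ax.
have h1 := dotp_ge0 (grad u x); have h2 : 0 <= u x * u x by rewrite -expr2 sqr_ge0.
by have : u x * u x = 0 by [lra]; move/eqP; rewrite mulf_eq0 orbb => /eqP.
Qed.

Lemma qform_cauchy_schwarz u v : C1bar R0 R1 u -> C1bar R0 R1 v ->
  qform u v <= Num.sqrt (qform u u) * Num.sqrt (qform v v).
Proof.
move=> cu cv; have h t : 0 <= qform u u + 2 * t * qform u v + t ^+ 2 * qform v v.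
  by rewrite -qform_expand //; exact: qform_ge0.
have u0 := qform_ge0 u; have v0 := qform_ge0 v.
rewrite -sqrtrM //; have [qn|qp] := leP (qform u v) 0.
  exact: le_trans qn (sqrtr_ge0 _).
rewrite -[leLHS](gtr0_norm qp) -sqrtr_sqr ler_wsqrtr //.
have [v00|vp] := leP (qform v v) 0.
  have {v00}v00 : qform v v = 0 by apply/eqP; rewrite eq_le v00.
  have := h (- (qform u u + 1) / qform u v); rewrite v00 mulr0 addr0.
  have -> : 2 * (- (qform u u + 1) / qform u v) * qform u v = - 2 * (qform u u + 1).
    by field; rewrite gt_eqF.
  lra.
have := h (- qform u v / qform v v).
have -> : qform u u + 2 * (- qform u v / qform v v) * qform u v +
   (- qform u v / qform v v) ^+ 2 * qform v v = qform u u - qform u v ^+ 2 / qform v v.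
  by field; rewrite gt_eqF.
by rewrite subr_ge0 ler_pdivrMr.
Qed.

(** The set [K] in the form used for limits: it involves no angular derivatives; see [in_coneP]. *)
Definition in_cone u := [/\ C10 R0 R1 u, forall x, closure A x -> 0 <= u x & symdec R0 R1 u].

Lemma in_coneP u : in_cone u <-> K R0 R1 u.
Proof.
split=> [[cu u0 su]|Ku]; first exact: K_of_symdec (ltnW hn) _ cu u0 su.
by have [[cu u0 _] bu] := Ku; split => //; apply: Khat_symdec (ltnW hn) _ _ => //; case: Ku.
Qed.

Lemma in_coneZ u t : 0 <= t -> in_cone u -> in_cone (fun x => t * u x).
Proof.
move=> t0 [cu u0 su]; split.
- by have := C10_lin t C10_cst0 cu; under eq_fun do rewrite add0r.
- by move=> x Ax; rewrite mulr_ge0 // u0.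
- by move=> x y Ax Ay d h; rewrite ler_wpM2l // su.
Qed.

Lemma qformZ u v t : C1bar R0 R1 u -> C1bar R0 R1 v ->
  qform (fun x => t * u x) v = t * qform u v.
Proof.
move=> cu cv; have [c0 _] := C10_cst0.
have := qform_lin t c0 cu cv; under [X in qform X _]eq_fun do rewrite add0r.
move=> ->; have : qform (fun=> 0) v = 0 * qform v v.
  rewrite /qform -integral_annulusZ //; last exact: qform_bcont.
  apply: integral_annulus_ext => x _; have -> : grad (fun _ : E => 0 : R) x = 0.
    by apply/rowP => i; rewrite !mxE derive_cst.
  by rewrite -(scale0r (0 : E)) dotpZl; ring.
by move=> ->; rewrite mul0r add0r.
Qed.

Lemma C1barZ u t : C1bar R0 R1 u -> C1bar R0 R1 (fun x => t * u x).
Proof.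
by move=> cu; have [c0 _] := C10_cst0; have := C1bar_lin t c0 cu; under eq_fun do rewrite add0r.
Qed.

Lemma qformZZ u t : C1bar R0 R1 u ->
  qform (fun x => t * u x) (fun x => t * u x) = t ^+ 2 * qform u u.
Proof. move=> cu; rewrite (qformZ t cu (C1barZ t cu)) (qformC u) (qformZ t cu cu).
by rewrite mulrA -expr2. Qed.

End dirichlet_form.

(** * Compactness of Lipschitz families *)

Section equicontinuity.
Context {R : realType} {n : nat} (R0 R1 : R).
Hypotheses (hR0 : 0 < R0) (hR01 : R0 < R1).
Local Notation E := 'rV[R]_n.+1.
Local Notation A := (@annulus R n R0 R1).

Lemma ultra_fmap (T U : Type) (f : T -> U) (F : set_system T) :
  UltraFilter F -> UltraFilter (f x @[x --> F]).
Proof.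
move=> UF; have PF := @ultra_proper _ _ UF.
split; first exact: fmap_proper_filter.
move=> G PG FG; rewrite predeqE => D; split; last exact: FG.
move=> GD; have [//|nD] := in_ultra_setVsetC (f @^-1` D) UF.
have GnD : G (~` D) by apply: FG; rewrite /fmap /= preimage_setC.
by have /filter_ex[? []] : G (D `&` ~` D) by exact: filterI.
Qed.

Lemma lipschitz_bounded (u : E -> R) (L : R) : 0 <= L -> vanishes_on_boundary R0 R1 u ->
  (forall x y, closure A x -> closure A y -> u x - u y <= L * enorm (x - y)) ->
  forall x, closure A x -> `|u x| <= L * R1.
Proof.
move=> L0 /(vanishes_on_boundaryP hR0 hR01) u0 hL x Ax.
move: (Ax); rewrite closure_annulus //= => /andP[r0 r1].
have R1p := lt_trans hR0 hR01; have xp : 0 < enorm x := lt_le_trans hR0 r0.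
pose y := (R1 / enorm x) *: x.
have ey : enorm y = R1 by rewrite enormZ ger0_norm ?divr_ge0 ?(ltW R1p) ?(ltW xp) // divfK // gt_eqF.
have Ay : closure A y by rewrite closure_annulus //= ey lexx ltW.
have d : enorm (x - y) <= R1.
  have -> : x - y = (1 - R1 / enorm x) *: x by rewrite scalerBl scale1r.
  have E1 : 1 - R1 / enorm x = - ((R1 - enorm x) / enorm x) by field; rewrite gt_eqF.
  rewrite enormZ E1 normrN ger0_norm; last by rewrite divr_ge0 ?subr_ge0 ?enorm_ge0.
  by rewrite divfK ?gt_eqF //; lra.
have yu : u y = 0 by apply: u0; right.
have := hL _ _ Ax Ay; have := hL _ _ Ay Ax; rewrite yu enorm_distC subr0 sub0r.
have : L * enorm (x - y) <= L * R1 by rewrite ler_wpM2l.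
by move=> a b c'; rewrite ler_norml; apply/andP; split; lra.
Qed.

(** Arzela-Ascoli by an ultrafilter: pointwise limits along it exist because the values stay in a
    segment, and the common Lipschitz constant with a compact covering makes the convergence
    uniform. Arbitrarily late good indices replace an explicit subsequence. *)
Lemma lipschitz_subsequence (w : nat -> E -> R) (L B : R) : 0 <= L ->
  (forall k x y, closure A x -> closure A y -> w k x - w k y <= L * enorm (x - y)) ->
  (forall k x, closure A x -> `|w k x| <= B) ->
  exists u : E -> R,
    (forall x y, closure A x -> closure A y -> u x - u y <= L * enorm (x - y)) /\
    forall e k0, 0 < e -> exists2 k, (k0 <= k)%N & forall x, closure A x -> `|w k x - u x| <= e.
Proof.
move=> L0 hL hB.
have [G [UG hG]] := @ultraFilterLemma nat (\oo) _.
have PG : ProperFilter G := @ultra_proper _ _ UG.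
have lim x : exists l : R, closure A x -> w k x @[k --> G] --> l.
  have [Ax|nA] := pselect (closure A x); last by exists 0.
  have := @segment_compact R (- B) B; rewrite compact_ultra => /(_ (w k x @[k --> G]) _) [].
    exact: ultra_fmap.
    have all (k : nat) : `[- B, B]%classic (w k x) by rewrite /= in_itv /= -ler_norml; exact: hB.
    exact: (@filterE _ G _ _ all).
  by move=> l [_ hl]; exists l.
have /choice[u hu] := lim.
have near_u x e : closure A x -> 0 < e -> \forall k \near G, `|w k x - u x| <= e.
  move=> Ax e0; have /cvgrPdist_le/(_ e e0) := hu x Ax.
  by apply: filterS => k; rewrite distrC.
have uL x y : closure A x -> closure A y -> u x - u y <= L * enorm (x - y).
  move=> Ax Ay; apply/ler_addgt0Pr => e e0; have e2 : 0 < e / 2 by rewrite divr_gt0.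
  have [k [h1 h2]] := filter_ex (filterI (near_u x _ Ax e2) (near_u y _ Ay e2)).
  move: h1 h2 (hL k x y Ax Ay); rewrite !ler_norml => /andP[? ?] /andP[? ?] ?; lra.
exists u; split=> // e k0 e0.
have cA : compact (closure A) by exact: compact_closure_annulus.
have cov : \forall k \near G, closure A `<=` (fun x => closure A x -> `|w k x - u x| <= e).
  move: cA; rewrite compact_near_coveringP; apply => x Ax.
  pose d := e / (4 * (L + 1)).
  have L1 : 0 < L + 1 by rewrite ltr_wpDl.
  have d0 : 0 < d by rewrite divr_gt0 // mulr_gt0.
  have e2 : 0 < e / 2 by rewrite divr_gt0.
  exists ([set x' | enorm (x - x') < d], [set k | `|w k x - u x| <= e / 2]).
    split=> /=; last exact: near_u.
    have cN : {for x, continuous (fun x' : E => enorm (x - x'))}.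
      apply: (@continuous_comp _ _ _ (fun x' : E => x - x') (@enorm R n.+1)).
        exact: (@cvgB _ _ _ (nbhs (x : E)) _ (fun=> x) id x x (cvg_cst x) cvg_id).
      exact: enorm_continuous.
    have := cvgr_lt _ cN d; rewrite subrr enorm0; exact.
  move=> [x' k] [/= hx' hk] Ax'.
  have Ld : L * enorm (x - x') <= e / 4.
    apply: le_trans (_ : (L + 1) * d <= _).
      by apply: ler_pM => //; [exact: enorm_ge0|rewrite lerDl|exact: ltW].
    by rewrite /d le_eqVlt; apply/orP; left; apply/eqP; field; rewrite gt_eqF.
  have h1 := hL k x x' Ax Ax'; have h2 := hL k x' x Ax' Ax.
  have h3 := uL x x' Ax Ax'; have h4 := uL x' x Ax' Ax.
  move: h1 h2 h3 h4 hk Ld; rewrite (enorm_distC x') !ler_norml.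
  by move=> h1 h2 h3 h4 /andP[h5 h6] h7; apply/andP; split; lra.
have late : \forall k \near G, (k0 <= k)%N by apply: hG; exact: nbhs_infty_ge.
have [k [h1 h2]] := filter_ex (filterI cov late).
by exists k => // x Ax; exact: h1.
Qed.

End equicontinuity.

(** * Maximising a convex potential on the unit ball of the cone *)

Section maximisation.
Context {R : realType} {n : nat} (R0 R1 : R).
Hypotheses (hR0 : 0 < R0) (hR01 : R0 < R1) (hn : (1 < n)%N).
Local Notation E := 'rV[R]_n.+1.
Local Notation A := (@annulus R n R0 R1).
Local Notation J := (integral_rV A).
Local Notation Q u := (qform R0 R1 u u).
Local Notation cone := (@in_cone R n R0 R1).
Implicit Types (x y : E) (u v w g : E -> R) (t : R).

Variables (a : E -> R).
Hypotheses (ca : {within closure A, continuous a}) (sa : symdec R0 R1 a).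
Hypothesis (a0 : forall x, closure A x -> 0 < a x).

(* f is the derivative of the convex function F *)
Record nonlinearity (f F : R -> R) : Prop := {
  nl_f_cont : continuous f; nl_F_cont : continuous F;
  nl_f_ge0 : forall t, 0 <= t -> 0 <= f t;
  nl_f_incr : forall s t, 0 <= s -> s <= t -> f s <= f t;
  nl_F0 : F 0 = 0;
  nl_F_ge0 : forall t, 0 <= t -> 0 <= F t;
  nl_convex : forall s t, 0 <= s -> 0 <= t -> F t + f t * (s - t) <= F s }.

Variables (f F : R -> R).
Hypothesis (fF : nonlinearity f F).

Definition potential u := J (fun x => a x * F (u x)).

Lemma C1bar_within u : C1bar R0 R1 u -> {within closure A, continuous u}.
Proof. by case. Qed.

Lemma cone_C1bar u : cone u -> C1bar R0 R1 u.
Proof. by case=> -[]. Qed.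

Lemma source_within u : {within closure A, continuous u} ->
  {within closure A, continuous (fun x => a x * f (u x))}.
Proof. by move=> cu; apply: within_contM => //; exact: within_cont_comp (nl_f_cont fF) cu. Qed.

Lemma potential_bcont u : {within closure A, continuous u} ->
  bcont R0 R1 (fun x => a x * F (u x)).
Proof.
move=> cu; apply: within_bcont => //; apply: within_contM => //.
exact: within_cont_comp (nl_F_cont fF) cu.
Qed.

Lemma source_symdec u : (forall x, closure A x -> 0 <= u x) -> symdec R0 R1 u ->
  symdec R0 R1 (fun x => a x * f (u x)).
Proof.
move=> u0 su x y Ax Ay d h; apply: ler_pM.
- by rewrite ltW // a0.
- by apply: (nl_f_ge0 fF); exact: u0.
- exact: sa.
- by apply: (nl_f_incr fF); [exact: u0|exact: su].
Qed.

Lemma source_ge0 u x : (forall x, closure A x -> 0 <= u x) -> closure A x -> 0 <= a x * f (u x).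
Proof. by move=> u0 Ax; rewrite mulr_ge0 ?(nl_f_ge0 fF) ?u0 // ltW // a0. Qed.

Lemma potential_tangent u v : {within closure A, continuous u} -> {within closure A, continuous v} ->
  (forall x, closure A x -> 0 <= u x) -> (forall x, closure A x -> 0 <= v x) ->
  potential u + J (fun x => a x * f (u x) * v x) - J (fun x => a x * f (u x) * u x) <= potential v.
Proof.
move=> cu cv u0 v0; have bu := potential_bcont cu; have bv := potential_bcont cv.
have bfu := within_bcont hR0 hR01 (source_within cu).
have buv : bcont R0 R1 (fun x => a x * f (u x) * v x) by apply: bcontM => //; exact: within_bcont.
have buu : bcont R0 R1 (fun x => a x * f (u x) * u x) by apply: bcontM => //; exact: within_bcont.
rewrite -integral_annulusD // -integral_annulusB //; last exact: bcontD.
apply: integral_annulus_le => //; first by apply: bcontB => //; exact: bcontD.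
move=> x Ax; have Acx := subset_closure Ax.
have := ler_wpM2l (ltW (a0 Acx)) (nl_convex fF (v0 _ Acx) (u0 _ Acx)).
by congr (_ <= _); ring.
Qed.

Variable (C : R).
Hypothesis (C0 : 0 <= C).
Hypothesis (solve : forall g M, {within closure A, continuous g} -> symdec R0 R1 g ->
  (forall x, closure A x -> 0 <= g x <= M) -> exists w, [/\ cone w,
    forall x y, closure A x -> closure A y -> w x - w y <= C * M * enorm (x - y),
    forall u, C10 R0 R1 u -> qform R0 R1 w u = J (fun x => g x * u x) &
    forall y x, A y -> A x -> 0 < g y ->
      `|dotp x x - dotp y y| < Num.min (dotp y y - R0 ^+ 2) (R1 ^+ 2 - dotp y y) -> 0 < w x]).

(* One step of the ascent u |-> T (a f(u)) / |T (a f(u))|. *)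
Lemma ascent u M : {within closure A, continuous u} -> symdec R0 R1 u ->
  (forall x, closure A x -> 0 <= u x) -> (forall x, closure A x -> a x * f (u x) <= M) ->
  exists w, [/\ cone w,
    forall x y, closure A x -> closure A y -> w x - w y <= C * M * enorm (x - y),
    forall v, C10 R0 R1 v -> qform R0 R1 w v = J (fun x => a x * f (u x) * v x),
    forall y x, A y -> A x -> 0 < a y * f (u y) ->
      `|dotp x x - dotp y y| < Num.min (dotp y y - R0 ^+ 2) (R1 ^+ 2 - dotp y y) -> 0 < w x &
    0 < Q w -> potential u + Num.sqrt (Q w) - J (fun x => a x * f (u x) * u x) <=
      potential (fun x => (Num.sqrt (Q w))^-1 * w x)].
Proof.
move=> cu su u0 hM; have := solve (source_within cu) (source_symdec u0 su).
move=> /(_ M) []; first by move=> x Ax; rewrite source_ge0 //= hM.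
move=> w [cw Lw Ww Pw]; exists w; split=> // Qw.
have [Cw w0 sw] := cw; have [C1w _] := Cw.
have s0 : 0 < Num.sqrt (Q w) by rewrite sqrtr_gt0.
have i0 : 0 <= (Num.sqrt (Q w))^-1 by rewrite invr_ge0 ltW.
have cn := in_coneZ i0 cw; have [Cn n0 _] := cn.
have := potential_tangent cu (C1bar_within Cn.1) u0 n0.
rewrite -(Ww _ Cn) qformC (qformZ hR0 hR01) //.
have -> : (Num.sqrt (Q w))^-1 * Q w = Num.sqrt (Q w).
  by rewrite -{2}(sqr_sqrtr (qform_ge0 R0 R1 w)) expr2 mulKf // gt_eqF.
by [].
Qed.

Lemma potential_le_source u : {within closure A, continuous u} ->
  (forall x, closure A x -> 0 <= u x) -> potential u <= J (fun x => a x * f (u x) * u x).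
Proof.
move=> cu u0; apply: integral_annulus_le => //; first exact: potential_bcont.
  by apply: bcontM; apply: within_bcont => //; exact: source_within.
move=> x Ax; have Acx := subset_closure Ax; rewrite -mulrA; apply: ler_wpM2l; first by rewrite ltW // a0.
by have := nl_convex fF (lexx 0) (u0 x Acx); rewrite (nl_F0 fF) sub0r mulrN; lra.
Qed.

Lemma source_le_norm u w : cone u -> Q u <= 1 -> cone w ->
  (forall v, C10 R0 R1 v -> qform R0 R1 w v = J (fun x => a x * f (u x) * v x)) ->
  J (fun x => a x * f (u x) * u x) <= Num.sqrt (Q w).
Proof.
move=> cu Qu cw Ww; have [Cu u0 _] := cu; rewrite -Ww //.
apply: le_trans (qform_cauchy_schwarz hR0 hR01 (cone_C1bar cw) (cone_C1bar cu)) _.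
by rewrite ler_piMr ?sqrtr_ge0 // -sqrtr1 ler_wsqrtr.
Qed.

Lemma normalised_qform w : C1bar R0 R1 w -> 0 < Q w ->
  Q (fun x => (Num.sqrt (Q w))^-1 * w x) = 1.
Proof.
move=> cw Qw; rewrite (qformZZ hR0 hR01) // exprVn sqr_sqrtr ?(ltW Qw) //.
by rewrite mulVf // gt_eqF.
Qed.

(** Let [w = T(a f(u))] and [mu = |w|]. Cauchy-Schwarz gives [Q(w, u) <= mu], and since the ascent
    step cannot increase the potential of a maximiser, [mu <= Q(w, u)]. Equality forces
    [Q(w - mu u) <= 0], hence [w = mu u]. *)
Theorem euler_lagrange u M : cone u -> Q u <= 1 -> 0 < potential u ->
  (forall v, cone v -> Q v <= 1 -> potential v <= potential u) ->
  (forall x, closure A x -> a x * f (u x) <= M) ->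
  exists mu, [/\ potential u <= mu,
    forall x y, closure A x -> closure A y -> mu * u x - mu * u y <= C * M * enorm (x - y),
    forall v, C10 R0 R1 v -> mu * qform R0 R1 u v = J (fun x => a x * f (u x) * v x) &
    forall y x, A y -> A x -> 0 < a y * f (u y) ->
      `|dotp x x - dotp y y| < Num.min (dotp y y - R0 ^+ 2) (R1 ^+ 2 - dotp y y) -> 0 < u x].
Proof.
move=> cu Qu Pu maxu hM; have [Cu u0 su] := cu; have C1u := Cu.1.
have [w [cw Lw Ww Pw Aw]] := ascent (C1bar_within C1u) su u0 hM.
have C1w := cone_C1bar cw.
have h1 := source_le_norm cu Qu cw Ww.
have h2 := potential_le_source (C1bar_within C1u) u0.
pose mu := Num.sqrt (Q w).
have mu0 : 0 < mu by apply: lt_le_trans h1; exact: lt_le_trans Pu h2.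
have Qw : 0 < Q w by rewrite -sqrtr_gt0.
have i0 : 0 <= mu^-1 by rewrite invr_ge0 ltW.
have h3 := maxu _ (in_coneZ i0 cw); rewrite normalised_qform // in h3.
have {}h3 := h3 (lexx _); have h4 := Aw Qw.
have h5 : J (fun x => a x * f (u x) * u x) = mu by apply/eqP; rewrite eq_le h1 /=; move: h3 h4; rewrite -/mu; lra.
have Qwu : qform R0 R1 w u = mu by rewrite Ww.
have Q0 : Q (fun x => w x + - mu * u x) = 0.
  apply/eqP; rewrite eq_le qform_ge0 andbT qform_expand // Qwu.
  rewrite -(sqr_sqrtr (qform_ge0 R0 R1 w)) -/mu.
  have -> : mu ^+ 2 + 2 * - mu * mu + (- mu) ^+ 2 * Q u = mu ^+ 2 * (Q u - 1) by ring.
  by rewrite mulr_ge0_le0 ?sqr_ge0 // subr_le0.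
have C1d := C1bar_lin (- mu) C1w C1u.
have wu x : closure A x -> w x = mu * u x.
  move=> Ax; have [Ax'|nAx] := pselect (A x).
    by have := qform_eq0 hR0 hR01 C1d Q0 Ax'; lra.
  have hx : enorm x = R0 \/ enorm x = R1.
    by apply/(interior_closure_annulus_boundary hR0 hR01); split.
  have [[_ w0] _ _] := cw; have [_ v0] := Cu.
  move/(vanishes_on_boundaryP hR0 hR01) : w0 => -> //.
  by move/(vanishes_on_boundaryP hR0 hR01) : v0 => -> //; rewrite mulr0.
exists mu; split.
- by rewrite -h5.
- by move=> x y Ax Ay; rewrite -!wu //; exact: Lw.
- move=> v Cv; rewrite -Ww //; have C1v := Cv.1.
  have z t : 0 <= t -> qform R0 R1 (fun x => w x + - mu * u x) v <= 0 /\
     qform R0 R1 (fun x => w x + - mu * u x) (fun x => -1 * v x) <= 0.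
    move=> _; split.
      by have := qform_cauchy_schwarz hR0 hR01 C1d C1v; rewrite Q0 sqrtr0 mul0r.
    by have := qform_cauchy_schwarz hR0 hR01 C1d (C1barZ (-1) C1v); rewrite Q0 sqrtr0 mul0r.
  have [z1] := z 0 (lexx 0); rewrite qformC (qformZ hR0 hR01) // qformC => z2.
  by move: z1 z2; rewrite (qform_lin hR0 hR01) //; lra.
- move=> y x Ay Ax gy hxy; have := Pw y x Ay Ax gy hxy.
  by rewrite wu ?pmulr_rgt0 //; exact: subset_closure.
Qed.

Lemma lipschitz_within u (L : R) : 0 <= L ->
  (forall x y, closure A x -> closure A y -> u x - u y <= L * enorm (x - y)) ->
  {within closure A, continuous u}.
Proof.
move=> L0 hL; apply/subspace_continuousP => x Ax; apply/cvgrPdist_le => e e0.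
have L1 : 0 < L + 1 by rewrite ltr_wpDl.
have cN : {for x, continuous (fun x' : E => enorm (x - x'))}.
  apply: (@continuous_comp _ _ _ (fun x' : E => x - x') (@enorm R n.+1)).
    exact: (@cvgB _ _ _ (nbhs (x : E)) _ (fun=> x) id x x (cvg_cst x) cvg_id).
  exact: enorm_continuous.
have := cvgr_lt _ cN (e / (L + 1)); rewrite subrr enorm0 => /(_ _ (divr_gt0 e0 L1)).
rewrite near_withinE; apply: filterS => y hy Ay.
have Ld : L * enorm (x - y) <= e.
  apply: le_trans (_ : (L + 1) * (e / (L + 1)) <= _).
    by apply: ler_pM => //; [exact: enorm_ge0|rewrite lerDl|exact: ltW].
  by rewrite mulrC divfK // gt_eqF.
have := hL x y Ax Ay; have := hL y x Ay Ax; rewrite enorm_distC => h1 h2.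
change (`|u x - u y| <= e).
by move: h1 h2; rewrite ler_norml => *; apply/andP; split; lra.
Qed.

Lemma source_close u v (M e : R) : {within closure A, continuous u} ->
  {within closure A, continuous v} -> 0 <= M -> 0 <= e ->
  (forall x, closure A x -> 0 <= u x) -> (forall x, closure A x -> a x * f (u x) <= M) ->
  forall w, {within closure A, continuous w} ->
  (forall x, closure A x -> `|w x - v x| <= e) ->
  `|J (fun x => a x * f (u x) * w x) - J (fun x => a x * f (u x) * v x)| <=
    M * e * @annulus_volume R n R0 R1.
Proof.
move=> cu cv M0 e0 u0 hM w cw hwv.
apply: integral_annulus_close => //; try by apply: bcontM; apply: within_bcont => //; exact: source_within.
move=> x Ax; have Acx := subset_closure Ax; rewrite -mulrBr normrM.
by apply: ler_pM => //; [rewrite ger0_norm ?source_ge0 // hM|exact: hwv].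
Qed.

(** A maximising sequence is bounded in [Q] only, which is not compact here. Its ascent images are
    as good and uniformly Lipschitz. Their uniform limit is merely Lipschitz, so one more ascent
    step brings it back into the cone. *)
Theorem maximiser_exists (M : R) phi : (forall t x, closure A x -> 0 <= t -> a x * f t <= M) ->
  cone phi -> Q phi <= 1 -> 0 < potential phi ->
  exists u, [/\ cone u, Q u <= 1, 0 < potential u &
    forall v, cone v -> Q v <= 1 -> potential v <= potential u].
Proof.
move=> hM cphi Qphi Pphi.
have M0 : 0 <= M.
  have [x Ax] : exists x : E, closure A x.
    by exists (profile_point (R0 ^+ 2) 0); apply: profile_point_closure; rewrite ?lexx ?ler01 //;
      [exact: ltnW|rewrite ler_sqr ?nnegrE ltW // (lt_trans hR0)].
  apply: le_trans (hM 0 x Ax (lexx 0)); rewrite mulr_ge0 ?(nl_f_ge0 fF) // ltW // a0 //.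
pose V := @annulus_volume R n R0 R1.
have V0 : 0 <= V by exact: annulus_volume_ge0.
pose D := [set r | exists v, [/\ cone v, Q v <= 1 & r = potential v]].
have Dphi : D (potential phi) by exists phi.
(* Convexity and [F 0 = 0] give [F(v) <= f(v) v], hence [a F(v) <= M v <= M (v^2 + 1) / 2]. *)
have ubD : ubound D (M / 2 * (1 + V)).
  move=> _ [v [cv Qv ->]]; have [Cv v0 _] := cv; have C1v := Cv.1.
  apply: le_trans (_ : M / 2 * (Q v + V) <= _); last first.
    by rewrite ler_wpM2l ?lerD2r // divr_ge0.
  have bq := qform_bcont hR0 hR01 C1v C1v; have b1 := bcont_cst R0 R1 (1 : R) : bcont R0 R1 (fun _ : E => 1).
  rewrite -integral_annulusD // -integral_annulusZ //; last exact: bcontD.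
  apply: integral_annulus_le => //.
  - exact: potential_bcont (C1bar_within C1v).
  - by apply: bcontZ; exact: bcontD.
  - move=> x Ax; have Acx := subset_closure Ax; have vx := v0 x Acx.
    have h1 : a x * F (v x) <= a x * f (v x) * v x.
      rewrite -mulrA; apply: ler_wpM2l; first by rewrite ltW // a0.
      by have := nl_convex fF (lexx 0) vx; rewrite (nl_F0 fF) sub0r mulrN; lra.
    have h2 : a x * f (v x) * v x <= M * v x by rewrite ler_wpM2r // hM.
    have h3 : v x <= (dotp (grad v x) (grad v x) + v x * v x + 1) / 2.
      by have := dotp_ge0 (grad v x); have := sqr_ge0 (v x - 1); rewrite sqrrB; lra.
    have := ler_wpM2l M0 h3; lra.
have hub : has_ubound D by exists (M / 2 * (1 + V)).
have hsup : has_sup D by split=> //; exists (potential phi).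
pose S := sup D.
have SD v : cone v -> Q v <= 1 -> potential v <= S.
  by move=> cv Qv; apply: ub_le_sup => //; exists v.
have S0 : 0 < S by apply: lt_le_trans Pphi _; exact: SD.
have step k : exists w, [/\ cone w, Q w = 1,
    forall x y, closure A x -> closure A y -> w x - w y <= C * M / (S / 2) * enorm (x - y) &
    S - S / 2 / k.+1%:R <= potential w].
  have e0 : 0 < S / 2 / k.+1%:R by rewrite !divr_gt0.
  have [_ [v [cv Qv ->]] hv] := sup_adherent e0 hsup.
  have eS : S / 2 / k.+1%:R <= S / 2.
    by rewrite ler_pdivrMr ?ltr0n // ler_peMr ?ler1n // ltW // divr_gt0.
  have [Cv v0 sv] := cv; have cwv := C1bar_within Cv.1.
  have hMv x : closure A x -> a x * f (v x) <= M by move=> Ax; apply: hM => //; exact: v0.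
  have [w [cw Lw Ww _ Aw]] := ascent cwv sv v0 hMv.
  have h1 := source_le_norm cv Qv cw Ww; have h2 := potential_le_source cwv v0.
  (* A lower bound on the norm is needed so that dividing by it keeps the Lipschitz constant under
     control. *)
  have h3 : S / 2 <= Num.sqrt (Q w).
    apply: le_trans (le_trans h2 h1); move: hv; rewrite -/S => /ltW hv; apply: le_trans hv.
    by rewrite lerBrDr {3}[S]splitr lerD2l.
  have sq0 : 0 < Num.sqrt (Q w) by apply: lt_le_trans h3; rewrite divr_gt0.
  have Qw : 0 < Q w by rewrite -sqrtr_gt0.
  have i0 : 0 <= (Num.sqrt (Q w))^-1 by rewrite invr_ge0 ltW.
  exists (fun x => (Num.sqrt (Q w))^-1 * w x); split.
  - exact: in_coneZ.
  - by apply: normalised_qform => //; exact: cone_C1bar.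
  - move=> x y Ax Ay; rewrite -mulrBr; apply: le_trans (ler_wpM2l i0 (Lw x y Ax Ay)) _.
    rewrite mulrA ler_wpM2r ?enorm_ge0 // mulrC ler_wpM2l ?mulr_ge0 //.
    by rewrite lef_pV2 ?posrE // divr_gt0.
  - by apply: le_trans (ltW hv) (le_trans _ (Aw Qw)); rewrite -addrA lerDl subr_ge0.
have /choice[w hw] := step.
pose L := C * M / (S / 2).
have L0 : 0 <= L by rewrite divr_ge0 ?mulr_ge0 // ?ltW // divr_gt0.
have wL k x y : closure A x -> closure A y -> w k x - w k y <= L * enorm (x - y).
  by have [_ _ + _] := hw k; apply.
have cw k : cone (w k) by have [] := hw k.
have wB k x : closure A x -> `|w k x| <= L * R1.
  by have [[_ b0] _ _] := cw k; apply: lipschitz_bounded => //; exact: wL.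
have [u [uL hu]] := lipschitz_subsequence hR0 hR01 L0 wL wB.
have cu : {within closure A, continuous u} := lipschitz_within L0 uL.
have u0 x : closure A x -> 0 <= u x.
  move=> Ax; apply/ler_addgt0Pr => e e0; have [k _ hk] := hu e 0%N e0.
  by have := hk x Ax; have [_ + _] := cw k => /(_ x Ax); rewrite ler_norml => ? /andP[? ?]; lra.
have su : symdec R0 R1 u.
  move=> x y Ax Ay d h; apply/ler_addgt0Pr => e e0; have e2 : 0 < e / 2 by rewrite divr_gt0.
  have [k _ hk] := hu (e / 2) 0%N e2.
  have := hk x Ax; have := hk y Ay; have [_ _ /(_ x y Ax Ay d h)] := cw k.
  by rewrite !ler_norml => ? /andP[? ?] /andP[? ?]; lra.
have hMu x : closure A x -> a x * f (u x) <= M by move=> Ax; apply: hM => //; exact: u0.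
have [z [cz Lz Wz _ Az]] := ascent cu su u0 hMu.
(* The tangent inequality at [w k] loses only a bounded source integrated against [u - w k], which
   is uniformly small. *)
have Pu : S <= potential u.
  apply/ler_addgt0Pr => e e0.
  pose e1 := e / 2 / (M * V + 1).
  have MV : 0 < M * V + 1 by rewrite ltr_wpDl // mulr_ge0.
  have e10 : 0 < e1 by rewrite !divr_gt0.
  have [k hk0 hk] := hu e1 (Num.truncn (S / e)) e10.
  have [_ w0 _] := cw k; have cwk := C1bar_within (cone_C1bar (cw k)).
  have hMw x : closure A x -> a x * f (w k x) <= M by move=> Ax; apply: hM => //; exact: w0.
  have h1 := potential_tangent cwk cu w0 u0.
  have h2 := source_close cwk cu M0 (ltW e10) w0 hMw cwk hk.
  have [_ _ _ h3] := hw k.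
  have {}h2 := le_trans (ler_norm _) h2.
  have h4 : S / 2 / k.+1%:R <= e / 2.
    rewrite ler_pdivrMr ?ltr0n // mulrAC ler_pdivlMr // divfK // mulrC -ler_pdivrMr //.
    by apply: ltW; apply: lt_le_trans (truncnS_gt _) _; rewrite ler_nat ltnS.
  have h5 : M * e1 * V <= e / 2.
    have -> : M * e1 * V = (M * V) * e1 by ring.
    apply: le_trans (_ : (M * V + 1) * e1 <= _); first by rewrite ler_wpM2r ?lerDl // ltW.
    by rewrite /e1 mulrC divfK // gt_eqF.
  move: h2; rewrite -/V => /le_trans/(_ h5); rewrite lerBlDr => h2.
  move: h3; rewrite lerBlDr => /le_trans-> //.
  rewrite [e]splitr addrA lerD // -lerBlDr; apply: le_trans h1.
  by rewrite -addrA lerD2l -opprB lerN2 lerBlDr.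
(* As [u] is not known to be C^1, it cannot be used as a test function for [z]; the inequality is
   proved with [w k] in its place and passed to the limit. *)
have hz : J (fun x => a x * f (u x) * u x) <= Num.sqrt (Q z).
  apply/ler_addgt0Pr => e e0.
  pose e1 := e / (M * V + 1).
  have MV : 0 < M * V + 1 by rewrite ltr_wpDl // mulr_ge0.
  have e10 : 0 < e1 by rewrite !divr_gt0.
  have [k _ hk] := hu e1 0%N e10.
  have [Cwk w0 _] := cw k; have cwk := C1bar_within (cone_C1bar (cw k)).
  have h2 := source_close cu cu M0 (ltW e10) u0 hMu cwk hk.
  have h3 := qform_cauchy_schwarz hR0 hR01 (cone_C1bar cz) (cone_C1bar (cw k)).
  have [_ Qk _ _] := hw k; rewrite Qk sqrtr1 mulr1 Wz // in h3.
  have h5 : M * e1 * V <= e.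
    have -> : M * e1 * V = (M * V) * e1 by ring.
    apply: le_trans (_ : (M * V + 1) * e1 <= _); first by rewrite ler_wpM2r ?lerDl // ltW.
    by rewrite /e1 mulrC divfK // gt_eqF.
  rewrite -lerBlDr; apply: le_trans h3; rewrite lerBlDr -lerBlDl.
  by apply: le_trans h5; apply: le_trans h2; rewrite distrC ler_norm.
have h6 := potential_le_source cu u0.
have Qz : 0 < Q z by rewrite -sqrtr_gt0; lra.
have i0 : 0 <= (Num.sqrt (Q z))^-1 by rewrite invr_ge0 sqrtr_ge0.
have Pz : S <= potential (fun x => (Num.sqrt (Q z))^-1 * z x) by have := Az Qz; lra.
exists (fun x => (Num.sqrt (Q z))^-1 * z x); split.
- exact: in_coneZ.
- by rewrite normalised_qform //; exact: cone_C1bar.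
- exact: lt_le_trans S0 Pz.
- by move=> v cv Qv; exact: le_trans (SD v cv Qv) Pz.
Qed.

End maximisation.

(** * The power and its cut-off *)

Section power_nonlinearity.
Context {R : realType}.
Implicit Types (s t r p M : R).

Lemma norm_powR_continuous r : 0 < r -> continuous (fun t => `|t| `^ r).
Proof.
move=> r0 t; have [->|t0] := eqVneq t 0.
  apply/cvgrPdist_lt => e e0; rewrite normr0 (powR0 (lt0r_neq0 r0)).
  have d0 : 0 < e `^ r^-1 by exact: powR_gt0.
  have : \forall s \near (0 : R), `|0 - s| < e `^ r^-1.
    by have /cvgrPdist_lt := @cvg_id R (nbhs (0 : R)); exact.
  apply: filterS => s; rewrite !sub0r !normrN => hs.
  rewrite (ger0_norm (powR_ge0 _ _)).
  have := gt0_ltr_powR r0 _ _ hs; rewrite !nnegrE normr_ge0 powR_ge0 => /(_ isT isT) h.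
  by apply: lt_le_trans h _; rewrite -powRrM mulVf ?gt_eqF // powRr1 // ltW.
apply: (@continuous_comp _ _ _ (fun s : R => `|s|) (fun s => s `^ r)).
  exact: norm_continuous.
apply: differentiable_continuous; apply/derivable1_diffP; apply: derivable_powR.
by rewrite in_itv /= normr_gt0 t0.
Qed.

(** Young's inequality for [s] and [t^(p-1)] with the conjugate exponents [p] and [p / (p - 1)]. *)
Lemma powR_tangent p s t : 1 < p -> 0 <= s -> 0 <= t ->
  p^-1 * t `^ p + t `^ (p - 1) * (s - t) <= p^-1 * s `^ p.
Proof.
move=> p1 s0 t0; have p0 : 0 < p by exact: lt_trans p1.
have q0 : 0 < p - 1 by rewrite subr_gt0.
have := @conjugate_powR R s (t `^ (p - 1)) p (p / (p - 1)) s0 (powR_ge0 _ _) p0.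
rewrite divr_gt0 // => /(_ isT).
have -> : p^-1 + (p / (p - 1))^-1 = 1 by field; rewrite !gt_eqF.
move=> /(_ erefl); rewrite -powRrM (_ : (p - 1) * (p / (p - 1)) = p); last by field; rewrite gt_eqF.
rewrite -(mulr_powRB1 t0 p0) => h.
set x := t `^ (p - 1) in h *; set y := s `^ p in h *.
have -> : p^-1 * (t * x) + x * (s - t) = s * x - t * x / (p / (p - 1)).
  by field; rewrite !gt_eqF.
by rewrite lerBlDr [_^-1 * y]mulrC.
Qed.

(* The nonlinearity t^(p-1) and its primitive, cut off at height M and
   extended evenly. *)
Definition trunc_pow p M t := Num.min `|t| M `^ (p - 1).
Definition trunc_pot p M t :=
  p^-1 * Num.min `|t| M `^ p + Num.min `|t| M `^ (p - 1) * (`|t| - Num.min `|t| M).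

Lemma trunc_continuous r M : 0 < r -> 0 <= M ->
  continuous (fun t => Num.min `|t| M `^ r).
Proof.
move=> r0 M0 t; have E s : Num.min `|s| M `^ r = `|Num.min `|s| M| `^ r.
  by rewrite [`|Num.min _ _|]ger0_norm // le_min normr_ge0.
rewrite [X in continuous_at _ X](_ : _ = (fun s => `|s| `^ r) \o (fun s => Num.min `|s| M)).
  apply: continuous_comp; last exact: norm_powR_continuous.
  by apply: continuous_min; [exact: norm_continuous|exact: cst_continuous].
by apply/funext => s; exact: E.
Qed.

Lemma trunc_powE p M t : 0 <= t <= M -> trunc_pow p M t = t `^ (p - 1).
Proof. by move=> /andP[t0 tM]; rewrite /trunc_pow ger0_norm // min_l. Qed.

Lemma trunc_potE p M t : 0 <= t <= M -> trunc_pot p M t = p^-1 * t `^ p.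
Proof.
by move=> /andP[t0 tM]; rewrite /trunc_pot ger0_norm // min_l // subrr mulr0 addr0.
Qed.

Lemma trunc_pow_le p M t : 1 < p -> 0 <= M -> 0 <= t ->
  trunc_pow p M t <= Num.min (t `^ (p - 1)) (M `^ (p - 1)).
Proof.
move=> p1 M0 t0; have q0 : 0 <= p - 1 by rewrite subr_ge0 ltW.
by rewrite le_min /trunc_pow (ger0_norm t0) !ge0_ler_powR ?nnegrE ?le_min ?t0 // ge_min lexx ?orbT.
Qed.

(** Beyond [M] the potential continues along its tangent. Convexity thus reduces to [powR_tangent]
    at the truncated arguments, plus the fact that no slope exceeds the one at [M]. *)
Lemma trunc_nonlinearity p M : 1 < p -> 0 <= M ->
  nonlinearity (trunc_pow p M) (trunc_pot p M).
Proof.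
move=> p1 M0; have p0 : 0 < p by exact: lt_trans p1.
have q0 : 0 < p - 1 by rewrite subr_gt0.
have m0 t : 0 <= Num.min `|t| M by rewrite le_min normr_ge0.
have mt t : Num.min `|t| M <= `|t| by rewrite ge_min lexx.
split.
- exact: trunc_continuous.
- move=> t; apply: cvgD.
    by apply: cvgM; [exact: cvg_cst|exact: trunc_continuous].
  apply: cvgM; first exact: trunc_continuous.
  apply: cvgB; first exact: norm_continuous.
  by apply: continuous_min; [exact: norm_continuous|exact: cst_continuous].
- by move=> t _; exact: powR_ge0.
- move=> s t s0 st; apply: ge0_ler_powR; rewrite ?nnegrE ?(ltW q0) //.
  rewrite !ger0_norm ?(le_trans s0) // le_min !ge_min st lexx ?orbT //.
- by rewrite trunc_potE ?lexx // powR0 ?mulr0 // gt_eqF.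
- by move=> t _; rewrite addr_ge0 // mulr_ge0 ?powR_ge0 ?subr_ge0 // invr_ge0 ltW.
- move=> s t s0 t0; rewrite /trunc_pow /trunc_pot.
  have ms := mt s; have mst : Num.min `|t| M `^ (p - 1) * (`|s| - Num.min `|s| M) <=
      Num.min `|s| M `^ (p - 1) * (`|s| - Num.min `|s| M).
    have [sM|Ms] := leP `|s| M; first by rewrite subrr !mulr0.
    rewrite ler_wpM2r ?subr_ge0 ?(ltW Ms) // ge0_ler_powR ?nnegrE ?(ltW q0) //.
    by rewrite ge_min lexx orbT.
  have := powR_tangent p1 (m0 s) (m0 t).
  move: mst; rewrite (ger0_norm s0) (ger0_norm t0).
  move: (Num.min s M) (Num.min t M) => x y; move: (y `^ (p - 1)) (x `^ (p - 1)) => Y X.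
  move: (p^-1 * _) (p^-1 * _) => Z W; lra.
Qed.

End power_nonlinearity.

(** * Moments on two-dimensional slices *)

Section planar_inequality.
Context {R : realType}.
Local Notation T := (measurableTypeR R).
Local Notation mu := (@lebesgue_measure R).
Local Open Scope ereal_scope.

Definition planar (f : T * T -> \bar R) : \bar R := \int[mu]_x \int[mu]_y f (x, y).

Section monotonicity.
Variables f g : T * T -> \bar R.
Hypotheses (mf : measurable_fun setT f) (mg : measurable_fun setT g).
Hypotheses (f0 : forall z, 0 <= f z) (g0 : forall z, 0 <= g z).

Lemma planar_le : (forall z, f z <= g z) -> planar f <= planar g.
Proof.
move=> fg; apply: ge0_le_integral => //.
- by move=> x _; apply: integral_ge0.
- exact: (measurable_fun_fubini_tonelli_F (m2 := mu) _ mf f0).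
- exact: (measurable_fun_fubini_tonelli_F (m2 := mu) _ mg g0).
- move=> x _; apply: ge0_le_integral => //.
    exact: measurableT_comp mf (pair1_measurable x).
  exact: measurableT_comp mg (pair1_measurable x).
Qed.

Lemma planarD : planar (fun z => f z + g z) = planar f + planar g.
Proof.
rewrite /planar -ge0_integralD //; last 4 first.
- by move=> x _; apply: integral_ge0.
- exact: (measurable_fun_fubini_tonelli_F (m2 := mu) _ mf f0).
- by move=> x _; apply: integral_ge0.
- exact: (measurable_fun_fubini_tonelli_F (m2 := mu) _ mg g0).
apply: eq_integral => x _; rewrite ge0_integralD //.
  exact: measurableT_comp mf (pair1_measurable x).
exact: measurableT_comp mg (pair1_measurable x).
Qed.

Lemma planarZ k : 0 <= k -> planar (fun z => k * f z) = k * planar f.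
Proof.
move=> k0; rewrite /planar -ge0_integralZl //; last 2 first.
- exact: (measurable_fun_fubini_tonelli_F (m2 := mu) _ mf f0).
- by move=> x _; apply: integral_ge0.
apply: eq_integral => x _; rewrite ge0_integralZl //.
exact: measurableT_comp mf (pair1_measurable x).
Qed.

End monotonicity.

Lemma planar_prod (f g : T -> \bar R) : measurable_fun setT f -> measurable_fun setT g ->
  (forall x, 0 <= f x) -> (forall x, 0 <= g x) ->
  planar (fun z => f z.1 * g z.2) = (\int[mu]_x f x) * (\int[mu]_x g x).
Proof.
move=> mf mg f0 g0; rewrite -ge0_integralZr //; last by apply: integral_ge0.
by apply: eq_integral => x _ /=; rewrite ge0_integralZl.
Qed.

Variables (U V : T * T -> R) (D : R).
Hypotheses (mU : measurable_fun setT U) (mV : measurable_fun setT V).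
Hypotheses (U0 : forall z, (0 <= U z)%R) (V0 : forall z, (0 <= V z)%R).
Hypothesis hy : forall j x y,
  (U (x, y) ^+ j.+1)%:E <= \int[mu]_t (j.+1%:R * (U (x, t) ^+ j * V (x, t)))%:E.
Hypothesis hx : forall j x y,
  (U (x, y) ^+ j.+1)%:E <= \int[mu]_t (j.+1%:R * (U (t, y) ^+ j * V (t, y)))%:E.
Hypothesis hD : planar (fun z => (V z ^+ 2 + U z ^+ 2)%:E) <= D%:E.

(** The square comes from the product of a horizontal and a vertical line integral; the bracket
    comes from [U^(j+1) V <= U^(2(j+1)) + V^2], bounded by the previous moment and by [D]. *)
Fixpoint moment_bound (D : R) (j : nat) : R :=
  if j is k.+1 then ((k.+2)%:R * (moment_bound D k + D)) ^+ 2 else D.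

(* Ladyzhenskaya's trick: bound one factor U^(j+1) by its derivative along
   horizontal lines and the other one along vertical lines. *)
Theorem planar_moments j : planar (fun z => (U z ^+ (2 * j.+1))%:E) <= (moment_bound D j)%:E.
Proof.
have mUX k : measurable_fun setT (fun z => (U z ^+ k)%:E).
  by apply/measurable_EFinP; exact: measurable_funX.
have mD : measurable_fun setT (fun z => (V z ^+ 2 + U z ^+ 2)%:E).
  by apply/measurable_EFinP; apply: measurable_funD; exact: measurable_funX.
have UX0 k z : 0 <= (U z ^+ k)%:E by rewrite lee_fin exprn_ge0.
have D0 z : 0 <= (V z ^+ 2 + U z ^+ 2)%:E by rewrite lee_fin addr_ge0 // sqr_ge0.
elim: j => [|j IH].
  apply: le_trans hD; apply: planar_le => // z.
  by rewrite lee_fin muln1 lerDr sqr_ge0.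
pose W z := (j.+2%:R * (U z ^+ j.+1 * V z))%:E.
have mW : measurable_fun setT W.
  apply/measurable_EFinP; apply: measurable_funM; first exact: measurable_cst.
  by apply: measurable_funM => //; exact: measurable_funX.
have W0 z : 0 <= W z by rewrite lee_fin mulr_ge0 // mulr_ge0 // exprn_ge0.
have WB : planar W <= (j.+2%:R * (moment_bound D j + D))%:E.
  apply: (@le_trans _ _ (planar (fun z => (j.+2%:R)%:E * ((U z ^+ (2 * j.+1))%:E + (V z ^+ 2 + U z ^+ 2)%:E)))).
    apply: planar_le => //.
    - by apply: measurable_funeM; exact: emeasurable_funD.
    - by move=> z; rewrite mule_ge0 ?lee_fin // addr_ge0 ?exprn_ge0 // addr_ge0 // sqr_ge0.
    - move=> z; rewrite -EFinD -EFinM lee_fin ler_wpM2l // mulnC exprM.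
      move: (U z ^+ j.+1)%R (V z) (sqr_ge0 (U z))  => x y; have := sqr_ge0 (x - y)%R.
      by have := sqr_ge0 x; have := sqr_ge0 y; rewrite sqrrB; lra.
  rewrite planarZ //; last 2 first.
  - exact: emeasurable_funD.
  - by move=> z; rewrite -EFinD lee_fin addr_ge0 ?exprn_ge0 // addr_ge0 // sqr_ge0.
  rewrite planarD // EFinM lee_wpmul2l ?lee_fin // EFinD; exact: leeD.
have F0 x : 0 <= \int[mu]_t W (x, t) by exact: integral_ge0.
have G0 y : 0 <= \int[mu]_t W (t, y) by exact: integral_ge0.
have mF : measurable_fun setT (fun x => \int[mu]_t W (x, t)).
  exact: (measurable_fun_fubini_tonelli_F (m2 := mu) _ mW W0).
have mG : measurable_fun setT (fun y => \int[mu]_t W (t, y)).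
  exact: (measurable_fun_fubini_tonelli_G (m1 := mu) _ mW W0).
apply: (@le_trans _ _ (planar (fun z => (\int[mu]_t W (z.1, t)) * (\int[mu]_t W (t, z.2))))).
  apply: planar_le => //.
  - apply: emeasurable_funM.
      exact: measurableT_comp mF measurable_fst.
    exact: measurableT_comp mG measurable_snd.
  - by move=> z; exact: mule_ge0.
  - move=> [x y]; rewrite mul2n -addnn exprD EFinM; exact: lee_pmul.
rewrite (planar_prod (f := fun x => \int[mu]_t W (x, t)) (g := fun y => \int[mu]_t W (t, y))) //.
rewrite -(fubini_tonelli _ mW W0) /= expr2 EFinM.
by apply: lee_pmul => //; apply: integral_ge0.
Qed.

End planar_inequality.

Section line_bound.
Context {R : realType} {n : nat} (R0 R1 : R).
Hypotheses (hR0 : 0 < R0) (hR01 : R0 < R1).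
Local Notation T := (measurableTypeR R).
Local Notation E := 'rV[R]_n.+1.
Local Notation A := (@annulus R n R0 R1).
Local Notation mu := (@lebesgue_measure R).

Lemma integral_derivative_itvB (g G : R -> R) (a b : R) : a < b -> {within `[a, b], continuous g} ->
  {within `[a, b], continuous G} -> (forall t, a < t < b -> is_derive t 1 G (g t)) ->
  (`|G b - G a|%:E <= \int[mu]_(t in `]a, b[) `|(g t)%:E|)%E.
Proof.
move=> ab cg cG dG.
have mg : measurable_fun `]a, b[%classic (EFin \o g).
  apply/measurable_EFinP; apply: (measurable_funS (measurable_itv `[a, b])).
    exact: subset_itv_oo_cc.
  by apply: subspace_continuous_measurable_fun; [exact: measurable_itv|].
have := @le_abse_integral _ _ _ mu `]a, b[%classic (EFin \o g) (measurable_itv _) mg.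
rewrite -(@integral_itv_bndoo R a b (EFin \o g) true false) //.
rewrite (@continuous_FTC2 R g G a b ab cg) //.
- by have /(continuous_within_itvP _ ab)[_ h1 h2] := cG; split => // t;
    rewrite in_itv /= => /dG h; exact: ex_derive.
- by move=> t; rewrite in_itv /= => /dG h; rewrite derive1E; exact: derive_val.
Qed.

Definition extension (u : E -> R) : E -> R := u \_ A.
Definition extension_grad (u : E -> R) (x : E) : R :=
  Num.sqrt (((fun x => dotp (grad u x) (grad u x)) \_ A) x).

Lemma extension_measurable u : C1bar R0 R1 u ->
  measurable_fun setT (extension u \o row_of_tuple : n.+1.-tuple T -> R).
Proof. by move=> cu; apply: bcont_measurable_restrict => //; exact: C1bar_bcont. Qed.

Lemma extension_grad_measurable u : C1bar R0 R1 u ->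
  measurable_fun setT (extension_grad u \o row_of_tuple : n.+1.-tuple T -> R).
Proof.
move=> cu; apply: (@measurableT_comp _ _ _ _ _ _ (@Num.sqrt R)).
  by apply: continuous_measurable_fun; exact: sqrt_continuous.
by apply: bcont_measurable_restrict => //; exact: grad_dot_bcont.
Qed.

Lemma extension_grad_ge0 u x : 0 <= extension_grad u x.
Proof. exact: sqrtr_ge0. Qed.

Lemma extension_ge0 u : (forall x, closure A x -> 0 <= u x) -> forall x, 0 <= extension u x.
Proof.
move=> u0 x; rewrite /extension /patch; case: ifP => // /set_mem Ax.
by apply: u0; exact: subset_closure.
Qed.

(** The power [u^(j+1)] vanishes on the outer sphere, so it is the integral of its derivative from
    [t0] to the end of the line on the side of [t0]. Going away from [t = 0] increases [|x|], so the
    hole is never met. *)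
Lemma line_bound (i : 'I_n.+1) u j y t0 : C10 R0 R1 u -> (forall x, closure A x -> 0 <= u x) ->
  ((extension u (row_insert i t0 y) ^+ j.+1)%:E <=
   \int[mu]_t (j.+1%:R * (extension u (row_insert i t y) ^+ j *
      extension_grad u (row_insert i t y)))%:E)%E.
Proof.
move=> [[cu du [G cG gG]] /(vanishes_on_boundaryP hR0 hR01) ub] u0.
pose P t := row_insert i t y; pose c := dotp y y; have c0 : 0 <= c by exact: dotp_ge0.
have PA t : A (P t) <-> R0 ^+ 2 < t ^+ 2 + c < R1 ^+ 2.
  by rewrite annulusE // dotp_row_insert.
pose F t := j.+1%:R * (extension u (P t) ^+ j * extension_grad u (P t)).
have F0 t : 0 <= F t.
  by rewrite mulr_ge0 // mulr_ge0 ?extension_grad_ge0 // exprn_ge0 // extension_ge0.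
have C1u : C1bar R0 R1 u by split => //; exists G.
have mF : measurable_fun setT F.
  pose y' := [tuple y 0 k | k < n]; have yE : y = row_of_tuple y'.
    by apply/rowP => k; rewrite mxE tnth_mktuple.
  have mI : measurable_fun setT (fun t : T => tuple_insert i t y').
    exact: measurableT_comp (measurable_tuple_insert i) (pair2_measurable y').
  apply: measurable_funM => //; apply: measurable_funM.
    apply: measurable_funX; rewrite /P yE; under eq_fun do rewrite -row_of_tuple_insert.
    exact: measurableT_comp (extension_measurable C1u) mI.
  rewrite /P yE; under eq_fun do rewrite -row_of_tuple_insert.
  exact: measurableT_comp (extension_grad_measurable C1u) mI.
have uE t : A (P t) -> extension u (P t) = u (P t).
  by move=> At; rewrite /extension patchE mem_set.
pose h t := u (P t) ^+ j.+1.
have piece (a b : R) : a < b ->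
    (forall t, a <= t <= b -> R0 ^+ 2 <= t ^+ 2 + c <= R1 ^+ 2) ->
    (forall t, a < t < b -> R0 ^+ 2 < t ^+ 2 + c < R1 ^+ 2) ->
    (`|h b - h a|%:E <= \int[mu]_t (F t)%:E)%E.
  move=> ab hc ho.
  have cA t : `[a, b]%classic t -> closure A (P t).
    by rewrite /= in_itv /= => /hc ht; apply/closure_annulusE => //; rewrite dotp_row_insert.
  pose g t := j.+1%:R * (u (P t) ^+ j * G (P t) 0 i).
  have cuP : {within `[a, b], continuous (fun t => u (P t))}.
    exact: (within_continuous_compS (@row_insert_continuous R n i y) cA cu).
  have cGi : {within closure A, continuous (fun x => G x 0 i)}.
    move=> x; apply: (@continuous_comp (subspace (closure A)) E R G (fun y : E => y 0 i)).
      exact: cG.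
    exact: coord_continuous.
  have cGP : {within `[a, b], continuous (fun t => G (P t) 0 i)}.
    exact: (within_continuous_compS (@row_insert_continuous R n i y) cA cGi).
  have cX k : {within `[a, b], continuous (fun t => u (P t) ^+ k)}.
    by apply: (within_cont_comp (g := fun x => x ^+ k)) cuP; exact: exprn_continuous.
  have cg : {within `[a, b], continuous g}.
    by apply: within_contM; [exact: within_cont_cst|exact: within_contM].
  have dh t : a < t < b -> is_derive t 1 h (g t).
    move=> /ho ht; have At : A (P t) by apply/PA.
    have d1 : is_derive t 1 (fun t => u (P t)) (G (P t) 0 i).
      rewrite /P; under [X in is_derive _ _ X _]eq_fun do rewrite row_insertE.
      apply: is_derive_line; rewrite -row_insertE -/(P t) -gG //.
      by apply: grad_is_derive; exact: du.
    have := @is_deriveX R R (fun t => u (P t)) j.+1 t 1 _ d1.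
    by rewrite exprfctE /= [_ *: _](_ : _ = g t) // /g /GRing.scale /=; ring.
  apply: le_trans (integral_derivative_itvB ab cg (cX j.+1) dh) _.
  apply: (@le_trans _ _ (\int[mu]_(t in `]a, b[) (F t)%:E)%E); last first.
    apply: ge0_subset_integral; [exact: measurable_itv|exact: measurableT| | |by []].
      exact/measurable_EFinP.
    by move=> t _; rewrite lee_fin.
  apply: ge0_le_integral; [exact: measurable_itv| by []| | |].
  - apply: measurableT_comp => //; apply/measurable_EFinP.
    apply: (measurable_funS (measurable_itv `[a, b])); first exact: subset_itv_oo_cc.
    by apply: subspace_continuous_measurable_fun; [exact: measurable_itv|].
  - by apply/measurable_EFinP; apply: measurable_funS mF.
  - move=> t; rewrite /= in_itv /= => /ho ht; have At : A (P t) by apply/PA.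
    have Act := subset_closure At.
    rewrite lee_fin /g /F normrM ger0_norm // ler_wpM2l // uE //.
    rewrite normrM ger0_norm ?exprn_ge0 ?u0 // ler_wpM2l ?exprn_ge0 ?u0 //.
    by rewrite /extension_grad patchE mem_set // -gG //; exact: coord_le_enorm.
have [At0|nA] := pselect (A (P t0)); last first.
  rewrite {1}/extension patchE memNset // expr0n /=.
  by apply: integral_ge0 => t _; rewrite lee_fin; exact: F0.
have /andP[q0 q1] : R0 ^+ 2 < t0 ^+ 2 + c < R1 ^+ 2 by apply/PA.
rewrite uE //; set be := Num.sqrt (R1 ^+ 2 - c).
have cR1 : c < R1 ^+ 2 by have := sqr_ge0 t0; lra.
have be2 : be ^+ 2 + c = R1 ^+ 2 by rewrite sqr_sqrtr; lra.
have be0 : 0 < be by rewrite sqrtr_gt0; lra.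
have R1p : 0 < R1 by exact: lt_trans hR01.
have hb s : s ^+ 2 = be ^+ 2 -> h s = 0.
  move=> sb; rewrite /h ub ?expr0n //; right.
  by rewrite /enorm dotp_row_insert sb be2 sqrtr_sqr gtr0_norm.
have hE : h t0 = `|h t0| by rewrite ger0_norm // exprn_ge0 // u0 //; exact: subset_closure.
have [t00|t00] := leP 0 t0.
  have tb : t0 < be by rewrite ltNge; apply/negP => hh; nra.
  apply: le_trans (piece t0 be tb _ _).
  - by rewrite [h be]hb // sub0r normrN -hE.
  - by move=> t /andP[h1 h2]; apply/andP; split; nra.
  - by move=> t /andP[h1 h2]; apply/andP; split; nra.
have tb : - be < t0 by rewrite ltNge; apply/negP => hh; nra.
apply: le_trans (piece (- be) t0 tb _ _).
- by rewrite [h (- be)]hb ?sqrrN // subr0 -hE.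
- by move=> t /andP[h1 h2]; apply/andP; split; nra.
- by move=> t /andP[h1 h2]; apply/andP; split; nra.
Qed.

End line_bound.

Section slices.
Context {R : realType} {m : nat}.
Local Notation T := (measurableTypeR R).
Local Notation E := 'rV[R]_m.+2.
Local Notation mu := (@lebesgue_measure R).

Definition plane_point (y : 'rV[R]_m) (z : T * T) : E :=
  row_insert ord0 z.2 (row_insert ord_max z.1 y).

Lemma row_insert_comm (y : 'rV[R]_m) (s z : R) :
  row_insert (ord_max : 'I_m.+2) z (row_insert ord0 s y) =
  row_insert ord0 s (row_insert ord_max z y).
Proof.
apply/rowP => j; rewrite [RHS]mxE; case: (unliftP ord0 j) => [k|] ->.
  rewrite [RHS]mxE; case: (unliftP ord_max k) => [l|] ->.
    have -> : lift ord0 (lift ord_max l) = lift ord_max (lift ord0 l) :> 'I_m.+2.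
      apply/val_inj; rewrite /= /bump /=.
      have h : (m <= l)%N = false by rewrite leqNgt ltn_ord.
      by rewrite h add0n add1n ltnS h.
    by rewrite mxE liftK mxE liftK.
  have -> : lift ord0 ord_max = ord_max :> 'I_m.+2 by apply/val_inj.
  by rewrite mxE unlift_none.
have -> : ord0 = lift ord_max ord0 :> 'I_m.+2 by apply/val_inj.
by rewrite mxE liftK mxE unlift_none.
Qed.

Lemma plane_point_shift y z s s' z' :
  plane_point y (z, s) - plane_point y (z', s') =
  (s - s') *: delta_mx 0 ord0 + (z - z') *: delta_mx 0 ord_max.
Proof.
rewrite /plane_point /= row_insertE (row_insertE ord0 s').
rewrite -!(row_insert_comm y 0) row_insertE (row_insertE ord_max z').
by rewrite !scalerBl opprD addrACA opprD [_ + (- _ - _)]addrACA subrr add0r addrC.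
Qed.

Lemma dotp_plane_point y z : dotp (plane_point y z) (plane_point y z) =
  z.2 ^+ 2 + z.1 ^+ 2 + dotp y y.
Proof. by rewrite /plane_point !dotp_row_insert addrA. Qed.

Lemma enorm_delta (i : 'I_m.+2) : enorm (delta_mx 0 i : E) = 1.
Proof.
rewrite /enorm /dotp (bigD1 i) //= big1 ?addr0.
  by rewrite mxE !eqxx /= mulr1 sqrtr1.
by move=> j ji; rewrite mxE eqxx /= (negbTE ji) mulr0.
Qed.

Lemma plane_point_dist y z s s' z' :
  enorm (plane_point y (z, s) - plane_point y (z', s')) <= `|s - s'| + `|z - z'|.
Proof.
rewrite plane_point_shift; apply: le_trans (ler_enormD _ _) _.
by rewrite !enormZ !enorm_delta !mulr1.
Qed.

Lemma measurable_plane_point (y : m.-tuple T) (F : m.+2.-tuple T -> R) :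
  measurable_fun setT F ->
  measurable_fun setT (fun z : T * T => F (tuple_insert ord0 z.2 (tuple_insert ord_max z.1 y))).
Proof.
move=> mF.
have m1 : measurable_fun setT (fun z : T * T => (z.1, y)).
  by apply: measurable_fun_pair; [exact: measurable_fst|exact: measurable_cst].
have m2 : measurable_fun setT (fun z : T * T => (z.2, tuple_insert ord_max z.1 y)).
  apply: measurable_fun_pair; first exact: measurable_snd.
  exact: measurableT_comp (measurable_tuple_insert ord_max) m1.
exact: measurableT_comp mF (measurableT_comp (measurable_tuple_insert ord0) m2).
Qed.

(** Pigeonhole over a cube of side [2 d]: if all its slices exceeded the bound, the total integral
    would be at least [B + 1]. *)
Lemma good_slice (G : E -> R) (B d : R) : 0 < d ->
  measurable_fun setT (G \o row_of_tuple : m.+2.-tuple T -> R) -> (forall x, 0 <= G x) ->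
  (\int[@lebesgue_tuple R m.+2]_t (G (row_of_tuple t))%:E <= B%:E)%E ->
  exists2 y : m.-tuple T, (forall i, `|tnth y i| < d) &
    (planar (fun z => (G (plane_point (row_of_tuple y) z))%:E) <= ((B + 1) / (d *+ 2) ^+ m)%:E)%E.
Proof.
move=> d0 mG G0 hB; apply: contrapT => nex.
pose F t := (G (row_of_tuple t))%:E.
have mF : measurable_fun setT F by exact/measurable_EFinP.
have F0 t : (0 <= F t)%E by rewrite lee_fin.
pose H (t : m.+1.-tuple T) := (\int[mu]_s F (tuple_insert ord0 s t))%E.
have mH : measurable_fun setT H by exact: measurable_integral_insert.
have H0 t : (0 <= H t)%E by exact: integral_ge0.
pose D (y : m.-tuple T) := (\int[mu]_z H (tuple_insert ord_max z y))%E.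
have mD : measurable_fun setT D by exact: measurable_integral_insert.
have D0 t : (0 <= D t)%E by exact: integral_ge0.
have intE : (\int[@lebesgue_tuple R m.+2]_t F t = \int[@lebesgue_tuple R m]_y D y)%E.
  by rewrite (tonelli_insert ord0) // (tonelli_insert ord_max).
pose Q := [set t : m.-tuple T | forall i, `|tnth t i - 0| < d].
have mQ : measurable Q by exact: (@measurable_cube R m (fun=> 0) d).
have volQ : @lebesgue_tuple R m Q = ((d *+ 2) ^+ m)%:E.
  exact: (@lebesgue_tuple_cube R m (fun=> 0) d d0).
have v0 : 0 < (d *+ 2) ^+ m by rewrite exprn_gt0 // mulrn_wgt0.
pose c := (B + 1) / (d *+ 2) ^+ m.
have B0 : 0 <= B.
  by rewrite -lee_fin; apply: le_trans hB; apply: integral_ge0 => t _; rewrite lee_fin.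
have c0 : 0 <= c by rewrite divr_ge0 ?addr_ge0 // ltW.
have DQ y : Q y -> (c%:E <= D y)%E.
  move=> Qy; rewrite leNgt; apply/negP => h; apply: nex; exists y.
    by move=> i; have := Qy i; rewrite subr0.
  apply: ltW; apply: le_lt_trans h; rewrite le_eqVlt; apply/orP; left; apply/eqP.
  apply: eq_integral => z _; apply: eq_integral => s _.
  by rewrite /F !row_of_tuple_insert.
have : ((B + 1)%:E <= B%:E)%E.
  apply: le_trans hB; rewrite intE.
  apply: (@le_trans _ _ (\int[@lebesgue_tuple R m]_(y in Q) D y)%E); last first.
    by apply: ge0_subset_integral.
  apply: (@le_trans _ _ (\int[@lebesgue_tuple R m]_(y in Q) (cst c%:E y))%E).
    rewrite integral_cst //.
    apply: (@le_trans _ _ (c%:E * ((d *+ 2) ^+ m)%:E)%E); last by rewrite -volQ.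
    by rewrite -EFinM /c divfK // gt_eqF.
  by apply: ge0_le_integral => //; exact: measurable_funS mD.
by rewrite lee_fin; lra.
Qed.

End slices.

(** * The a priori bound on the maximum *)

Section sup_bound.
Context {R : realType} {m : nat} (R0 R1 : R).
Hypotheses (hR0 : 0 < R0) (hR01 : R0 < R1).
Local Notation T := (measurableTypeR R).
Local Notation E := 'rV[R]_m.+2.
Local Notation A := (@annulus R m.+1 R0 R1).
Local Notation J := (integral_rV A).
Local Notation mu := (@lebesgue_measure R).
Local Notation Q u := (qform R0 R1 u u).
Implicit Types (u : E -> R).

Lemma qform_extension u : C1bar R0 R1 u ->
  (\int[@lebesgue_tuple R m.+2]_t
    (extension_grad R0 R1 u (row_of_tuple t) ^+ 2 + extension R0 R1 u (row_of_tuple t) ^+ 2)%:E =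
   (Q u)%:E)%E.
Proof.
move=> cu; pose f x := dotp (grad u x) (grad u x) + u x * u x.
have bf : bcont R0 R1 f by exact: qform_bcont.
have If := bcont_integrable hR0 hR01 bf.
rewrite /qform /integral_rV /Rintegral fineK; last first.
  by apply: integrable_fin_num => //; exact: measurable_annulus.
rewrite [RHS]integral_mkcond; apply: eq_integral => t _.
rewrite /extension_grad /extension !patchE; case: ifPn => [|/negbTE tA].
  rewrite inE => At; rewrite mem_set // sqr_sqrtr ?dotp_ge0 // expr2 //.
have -> : (t \in row_of_tuple @^-1` A) = false by rewrite -tA.
transitivity ((Num.sqrt 0 ^+ 2 + 0 ^+ 2 : R)%:E) => //.
by rewrite sqrtr0 expr0n addr0.
Qed.

Lemma plane_moments d : 0 < d -> exists2 D : R, 0 <= D & forall u, C10 R0 R1 u ->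
  (forall x, closure A x -> 0 <= u x) -> Q u <= 1 ->
  exists2 y : 'rV[R]_m, (forall i, `|y 0 i| < d) & forall j,
    (planar (fun z => (extension R0 R1 u (plane_point y z) ^+ (2 * j.+1))%:E) <=
     (moment_bound D j)%:E)%E.
Proof.
move=> d0; exists ((1 + 1) / (d *+ 2) ^+ m).
  by rewrite divr_ge0 ?exprn_ge0 ?mulrn_wge0 // ltW.
move=> u Cu u0 Qu; have [C1u _] := Cu.
pose G x := extension_grad R0 R1 u x ^+ 2 + extension R0 R1 u x ^+ 2.
have mU := extension_measurable hR0 hR01 C1u.
have mV := extension_grad_measurable hR0 hR01 C1u.
have [|||y hy hD] := @good_slice R m G 1 d d0.
- by apply: measurable_funD; exact: measurable_funX.
- by move=> x; rewrite addr_ge0 // sqr_ge0.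
- by rewrite qform_extension.
exists (row_of_tuple y); first by move=> i; rewrite mxE.
pose U z := extension R0 R1 u (plane_point (row_of_tuple y) z).
pose V z := extension_grad R0 R1 u (plane_point (row_of_tuple y) z).
move=> j; apply: (@planar_moments R U V) => //.
- have := measurable_plane_point y mU; congr (measurable_fun _ _); apply/funext => z.
  by rewrite /= !row_of_tuple_insert.
- have := measurable_plane_point y mV; congr (measurable_fun _ _); apply/funext => z.
  by rewrite /= !row_of_tuple_insert.
- by move=> z; exact: extension_ge0.
- by move=> z; exact: extension_grad_ge0.
- by move=> k z s; exact: line_bound.
- move=> k z s; rewrite /U /V /plane_point /= -row_insert_comm.
  under eq_integral do rewrite -row_insert_comm.
  exact: line_bound.
Qed.

(** Along the radius through [P] the function must fall from [M] to 0 before either boundary sphere,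
    so both are at distance at least [M / L]. *)
Lemma ball_in_annulus u P (L M : R) : vanishes_on_boundary R0 R1 u -> 0 < L -> 0 < M ->
  (forall x y, closure A x -> closure A y -> u x - u y <= L * enorm (x - y)) ->
  closure A P -> u P = M -> forall X, enorm (X - P) < M / L -> A X.
Proof.
move=> /(vanishes_on_boundaryP hR0 hR01) ub L0 M0 hL AP uP X hX.
move: (AP); rewrite closure_annulus //= => /andP[r0 r1].
have Pp : 0 < enorm P by exact: lt_le_trans r0.
have key r : r = R0 \/ r = R1 -> `|enorm P - r| >= M / L.
  move=> hr; have rp : 0 < r by have h1 := hR01; case: hr => ->; have := hR0; lra.
  pose P' := (r / enorm P) *: P.
  have eP' : enorm P' = r by rewrite enormZ ger0_norm ?divr_ge0 ?divfK ?gt_eqF ?(ltW rp) ?(ltW Pp).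
  have AP' : closure A P'.
    by rewrite closure_annulus //= eP'; case: hr => ->; rewrite lexx ltW.
  have := hL _ _ AP AP'; rewrite uP ub; last by rewrite eP'.
  have -> : P - P' = (1 - r / enorm P) *: P by rewrite scalerBl scale1r.
  rewrite enormZ subr0 -{2}(ger0_norm (ltW Pp)) -normrM mulrBl mul1r divfK ?gt_eqF //.
  by rewrite ler_pdivrMr // mulrC.
have h : `|enorm X - enorm P| < M / L by apply: le_lt_trans hX; exact: ler_dist_enorm.
have := key R0 (or_introl erefl); have := key R1 (or_intror erefl).
rewrite ler0_norm ?subr_le0 // (ger0_norm (x := _ - R0)) ?subr_ge0 //.
by move: h; rewrite ltr_norml => /andP[h1 h2] h3 h4; apply/andP; split; lra.
Qed.

Lemma planar_square (F : T * T -> R) (z0 s0 r c : R) : 0 <= c -> 0 < r -> measurable_fun setT F ->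
  (forall z, 0 <= F z) ->
  (forall z s, `|z0 - z| < r -> `|s0 - s| < r -> c <= F (z, s)) ->
  ((c * (r *+ 2) ^+ 2)%:E <= planar (fun z => (F z)%:E))%E.
Proof.
move=> c0 r0 mF F0 hF.
have mB (t : R) : measurable (ball t r : set T) by rewrite ball_itv; exact: measurable_itv.
have iB (t : R) : (\int[mu]_x (\1_(ball t r) x)%:E = (r *+ 2)%:E)%E.
  by rewrite integral_indic // setIT; exact: lebesgue_measure_ball (ltW r0).
pose f (x : T) : \bar R := (c%:E * (\1_(ball z0 r) x)%:E)%E.
have mI (t : R) : measurable_fun setT (fun x : T => (\1_(ball t r) x)%:E : \bar R).
  by apply/measurable_EFinP; exact: measurable_indic.
have i0 (t x : R) : (0 <= (\1_(ball t r) x)%:E :> \bar R)%E by rewrite lee_fin indicE.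
have mf : measurable_fun setT f by exact: measurable_funeM (mI z0).
have f0 x : (0 <= f x)%E by rewrite mule_ge0 // lee_fin.
have := planar_prod mf (mI s0) f0 (i0 s0).
have -> : (\int[mu]_x f x = c%:E * \int[mu]_x (\1_(ball z0 r) x)%:E)%E.
  by apply: (ge0_integralZl mu measurableT (mI z0)); rewrite ?lee_fin.
have -> : (c%:E * \int[mu]_x (\1_(ball z0 r) x)%:E * \int[mu]_x (\1_(ball s0 r) x)%:E =
    (c * (r *+ 2) ^+ 2)%:E)%E.
  by rewrite (iB z0) (iB s0) -!EFinM -mulrA -expr2.
move=> <-.
apply: planar_le.
- apply: emeasurable_funM.
    exact: measurableT_comp mf measurable_fst.
  exact: measurableT_comp (mI s0) measurable_snd.
- exact/measurable_EFinP.
- by move=> z; rewrite mule_ge0.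
- by move=> z; rewrite lee_fin.
- move=> [z s]; rewrite /f /= -!EFinM lee_fin !indicE.
  case: (boolP (z \in (ball z0 r : set R))) => [|_]; last by rewrite mulr0 mul0r.
  rewrite inE => hz; case: (boolP (s \in (ball s0 r : set R))) => [|_]; last by rewrite mulr0.
  by rewrite inE => hs; rewrite !mulr1; exact: hF.
Qed.

(* If u reaches a height M >= 1 at P and is Lipschitz with constant
   L M^(p-1) then u >= M/2 on a ball of radius M/(4 L M^(p-1)), which is
   incompatible for large M with the bound on the moment of order 2j, j > p-1,
   on a two-dimensional slice through P. *)
Lemma height_bound (p L : R) : 0 < L -> exists2 B : R, 0 <= B & forall u x (M : R),
  in_cone R0 R1 u -> Q u <= 1 -> closure A x -> u x = M ->
  (forall x y, closure A x -> closure A y -> u x - u y <= L * M `^ (p - 1) * enorm (x - y)) ->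
  M <= B.
Proof.
(* With all coordinates of [y] below [d], [|y| <= R0]: the slice meets the equator of every sphere
   of the closed annulus. *)
move=> L0; pose d := R0 / m.+1%:R; have d0 : 0 < d by rewrite divr_gt0.
have [D D0 hD] := plane_moments d0.
(* An integer exponent [j + 1 > p - 1]: since [M > 1], the Lipschitz constant is at most
   [L M^(j+1)], matching the moment of order [2 (j + 1)]. *)
pose j := Num.truncn p; pose K := moment_bound D j.
have K0 : 0 <= K by rewrite /K; case: (j) => //= k; exact: sqr_ge0.
pose B := 4 * L ^+ 2 * 4 ^+ j.+1 * K.
exists (1 + B); first by rewrite addr_ge0 // !mulr_ge0 ?exprn_ge0 // ltW.
move=> u x M [Cu u0 su] Qu Ax ux hL; have B0 : 0 <= B by rewrite !mulr_ge0 ?exprn_ge0 // ltW.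
have [M1|M1] := leP M 1; first by lra.
have M0 : 0 < M by lra.
pose La := L * M ^+ j.+1; have La0 : 0 < La by rewrite mulr_gt0 ?exprn_gt0.
have hLa y z : closure A y -> closure A z -> u y - u z <= La * enorm (y - z).
  move=> Ay Az; apply: le_trans (hL y z Ay Az) _.
  rewrite ler_wpM2r ?enorm_ge0 // ler_wpM2l ?(ltW L0) // -powR_mulrn ?(ltW M0) //.
  apply: ler_powR; first exact: ltW.
  by have := truncnS_gt p; rewrite -/j; lra.
have [y hy my] := hD u Cu u0 Qu.
have yR : dotp y y <= R0 ^+ 2.
  apply: (@le_trans _ _ (m%:R * d ^+ 2)).
    rewrite /dotp; apply: (@le_trans _ _ (\sum_(i < m) d ^+ 2)).
      apply: ler_sum => i _; rewrite -expr2 -(real_normK (num_real (y 0 i))).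
      by rewrite ler_sqr ?nnegrE ?(ltW d0) // ltW.
    by rewrite sumr_const card_ord mulr_natl.
  rewrite /d expr_div_n mulrA ler_pdivrMr ?exprn_gt0 // [leRHS]mulrC ler_wpM2r ?sqr_ge0 //.
  by rewrite expr2 -natrM ler_nat (leq_trans (leqnSn m)) // leq_pmulr.
have [/andP[q0 q1]] : R0 ^+ 2 <= dotp x x <= R1 ^+ 2 by apply/closure_annulusE.
(* [P] lies in the slice, at the radius of [x] and height 0, so [u P >= u x] by monotonicity in the
   latitude. *)
pose s0 := Num.sqrt (dotp x x - dotp y y); pose P := plane_point y (0, s0).
have dP : dotp P P = dotp x x.
  by rewrite dotp_plane_point /= sqr_sqrtr ?subr_ge0 ?(le_trans yR) // expr0n addr0 subrK.
have AP : closure A P by apply/closure_annulusE => //; rewrite dP q0 q1.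
have hP : height2 P = 0.
  by rewrite /height2 /P /plane_point /= -row_insert_comm mxE unlift_none expr0n.
pose M' := u P; have MM' : M <= M'.
  by rewrite -ux; apply: su => //; rewrite hP sqr_ge0.
pose r := M / La / 4; have r0 : 0 < r by rewrite !divr_gt0.
have hball z s : `|0 - z| < r -> `|s0 - s| < r ->
    (M / 2) ^+ (2 * j.+1) <= extension R0 R1 u (plane_point y (z, s)) ^+ (2 * j.+1).
  move=> hz hs; have dist : enorm (plane_point y (z, s) - P) < M / La / 2.
    apply: le_lt_trans (plane_point_dist y z s s0 0) _.
    by rewrite distrC [`|z - 0|]distrC; move: hz hs; rewrite /r; lra.
  have ML : 0 < M / La by rewrite divr_gt0.
  have AX : A (plane_point y (z, s)).
    apply: (ball_in_annulus Cu.2 La0 (lt_le_trans M0 MM') hLa AP erefl).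
    apply: lt_le_trans dist _; apply: le_trans (_ : M / La <= _); first by lra.
    by rewrite ler_wpM2r // invr_ge0 ltW.
  have h := hLa _ _ AP (subset_closure AX).
  have {}dist : La * enorm (P - plane_point y (z, s)) <= M / 2.
    rewrite enorm_distC; apply: le_trans (ler_wpM2l (ltW La0) (ltW dist)) _.
    by rewrite mulrA [La * _]mulrC divfK // gt_eqF.
  rewrite /extension patchE mem_set //; apply: lerXn2r; rewrite ?nnegrE; try by lra.
  - by apply: u0; exact: subset_closure.
  - by move: h dist MM'; rewrite /M'; lra.
have mE : measurable_fun setT (fun z => extension R0 R1 u (plane_point y z) ^+ (2 * j.+1)).
  apply: measurable_funX.
  have := measurable_plane_point [tuple y 0 k | k < m] (extension_measurable hR0 hR01 Cu.1).
  congr (measurable_fun _ _); apply/funext => z.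
  rewrite /= !row_of_tuple_insert; congr (extension _ _ _ (row_insert _ _ (row_insert _ _ _))).
  by apply/rowP => k; rewrite mxE tnth_mktuple.
have c0 : 0 <= (M / 2) ^+ (2 * j.+1) by rewrite exprn_ge0 // divr_ge0 // ltW.
have := planar_square c0 r0 mE _ hball.
move=> /(_ (fun z => exprn_ge0 _ (extension_ge0 u0 _))) /le_trans/(_ (my j)).
rewrite lee_fin -/K => hK.
(* The moment over the square is [(M/2)^(2(j+1)) (2 r)^2] with [2 r = M / (2 L M^(j+1))]: the powers
   cancel down to [M^2]. *)
have M2 : M ^+ 2 <= B.
  have E : M ^+ 2 = 4 * L ^+ 2 * 4 ^+ j.+1 * ((M / 2) ^+ (2 * j.+1) * (r *+ 2) ^+ 2).
    have -> : 4 ^+ j.+1 = (2 ^+ j.+1) ^+ 2 :> R.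
      by rewrite -exprM mulnC exprM; congr (_ ^+ _); ring.
    rewrite mulnC exprM expr_div_n /r /La.
    have : M ^+ j.+1 != 0 by rewrite expf_neq0 // gt_eqF.
    have : 2 ^+ j.+1 != 0 :> R by rewrite expf_neq0.
    move: (M ^+ j.+1) (2 ^+ j.+1) => X Y Y0 X0.
    by field; rewrite X0 Y0 gt_eqF.
  by rewrite E /B ler_wpM2l // !mulr_ge0 ?exprn_ge0 // ltW.
have : M <= M ^+ 2 by rewrite expr2 ler_peMl // ltW.
by lra.
Qed.

End sup_bound.

(** * The power nonlinearity *)

Lemma cone_height_bound (R : realType) (n : nat) (R0 R1 p L : R) : 0 < R0 -> R0 < R1 ->
  (0 < n)%N -> 0 < L -> exists2 B : R, 0 <= B & forall (u : 'rV[R]_n.+1 -> R) x (M : R),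
  in_cone R0 R1 u -> qform R0 R1 u u <= 1 -> closure (annulus R0 R1) x -> u x = M ->
  (forall x y, closure (annulus R0 R1) x -> closure (annulus R0 R1) y ->
    u x - u y <= L * M `^ (p - 1) * enorm (x - y)) -> M <= B.
Proof. by move=> hR0 hR01; case: n => // m _; exact: height_bound. Qed.

Lemma segment_bounds (R : realType) (lo hi x y t : R) : lo <= x <= hi -> lo <= y <= hi ->
  0 <= t <= 1 -> lo <= x + t * (y - x) <= hi.
Proof. by move=> /andP[? ?] /andP[? ?] /andP[? ?]; apply/andP; split; nra. Qed.

Section power_maximisers.
Context {R : realType} {n : nat} (R0 R1 : R).
Hypotheses (hR0 : 0 < R0) (hR01 : R0 < R1) (hn : (1 < n)%N).
Local Notation E := 'rV[R]_n.+1.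
Local Notation A := (@annulus R n R0 R1).
Local Notation J := (integral_rV A).
Local Notation Q u := (qform R0 R1 u u).
Local Notation cone := (@in_cone R n R0 R1).
Implicit Types (x y : E) (u v w g : E -> R).

Variables (a : E -> R) (p : R).
Hypotheses (ca : {within closure A, continuous a}) (sa : symdec R0 R1 a).
Hypothesis (a0 : forall x, closure A x -> 0 < a x).
Hypothesis (hp : 1 < p).

Let p0 : 0 < p. Proof. exact: lt_trans hp. Qed.

Lemma closure_point : exists x, closure A x.
Proof.
have q0 : R0 ^+ 2 <= R0 ^+ 2 <= R1 ^+ 2.
  by rewrite lexx /= ler_sqr ?nnegrE ?ltW // (lt_trans hR0).
have z0 : 0 <= (0 : R) <= R0 ^+ 2 by rewrite lexx sqr_ge0.
by have [x [Ax _ _]] := region_point hR0 hR01 hn q0 z0; exists x.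
Qed.

Lemma closure_max g : {within closure A, continuous g} ->
  exists2 x, closure A x & forall y, closure A y -> g y <= g x.
Proof.
move=> cg; have [x Ax] := closure_point.
have [|c + hc] := @compact_EVT_max E R g (closure A) _ (compact_closure_annulus hR0 hR01) cg.
  by exists x.
by rewrite inE => Ac; exists c => // y Ay; apply: hc; rewrite inE.
Qed.

Definition power_potential u := J (fun x => a x * `|u x| `^ p).

Lemma power_bcont u : {within closure A, continuous u} -> bcont R0 R1 (fun x => a x * `|u x| `^ p).
Proof.
move=> cu; apply: within_bcont => //; apply: within_contM => //.
exact: within_cont_comp (norm_powR_continuous p0) cu.
Qed.

Lemma trunc_potentialE M u : {within closure A, continuous u} ->
  (forall x, closure A x -> 0 <= u x <= M) ->
  potential R0 R1 a (trunc_pot p M) u = p^-1 * power_potential u.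
Proof.
move=> cu uM; rewrite /power_potential -(integral_annulusZ hR0 hR01) //; last exact: power_bcont.
apply: integral_annulus_ext => x Ax; have ux := uM x (subset_closure Ax).
by have [u0 _] := andP ux; rewrite (trunc_potE p ux) (ger0_norm u0) mulrCA.
Qed.

Lemma power_potentialZ t u : {within closure A, continuous u} ->
  power_potential (fun x => t * u x) = `|t| `^ p * power_potential u.
Proof.
move=> cu; rewrite -(integral_annulusZ hR0 hR01) //; last exact: power_bcont.
apply: integral_annulus_ext => x Ax.
by rewrite normrM powRM // mulrCA.
Qed.

Lemma power_potential_gt0 u x : {within closure A, continuous u} ->
  A x -> u x != 0 -> 0 < power_potential u.
Proof.
move=> cu Ax ux; apply: (integral_annulus_gt0 hR0 hR01 (power_bcont cu) _ Ax).
  by move=> y Ay; rewrite mulr_ge0 ?powR_ge0 // ltW // a0 //; exact: subset_closure.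
by rewrite mulr_gt0 ?powR_gt0 ?normr_gt0 // a0 //; exact: subset_closure.
Qed.

Lemma power_potential_support u : 0 < power_potential u -> exists2 x, A x & u x != 0.
Proof.
move=> P0; apply: contrapT => h; have : power_potential u = J (fun=> 0).
  apply: integral_annulus_ext => x Ax; have -> : u x = 0.
    by apply/eqP/negPn/negP => ux; apply: h; exists x.
  by rewrite normr0 powR0 ?gt_eqF // mulr0.
have b0 := bcont_cst R0 R1 (1 : R) : bcont R0 R1 (fun _ : E => 1).
by have := integral_annulusZ hR0 hR01 0 b0; rewrite !mul0r => -> /eqP; rewrite gt_eqF.
Qed.

Lemma qform_gt0 u x : C1bar R0 R1 u -> A x -> u x != 0 -> 0 < Q u.
Proof.
move=> cu Ax ux; rewrite lt_neqAle qform_ge0 andbT eq_sym; apply/eqP => Q0.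
by have := qform_eq0 hR0 hR01 cu Q0 Ax; apply/eqP.
Qed.

(* The squared radii reached from a point where u > 0 by steps shorter than
   the distance to the boundary values exhaust the annulus. *)
Lemma radial_chain u y :
  (forall y x, A y -> A x -> 0 < u y ->
    `|dotp x x - dotp y y| < Num.min (dotp y y - R0 ^+ 2) (R1 ^+ 2 - dotp y y) -> 0 < u x) ->
  A y -> 0 < u y -> forall x, A x -> 0 < u x.
Proof.
move=> loc Ay uy x Ax; move: (Ay) (Ax) => /(annulusE hR0 hR01) /andP[y0 y1] /(annulusE hR0 hR01) /andP[x0 x1].
(* Half the least distance of the two squared radii to the ends. All intermediate values keep
   distance [2 c] from the ends, so steps of length at most [c] are admissible; the induction is on
   their number. *)
pose c := Num.min (Num.min (dotp y y - R0 ^+ 2) (R1 ^+ 2 - dotp y y))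
  (Num.min (dotp x x - R0 ^+ 2) (R1 ^+ 2 - dotp x x)) / 2.
have c0 : 0 < c by rewrite divr_gt0 // !lt_min !subr_gt0 y0 y1 x0 x1.
have [h1 h2 h3 h4] : [/\ c * 2 <= dotp y y - R0 ^+ 2, c * 2 <= R1 ^+ 2 - dotp y y,
    c * 2 <= dotp x x - R0 ^+ 2 & c * 2 <= R1 ^+ 2 - dotp x x].
  by rewrite /c divfK //; split; rewrite !ge_min lexx ?orbT.
have chain k : forall q (z : E), R0 ^+ 2 + c * 2 <= q -> q <= R1 ^+ 2 - c * 2 ->
    `|q - dotp y y| <= k%:R * c -> A z -> dotp z z = q -> 0 < u z.
  elim: k => [|k IH] q z q0 q1 qk Az zq.
    rewrite mul0r normr_le0 subr_eq0 in qk; apply: (loc y) => //.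
    by rewrite zq (eqP qk) subrr normr0 lt_min !subr_gt0 y0 y1.
  pose th : R := k%:R / k.+1%:R; have k10 : 0 < k.+1%:R :> R by rewrite ltr0n.
  have th0 : 0 <= th by rewrite divr_ge0.
  have th1 : th <= 1 by rewrite ler_pdivrMr // mul1r ler_nat.
  pose q' := dotp y y + th * (q - dotp y y).
  have /andP[b0 b1] : R0 ^+ 2 + c * 2 <= q' <= R1 ^+ 2 - c * 2.
    by apply: segment_bounds; rewrite ?th0 ?q0 ?q1 //; apply/andP; split; lra.
  have bq : R0 ^+ 2 <= q' <= R1 ^+ 2 by apply/andP; split; lra.
  have bz : 0 <= (0 : R) <= q' by rewrite lexx; have := sqr_ge0 R0; lra.
  have [z' [_ zq' _]] := region_point hR0 hR01 hn bq bz.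
  have Az' : A z' by apply/(annulusE hR0 hR01); rewrite zq'; apply/andP; split; lra.
  have uz' : 0 < u z'.
    apply: (IH q' z' b0 b1 _ Az' zq'); rewrite /q' addrC addKr normrM ger0_norm //.
    apply: le_trans (ler_wpM2l th0 qk) _.
    by rewrite /th mulrA divfK // gt_eqF.
  apply: (loc z') => //; rewrite zq zq'.
  have -> : q - q' = (q - dotp y y) / k.+1%:R.
    by rewrite /q' /th -natr1; field; rewrite natr1 gt_eqF.
  apply: (@le_lt_trans _ _ c); last by rewrite lt_min; apply/andP; split; lra.
  by rewrite normf_div (ger0_norm (ltW k10)) ler_pdivrMr // mulrC.
apply: (chain (Num.truncn (`|dotp x x - dotp y y| / c)).+1 (dotp x x)) => //; try lra.
by rewrite -ler_pdivrMr // ltW // truncnS_gt.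
Qed.

Lemma solve_in_cone : exists2 C, 0 <= C & forall g M, {within closure A, continuous g} ->
  symdec R0 R1 g -> (forall x, closure A x -> 0 <= g x <= M) -> exists w, [/\ cone w,
    forall x y, closure A x -> closure A y -> w x - w y <= C * M * enorm (x - y),
    forall u, C10 R0 R1 u -> qform R0 R1 w u = J (fun x => g x * u x) &
    forall y x, A y -> A x -> 0 < g y ->
      `|dotp x x - dotp y y| < Num.min (dotp y y - R0 ^+ 2) (R1 ^+ 2 - dotp y y) -> 0 < w x].
Proof.
have [C C0 hC] := elliptic_solution hR0 hR01 hn; exists C => // g M cg sg gM.
have [w [Kw sw Lw Ww Pw]] := hC g M cg sg gM; exists w; split => //.
exact/(in_coneP hR0 hR01 hn).
Qed.

Lemma unit_cone_element : exists phi, [/\ cone phi, Q phi <= 1 & 0 < power_potential phi].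
Proof.
have [C _ hC] := solve_in_cone.
have [|||w [cw _ Ww Pw]] := hC (fun=> 1) 1.
- exact: within_cont_cst.
- by [].
- by move=> x _; rewrite ler01 lexx.
have q01 : R0 ^+ 2 < R1 ^+ 2 by rewrite ltr_sqr ?nnegrE ?ltW // (lt_trans hR0).
pose q := (R0 ^+ 2 + R1 ^+ 2) / 2.
have bq : R0 ^+ 2 <= q <= R1 ^+ 2 by rewrite /q; apply/andP; split; lra.
have bz : 0 <= (0 : R) <= q by rewrite lexx /q; have := sqr_ge0 R0; lra.
have [x [_ xq _]] := region_point hR0 hR01 hn bq bz.
have Ax : A x by apply/(annulusE hR0 hR01); rewrite xq /q; apply/andP; split; lra.
have wx : 0 < w x.
  apply: (Pw x x) => //; rewrite subrr normr0 lt_min xq /q; apply/andP; split; lra.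
have C1w := cone_C1bar cw.
have Qw : 0 < Q w by apply: qform_gt0 Ax _ => //; rewrite gt_eqF.
have i0 : 0 < (Num.sqrt (Q w))^-1 by rewrite invr_gt0 sqrtr_gt0.
exists (fun x => (Num.sqrt (Q w))^-1 * w x); split.
- by apply: in_coneZ cw; exact: ltW.
- by rewrite normalised_qform.
- rewrite (power_potentialZ _ (C1bar_within C1w)) (gtr0_norm i0).
  apply: mulr_gt0; first exact: powR_gt0.
  by apply: power_potential_gt0 Ax _; [exact: C1bar_within|rewrite gt_eqF].
Qed.

Lemma trunc_euler_lagrange C a1 M u m :
  (forall g M, {within closure A, continuous g} ->
    symdec R0 R1 g -> (forall x, closure A x -> 0 <= g x <= M) -> exists w, [/\ cone w,
    forall x y, closure A x -> closure A y -> w x - w y <= C * M * enorm (x - y),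
    forall u, C10 R0 R1 u -> qform R0 R1 w u = J (fun x => g x * u x) &
    forall y x, A y -> A x -> 0 < g y ->
      `|dotp x x - dotp y y| < Num.min (dotp y y - R0 ^+ 2) (R1 ^+ 2 - dotp y y) -> 0 < w x]) ->
  (forall x, closure A x -> a x <= a1) -> 0 <= M ->
  cone u -> Q u <= 1 -> 0 < potential R0 R1 a (trunc_pot p M) u ->
  (forall v, cone v -> Q v <= 1 ->
    potential R0 R1 a (trunc_pot p M) v <= potential R0 R1 a (trunc_pot p M) u) ->
  (forall x, closure A x -> u x <= m) ->
  exists mu, [/\ potential R0 R1 a (trunc_pot p M) u <= mu,
    forall x y, closure A x -> closure A y ->
      mu * u x - mu * u y <= C * (a1 * m `^ (p - 1)) * enorm (x - y),
    forall v, C10 R0 R1 v ->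
      mu * qform R0 R1 u v = J (fun x => a x * trunc_pow p M (u x) * v x) &
    forall y x, A y -> A x -> 0 < a y * trunc_pow p M (u y) ->
      `|dotp x x - dotp y y| < Num.min (dotp y y - R0 ^+ 2) (R1 ^+ 2 - dotp y y) -> 0 < u x].
Proof.
move=> hC ha1 M0 cu Qu Pu maxu um; have [_ u0 _] := cu.
apply: (euler_lagrange hR0 hR01 ca sa a0 (trunc_nonlinearity hp M0) hC cu Qu Pu maxu) => x Ax.
have ux := u0 x Ax; apply: ler_pM; rewrite ?powR_ge0 ?ha1 //; first by rewrite ltW // a0.
have := trunc_pow_le hp M0 ux; rewrite le_min => /andP[h _]; apply: le_trans h _.
by apply: ge0_ler_powR; rewrite ?nnegrE ?subr_ge0 ?(ltW hp) ?um // (le_trans ux) // um.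
Qed.

(** The multiplier is at least the potential of a fixed [phi], which does not change with [M] once
    [M] exceeds [phi]. The Lipschitz constant is thus a fixed multiple of [(max u)^(p-1)], and
    [height_bound] gives a [B] independent of [M]. *)
Lemma truncated_maximisers : exists2 B : R, 0 <= B & forall M, B <= M ->
  exists u, [/\ cone u, Q u <= 1, forall x, closure A x -> u x <= B,
    0 < potential R0 R1 a (trunc_pot p M) u &
    forall v, cone v -> Q v <= 1 ->
      potential R0 R1 a (trunc_pot p M) v <= potential R0 R1 a (trunc_pot p M) u].
Proof.
have [C C0 hC] := solve_in_cone.
have [phi [cphi Qphi Pphi]] := unit_cone_element.
have [Cphi phi0 _] := cphi; have cwphi := C1bar_within Cphi.1.
have [xp Axp hxp] := closure_max cwphi.
have [xa Axa hxa] := closure_max ca; pose a1 := a xa; have a10 : 0 < a1 by exact: a0.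
pose S := p^-1 * power_potential phi; have S0 : 0 < S by rewrite mulr_gt0 ?invr_gt0.
(* The summand 1 makes [L] positive even if [C = 0]. *)
pose L := C * a1 / S + 1.
have L0 : 0 < L.
  apply: ltr_wpDl ltr01; apply: divr_ge0 (ltW S0); exact: mulr_ge0 C0 (ltW a10).
have [B B0 hB] := @cone_height_bound R n R0 R1 p L hR0 hR01 (ltnW hn) L0.
exists (Num.max B (phi xp)); first by rewrite le_max B0.
move=> M; rewrite ge_max => /andP[BM pM]; have M0 := le_trans B0 BM.
have Sphi : potential R0 R1 a (trunc_pot p M) phi = S.
  by apply: trunc_potentialE => // x Ax; rewrite phi0 //= (le_trans (hxp x Ax)).
have hM t x : closure A x -> 0 <= t -> a x * trunc_pow p M t <= a1 * M `^ (p - 1).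
  move=> Ax t0; apply: ler_pM; rewrite ?powR_ge0 ?hxa //; first by rewrite ltW // a0.
  by have := trunc_pow_le hp M0 t0; rewrite le_min => /andP[].
have Pphi' : 0 < potential R0 R1 a (trunc_pot p M) phi by rewrite Sphi.
have [u [cu Qu Pu maxu]] := maximiser_exists hR0 hR01 hn ca sa a0 (trunc_nonlinearity hp M0)
  C0 hC hM cphi Qphi Pphi'.
exists u; split=> // x Ax; rewrite le_max; apply/orP; left.
have [Cu u0 _] := cu; have [xu Axu hxu] := closure_max (C1bar_within Cu.1).
apply: le_trans (hxu x Ax) _.
have [mu [Smu Lmu _ _]] := trunc_euler_lagrange hC hxa M0 cu Qu Pu maxu hxu.
have Sm : S <= mu by rewrite -Sphi; apply: le_trans Smu; exact: maxu.
have mu0 : 0 < mu by exact: lt_le_trans Sm.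
apply: (hB u xu _ cu Qu Axu erefl) => y z Ay Az.
have := Lmu y z Ay Az; rewrite -mulrBr -ler_pdivlMl // => h; apply: le_trans h _.
rewrite [leLHS]mulrA; apply: ler_wpM2r; first exact: enorm_ge0.
rewrite !mulrA; apply: ler_wpM2r; first exact: powR_ge0.
apply: (@le_trans _ _ (C * a1 / S)); last by rewrite /L lerDl.
by rewrite -mulrA mulrC ler_wpM2l ?mulr_ge0 ?(ltW a10) // lef_pV2.
Qed.

Lemma trunc_potential_cone M u : cone u -> (forall x, closure A x -> u x <= M) ->
  potential R0 R1 a (trunc_pot p M) u = p^-1 * power_potential u.
Proof.
move=> [Cu u0 _] uM; apply: trunc_potentialE; first exact: C1bar_within Cu.1.
by move=> x Ax; rewrite u0 //= uM.
Qed.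

Definition power_maximiser u := [/\ cone u, Q u <= 1, 0 < power_potential u &
  forall v, cone v -> Q v <= 1 -> power_potential v <= power_potential u].

(** The cut-off problem at [M] has a maximiser below [B <= M], where the cut-off is invisible, so
    its value does not exceed that of [u]. *)
Lemma trunc_maximal_of_power B : (forall M, B <= M ->
  exists u, [/\ cone u, Q u <= 1, forall x, closure A x -> u x <= B,
    0 < potential R0 R1 a (trunc_pot p M) u &
    forall v, cone v -> Q v <= 1 ->
      potential R0 R1 a (trunc_pot p M) v <= potential R0 R1 a (trunc_pot p M) u]) ->
  forall M u, B <= M -> cone u -> (forall x, closure A x -> u x <= M) ->
  (forall v, cone v -> Q v <= 1 -> power_potential v <= power_potential u) ->
  forall v, cone v -> Q v <= 1 ->
    potential R0 R1 a (trunc_pot p M) v <= potential R0 R1 a (trunc_pot p M) u.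
Proof.
move=> hB M u BM cu uM maxu v cv Qv; have [w [cw Qw wB _ maxw]] := hB M BM.
apply: le_trans (maxw v cv Qv) _.
have wM x (Ax : closure A x) : w x <= M := le_trans (wB x Ax) BM.
rewrite (trunc_potential_cone cw wM) (trunc_potential_cone cu uM).
by apply: ler_wpM2l; [rewrite invr_ge0 ltW|exact: maxu].
Qed.

(** A competitor [v] may exceed [B]. It is compared at a cut-off above its own maximum with a
    maximiser there, which stays below [B] and is therefore admissible for the comparison at cut-off
    [B]. *)
Theorem power_maximiser_exists : exists u, power_maximiser u.
Proof.
have [B B0 hB] := truncated_maximisers.
have [u [cu Qu uB Pu maxu]] := hB B (lexx B); exists u.
have ip : 0 < p^-1 by rewrite invr_gt0.
split; [exact: cu|exact: Qu| |].
  by move: Pu; rewrite (trunc_potential_cone cu uB) (pmulr_rgt0 _ ip).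
move=> v cv Qv; have [xv Axv hxv] := closure_max (C1bar_within (cone_C1bar cv)).
pose M := Num.max B (v xv); have BM : B <= M by rewrite le_max lexx.
have [w [cw Qw wB _ maxw]] := hB M BM.
have vM x : closure A x -> v x <= M by move=> Ax; rewrite le_max hxv ?orbT.
have wM x (Ax : closure A x) : w x <= M := le_trans (wB x Ax) BM.
have := maxw v cv Qv; rewrite (trunc_potential_cone cv vM) (trunc_potential_cone cw wM) (ler_pM2l ip).
move/le_trans; apply.
have := maxu w cw Qw; rewrite (trunc_potential_cone cw wB) (trunc_potential_cone cu uB).
by rewrite (ler_pM2l ip).
Qed.

(** Goes through the cut-off at a height above both [B] and the maximum of [u], where [u] is a
    maximiser too. Positivity spreads along radii from one point where [u] is nonzero. *)
Theorem power_euler_lagrange u : power_maximiser u -> exists mu, [/\ 0 < mu,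
  forall v, C10 R0 R1 v ->
    mu * qform R0 R1 u v = J (fun x => a x * u x `^ (p - 1) * v x) &
  forall x, A x -> 0 < u x].
Proof.
move=> [cu Qu Pu maxu]; have [B B0 hB] := truncated_maximisers.
have [C C0 hC] := solve_in_cone.
have [Cu u0 _] := cu; have cwu := C1bar_within Cu.1.
have [xa Axa hxa] := closure_max ca; have [xu Axu hxu] := closure_max cwu.
pose M := Num.max B (u xu); have BM : B <= M by rewrite le_max lexx.
have M0 := le_trans B0 BM.
have uM x : closure A x -> u x <= M by move=> Ax; rewrite le_max hxu ?orbT.
have maxM := trunc_maximal_of_power hB BM cu uM maxu.
have PuM : 0 < potential R0 R1 a (trunc_pot p M) u.
  by rewrite (trunc_potential_cone cu uM) pmulr_rgt0 ?invr_gt0.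
have [mu [Pmu _ Wmu Lmu]] := trunc_euler_lagrange hC hxa M0 cu Qu PuM maxM hxu.
have powE x : closure A x -> trunc_pow p M (u x) = u x `^ (p - 1).
  by move=> Ax; apply: trunc_powE; rewrite u0 // uM.
exists mu; split.
- exact: lt_le_trans Pmu.
- move=> v Cv; rewrite (Wmu v Cv); apply: integral_annulus_ext => x Ax.
  by rewrite (powE x (subset_closure Ax)).
- have [y Ay uy] := power_potential_support Pu.
  have {}uy : 0 < u y by rewrite lt_neqAle eq_sym uy u0 //; exact: subset_closure.
  apply: (@radial_chain u y) => // y' x Ay' Ax uy'; apply: Lmu => //.
  by have Acy := subset_closure Ay'; rewrite powE // mulr_gt0 ?powR_gt0 ?a0.
Qed.

End power_maximisers.

(** * The Nehari set *)

Section nehari.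
Context {R : realType} {n : nat} (R0 R1 : R).
Hypotheses (hR0 : 0 < R0) (hR01 : R0 < R1) (hn : (1 < n)%N).
Local Notation E := 'rV[R]_n.+1.
Local Notation A := (@annulus R n R0 R1).
Local Notation J := (integral_rV A).
Local Notation Q u := (qform R0 R1 u u).
Local Notation cone := (@in_cone R n R0 R1).
Implicit Types (x y : E) (u v w g : E -> R).

Variables (a : E -> R) (p : R).
Hypotheses (ca : {within closure A, continuous a}) (sa : symdec R0 R1 a).
Hypothesis (a0 : forall x, closure A x -> 0 < a x).
Hypothesis (hp : 2 < p).
Local Notation P u := (power_potential R0 R1 a p u).

Let hp1 : 1 < p. Proof. by apply: lt_trans hp; rewrite ltr1n. Qed.
Let p0 : 0 < p. Proof. exact: lt_trans hp1. Qed.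

Lemma energyE u : energy R0 R1 p a u = 2^-1 * Q u - p^-1 * P u.
Proof. by rewrite /energy; congr (_ * _ - _); apply: integral_annulus_ext => x _; rewrite expr2. Qed.

(** In the direction [u] itself homogeneity suffices: the energy along the ray is an explicit
    function of [1 + t]. *)
Lemma denergyE u : C1bar R0 R1 u -> denergy R0 R1 p a u u = Q u - P u.
Proof.
move=> cu; rewrite /denergy.
have -> : (fun t : R => energy R0 R1 p a (fun x => u x + t * u x)) =
    (fun t => 2^-1 * ((1 + t) ^+ 2 * Q u) - p^-1 * (`|1 + t| `^ p * P u)).
  apply/funext => t; have -> : (fun x => u x + t * u x) = (fun x => (1 + t) * u x).
    by apply/funext => x; rewrite mulrDl mul1r.
  rewrite energyE (qformZZ hR0 hR01 _ cu).
  by rewrite (power_potentialZ hR0 hR01 ca hp1 _ (C1bar_within cu)).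
have d1 : is_derive (0 : R) 1 (fun t : R => 1 + t) 1.
  by have := @is_deriveD R R R (cst 1) id 0 1 0 1 (is_derive_cst _ _ _) (is_derive_id _ _); rewrite add0r.
have d2 : is_derive (0 : R) 1 (fun t : R => `|1 + t| `^ p) p.
  have d3 : is_derive ((1 : R) + 0) 1 (fun x : R => x `^ p) (p * (1 + 0) `^ (p - 1)).
    by apply: is_derive1_powR; rewrite addr0.
  have := @is_derive1_comp R (fun x : R => x `^ p) (fun t : R => 1 + t) 0 _ _ d3 d1.
  rewrite addr0 powR1 !mulr1; apply: near_eq_is_derive.
  have : \forall t \near (0 : R), - 1 < t.
    by apply: lt_nbhsr; rewrite ltrN10.
  by apply: filterS => t t1 /=; rewrite ger0_norm //; lra.
rewrite derive1E; apply: derive_val; apply: is_derive_eq.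
by rewrite /GRing.scale /=; field; rewrite gt_eqF.
Qed.

Lemma nehariP u : NK R0 R1 p a u <-> [/\ cone u, 0 < P u & Q u = P u].
Proof.
split=> [[/(in_coneP hR0 hR01 hn) cu [x Ax ux]]|[cu Pu QP]]; have [Cu u0 _] := cu.
  rewrite (denergyE Cu.1) => /eqP; rewrite subr_eq0 => /eqP QP; split => //.
  have [Ax'|nAx] := pselect (A x).
    by apply: power_potential_gt0 Ax' ux => //; exact: C1bar_within Cu.1.
  have hx : enorm x = R0 \/ enorm x = R1.
    by apply/(interior_closure_annulus_boundary hR0 hR01); split.
  by case: Cu => _ /(vanishes_on_boundaryP hR0 hR01)/(_ x hx) ux0; rewrite ux0 eqxx in ux.
split; first exact/(in_coneP hR0 hR01 hn).
  have [x Ax ux] := power_potential_support hR0 hR01 hp1 Pu.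
  by exists x => //; exact: subset_closure.
by rewrite (denergyE Cu.1) QP subrr.
Qed.

Lemma power_potential_pos_qform u : cone u -> 0 < P u -> 0 < Q u.
Proof.
move=> cu Pu; have [x Ax ux] := power_potential_support hR0 hR01 hp1 Pu.
exact: qform_gt0 (cone_C1bar cu) Ax ux.
Qed.

Lemma unscale u (s : R) : 0 < s -> u = (fun x => s * (s^-1 * u x)).
Proof. by move=> s0; apply/funext => x; rewrite mulVKf // gt_eqF. Qed.

Lemma power_potential_le u v : power_maximiser R0 R1 a p u -> cone v -> 0 < Q v ->
  P v <= Num.sqrt (Q v) `^ p * P u.
Proof.
move=> [_ _ _ maxu] cv Qv; have C1v := cone_C1bar cv.
set s := Num.sqrt (Q v); have s0 : 0 < s by rewrite sqrtr_gt0.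
have i0 : 0 <= s^-1 by rewrite invr_ge0 ltW.
have cw := in_coneZ i0 cv.
rewrite {1}(unscale v s0) (power_potentialZ hR0 hR01 ca hp1 _ (C1bar_within (cone_C1bar cw))).
rewrite (gtr0_norm s0); apply: ler_wpM2l; first exact: powR_ge0.
by apply: maxu => //; rewrite (normalised_qform hR0 hR01 C1v Qv).
Qed.

(** If [Q u < 1], rescaling to [Q = 1] would multiply the potential by [Q^(-p/2) > 1]. *)
Lemma maximiser_norm u : power_maximiser R0 R1 a p u -> Q u = 1.
Proof.
move=> maxu; have [cu Qu Pu _] := maxu; have Q0 := power_potential_pos_qform cu Pu.
have := power_potential_le maxu cu Q0; rewrite -ler_pdivrMr // divff ?gt_eqF // => h.
apply/eqP; rewrite eq_le Qu /= leNgt; apply/negP => Q1.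
have s1 : Num.sqrt (Q u) < 1 by rewrite -sqrtr1 ltr_sqrt.
have := gt0_ltr_powR p0 _ _ s1; rewrite !nnegrE sqrtr_ge0 ler01 powR1 => /(_ isT isT).
by rewrite ltNge h.
Qed.

Lemma powR_split (s : R) : 0 < s -> s `^ p = s ^+ 2 * s `^ (p - 2).
Proof.
move=> s0; rewrite -powR_mulrn ?(ltW s0) // -powRD; last by rewrite (gt_eqF s0) implybT.
by congr (_ `^ _); ring.
Qed.

Section ground_state.
Variable u1 : E -> R.
Hypothesis maxu1 : power_maximiser R0 R1 a p u1.

(** The positive root of [tau^2 = tau^p P(u1)]: as [Q u1 = 1], it puts [tau u1] on the Nehari
    set. *)
Definition nehari_scale : R := (P u1)^-1 `^ (p - 2)^-1.
Local Notation tau := nehari_scale.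

Let S0 : 0 < P u1. Proof. by case: maxu1. Qed.

Lemma nehari_scale_gt0 : 0 < tau.
Proof. by rewrite powR_gt0 // invr_gt0. Qed.

Lemma nehari_scale_powR : tau `^ (p - 2) = (P u1)^-1.
Proof. by rewrite -powRrM mulVf ?powRr1 ?invr_ge0 ?(ltW S0) // gt_eqF // subr_gt0. Qed.

Lemma nehari_scaled : NK R0 R1 p a (fun x => tau * u1 x) /\ Q (fun x => tau * u1 x) = tau ^+ 2.
Proof.
have [cu _ _ _] := maxu1; have C1u := cone_C1bar cu; have t0 := nehari_scale_gt0.
have Qt : Q (fun x => tau * u1 x) = tau ^+ 2.
  by rewrite (qformZZ hR0 hR01 _ C1u) (maximiser_norm maxu1) mulr1.
have Pt : P (fun x => tau * u1 x) = tau ^+ 2.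
  rewrite (power_potentialZ hR0 hR01 ca hp1 _ (C1bar_within C1u)) (gtr0_norm t0).
  by rewrite powR_split // nehari_scale_powR -mulrA mulVf ?mulr1 // gt_eqF.
split; last exact: Qt.
by apply/nehariP; rewrite Qt Pt exprn_gt0 //; split => //; apply: in_coneZ cu; exact: ltW.
Qed.

(** Homogeneity gives [P u <= Q(u)^(p/2) P(u1)]; with [Q u = P u] this forces
    [Q(u)^((p-2)/2) >= 1 / P(u1) = tau^(p-2)]. *)
Lemma nehari_norm_ge u : NK R0 R1 p a u -> tau ^+ 2 <= Q u.
Proof.
move=> /nehariP[cu Pu QP]; have Q0 : 0 < Q u by rewrite QP.
have s0 : 0 < Num.sqrt (Q u) by rewrite sqrtr_gt0.
have t0 := nehari_scale_gt0.
have := power_potential_le maxu1 cu Q0; rewrite -QP powR_split // sqr_sqrtr ?(ltW Q0) //.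
rewrite -mulrA ler_pMr // => h.
rewrite -(sqr_sqrtr (ltW Q0)) ler_sqr ?nnegrE ?(ltW t0) ?(ltW s0) // leNgt.
apply/negP => st; have q0 : 0 < p - 2 by rewrite subr_gt0.
have := gt0_ltr_powR q0 _ _ st; rewrite !nnegrE (ltW s0) (ltW t0) => /(_ isT isT).
by rewrite nehari_scale_powR -[_^-1]mul1r (ltr_pdivlMr _ _ S0) ltNge h.
Qed.

Lemma nehari_energy u : NK R0 R1 p a u -> energy R0 R1 p a u = (2^-1 - p^-1) * Q u.
Proof. by move=> /nehariP[_ _ QP]; rewrite energyE -QP mulrBl. Qed.

Lemma nehari_coef : 0 < 2^-1 - p^-1.
Proof. by rewrite subr_gt0 ltf_pV2 // posrE. Qed.

Lemma nehari_minimum u : NK R0 R1 p a u ->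
  energy R0 R1 p a (fun x => tau * u1 x) <= energy R0 R1 p a u.
Proof.
move=> Nu; have [N1 Q1] := nehari_scaled; rewrite (nehari_energy N1) (nehari_energy Nu) Q1.
by apply: ler_wpM2l; [exact: ltW nehari_coef|exact: nehari_norm_ge].
Qed.

Lemma cI_ground_state : cI R0 R1 p a = energy R0 R1 p a (fun x => tau * u1 x).
Proof.
have [N1 _] := nehari_scaled; rewrite /cI; apply/eqP; rewrite eq_le; apply/andP; split.
  apply: ge_inf; last by exists (fun x => tau * u1 x).
  by exists (energy R0 R1 p a (fun x => tau * u1 x)) => _ [u Nu <-]; exact: nehari_minimum.
apply: lb_le_inf; first by exists (energy R0 R1 p a (fun x => tau * u1 x)); exists (fun x => tau * u1 x).
by move=> _ [u Nu <-]; exact: nehari_minimum.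
Qed.

Lemma cI_gt0 : 0 < cI R0 R1 p a.
Proof.
have [N1 Q1] := nehari_scaled; rewrite cI_ground_state (nehari_energy N1) Q1.
by rewrite mulr_gt0 ?nehari_coef // exprn_gt0 // nehari_scale_gt0.
Qed.

Lemma minimizer_norm u : minimizer R0 R1 p a u -> Q u = tau ^+ 2.
Proof.
move=> [Nu minu]; have [N1 Q1] := nehari_scaled; apply/eqP; rewrite eq_le nehari_norm_ge // andbT.
have := minu _ N1; rewrite (nehari_energy N1) (nehari_energy Nu) Q1.
by rewrite (ler_pM2l nehari_coef).
Qed.

(** A minimiser has [P u = Q u = tau^2], so dividing by [tau] gives norm 1 and potential
    [tau^2 / tau^p = P(u1)], the maximal value. *)
Lemma minimizer_normalised u : minimizer R0 R1 p a u ->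
  power_maximiser R0 R1 a p (fun x => tau^-1 * u x).
Proof.
move=> minu; have Qu := minimizer_norm minu; have [/nehariP[cu Pu QP] _] := minu.
have t0 := nehari_scale_gt0; have i0 : 0 <= tau^-1 by rewrite invr_ge0 ltW.
have cw := in_coneZ i0 cu; have C1w := cone_C1bar cw.
have Pw : P (fun x => tau^-1 * u x) = P u1.
  have Ps : P u = tau `^ p * P (fun x => tau^-1 * u x).
    rewrite {1}(unscale u t0).
    by rewrite (power_potentialZ hR0 hR01 ca hp1 _ (C1bar_within C1w)) (gtr0_norm t0).
  have := QP; rewrite Qu Ps (powR_split t0) nehari_scale_powR -mulrA -{1}[tau ^+ 2]mulr1.
  move=> /(mulfI (lt0r_neq0 (exprn_gt0 2 t0))) h.
  exact: (mulfI (invr_neq0 (lt0r_neq0 S0))) (etrans (esym h) (esym (mulVf (lt0r_neq0 S0)))).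
have [_ _ _ mx] := maxu1; split; [exact: cw| |by rewrite Pw|by rewrite Pw].
rewrite (qformZZ hR0 hR01 _ (cone_C1bar cu)) Qu exprVn.
by rewrite (mulVf (lt0r_neq0 (exprn_gt0 2 t0))).
Qed.

End ground_state.

Lemma minimizer_solution u : minimizer R0 R1 p a u -> solution R0 R1 p a u.
Proof.
move=> minu; have [u1 maxu1] := power_maximiser_exists hR0 hR01 hn ca sa a0 hp1.
have t0 := nehari_scale_gt0 maxu1; set tau := nehari_scale u1 in t0.
have maxw := minimizer_normalised maxu1 minu; rewrite -/tau in maxw.
have [/nehariP[cu Pu QP] _] := minu; have [Cu u0 _] := cu; have C1u := Cu.1.
have Q0 : 0 < Q u by rewrite QP.
have [mu [mu0 Wmu wpos]] := power_euler_lagrange hR0 hR01 hn ca sa a0 hp1 maxw.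
pose k := tau `^ (p - 1) * (mu * tau^-1).
have weak v : C10 R0 R1 v ->
    k * qform R0 R1 u v = J (fun x => a x * u x `^ (p - 1) * v x).
  move=> Cv; have -> : J (fun x => a x * u x `^ (p - 1) * v x) =
      J (fun x => tau `^ (p - 1) * (a x * (tau^-1 * u x) `^ (p - 1) * v x)).
    apply: integral_annulus_ext => x Ax; have ux := u0 x (subset_closure Ax).
    rewrite {1}(_ : u x = tau * (tau^-1 * u x)); last by rewrite mulVKf // gt_eqF.
    by rewrite powRM ?(ltW t0) ?mulr_ge0 ?invr_ge0 ?(ltW t0) //; ring.
  rewrite (integral_annulusZ hR0 hR01) //.
    by rewrite -Wmu // (qformZ hR0 hR01 _ C1u Cv.1) /k; ring.
  apply: (eq_bcont (f := fun x => a x * `|tau^-1 * u x| `^ (p - 1) * v x)).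
    move=> x Ax; rewrite ger0_norm // mulr_ge0 ?invr_ge0 ?(ltW t0) // u0 //.
    exact: subset_closure.
  apply: within_bcont => //; apply: within_contM; last exact: C1bar_within Cv.1.
  apply: within_contM => //; apply: within_cont_comp (norm_powR_continuous _) _.
    by rewrite subr_gt0.
  by apply: C1bar_within; exact: C1barZ.
(* Testing with [u] itself and using the Nehari identity [Q u = P u] determines the multiplier. *)
have k1 : k = 1.
  have := weak u Cu; have -> : J (fun x => a x * u x `^ (p - 1) * u x) = P u.
    apply: integral_annulus_ext => x Ax; have ux := u0 x (subset_closure Ax).
    by rewrite ger0_norm // -mulrA [_ * u x]mulrC mulr_powRB1.
  by rewrite -QP -{2}[Q u]mul1r => /mulIf; apply; rewrite gt_eqF.
split; [exact: Cu| |].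
- by move=> v Cv; rewrite -(weak v Cv) k1 mul1r.
- by move=> x Ax; have := wpos x Ax; rewrite pmulr_rgt0 // invr_gt0.
Qed.

End nehari.

Theorem theorem1p1 (R : realType) (n : nat) (p R0 R1 : R) (a : 'rV[R]_n.+1 -> R)
    (hN : (3 <= n.+1)%N) (hp : 2 < p) (hR0 : 0 < R0) (hR01 : R0 < R1)
    (ha : Khat R0 R1 a)
    (ha_pos : forall x, closure (annulus R0 R1) x -> 0 < a x) :
  [/\ 0 < cI R0 R1 p a,
      exists2 u, NK R0 R1 p a u & energy R0 R1 p a u = cI R0 R1 p a &
      forall u, minimizer R0 R1 p a u ->
        [/\ nontrivial R0 R1 u, K R0 R1 u & solution R0 R1 p a u]].
Proof.
have hn : (1 < n)%N by [].
have ca : {within closure (annulus R0 R1), continuous a} by case: ha => -[].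
have sa := Khat_symdec hR0 hR01 (ltnW hn) ha.
have hp1 : 1 < p by apply: lt_trans hp; rewrite ltr1n.
have [u1 maxu1] := power_maximiser_exists hR0 hR01 hn ca sa ha_pos hp1.
split.
- exact: cI_gt0 maxu1.
- have [N1 _] := nehari_scaled hR0 hR01 hn ca ha_pos hp maxu1.
  exists (fun x => nehari_scale R0 R1 a p u1 * u1 x); first exact: N1.
  by symmetry; apply: cI_ground_state maxu1.
- move=> u minu; have [[Ku nu _] _] := minu; split => //.
  exact: minimizer_solution minu.
Qed.
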